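(* The Lie supergroup of $N=2$ superconformal automorphisms of the $N=2$ super-Riemann sphere $S^2\hat{\mathbb C}$ over $\Lambda=\bigwedge_\infty$ is the group of $N=2$ superprojective transformations, i.e. of those maps $T$ determined by a coordinate expression $\Delta\circ T\circ\Delta^{-1}:(w,\rho^+,\rho^-)\mapsto(\tilde w,\tilde\rho^+,\tilde\rho^-)$ (defined where $(cw+d)_B\neq0$) of the form $$\begin{aligned}\tilde w={}&\frac{aw+b}{cw+d}+\rho^+\frac{e^+(\gamma^-w+\delta^-)}{(cw+d)^2}+\rho^+\frac{(f^+w+h^+)(\gamma^-w+\delta^-)}{(cw+d)^3}+\rho^-\frac{e^-(\gamma^+w+\delta^+)}{(cw+d)^2}+\rho^-\frac{(f^-w+h^-)(\gamma^+w+\delta^+)}{(cw+d)^3}\\&+\rho^+\rho^-\frac{2\gamma^+\gamma^-dw-(\gamma^+\delta^-+\delta^+\gamma^-)(cw-d)-2\delta^+\delta^-c}{(cw+d)^3},\\ \tilde\rho^+={}&\frac{\gamma^+w+\delta^+}{cw+d}+\rho^+\frac{e^+}{cw+d}+\rho^+\frac{f^+w+h^+}{(cw+d)^2}+\rho^+\rho^-\frac{\gamma^+d-\delta^+c}{(cw+d)^2},\\ \tilde\rho^-={}&\frac{\gamma^-w+\delta^-}{cw+d}+\rho^-\frac{e^-}{cw+d}+\rho^-\frac{f^-w+h^-}{(cw+d)^2}-\rho^+\rho^-\frac{\gamma^-d-\delta^-c}{(cw+d)^2},\end{aligned}$$ for $a,b,c,d,e^\pm,f^\pm,h^\pm\in\Lambda^0$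 and $\gamma^\pm,\delta^\pm\in\Lambda^1$ satisfying $$ad-bc=1,\qquad e^+e^-=1-\gamma^+\delta^-+\delta^+\gamma^-,$$ $$f^\pm=\mp e^\pm\gamma^+\gamma^-d,\qquad h^\pm=\pm e^\pm\bigl(\delta^+\delta^-c-(\gamma^+\delta^-+\delta^+\gamma^-)d\mp\delta^+\delta^-\gamma^+\gamma^-d\bigr).$$
   Context: Grassmann algebra: $\Lambda=\bigwedge_\infty$ is the Grassmann algebra over $\mathbb C$ on generators $\zeta_1,\zeta_2,\dots$, with even and odd parts $\Lambda^0,\Lambda^1$. Each $a\in\Lambda$ is $a=a_B+a_S$ with body $a_B\in\mathbb C$ and soul $a_S$; $(\Lambda^0)^\times=\{a\in\Lambda^0: a_B\ne0\}$. The space $\Lambda^0\oplus(\Lambda^1)^2$ has the DeWitt topology, whose open sets are the preimages of open subsets of $\mathbb C$ under $(z,\theta^+,\theta^-)\mapsto z_B$. Superanalytic functions: for complex analytic $f$, set $f(z)=\sum_l \frac{z_S^l}{l!}f^{(l)}(z_B)$. A superanalytic function on a DeWitt open $U$ is $f_0(z)+\theta^+f_1(z)+\theta^-f_2(z)+\theta^+\theta^-f_3(z)$, with each $f_l$ a combination of monomials in the $\zeta_j$ with coefficients analytic on $U_B$; it is even (odd) if its values are in $\Lambda^0$ ($\Lambda^1$), i.e. $f_0,f_3$ even and $f_1,f_2$ odd (resp. opposite). $N=2$ superconformal functions: let $D^\pm=\frac{\partial}{\partial\theta^\pm}+\theta^\mp\frac{\partial}{\partial z}$. A superanalytic $H=(\tilde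 z,\tilde\theta^+,\tilde\theta^-)$ ($\tilde z$ even, $\tilde\theta^\pm$ odd) is $N=2$ superconformal if $D^+\tilde\theta^-=D^-\tilde\theta^+=0$, $D^\pm\tilde z=\tilde\theta^\mp D^\pm\tilde\theta^\pm$, and $D^\pm\tilde\theta^\pm$ are not identically zero. The $N=2$ super-Riemann sphere $S^2\hat{\mathbb C}$ is covered by two coordinate neighborhoods $U_\Delta,U_\Upsilon$ with homeomorphisms $\Delta:U_\Delta\to\Lambda^0\oplus(\Lambda^1)^2$, $\Upsilon:U_\Upsilon\to\Lambda^0\oplus(\Lambda^1)^2$ and transition function $\Delta\circ\Upsilon^{-1}(w,\rho^+,\rho^-)=(1/w,i\rho^+/w,i\rho^-/w)$ on $(\Lambda^0)^\times\oplus(\Lambda^1)^2$. An $N=2$ superconformal automorphism is a bijection $T$ of $S^2\hat{\mathbb C}$ such that $T$ and $T^{-1}$ are $N=2$ superconformal when expressed in the charts $\Delta,\Upsilon$; it is uniquely determined by the expression $\Delta\circ T\circ\Delta^{-1}$. *)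

(* Defs.v *)
From HB Require Import structures.
From mathcomp Require Import all_boot all_order all_algebra.
From mathcomp Require Import finmap complex.
From mathcomp Require Import all_classical all_reals all_analysis.
From mathcomp Require Import -(notations) monalg.

Set Implicit Arguments.
Unset Strict Implicit.
Unset Printing Implicit Defensive.

Import Order.TTheory GRing.Theory Num.Theory.
Import numFieldNormedType.Exports.

Local Open Scope classical_set_scope.
Local Open Scope ring_scope.

Notation "a @_ I" := (mcoeff I a)
  (at level 3, I at level 2, left associativity, format "a @_ I") : ring_scope.

Section GrassmannProduct.
Local Open Scope fset_scope.
Local Open Scope ring_scope.
Variable C : fieldType.
Local Notation pregrassmann := (malg {fset nat} C).
Local Notation prezeta I := (mkmalgU I 1 : pregrassmann).
Implicit Types (I J L : {fset nat}) (a b : pregrassmann).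

Definition inversions I J : nat := (\sum_(i <- I) \sum_(j <- J) (j < i))%N.

(* zeta_I zeta_J = monomial_sign I J *: zeta_(I `|` J) for the monomials     *)
(* zeta_I = zeta_i1 ... zeta_ik, I = {i1 < ... < ik}.                         *)
Definition monomial_sign I J : C :=
  if [disjoint I & J]%fset then (-1) ^+ inversions I J else 0.

Definition gmul a b : pregrassmann :=
  \sum_(I <- msupp a) \sum_(J <- msupp b)
    (a@_I * b@_J * monomial_sign I J) *: prezeta (I `|` J).

Lemma big_fsetU_disjoint (F : nat -> nat) I J : [disjoint I & J]%fset ->
  (\sum_(i <- I `|` J) F i = \sum_(i <- I) F i + \sum_(i <- J) F i)%N.
Proof.
move=> dIJ; rewrite -big_cat /=; apply: perm_big; apply: uniq_perm.
- exact: fset_uniq.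
- rewrite cat_uniq !fset_uniq /= andbT; apply/hasPn => x xJ.
  by apply: contraL xJ => xI; exact: (fdisjointP dIJ).
- by move=> x; rewrite mem_cat in_fsetU.
Qed.

Lemma monomial_signA I J L :
  monomial_sign J L * monomial_sign I (J `|` L) =
  monomial_sign I J * monomial_sign (I `|` J) L.
Proof.
rewrite /monomial_sign fdisjointXU fdisjointUX.
case: (boolP [disjoint I & J]%fset) => dIJ; last by rewrite /= mulr0 mul0r.
case: (boolP [disjoint J & L]%fset) => dJL; last by rewrite andbF mul0r mulr0.
case: (boolP [disjoint I & L]%fset) => dIL; last by rewrite !mulr0.
rewrite /= -!exprD; congr (_ ^+ _); rewrite /inversions [in RHS]big_fsetU_disjoint //.
have -> : (\sum_(i <- I) \sum_(j <- J `|` L) (j < i) =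
  \sum_(i <- I) (\sum_(j <- J) (j < i) + \sum_(j <- L) (j < i)))%N.
  by apply: eq_bigr => i _; rewrite big_fsetU_disjoint.
by rewrite big_split /= addnC -addnA.
Qed.

Lemma malg_zetaE (a : pregrassmann) (D : {fset {fset nat}}) :
  msupp a `<=` D -> a = \sum_(I <- D) a@_I *: prezeta I.
Proof.
move=> le; rewrite {1}(monalgEw le); apply: eq_bigr => I _.
apply/malgP => J; rewrite [RHS]mcoeffZ !mcoeffU.
by case: eqP; rewrite ?mulr1 ?mulr0 ?mulr1n.
Qed.

Lemma gmulEw a b (D E : {fset {fset nat}}) : msupp a `<=` D -> msupp b `<=` E ->
  gmul a b = \sum_(I <- D) \sum_(J <- E)
    (a@_I * b@_J * monomial_sign I J) *: prezeta (I `|` J).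
Proof.
move=> leD leE; rewrite /gmul (big_fset_incl _ leD) /=.
  apply/eq_bigr => I _; apply/big_fset_incl => // J _ /mcoeff_outdom ->.
  by rewrite mulr0 mul0r scale0r.
by move=> I _ /mcoeff_outdom aI; rewrite big1 // => J _; rewrite aI !mul0r scale0r.
Qed.

Lemma gmulDl : left_distributive gmul +%R.
Proof.
move=> a b c; rewrite (gmulEw (msuppD_le a b) (fsubset_refl _)).
rewrite (gmulEw (fsubsetUl _ (msupp b)) (fsubset_refl _)).
rewrite (gmulEw (fsubsetUr (msupp a) _) (fsubset_refl _)) -big_split /=.
apply: eq_bigr => I _; rewrite -big_split /=; apply: eq_bigr => J _.
by rewrite mcoeffD !mulrDl scalerDl.
Qed.

Lemma gmulDr : right_distributive gmul +%R.
Proof.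
move=> c a b; rewrite (gmulEw (fsubset_refl _) (msuppD_le a b)).
rewrite (gmulEw (fsubset_refl _) (fsubsetUl _ (msupp b))).
rewrite (gmulEw (fsubset_refl _) (fsubsetUr (msupp a) _)) -big_split /=.
apply: eq_bigr => I _; rewrite -big_split /=; apply: eq_bigr => J _.
by rewrite mcoeffD mulrDr mulrDl scalerDl.
Qed.

Lemma msuppZ_sub (k : C) a : msupp (k *: a) `<=` msupp a.
Proof. exact: msuppZ_le. Qed.

Lemma gscalerAl k a b : k *: gmul a b = gmul (k *: a) b.
Proof.
rewrite (gmulEw (msuppZ_sub k a) (fsubset_refl _)) /gmul scaler_sumr.
apply: eq_bigr => I _; rewrite scaler_sumr; apply: eq_bigr => J _.
by rewrite [in RHS]mcoeffZ scalerA !mulrA.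
Qed.

Lemma gscalerAr k a b : k *: gmul a b = gmul a (k *: b).
Proof.
rewrite (gmulEw (fsubset_refl _) (msuppZ_sub k b)) /gmul scaler_sumr.
apply: eq_bigr => I _; rewrite scaler_sumr; apply: eq_bigr => J _.
by rewrite [in RHS]mcoeffZ scalerA !mulrA (mulrC k).
Qed.

Lemma gmul0 a : gmul a 0 = 0.
Proof. by rewrite /gmul big1 // => I _; rewrite msupp0 big_seq_fset0. Qed.

Lemma g0mul a : gmul 0 a = 0.
Proof. by rewrite /gmul msupp0 big_seq_fset0. Qed.

Lemma gmul_prezeta I J : gmul (prezeta I) (prezeta J) = monomial_sign I J *: prezeta (I `|` J).
Proof.
rewrite (gmulEw msuppU_le msuppU_le) !big_seq_fset1 !mcoeffUU.
by rewrite !mul1r.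
Qed.

Lemma gmul_suml (T : Type) (r : seq T) (F : T -> pregrassmann) b :
  gmul (\sum_(t <- r) F t) b = \sum_(t <- r) gmul (F t) b.
Proof. by apply: (big_morph (gmul^~ b)) => [x y|]; rewrite ?gmulDl ?g0mul. Qed.

Lemma gmul_sumr (T : Type) (r : seq T) (F : T -> pregrassmann) a :
  gmul a (\sum_(t <- r) F t) = \sum_(t <- r) gmul a (F t).
Proof. by apply: (big_morph (gmul a)) => [x y|]; rewrite ?gmulDr ?gmul0. Qed.

Lemma gmulA : associative gmul.
Proof.
have gmull (F : pregrassmann -> pregrassmann) (G : pregrassmann -> pregrassmann) a :
    {morph F : x y / x + y} -> {morph G : x y / x + y} ->
    (forall k x, F (k *: x) = k *: F x) -> (forall k x, G (k *: x) = k *: G x) ->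
    (forall I, F (prezeta I) = G (prezeta I)) -> F a = G a.
  move=> FD GD FZ GZ FG.
  have F0 : F 0 = 0 by rewrite -(scale0r 0) FZ !scale0r.
  have G0 : G 0 = 0 by rewrite -(scale0r 0) GZ !scale0r.
  rewrite (malg_zetaE (fsubset_refl (msupp a))) (big_morph F FD F0).
  by rewrite (big_morph G GD G0); apply: eq_bigr => I _; rewrite FZ GZ FG.
move=> a b c.
apply: (gmull (fun x => gmul x (gmul b c)) (fun x => gmul (gmul x b) c)).
- by move=> x y; rewrite gmulDl.
- by move=> x y; rewrite !gmulDl.
- by move=> k x; rewrite -gscalerAl.
- by move=> k x; rewrite -!gscalerAl.
move=> I.
apply: (gmull (fun x => gmul (prezeta I) (gmul x c)) (fun x => gmul (gmul (prezeta I) x) c)).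
- by move=> x y; rewrite gmulDl gmulDr.
- by move=> x y; rewrite gmulDr gmulDl.
- by move=> k x; rewrite -gscalerAl -gscalerAr.
- by move=> k x; rewrite -gscalerAr -gscalerAl.
move=> J.
apply: (gmull (fun x => gmul (prezeta I) (gmul (prezeta J) x))
              (fun x => gmul (gmul (prezeta I) (prezeta J)) x)).
- by move=> x y; rewrite !gmulDr.
- by move=> x y; rewrite gmulDr.
- by move=> k x; rewrite -!gscalerAr.
- by move=> k x; rewrite -gscalerAr.
move=> L; rewrite !gmul_prezeta -gscalerAr -gscalerAl !gmul_prezeta !scalerA.
by rewrite monomial_signA fsetUA.
Qed.

Lemma g1mul : left_id (prezeta fset0) gmul.
Proof.
move=> a; rewrite [in RHS](malg_zetaE (fsubset_refl (msupp a))).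
rewrite {1}(malg_zetaE (fsubset_refl (msupp a))) gmul_sumr.
apply: eq_bigr => I _; rewrite -gscalerAr gmul_prezeta fset0U /monomial_sign.
by rewrite fdisjoint0X /inversions big_seq_fset0 scale1r.
Qed.

Lemma gmul1 : right_id (prezeta fset0) gmul.
Proof.
move=> a; rewrite [in RHS](malg_zetaE (fsubset_refl (msupp a))).
rewrite {1}(malg_zetaE (fsubset_refl (msupp a))) gmul_suml.
apply: eq_bigr => I _; rewrite -gscalerAl gmul_prezeta fsetU0 /monomial_sign.
rewrite fdisjointX0 /inversions big1 ?scale1r // => i _.
by rewrite big_seq_fset0.
Qed.

Lemma zeta0_neq0 : prezeta fset0 != 0.
Proof. by rewrite monalgU_eq0 oner_eq0. Qed.

End GrassmannProduct.

(* The Grassmann algebra on countably many generators: the finite linear      *)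
(* combinations of the monomials zeta_I, for I a finite set of naturals. The  *)
(* record keeps its product apart from that of monoid algebras, and the       *)
(* operations are locked to prevent their unfolding by unification.           *)
Record grassmann (C : fieldType) : Type :=
  Grassmann { gval : malg {fset nat} C }.

Fact glock (n : nat) : unit. Proof. exact: tt. Qed.

Section GrassmannAlgebra.
Local Open Scope fset_scope.
Local Open Scope ring_scope.
Variable C : fieldType.
Implicit Types (I : {fset nat}) (a b : grassmann C).

HB.instance Definition _ := [isNew for @gval C].
HB.instance Definition _ := [Choice of grassmann C by <:].

Definition zeta : {fset nat} -> grassmann C :=
  locked_with (glock 0) (fun I => Grassmann (mkmalgU I 1)).

Definition gcoef : {fset nat} -> grassmann C -> C :=
  locked_with (glock 1) (fun I a => (gval a)@_I).

Let gval_inj : injective (@gval C). Proof. exact: val_inj. Qed.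

Let zero := locked_with (glock 2) (Grassmann (0 : malg {fset nat} C)).
Let add := locked_with (glock 3) (fun a b => Grassmann (gval a + gval b)).
Let opp := locked_with (glock 4) (fun a => Grassmann (- gval a)).
Let mul := locked_with (glock 5) (fun a b => Grassmann (gmul (gval a) (gval b))).
Let scale := locked_with (glock 6) (fun (k : C) a => Grassmann (k *: gval a)).

Let val0 : gval zero = 0. Proof. by rewrite /zero unlock. Qed.
Let valD a b : gval (add a b) = gval a + gval b. Proof. by rewrite /add unlock. Qed.
Let valN a : gval (opp a) = - gval a. Proof. by rewrite /opp unlock. Qed.
Let valM a b : gval (mul a b) = gmul (gval a) (gval b).
Proof. by rewrite /mul unlock. Qed.
Let valZ k a : gval (scale k a) = k *: gval a. Proof. by rewrite /scale unlock. Qed.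
Let val_zeta I : gval (zeta I) = mkmalgU I 1. Proof. by rewrite /zeta unlock. Qed.
Let valE := (val0, valD, valN, valM, valZ, val_zeta).

Let addA : associative add.
Proof. by move=> a b c; apply: gval_inj; rewrite !valE addrA. Qed.
Let addC : commutative add.
Proof. by move=> a b; apply: gval_inj; rewrite !valE addrC. Qed.
Let add0 : left_id zero add.
Proof. by move=> a; apply: gval_inj; rewrite !valE add0r. Qed.
Let addN : left_inverse zero opp add.
Proof. by move=> a; apply: gval_inj; rewrite !valE addNr. Qed.
HB.instance Definition _ := GRing.isZmodule.Build (grassmann C) addA addC add0 addN.

Let scaleA k l a : scale k (scale l a) = scale (k * l) a.
Proof. by apply: gval_inj; rewrite !valE scalerA. Qed.
Let scale1 : left_id 1 scale.
Proof. by move=> a; apply: gval_inj; rewrite !valE scale1r. Qed.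
Let scaleDr : right_distributive scale +%R.
Proof. by move=> k a b; apply: gval_inj; rewrite !valE scalerDr. Qed.
Let scaleDl a : {morph scale^~ a : k l / k + l}.
Proof. by move=> k l; apply: gval_inj; rewrite !valE scalerDl. Qed.
HB.instance Definition _ :=
  GRing.Zmodule_isLmodule.Build C (grassmann C) scaleA scale1 scaleDr scaleDl.

Let mulA : associative mul.
Proof. by move=> a b c; apply: gval_inj; rewrite !valE gmulA. Qed.
Let mul1 : left_id (zeta fset0) mul.
Proof. by move=> a; apply: gval_inj; rewrite !valE g1mul. Qed.
Let mulr1 : right_id (zeta fset0) mul.
Proof. by move=> a; apply: gval_inj; rewrite !valE gmul1. Qed.
Let mulDl : left_distributive mul +%R.
Proof. by move=> a b c; apply: gval_inj; rewrite !valE gmulDl. Qed.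
Let mulDr : right_distributive mul +%R.
Proof. by move=> a b c; apply: gval_inj; rewrite !valE gmulDr. Qed.
Let one_neq0 : zeta fset0 != 0.
Proof. by rewrite -(inj_eq gval_inj) !valE zeta0_neq0. Qed.
HB.instance Definition _ := GRing.Zmodule_isNzRing.Build (grassmann C)
  mulA mul1 mulr1 mulDl mulDr one_neq0.

Let scaleAl (k : C) a b : k *: (a * b) = (k *: a) * b.
Proof. by apply: gval_inj; rewrite !valE gscalerAl. Qed.
Let scaleAr (k : C) a b : k *: (a * b) = a * (k *: b).
Proof. by apply: gval_inj; rewrite !valE gscalerAr. Qed.
HB.instance Definition _ :=
  GRing.Lmodule_isLalgebra.Build C (grassmann C) scaleAl.
HB.instance Definition _ :=
  GRing.Lalgebra_isAlgebra.Build C (grassmann C) scaleAr.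

Lemma gcoefE a I : gcoef I a = (gval a)@_I. Proof. by rewrite /gcoef unlock. Qed.
Lemma gcoefP a b : (forall I, gcoef I a = gcoef I b) -> a = b.
Proof.
move=> ab; apply: gval_inj; apply/malgP => I.
by have := ab I; rewrite !gcoefE.
Qed.
Lemma gcoef0 I : gcoef I 0 = 0. Proof. by rewrite gcoefE [gval _]valE mcoeff0. Qed.
Lemma gcoefD I a b : gcoef I (a + b) = gcoef I a + gcoef I b.
Proof. by rewrite !gcoefE [gval _]valE mcoeffD. Qed.
Lemma gcoefN I a : gcoef I (- a) = - gcoef I a.
Proof. by rewrite !gcoefE [gval _]valE mcoeffN. Qed.
Lemma gcoefZ I k a : gcoef I (k *: a) = k * gcoef I a.
Proof. by rewrite !gcoefE [gval _]valE mcoeffZ. Qed.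
Lemma gcoef_zeta I J : gcoef J (zeta I) = (I == J)%:R.
Proof. by rewrite gcoefE val_zeta mcoeffU. Qed.
Lemma gcoef_finite a : exists D : {fset {fset nat}},
  forall I, I \notin D -> gcoef I a = 0.
Proof.
by exists (msupp (gval a)) => I; rewrite gcoefE -mcoeff_eq0 => /eqP.
Qed.
Lemma zeta1 : zeta fset0 = 1. Proof. by []. Qed.
Lemma zetaM I J : zeta I * zeta J = monomial_sign C I J *: zeta (I `|` J).
Proof. by apply: gval_inj; rewrite !valE gmul_prezeta. Qed.

Definition gunit : pred (grassmann C) :=
  fun a => `[< exists b, b * a = 1 /\ a * b = 1 >].

Definition ginv a : grassmann C :=
  if pselect (exists b, b * a = 1 /\ a * b = 1) is left e
  then projT1 (cid e) else a.

Lemma ginvP a : gunit a -> ginv a * a = 1 /\ a * ginv a = 1.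
Proof. by move=> /asboolP ua; rewrite /ginv; case: pselect => // e; case: cid. Qed.

Lemma gmulVr : {in gunit, left_inverse 1 ginv *%R}.
Proof. by move=> a /ginvP[]. Qed.

Lemma gdivrr : {in gunit, right_inverse 1 ginv *%R}.
Proof. by move=> a /ginvP[]. Qed.

Lemma gunitP a b : b * a = 1 /\ a * b = 1 -> gunit a.
Proof. by move=> ab; apply/asboolP; exists b. Qed.

Lemma ginv_out : {in [predC gunit], ginv =1 id}.
Proof.
move=> a /negP na; rewrite /ginv; case: pselect => // e.
by case: na; apply/asboolP.
Qed.

HB.instance Definition _ := GRing.NzRing_hasMulInverse.Build (grassmann C)
  gmulVr gdivrr gunitP ginv_out.

Definition body a : C := gcoef fset0 a.
Definition soul a : grassmann C := a - (body a)%:A.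

Definition geven a : bool :=
  `[< forall I, gcoef I a != 0 -> ~~ odd #|` I| >].
Definition godd a : bool := `[< forall I, gcoef I a != 0 -> odd #|` I| >].

End GrassmannAlgebra.

Section Superanalytic.
Variable C : numClosedFieldType.
Local Notation Lambda := (grassmann C).

(* The space of triples (z, theta+, theta-) with z even and theta+, theta-    *)
(* odd.                                                                       *)
Definition in_superspace (p : Lambda * Lambda * Lambda) : bool :=
  [&& geven p.1.1, godd p.1.2 & godd p.2].

Record superspace : Type := SuperPoint {
  coords :> Lambda * Lambda * Lambda ;
  coordsP : in_superspace coords }.

HB.instance Definition _ := [isSub for coords].
HB.instance Definition _ := [Choice of superspace by <:].

Definition even_coord (p : superspace) : Lambda := (coords p).1.1.
Definition odd_coordp (p : superspace) : Lambda := (coords p).1.2.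
Definition odd_coordm (p : superspace) : Lambda := (coords p).2.
Definition body_coord (p : superspace) : C := body (even_coord p).

(* DeWitt topology *)
HB.instance Definition _ :=
  Topological.copy superspace (initial_topology body_coord).

Definition analytic_on (A : set C) (f : C -> C) : Prop :=
  forall x, A x -> exists a : nat -> C,
    \forall y \near x, [series a k * (y - x) ^+ k]_k @ \oo --> f y.

(* The sum over l is finite since soul z is nilpotent. *)
Definition soul_extension (f : C -> C) (z : Lambda) : Lambda :=
  \sum_(l \in [set: nat]) ((l`!%:R)^-1 * derive1n l f (body z)) *: soul z ^+ l.

(* A combination sum_t f_t(z) zeta_(I_t) of monomials with coefficient        *)
(* functions, as the list of the pairs (I_t, f_t).                            *)
Definition combination : Type := seq ({fset nat} * (C -> C)).

Definition comb_eval (s : combination) (z : Lambda) : Lambda :=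
  \sum_(t <- s) soul_extension t.2 z * zeta C t.1.

Definition comb_opp (s : combination) : combination :=
  [seq (t.1, fun x => - t.2 x) | t <- s].

Definition comb_deriv (s : combination) : combination :=
  [seq (t.1, derive1 t.2 : C -> C) | t <- s].

Definition comb_analytic (A : set C) (s : combination) : Prop :=
  {in s, forall t, analytic_on A t.2}.

(* The components of f0 + theta+ f1 + theta- f2 + theta+ theta- f3 *)
Record superfun : Type := SuperFun {
  comp0 : combination ; comp1 : combination ;
  comp2 : combination ; comp3 : combination }.

Definition superfun_eval (F : superfun) (p : superspace) : Lambda :=
  let z := even_coord p in let tp := odd_coordp p in let tm := odd_coordm p in
  comb_eval (comp0 F) z + tp * comb_eval (comp1 F) z
  + tm * comb_eval (comp2 F) z + tp * tm * comb_eval (comp3 F) z.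

Definition superfun_analytic (A : set C) (F : superfun) : Prop :=
  [/\ comb_analytic A (comp0 F), comb_analytic A (comp1 F),
      comb_analytic A (comp2 F) & comb_analytic A (comp3 F)].

Definition partial_z (F : superfun) : superfun :=
  SuperFun (comb_deriv (comp0 F)) (comb_deriv (comp1 F))
           (comb_deriv (comp2 F)) (comb_deriv (comp3 F)).

(* Left derivatives: d/dtheta- of theta+ theta- f3 is - theta+ f3. *)
Definition partial_thetap (F : superfun) : superfun :=
  SuperFun (comp1 F) [::] (comp3 F) [::].

Definition partial_thetam (F : superfun) : superfun :=
  SuperFun (comp2 F) (comb_opp (comp3 F)) [::] [::].

Definition Dplus (F : superfun) (p : superspace) : Lambda :=
  superfun_eval (partial_thetap F) p + odd_coordm p * superfun_eval (partial_z F) p.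

Definition Dminus (F : superfun) (p : superspace) : Lambda :=
  superfun_eval (partial_thetam F) p + odd_coordp p * superfun_eval (partial_z F) p.

(* h is the superanalytic function on U with components F. As there are       *)
(* infinitely many generators, h determines the values of the components of F *)
(* on U, hence also those of Dplus F and Dminus F.                            *)
Definition expands (U : set superspace) (h : superspace -> Lambda)
    (F : superfun) : Prop :=
  superfun_analytic (body_coord @` U) F /\
  forall p, U p -> h p = superfun_eval F p.

(* The parities of the coordinates of H are enforced by its codomain. *)
Definition superconformal (U : set superspace) (H : superspace -> superspace) :
    Prop :=
  open U /\ exists Z P M : superfun,
  [/\ expands U (even_coord \o H) Z,
      expands U (odd_coordp \o H) P &
      expands U (odd_coordm \o H) M] /\
  [/\ (forall p, U p -> Dplus M p = 0 /\ Dminus P p = 0),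
      (forall p, U p -> Dplus Z p = odd_coordm (H p) * Dplus P p),
      (forall p, U p -> Dminus Z p = odd_coordp (H p) * Dminus M p),
      (exists2 p, U p & Dplus P p != 0) &
      (exists2 p, U p & Dminus M p != 0)].

End Superanalytic.

Section SuperRiemannSphere.
Variable C : numClosedFieldType.

(* A coordinate neighborhood with a homeomorphism onto the superspace. *)
Record superchart (S : topologicalType) : Type := SuperChart {
  chart_dom : set S ;
  chart_map :> S -> superspace C ;
  chart_inv : superspace C -> S ;
  chart_open : open chart_dom ;
  chart_inv_dom : forall p, chart_dom (chart_inv p) ;
  chart_mapK : {in chart_dom, cancel chart_map chart_inv} ;
  chart_invK : cancel chart_inv chart_map ;
  chart_map_continuous : {in chart_dom, continuous chart_map} ;
  chart_inv_continuous : continuous chart_inv }.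

Record superRiemannSphere : Type := SuperRiemannSphere {
  sphere :> topologicalType ;
  Delta : superchart sphere ;
  Upsilon : superchart sphere ;
  sphere_cover : chart_dom Delta `|` chart_dom Upsilon = [set: sphere] ;
  sphere_overlap : forall p,
    chart_dom Delta (chart_inv Upsilon p) <-> body_coord p != 0 ;
  sphere_transition : forall p, body_coord p != 0 ->
    coords (Delta (chart_inv Upsilon p)) =
      ((even_coord p)^-1, 'i *: odd_coordp p / even_coord p,
       'i *: odd_coordm p / even_coord p) }.

Variable S : superRiemannSphere.

Definition local_domain (X Y : superchart S) (T : S -> S) : set (superspace C) :=
  [set p | chart_dom Y (T (chart_inv X p))].

Definition local_expression (X Y : superchart S) (T : S -> S) :
    superspace C -> superspace C :=
  fun p => Y (T (chart_inv X p)).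

Definition superconformal_in_charts (T : S -> S) : Prop :=
  let expressed X Y :=
    superconformal (local_domain X Y T) (local_expression X Y T) in
  [/\ expressed (Delta S) (Delta S), expressed (Delta S) (Upsilon S),
      expressed (Upsilon S) (Delta S) & expressed (Upsilon S) (Upsilon S)].

Definition superconformal_automorphism (T : S -> S) : Prop :=
  exists2 Tinv : S -> S, cancel T Tinv /\ cancel Tinv T &
    superconformal_in_charts T /\ superconformal_in_charts Tinv.

Record superprojective_data : Type := SuperprojectiveData {
  sp_a : grassmann C ; sp_b : grassmann C ; sp_c : grassmann C ; sp_d : grassmann C ;
  sp_ep : grassmann C ; sp_em : grassmann C ;
  sp_fp : grassmann C ; sp_fm : grassmann C ;
  sp_hp : grassmann C ; sp_hm : grassmann C ;
  sp_gp : grassmann C ; sp_gm : grassmann C ;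
  sp_dp : grassmann C ; sp_dm : grassmann C }.

(* In the next two definitions, gp, gm, dp, dm stand for gamma+, gamma-,      *)
(* delta+, delta-.                                                            *)
Definition superprojective_admissible (q : superprojective_data) : Prop :=
  let: SuperprojectiveData a b c d ep em fp fm hp hm gp gm dp dm := q in
  [/\ all (@geven C) [:: a; b; c; d; ep; em; fp; fm; hp; hm],
      all (@godd C) [:: gp; gm; dp; dm],
      a * d - b * c = 1 /\ ep * em = 1 - gp * dm + dp * gm,
      fp = - (ep * gp * gm * d) /\ fm = em * gp * gm * d &
      hp = ep * (dp * dm * c - (gp * dm + dp * gm) * d - dp * dm * gp * gm * d) /\
      hm = - (em * (dp * dm * c - (gp * dm + dp * gm) * d
                    + dp * dm * gp * gm * d))].

Definition superprojective_map (q : superprojective_data) (p : superspace C) :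
    grassmann C * grassmann C * grassmann C :=
  let: SuperprojectiveData a b c d ep em fp fm hp hm gp gm dp dm := q in
  let w := even_coord p in let rp := odd_coordp p in let rm := odd_coordm p in
  let den := c * w + d in
  ((a * w + b) / den
     + rp * (ep * (gm * w + dm)) / den ^+ 2
     + rp * ((fp * w + hp) * (gm * w + dm)) / den ^+ 3
     + rm * (em * (gp * w + dp)) / den ^+ 2
     + rm * ((fm * w + hm) * (gp * w + dp)) / den ^+ 3
     + rp * rm * (2 * gp * gm * d * w - (gp * dm + dp * gm) * (c * w - d)
                  - 2 * dp * dm * c) / den ^+ 3,
   (gp * w + dp) / den + rp * ep / den + rp * (fp * w + hp) / den ^+ 2
     + rp * rm * (gp * d - dp * c) / den ^+ 2,
   (gm * w + dm) / den + rm * em / den + rm * (fm * w + hm) / den ^+ 2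
     - rp * rm * (gm * d - dm * c) / den ^+ 2).

Definition has_superprojective_expression (q : superprojective_data)
    (T : S -> S) : Prop :=
  (forall p, local_domain (Delta S) (Delta S) T p <->
     body (sp_c q * even_coord p + sp_d q) != 0) /\
  (forall p, local_domain (Delta S) (Delta S) T p ->
     coords (local_expression (Delta S) (Delta S) T p) = superprojective_map q p).

End SuperRiemannSphere.

Definition transformation_group (X : Type) (G : set (X -> X)) : Prop :=
  [/\ G id, (forall f g, G f -> G g -> G (f \o g)) &
      forall f, G f -> exists2 g, G g & cancel f g /\ cancel g f].

(* Main.v *)
Require Import Defs.
From HB Require Import structures.
From mathcomp Require Import all_boot all_order all_algebra.
From mathcomp Require Import finmap complex.
From mathcomp Require Import all_classical all_reals all_analysis.
Import Order.TTheory GRing.Theory Num.Theory.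
Import numFieldNormedType.Exports.
Local Open Scope classical_set_scope.
Local Open Scope ring_scope.
From mathcomp Require Import ring.

(* The chiral coordinates (z + theta+ theta-, theta+) of the image of a point   *)
(* under an N=2 superconformal map are analytic functions of the chiral         *)
(* coordinates of the point alone, and they determine the map. Points of the    *)
(* sphere correspond to pairs of a column v = (z + theta+ theta-, 1, theta+)    *)
(* and a row w = (1, - (z - theta+ theta-), 2 theta-), each up to an even       *)
(* scalar, with w v = 0; the invertible even supermatrices of size 2|1 act on   *)
(* such pairs, hence on the sphere, by superconformal automorphisms.            *)
(* Conversely, composing an automorphism with such an action we may assume that *)
(* it fixes infinity. Its chiral components are then entire, with at most a     *)
(* simple pole at infinity, hence affine by Liouville's theorem, so that the    *)
(* automorphism is the action of a triangular supermatrix. Finally a            *)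
(* supermatrix is, up to an even scalar, the product of a factor with           *)
(* independent odd parameters and of a Moebius matrix of determinant one;       *)
(* expanding the action of this product gives the superprojective formulas.     *)

Set Implicit Arguments.
Unset Strict Implicit.
Unset Printing Implicit Defensive.

(** * Power series over a normed algebraically closed field *)

(** The derivation D- kills z + theta+ theta- and theta+, and D+ kills z - theta+ theta- and theta-.
    An N=2 superconformal map carries the first, chiral, pair of coordinates to functions of the
    chiral pair alone ([normal_form_chiral]), and this half determines the whole map once the
    coefficient of theta+ is invertible ([normal_form_determined]). Conversely, a map whose chiral
    and antichiral coordinates depend only on the coordinates of their own kind has the
    superconformal normal form ([normal_form_of_chiral], [superconformal_of_normal_form]). The
    problem thereby becomes one about analytic functions of one variable with values in the
    Grassmann algebra, extended to even arguments by [hat].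

    Automorphisms come from linear algebra. A point is a column [v] and a row [w] with [w *m v = 0],
    each up to an even unit. For an invertible even supermatrix [X] with inverse [Y], the entries of
    [X *m v] are affine in the chiral coordinates and those of [w *m Y] in the antichiral ones, so
    their quotients define a superconformal map ([superconformal_fracmap]). The transition function
    of the sphere is itself such an action ([transition_homog]), so the action is defined on the
    whole sphere, compatibly with products ([spheremapM], [spheremap_automorphism]).

    Every automorphism arises in this way ([automorphism_spheremap]). A supermatrix brings the image
    of infinity back to infinity ([clear_column]). The chiral components are then entire. The
    inverse automorphism forces their derivatives to be invertible ([chiral_inverse]), so the growth
    at infinity is that of a simple pole at most, and Liouville's theorem, applied to each Grassmann
    coefficient, makes them affine or constant ([entire_limit], [fixed_infinity_affine]). Such a map
    is the action of a triangular supermatrix, and the identity theorem extends the equality to the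
    whole sphere ([agree_everywhere]).

    The superprojective formulas are coordinates on this group modulo even scalars: a supermatrix is
    a scalar times an odd factor times a Moebius matrix of determinant one
    ([supergl_decomposition]), and the action of the product expands to the stated expression
    ([superprojective_homog]). Admissible data are exactly the parameters of such products
    ([superprojective_of_admissible], [admissible_superprojective_of]).

    The analysis is carried out over a [numClosedFieldType], with geometric remainder bounds
    ([taylor]) in place of contour integrals. What it assumes of the topology is verified for the
    complex numbers by [small_powers_complex] and [extreme_value_complex]. *)

Section Taylor.
Variable C : numClosedFieldType.
Implicit Types (f g : C -> C) (a b : nat -> C) (x y h M r : C).

Definition psum a n h : C := \sum_(k < n) a k * h ^+ k.

(* The geometric bound on the remainders replaces the convergence of the series,
   so that no completeness of [C] is needed. *)
Definition taylor f x a := exists M r : C, [/\ 0 <= M, 0 < r &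
  forall h n, `|h| * r <= 2^-1 -> `|f (x + h) - psum a n h| <= M * (`|h| * r) ^+ n].

Lemma nearE x (P : C -> Prop) :
  (\forall y \near x, P y) <-> exists2 e : C, 0 < e & forall h, `|h| < e -> P (x + h).
Proof.
split=> [/nbhs_normP[e /= e0 eP]|[e e0 eP]].
  exists e => // h he; apply: eP => /=.
  by rewrite opprD addrA subrr add0r normrN.
apply/nbhs_normP; exists e => //= y /= xy.
by rewrite -(subrKC x y); apply: eP; rewrite distrC.
Qed.

Lemma half_gt0 : 0 < 2^-1 :> C. Proof. by rewrite invr_gt0 ltr0n. Qed.
Lemma half_le1 : 2^-1 <= 1 :> C. Proof. by rewrite invf_le1 ?ler1n ?ltr0n. Qed.
Lemma half_half : 2^-1 + 2^-1 = 1 :> C. Proof. by field. Qed.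

(** Dividing the product by the sum gives a common lower bound without comparing the two numbers in
    the partial order of [C]. *)
Lemma pos_min (e1 e2 : C) : 0 < e1 -> 0 < e2 ->
  exists e, [/\ 0 < e, e <= e1 & e <= e2].
Proof.
move=> e10 e20; have s0 : 0 < e1 + e2 by apply: addr_gt0.
exists (e1 * e2 / (e1 + e2)); split.
- by rewrite divr_gt0 ?mulr_gt0.
- by rewrite ler_pdivrMr // ler_wpM2l ?(ltW e10) // lerDr ltW.
- by rewrite ler_pdivrMr // mulrC ler_wpM2l ?(ltW e20) // lerDl ltW.
Qed.

Lemma geom_half (t : C) k : 0 <= t -> t <= 2^-1 -> \sum_(i < k) t ^+ i <= 2.
Proof.
(* The term [2 * t ^+ k] strengthens the bound so that it passes through the induction. *)
move=> t0 th; suff: \sum_(i < k) t ^+ i + 2 * t ^+ k <= 2.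
  by apply: le_trans; rewrite lerDl mulr_ge0 ?exprn_ge0.
elim: k => [|k IH]; first by rewrite big_ord0 add0r expr0 mulr1.
apply: le_trans IH; rewrite big_ord_recr /= -addrA lerD2l exprS.
rewrite (_ : 2 * t ^+ k = t ^+ k + t ^+ k); last by rewrite mulr2n mulrDl mul1r.
rewrite lerD2l mulrA -[leRHS]mul1r ler_wpM2r ?exprn_ge0 //.
by rewrite mulrC -ler_pdivlMr ?ltr0n // mul1r.
Qed.

Lemma normX_half (t : C) n : 0 <= t -> t <= 2^-1 -> t ^+ n <= 1.
Proof. by move=> t0 th; rewrite exprn_ile1 // (le_trans th) ?half_le1. Qed.

Lemma taylor_value f x a : taylor f x a -> f x = a 0%N.
Proof.
move=> [M [r [M0 r0 H]]]; have := H 0 1%N.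
rewrite normr0 mul0r addr0 expr1 mulr0 (ltW half_gt0) => /(_ isT).
by rewrite /psum big_ord1 expr0 mulr1 normr_le0 subr_eq0 => /eqP.
Qed.

Lemma psumS a n h : psum a n.+1 h = psum a n h + a n * h ^+ n.
Proof. by rewrite /psum big_ord_recr. Qed.

(** A term of the series is the difference of two consecutive remainders. Evaluated at [h] with
    [|h| r = 1/2], their bounds give Cauchy's estimate, at the cost of doubling [M]. *)
Lemma taylor_coef f x a : taylor f x a ->
  exists M r : C, [/\ 0 <= M, 0 < r, forall k, `|a k| <= M * r ^+ k &
  forall h n, `|h| * r <= 2^-1 -> `|f (x + h) - psum a n h| <= M * (`|h| * r) ^+ n].
Proof.
move=> [M [r [M0 r0 H]]].
have H2 h n : `|h| * r <= 2^-1 ->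
    `|f (x + h) - psum a n h| <= 2 * M * (`|h| * r) ^+ n.
  move=> hr; apply: (le_trans (H _ _ hr)); rewrite ler_wpM2r ?exprn_ge0 ?mulr_ge0 ?(ltW r0) //.
  by rewrite ler_peMl // ler1n.
exists (2 * M), r; split=> // [|k]; first by rewrite mulr_ge0.
pose h := (2 * r)^-1; have h0 : 0 < h by rewrite invr_gt0 mulr_gt0.
have hr : `|h| * r = 2^-1 by rewrite gtr0_norm // /h invfM mulfVK ?gt_eqF.
have E : a k * h ^+ k = (f (x + h) - psum a k h) - (f (x + h) - psum a k.+1 h).
  by rewrite psumS; ring.
have : `|a k * h ^+ k| <= M * 2^-1 ^+ k + M * 2^-1 ^+ k.
  rewrite E; apply: le_trans (ler_normB _ _) _; apply: lerD.
    by have := H h k; rewrite hr => /(_ (lexx _)).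
  have := H h k.+1; rewrite hr => /(_ (lexx _)) /le_trans; apply.
  by rewrite ler_wpM2l // exprS ler_piMl ?half_le1 // exprn_ge0 // ltW // half_gt0.
rewrite normrM normrX (gtr0_norm h0) -ler_pdivlMr ?exprn_gt0 //; move/le_trans; apply.
rewrite -hr (gtr0_norm h0) exprMn le_eqVlt; apply/orP; left; apply/eqP.
by field; rewrite expf_neq0 ?gt_eqF.
Qed.

Lemma taylor_weak f x a M r : 0 <= M -> 0 < r ->
  (forall h n, `|h| * r <= 2^-1 -> `|f (x + h) - psum a n h| <= M * (`|h| * r) ^+ n) ->
  forall M' r' h n, M <= M' -> r <= r' -> `|h| * r' <= 2^-1 ->
  `|f (x + h) - psum a n h| <= M' * (`|h| * r') ^+ n.
Proof.
move=> M0 r0 H M' r' h n MM rr hr.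
have le : `|h| * r <= `|h| * r' by rewrite ler_wpM2l.
apply: le_trans (H _ _ (le_trans le hr)) _.
by apply: ler_pM; rewrite ?exprn_ge0 ?mulr_ge0 ?(ltW r0) // lerXn2r // nnegrE mulr_ge0 ?(ltW r0) // (le_trans (ltW r0)).
Qed.

Lemma taylor_near f g x a : taylor f x a -> (\forall y \near x, f y = g y) -> taylor g x a.
Proof.
move=> [M [r [M0 r0 H]]] /nearE[e e0 fg].
exists M, (r + e^-1); have e'0 : 0 < e^-1 by rewrite invr_gt0.
have rr : r <= r + e^-1 by rewrite lerDl ltW.
split=> // [|h n hr]; first by rewrite addr_gt0.
rewrite -fg; first exact: (taylor_weak M0 r0 H).
have : `|h| * e^-1 <= 2^-1 by apply: le_trans hr; rewrite ler_wpM2l // lerDr ltW.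
rewrite -ler_pdivlMr // invrK => /le_lt_trans; apply.
by rewrite gtr_pMl // invf_lt1 ?ltr1n.
Qed.

Lemma small_eq0 (c K e : C) : 0 < e -> 0 <= K ->
  (forall h, 0 < h -> h < e -> `|c| <= K * h) -> c = 0.
Proof.
move=> e0 K0 H; apply/eqP; apply/negP => /negP c0.
have nc : 0 < `|c| by rewrite normr_gt0.
have d0 : 0 < `|c| + K * e by rewrite ltr_pwDl // mulr_ge0 // ltW.
(* This [h] lies below [e] and makes [K * h] smaller than the norm of [c], which contradicts the
   bound. *)
pose h := e * (`|c| / (`|c| + K * e)) / 2.
have q0 : 0 < `|c| / (`|c| + K * e) by rewrite divr_gt0.
have h0 : 0 < h by apply: divr_gt0 => //; apply: mulr_gt0.
have q1 : `|c| / (`|c| + K * e) <= 1.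
  by rewrite ler_pdivrMr // mul1r lerDl mulr_ge0 // ltW.
have he : h < e.
  rewrite /h ltr_pdivrMr ?ltr0n // ; apply: (@le_lt_trans _ _ e).
    by rewrite ger_pMr.
  by rewrite ltr_pMr // ltr1n.
have := H h h0 he; rewrite /h => /le_gtF/negP; apply.
rewrite mulrA ltr_pdivrMr ?ltr0n //.
rewrite [_ * (_ * _)](_ : _ = `|c| * (K * e / (`|c| + K * e))); last by ring.
rewrite ltr_pM2l //; apply: (@le_lt_trans _ _ 1); last by rewrite ltr1n.
by rewrite ler_pdivrMr // mul1r lerDr normr_ge0.
Qed.

Lemma psum1 a h : psum a 1 h = a 0%N.
Proof. by rewrite /psum big_ord1 expr0 mulr1. Qed.

Lemma psum_eq a b n h : (forall k, (k < n)%N -> a k = b k) -> psum a n h = psum b n h.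
Proof. by move=> ab; apply: eq_bigr => i _; rewrite ab. Qed.

(** Once the coefficients below [n] agree, subtracting the two remainders of order [n.+1] bounds the
    difference of the [n]-th ones by a multiple of [|h|]. The centre is left out so that the lemma
    can continue identities across isolated points. *)
Lemma taylor_uniq_punct f g x a b : taylor f x a -> taylor g x b ->
  (exists2 e : C, 0 < e & forall h, h != 0 -> `|h| < e -> f (x + h) = g (x + h)) -> a = b.
Proof.
move=> [M [r [M0 r0 H]]] [M' [r' [M'0 r'0 H']]] [e e0 fg].
apply/funext => n; elim/ltn_ind: n => n IH.
apply/eqP; rewrite -subr_eq0; apply/eqP.
pose s := r + r'.
have s0 : 0 < s by rewrite addr_gt0.
have [d [d0 de ds]] : exists d : C, [/\ 0 < d, d <= e & d <= (2 * s)^-1].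
  by apply: pos_min => //; rewrite invr_gt0 mulr_gt0.
apply: (@small_eq0 _ ((M + M') * s ^+ n.+1) d) => //.
  by rewrite mulr_ge0 ?addr_ge0 ?exprn_ge0 ?(ltW s0).
move=> h h0 hd.
have nh : `|h| = h by rewrite gtr0_norm.
have hs : `|h| * s <= 2^-1.
  rewrite nh -ler_pdivlMr // -invfM; exact: ltW (lt_le_trans hd ds).
have hn0 : h != 0 by rewrite gt_eqF.
have Hf := taylor_weak M0 r0 H (M' := M) n.+1 (lexx _) (_ : r <= s) hs.
have Hg := taylor_weak M'0 r'0 H' (M' := M') n.+1 (lexx _) (_ : r' <= s) hs.
have {Hf Hg} : `|(a n - b n) * h ^+ n| <= (M + M') * (`|h| * s) ^+ n.+1.
  rewrite [(M + M') * _]mulrDl.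
  have -> : (a n - b n) * h ^+ n =
      (g (x + h) - psum b n.+1 h) - (f (x + h) - psum a n.+1 h).
    rewrite fg //; last by rewrite nh (lt_le_trans hd).
    by rewrite !psumS (psum_eq (b := b)) //; ring.
  rewrite [leRHS]addrC; apply: le_trans (ler_normB _ _) _; apply: lerD.
    by apply: Hg; rewrite lerDr ltW.
  by apply: Hf; rewrite lerDl ltW.
rewrite normrM normrX nh -ler_pdivlMr ?exprn_gt0 // => /le_trans; apply.
rewrite exprMn exprS -!mulrA.
rewrite [h * _](_ : _ = h ^+ n * (h * (s ^+ n.+1 / h ^+ n))); last by ring.
rewrite le_eqVlt; apply/orP; left; apply/eqP.
by field; rewrite expf_neq0.
Qed.

Lemma taylor_uniq f x a b : taylor f x a -> taylor f x b -> a = b.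
Proof. by move=> fa fb; apply: (taylor_uniq_punct fa fb); exists 1. Qed.

Lemma taylorD f g x a b : taylor f x a -> taylor g x b ->
  taylor (fun y => f y + g y) x (fun k => a k + b k).
Proof.
move=> [M [r [M0 r0 H]]] [M' [r' [M'0 r'0 H']]].
exists (M + M'), (r + r'); split; rewrite ?addr_ge0 ?addr_gt0 // => h n hr.
rewrite [X in `|X|](_ : _ = (f (x + h) - psum a n h) + (g (x + h) - psum b n h)); last first.
  rewrite [psum _ _ _](_ : _ = psum a n h + psum b n h); first by ring.
  by rewrite /psum -big_split /=; apply: eq_bigr => i _; rewrite mulrDl.
apply: le_trans (ler_normD _ _) _; rewrite mulrDl; apply: lerD.
  by apply: (taylor_weak M0 r0 H) => //; rewrite lerDl ltW.
by apply: (taylor_weak M'0 r'0 H') => //; rewrite lerDr ltW.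
Qed.

Lemma taylorZ (c : C) f x a : taylor f x a -> taylor (fun y => c * f y) x (fun k => c * a k).
Proof.
move=> [M [r [M0 r0 H]]].
exists (`|c| * M), r; split; rewrite ?mulr_ge0 // => h n hr.
rewrite [X in `|X|](_ : _ = c * (f (x + h) - psum a n h)); last first.
  rewrite mulrBr; congr (_ - _); rewrite /psum mulr_sumr; apply: eq_bigr => i _.
  by rewrite mulrA.
by rewrite normrM -mulrA ler_wpM2l // H.
Qed.

Lemma taylor_const (c : C) x : taylor (fun=> c) x (fun k => if k is 0 then c else 0).
Proof.
exists `|c|, 1; split=> // h n; rewrite mulr1 => hr.
case: n => [|n]; first by rewrite /psum big_ord0 subr0 expr0 mulr1.
rewrite /psum big_ord_recl /= expr0 mulr1 big1 ?addr0 ?subrr ?normr0 ?mulr_ge0 ?exprn_ge0 //.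
by move=> i _; rewrite mul0r.
Qed.

Lemma taylor_id x : taylor id x (fun k => if k is k'.+1 then (k' == 0)%:R else x).
Proof.
exists (`|x| + 1), 1; split=> // h n.
rewrite mulr1 => hr; case: n => [|[|n]].
- rewrite /psum big_ord0 subr0 expr0 mulr1; apply: le_trans (ler_normD _ _) _.
  by rewrite lerD2l; apply: le_trans hr half_le1.
- by rewrite /psum big_ord1 expr0 mulr1 expr1 addrC addKr mulrDl mul1r lerDr mulr_ge0.
rewrite /psum 2!big_ord_recl /= !expr0 mulr1 mul1r expr1 big1; last by move=> i _; rewrite mul0r.
by rewrite addr0 subrr normr0 mulr_ge0 ?addr_ge0 ?exprn_ge0.
Qed.

Definition cauchy a b n : C := \sum_(i < n.+1) a i * b (n - i)%N.

(** The difference is the sum over [k < n] of [b k * h ^+ k] times the remainder of [f] of order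
    [n - k]. These [n] terms all obey the same geometric bound, whence the factor [n]. *)
Lemma cauchy_psum_half f x a b M r (N : C) : 0 <= M -> 0 <= N -> 0 < r ->
  (forall h n, `|h| * r <= 2^-1 -> `|f (x + h) - psum a n h| <= M * (`|h| * r) ^+ n) ->
  (forall k, `|b k| <= N * r ^+ k) ->
  forall h n, `|h| * r <= 2^-1 ->
    `|f (x + h) * psum b n h - psum (cauchy a b) n h| <= n%:R * (N * M) * (`|h| * r) ^+ n.
Proof.
move=> M0 N0 r0 H Hb h n hr.
have E m : psum (cauchy a b) m h = \sum_(k < m) b k * h ^+ k * psum a (m - k) h.
  elim: m => [|m IH]; first by rewrite /psum !big_ord0.
  rewrite psumS IH big_ord_recr /= subSnn psum1.
  have -> : \sum_(i < m) b i * h ^+ i * psum a (m.+1 - i) h =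
    \sum_(i < m) (b i * h ^+ i * psum a (m - i) h + b i * a (m - i)%N * h ^+ m).
    apply: eq_bigr => i _; rewrite subSn ?(ltnW (ltn_ord i)) // psumS mulrDr; congr (_ + _).
    have -> : h ^+ m = h ^+ i * h ^+ (m - i) by rewrite -exprD subnKC // ltnW.
    ring.
  rewrite big_split /= -addrA; congr (_ + _).
  rewrite /cauchy (reindex_inj rev_ord_inj) /= big_ord_recr /= mulrDl mulr_suml subSS subnn.
  congr (_ + _); last by rewrite subn0; ring.
  apply: eq_bigr => i _.
  by rewrite subSS subKn ?(ltnW (ltn_ord i)) // mulrC [a _ * b _]mulrC mulrC.
rewrite E {1}/psum mulr_sumr -sumrB.
apply: le_trans (ler_norm_sum _ _ _) _.
have -> : n%:R * (N * M) * (`|h| * r) ^+ n = \sum_(i < n) N * M * (`|h| * r) ^+ n.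
  by rewrite sumr_const card_ord -[RHS]mulr_natl !mulrA.
apply: ler_sum => i _.
rewrite mulrC -mulrBr normrM normrM normrX.
have -> : (`|h| * r) ^+ n = (`|h| * r) ^+ i * (`|h| * r) ^+ (n - i).
  by rewrite -exprD subnKC // ltnW.
rewrite mulrACA; apply: ler_pM; rewrite ?mulr_ge0 ?exprn_ge0 //; last exact: H.
by rewrite exprMn [(`|h| ^+ i) * _]mulrC mulrA ler_wpM2r ?exprn_ge0.
Qed.

Lemma natr_pow2 n : n.+1%:R <= 2 ^+ n :> C.
Proof. by rewrite -natrX ler_nat ltn_expl. Qed.

Lemma taylorM f g x a b : taylor f x a -> taylor g x b ->
  taylor (fun y => f y * g y) x (cauchy a b).
Proof.
move=> /taylor_coef[M [r [M0 r0 Ha H]]] /taylor_coef[N [t [N0 t0 Hb H']]].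
pose s := r + t; have s0 : 0 < s by rewrite addr_gt0.
have rs : r <= s by rewrite lerDl ltW.
have ts : t <= s by rewrite lerDr ltW.
(* Doubling the ratio absorbs the linear factor, as [n.+1 <= 2 ^+ n]. *)
exists (N * M), (2 * s); split; rewrite ?mulr_ge0 ?mulr_gt0 // => h n hr.
have hs : `|h| * s <= 2^-1.
  apply: le_trans hr; rewrite ler_wpM2l // ler_peMl ?ler1n //; exact: ltW.
have Hf m := taylor_weak M0 r0 H m (lexx M) rs hs.
have Hg m := taylor_weak N0 t0 H' m (lexx N) ts hs.
have Hb' k : `|b k| <= N * s ^+ k.
  apply: le_trans (Hb k) _; rewrite ler_wpM2l // lerXn2r // nnegrE ltW //.
have Hc := cauchy_psum_half M0 N0 s0 (fun h n => @taylor_weak f x a M r M0 r0 H M s h n (lexx M) rs) Hb' n hs.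
have -> : f (x + h) * g (x + h) - psum (cauchy a b) n h =
  f (x + h) * (g (x + h) - psum b n h) + (f (x + h) * psum b n h - psum (cauchy a b) n h) by ring.
apply: le_trans (ler_normD _ _) _.
apply: (@le_trans _ _ (n.+1%:R * (N * M) * (`|h| * s) ^+ n)).
  rewrite -addn1 natrD !mulrDl addrC; apply: lerD => //.
  rewrite mul1r normrM [N * M]mulrC -mulrA; apply: ler_pM => //.
  by have := Hf 0%N; rewrite /psum big_ord0 subr0 expr0 mulr1.
rewrite -[leLHS]mulrA [leLHS]mulrCA ler_wpM2l ?mulr_ge0 //.
rewrite (mulrCA _ 2 s) [leRHS]exprMn ler_wpM2r ?natr_pow2 //.
by rewrite exprn_ge0 // mulr_ge0 // ltW.
Qed.

(** A coefficient of the inverse series depends on all the earlier ones, so the recursion carries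
    their whole list. *)
Fixpoint inv_coefs a n : seq C :=
  if n is m.+1 then let s := inv_coefs a m in
    rcons s (if m is 0 then (a 0%N)^-1
             else - ((a 0%N)^-1 * \sum_(i < m) a i.+1 * s`_(m - i.+1)))
  else [::].

Definition inv_coef a n := (inv_coefs a n.+1)`_n.

Lemma size_inv_coefs a n : size (inv_coefs a n) = n.
Proof. by elim: n => //= n IH; rewrite size_rcons IH. Qed.

Lemma nth_inv_coefs a n k : (k < n)%N -> (inv_coefs a n)`_k = inv_coef a k.
Proof.
elim: n => // n IH; rewrite ltnS leq_eqVlt => /orP[/eqP -> //|kn].
by rewrite /= nth_rcons size_inv_coefs kn IH.
Qed.

Lemma inv_coef0 a : inv_coef a 0 = (a 0%N)^-1. Proof. by []. Qed.

Lemma inv_coefsS a m : inv_coefs a m.+1 = rcons (inv_coefs a m)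
  (if m is 0 then (a 0%N)^-1
   else - ((a 0%N)^-1 * \sum_(i < m) a i.+1 * (inv_coefs a m)`_(m - i.+1))).
Proof. by []. Qed.

Lemma inv_coefS a n : inv_coef a n.+1 =
  - ((a 0%N)^-1 * \sum_(i < n.+1) a i.+1 * inv_coef a (n - i)).
Proof.
rewrite /inv_coef; set m := n.+1.
rewrite inv_coefsS nth_rcons size_inv_coefs ltnn eqxx.
congr (- (_ * _)); apply: eq_bigr => i _.
by rewrite nth_inv_coefs ?subSS // ltnS leq_subr.
Qed.

Lemma cauchy_inv a n : a 0%N != 0 -> cauchy a (inv_coef a) n = (n == 0%N)%:R.
Proof.
move=> a0; case: n => [|n]; first by rewrite /cauchy big_ord1 inv_coef0 mulfV.
rewrite /cauchy big_ord_recl subn0 inv_coefS mulrN mulVKf //= addrC.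
apply/eqP; rewrite subr_eq0; apply/eqP; apply: eq_bigr => i _.
by rewrite /bump /= add1n subSS.
Qed.

(** With [c = M / |a 0|], the recursion bounds the next coefficient by [c] times the sum of the
    powers of [1 + c], and this sum telescopes by [subrX1]. *)
Lemma inv_coef_bound a M r : a 0%N != 0 -> 0 <= M -> 0 < r ->
  (forall k, `|a k| <= M * r ^+ k) ->
  forall k, `|inv_coef a k| <= `|a 0%N|^-1 * (r * (1 + M / `|a 0%N|)) ^+ k.
Proof.
move=> a0 M0 r0 H; have na0 : 0 < `|a 0%N| by rewrite normr_gt0.
set c := M / _; have c0 : 0 <= c by rewrite divr_ge0 // ltW.
elim/ltn_ind => -[|n] IH; first by rewrite inv_coef0 normfV expr0 mulr1.
rewrite inv_coefS normrN normrM normfV ler_wpM2l ?invr_ge0 //.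
apply: le_trans (ler_norm_sum _ _ _) _.
apply: (@le_trans _ _ (\sum_(i < n.+1) M * r ^+ i.+1 * (`|a 0%N|^-1 * (r * (1 + c)) ^+ (n - i)))).
  apply: ler_sum => i _; rewrite normrM; apply: ler_pM => //.
  by apply: IH; rewrite ltnS leq_subr.
rewrite (reindex_inj rev_ord_inj) /=.
apply: (@le_trans _ _ (\sum_(i < n.+1) r ^+ n.+1 * (c * (1 + c) ^+ i))); last first.
  rewrite -mulr_sumr -mulr_sumr exprMn ler_wpM2l ?exprn_ge0 ?(ltW r0) //.
  have := subrX1 (1 + c) n.+1; rewrite [1 + c - 1]addrAC subrr add0r => <-.
  by rewrite gerBl.
apply: ler_sum => i _; rewrite le_eqVlt; apply/orP; left; apply/eqP.
have le : (i <= n)%N by rewrite -ltnS.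
rewrite subSS subKn // exprMn.
have -> : r ^+ n.+1 = r ^+ (n - i).+1 * r ^+ i by rewrite -exprD addSn subnK.
by rewrite /c; ring.
Qed.

(** The remainder is [(1 - f * psum b) / f]. The product with the inverse series has partial sums 1,
    so [cauchy_psum_half] controls the numerator, while the first-order remainder keeps [f] away
    from zero. *)
Lemma taylorV f x a : taylor f x a -> f x != 0 ->
  exists b, taylor (fun y => (f y)^-1) x b.
Proof.
move=> fa; rewrite (taylor_value fa); move: fa => /taylor_coef[M [r [M0 r0 Ha H]]] a0.
have na0 : 0 < `|a 0%N| by rewrite normr_gt0.
exists (inv_coef a); set c := M / `|a 0%N|.
have c0 : 0 <= c by rewrite divr_ge0 // ltW.
pose s := r * (1 + c).
have c10 : 0 < 1 + c by rewrite ltr_pwDl.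
have s0 : 0 < s by rewrite mulr_gt0.
have rs : r <= s by rewrite ler_peMr ?(ltW r0) // lerDl.
pose N := `|a 0%N|^-1; have N0 : 0 <= N by rewrite invr_ge0.
have Hb := inv_coef_bound a0 M0 r0 Ha.
(* The part [2 * s] absorbs the factor [n] of the product estimate; the part [c * r] keeps
   [|f (x + h)|] above half of [|a 0|]. *)
pose d := 2 * s + c * r.
exists (2 * N * (1 + N * M)), d.
have d0 : 0 < d by rewrite /d ltr_pwDl ?mulr_ge0 ?(ltW r0) // mulr_gt0.
split=> // [|h n hd]; first by rewrite !mulr_ge0 // addr_ge0 // mulr_ge0.
have h2s : `|h| * (2 * s) <= 2^-1.
  by apply: le_trans hd; rewrite ler_wpM2l // lerDl mulr_ge0 ?(ltW r0).
have hcr : `|h| * (c * r) <= 2^-1.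
  by apply: le_trans hd; rewrite ler_wpM2l // lerDr mulr_ge0 ?(ltW s0).
have hs : `|h| * s <= 2^-1.
  apply: le_trans h2s; rewrite ler_wpM2l // ler_peMl ?ler1n //; exact: ltW.
have hr : `|h| * r <= 2^-1 by apply: le_trans hs; rewrite ler_wpM2l.
have low : 2^-1 * `|a 0%N| <= `|f (x + h)|.
  have := H h 1%N hr; rewrite psum1 expr1 => fh.
  have : `|a 0%N| <= `|f (x + h)| + M * (`|h| * r).
    rewrite -{1}(subKr (f (x + h)) (a 0%N)).
    by apply: le_trans (ler_normB _ _) _; rewrite lerD2l.
  have -> : M * (`|h| * r) = `|h| * (c * r) * `|a 0%N|.
    by rewrite /c; field; rewrite gt_eqF.
  rewrite -lerBlDr; apply: le_trans.
  apply: le_trans (_ : (1 - `|h| * (c * r)) * `|a 0%N| <= _); last by rewrite mulrBl mul1r.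
  rewrite ler_wpM2r // lerBrDr.
  by rewrite -[leRHS]half_half lerD2l.
have fn0 : 0 < `|f (x + h)| by apply: lt_le_trans low; rewrite mulr_gt0 ?half_gt0.
have fx0 : f (x + h) != 0 by rewrite -normr_gt0.
have -> : (f (x + h))^-1 - psum (inv_coef a) n h =
   (f (x + h))^-1 * (1 - f (x + h) * psum (inv_coef a) n h) by field.
rewrite normrM normfV.
have key : `|1 - f (x + h) * psum (inv_coef a) n h| <= (1 + N * M) * (`|h| * d) ^+ n.
  have dn : (`|h| * (2 * s)) ^+ n <= (`|h| * d) ^+ n.
    have A1 : 0 <= `|h| * (2 * s) by rewrite mulr_ge0 // mulr_ge0 // ltW.
    have A2 : 0 <= `|h| * d by rewrite mulr_ge0 // ltW.
    have A3 : `|h| * (2 * s) <= `|h| * d by rewrite ler_wpM2l // lerDl mulr_ge0 // ltW.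
    by rewrite lerXn2r.
  apply: (@le_trans _ _ ((1 + N * M) * (`|h| * (2 * s)) ^+ n)); last first.
    by rewrite ler_wpM2l // addr_ge0 // mulr_ge0.
  case: n dn => [|n] _.
    by rewrite /psum big_ord0 mulr0 subr0 normr1 expr0 mulr1 lerDl mulr_ge0.
  have := cauchy_psum_half M0 N0 s0 (fun h n => @taylor_weak f x a M r M0 r0 H M s h n (lexx M) rs) Hb n.+1 hs.
  have -> : psum (cauchy a (inv_coef a)) n.+1 h = 1.
    rewrite /psum big_ord_recl /= cauchy_inv // expr0 mulr1 big1 ?addr0 // => i _.
    by rewrite cauchy_inv // mul0r.
  rewrite distrC => /le_trans; apply.
  apply: (@le_trans _ _ ((N * M) * (`|h| * (2 * s)) ^+ n.+1)); last first.
    apply: ler_wpM2r; last by rewrite lerDr.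
    by rewrite exprn_ge0 // mulr_ge0 // mulr_ge0 // ltW.
  rewrite -[leLHS]mulrA [leLHS]mulrCA ler_wpM2l ?mulr_ge0 //.
  rewrite (mulrCA _ 2 s) [leRHS]exprMn ler_wpM2r //.
    by rewrite exprn_ge0 // mulr_ge0 // ltW.
  apply: le_trans (natr_pow2 _) _; rewrite exprS ler_peMl ?ler1n // exprn_ge0 //.
rewrite -[leRHS]mulrA.
apply: ler_pM; rewrite ?invr_ge0 //.
rewrite /N -[2]invrK -invfM lef_pV2 // posrE ?mulr_gt0 ?half_gt0 //.
Qed.

Lemma taylor_shift f g x a : taylor f x a -> g x = a 1%N ->
  (forall h, f (x + h) = a 0%N + h * g (x + h)) -> taylor g x (fun k => a k.+1).
Proof.
move=> /taylor_coef[M [r [M0 r0 Ha H]]] g0 fg.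
exists (M * r), r; split=> // [|h n hr]; first by rewrite mulr_ge0 // ltW.
have [->|h0] := eqVneq h 0.
  rewrite addr0 g0 normr0 mul0r; case: n => [|n].
    by rewrite /psum big_ord0 subr0 expr0 mulr1; have := Ha 1%N; rewrite expr1.
  rewrite /psum big_ord_recl expr0 mulr1 big1 => [|i _]; last by rewrite /= expr0n mulr0.
  by rewrite addr0 subrr normr0 expr0n mulr0.
have nh : 0 < `|h| by rewrite normr_gt0.
have := H h n.+1 hr; rewrite fg /psum big_ord_recl expr0 mulr1 opprD addrACA subrr add0r.
have -> : \sum_(i < n) a (lift ord0 i) * h ^+ lift ord0 i = h * psum (fun k => a k.+1) n h.
  rewrite /psum mulr_sumr; apply: eq_bigr => i _.
  by rewrite /= /bump add1n exprS; ring.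
rewrite -mulrBr normrM mulrC -ler_pdivlMr // => /le_trans; apply.
rewrite exprS le_eqVlt; apply/orP; left; apply/eqP; field.
by rewrite gt_eqF.
Qed.

Lemma taylor_lip f x a : taylor f x a -> exists L e : C, [/\ 0 <= L, 0 < e &
  forall h, `|h| < e -> `|f (x + h) - f x| <= L * `|h| ].
Proof.
move=> fa; have v := taylor_value fa; case: fa => M [r [M0 r0 H]].
exists (M * r), (2 * r)^-1; split; rewrite ?mulr_ge0 ?invr_gt0 ?mulr_gt0 ?(ltW r0) // => h hr.
have := H h 1%N; rewrite psum1 expr1 -v mulrAC -mulrA; apply.
by rewrite -ler_pdivlMr // -invfM ltW.
Qed.

Lemma taylor_continuous f x a : taylor f x a -> {for x, continuous f}.
Proof.
move=> /taylor_lip[L [e [L0 e0 H]]]; apply/(@cvgrPdist_lt _ _ _ _ (nbhs_filter x)) => d d0; apply/nearE.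
have L10 : 0 < L + 1 by rewrite ltr_pwDr.
have [c [c0 ce cd]] := pos_min e0 (divr_gt0 d0 L10).
exists c => // h hc; rewrite distrC; apply: le_lt_trans (H _ (lt_le_trans hc ce)) _.
apply: (@le_lt_trans _ _ ((L + 1) * `|h|)); first by rewrite ler_wpM2r // lerDl.
by rewrite mulrC -ltr_pdivlMr //; apply: lt_le_trans cd.
Qed.

Lemma taylor_quad f x a : taylor f x a -> exists L e : C, [/\ 0 <= L, 0 < e &
  forall h, `|h| < e -> `|f (x + h) - f x - a 1%N * h| <= L * `|h| ^+ 2 ].
Proof.
move=> fa; have v := taylor_value fa; case: fa => M [r [M0 r0 H]].
exists (M * r ^+ 2), (2 * r)^-1; split; rewrite ?mulr_ge0 ?exprn_ge0 ?invr_gt0 ?mulr_gt0 ?(ltW r0) // => h hr.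
have := H h 2%N; rewrite psumS psum1 expr1 -v opprD addrA.
have -> : M * (`|h| * r) ^+ 2 = M * r ^+ 2 * `|h| ^+ 2 by ring.
apply.
by rewrite -ler_pdivlMr // -invfM ltW.
Qed.

Lemma taylor_derive1 f x a : taylor f x a -> derive1 f x = a 1%N.
Proof.
move=> /taylor_quad[L [e [L0 e0 H]]]; apply/cvg_lim => //.
apply/cvgrPdist_lt => d d0; apply/nearE.
have L10 : 0 < L + 1 by rewrite ltr_pwDr.
have [c [c0 ce cd]] := pos_min e0 (divr_gt0 d0 L10).
exists c => // h hc; rewrite add0r => h0.
have nh : 0 < `|h| by rewrite normr_gt0.
have -> : a 1%N - h^-1 *: (f (h + x) - f x) = - (h^-1 * (f (x + h) - f x - a 1%N * h)).
  by rewrite (addrC h x) /GRing.scale /=; field.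
rewrite normrN normrM normfV mulrC ltr_pdivrMr //.
apply: le_lt_trans (H _ (lt_le_trans hc ce)) _; rewrite expr2 mulrA ltr_pM2r //.
apply: (@le_lt_trans _ _ ((L + 1) * `|h|)); first by rewrite ler_wpM2r // lerDl.
by rewrite mulrC -ltr_pdivlMr //; apply: lt_le_trans cd.
Qed.

Lemma eq_taylor f g x a : taylor f x a -> f =1 g -> taylor g x a.
Proof. by move=> fa fg; have -> : g = f by apply/funext => y; rewrite fg. Qed.

Lemma diffX_bound (k : nat) (h t s : C) : 0 <= s -> `|h| <= s -> `|h + t| <= s ->
  `|(h + t) ^+ k.+1 - h ^+ k.+1| <= k.+1%:R * s ^+ k * `|t|.
Proof.
move=> s0 hs hts; rewrite subrXX (addrAC h t) subrr add0r normrM mulrC ler_wpM2r //.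
apply: le_trans (ler_norm_sum _ _ _) _.
have -> : k.+1%:R * s ^+ k = \sum_(i < k.+1) s ^+ k by rewrite sumr_const card_ord mulr_natl.
apply: ler_sum => i _.
rewrite normrM !normrX; have -> : s ^+ k = s ^+ (k - i) * s ^+ i.
  by rewrite -exprD subnK // -ltnS.
by apply: ler_pM; rewrite ?exprn_ge0 // lerXn2r ?nnegrE.
Qed.

Lemma diffX_quad (k : nat) (h : C) : exists2 K, 0 <= K & forall t, `|t| <= `|h| ->
  `|(h + t) ^+ k - h ^+ k - k%:R * h ^+ k.-1 * t| <= K * `|t| ^+ 2.
Proof.
elim: k => [|k [K K0 IH]].
  by exists 0 => // t _; rewrite !expr0 subrr !mul0r subr0 normr0.
exists (2 * `|h| * K + k%:R * `|h| ^+ k.-1) => [|t th].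
  by rewrite addr_ge0 ?mulr_ge0 // ?exprn_ge0.
have -> : (h + t) ^+ k.+1 - h ^+ k.+1 - k.+1%:R * h ^+ k.+1.-1 * t =
  (h + t) * ((h + t) ^+ k - h ^+ k - k%:R * h ^+ k.-1 * t) + k%:R * h ^+ k.-1 * t ^+ 2.
  case: k {IH} => [|k]; first by rewrite !expr0 !expr1; ring.
  rewrite /= !exprS -[k.+2%:R]natr1; ring.
apply: le_trans (ler_normD _ _) _; rewrite [leRHS]mulrDl; apply: lerD.
  rewrite normrM -[leRHS]mulrA.
  apply: ler_pM => //; last exact: IH.
  apply: le_trans (ler_normD _ _) _.
  by rewrite mulr_natl mulr2n lerD2l.
by rewrite !normrM !normrX normr_nat.
Qed.

(* [small_powers] and [extreme_value] below are what is used of the topology of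
   the complex numbers. *)
Definition small_powers := forall e : C, 0 < e -> exists n, 2^-1 ^+ n < e.
Hypothesis archC : small_powers.

Lemma le_small_powers (t x K : C) : 0 <= K -> 0 <= t -> t <= 2^-1 -> x \is Num.real ->
  (forall n, x <= K * t ^+ n) -> x <= 0.
Proof.
move=> K0 t0 th xr H; rewrite real_leNgt ?real0 //; apply/negP => x0.
have K10 : 0 < K + 1 by rewrite ltr_pwDr.
have [n] := archC (divr_gt0 x0 K10).
rewrite ltr_pdivlMr // => /lt_geF/negP; apply.
apply: le_trans (H n) _; rewrite mulrC; apply: ler_pM; rewrite ?exprn_ge0 // ?lerDl //.
by rewrite lerXn2r // nnegrE // ltW // half_gt0.
Qed.

Definition dcoef a k : C := k.+1%:R * a k.+1.

Lemma psum_dcoef a n h : psum (dcoef a) n h = \sum_(k < n.+1) k%:R * a k * h ^+ k.-1.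
Proof.
rewrite big_ord_recl mul0r mul0r add0r; apply: eq_bigr => i _.
by rewrite /= /bump add1n.
Qed.

Lemma psum_split a n N h : (n <= N)%N ->
  psum a N h = psum a n h + \sum_(n <= k < N) a k * h ^+ k.
Proof.
move=> nN; have F m : psum a m h = \sum_(0 <= k < m) a k * h ^+ k by rewrite big_mkord.
by rewrite !F (@big_cat_nat _ _ _ n).
Qed.

(** Each difference of powers contributes [k.+1 * (2 |h|) ^ k * |t|]; bounding [k.+1] by [2 ^ k]
    gives the ratio [4 r |h|], at most one half, and the geometric sum is at most 2. *)
Lemma tail_bound a M r n N h t : 0 <= M -> 0 < r -> (forall k, `|a k| <= M * r ^+ k) ->
  `|t| <= `|h| -> `|h| * (4 * r) <= 2^-1 ->
  `|\sum_(n.+1 <= k < N) a k * ((h + t) ^+ k - h ^+ k)| <=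
    2 * M * r * (`|h| * (4 * r)) ^+ n * `|t|.
Proof.
move=> M0 r0 Ha th hr.
pose q := `|h| * (4 * r); have q0 : 0 <= q by rewrite mulr_ge0 // mulr_ge0 // ltW.
have h2 : `|h| <= 2 * `|h| by rewrite ler_peMl // ler1n.
have ht2 : `|h + t| <= 2 * `|h|.
  by apply: le_trans (ler_normD _ _) _; rewrite mulr_natl mulr2n lerD2l.
have step k : `|a k.+1 * ((h + t) ^+ k.+1 - h ^+ k.+1)| <= M * r * `|t| * q ^+ k.
  rewrite normrM; apply: (@le_trans _ _ (M * r ^+ k.+1 * (k.+1%:R * (2 * `|h|) ^+ k * `|t|))).
    by apply: ler_pM => //; apply: diffX_bound => //; rewrite mulr_ge0.
  rewrite exprS.
  have -> : M * (r * r ^+ k) * (k.+1%:R * (2 * `|h|) ^+ k * `|t|) =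
     M * r * `|t| * (k.+1%:R * (2 * `|h| * r) ^+ k) by rewrite !exprMn; ring.
  rewrite ler_wpM2l ?mulr_ge0 ?(ltW r0) //.
  have -> : q ^+ k = 2 ^+ k * (2 * `|h| * r) ^+ k by rewrite -exprMn /q; congr (_ ^+ _); ring.
  by rewrite ler_wpM2r ?natr_pow2 // exprn_ge0 // !mulr_ge0 // ltW.
have [Nn|nN] := leqP N n.+1.
  by rewrite big_geq // normr0 !mulr_ge0 ?exprn_ge0 // ltW.
apply: le_trans (ler_norm_sum _ _ _) _.
rewrite -(subnK (ltnW nN)) -{1}(add0n n.+1) big_addn addnK big_mkord.
apply: (@le_trans _ _ (\sum_(i < N - n.+1) M * r * `|t| * q ^+ n * q ^+ i)).
  apply: ler_sum => i _; rewrite addnS; apply: le_trans (step _) _.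
  by rewrite exprD le_eqVlt; apply/orP; left; apply/eqP; ring.
rewrite -mulr_sumr.
have -> : 2 * M * r * q ^+ n * `|t| = M * r * `|t| * q ^+ n * 2 by ring.
by rewrite ler_wpM2l ?geom_half // !mulr_ge0 ?exprn_ge0 // ltW.
Qed.

(** Term-by-term differentiation without integrals. The derivative [D] at [x + h] exists since [f]
    has an expansion there; an increment [t] compares [D] with the truncated derived series [S], the
    tail of the series being bounded by a multiple of [|t|]. *)
Lemma taylor_deriv f x a : (\forall y \near x, exists b, taylor f y b) -> taylor f x a ->
  taylor (derive1 f) x (dcoef a).
Proof.
move=> /nearE[e e0 near_f] fa; have := taylor_coef fa => -[M [r [M0 r0 Ha H]]].
(* The summand [4 * r] meets the condition of [tail_bound], and [e^-1] keeps [x + h] where [f] has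
   an expansion. *)
pose r' := 4 * r + e^-1.
have e'0 : 0 < e^-1 by rewrite invr_gt0.
have r'0 : 0 < r' by rewrite addr_gt0 // mulr_gt0.
exists (2 * M * r), r'; split=> // [|h n hr]; first by rewrite !mulr_ge0 // ltW.
have h4r : `|h| * (4 * r) <= 2^-1.
  by apply: le_trans hr; rewrite ler_wpM2l // lerDl ltW.
have q0 : 0 <= `|h| * (4 * r) by rewrite mulr_ge0 // mulr_ge0 // ltW.
have qle : (`|h| * (4 * r)) ^+ n <= (`|h| * r') ^+ n.
  have A : `|h| * (4 * r) <= `|h| * r' by rewrite ler_wpM2l // lerDl ltW.
  by rewrite lerXn2r // nnegrE (le_trans q0).
have [h0|h0] := eqVneq h 0.
  rewrite h0 addr0 (taylor_derive1 fa) normr0 mul0r; case: n {qle} => [|n].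
    rewrite /psum big_ord0 subr0 expr0 mulr1 -mulrA; have := Ha 1%N; rewrite expr1 => /le_trans; apply.
    by rewrite ler_peMl ?ler1n // mulr_ge0 // ltW.
  rewrite /psum big_ord_recl expr0 mulr1 big1 => [|i _]; last by rewrite /= expr0n mulr0.
  by rewrite /dcoef mul1r addr0 subrr normr0 expr0n mulr0.
have nh : 0 < `|h| by rewrite normr_gt0.
have he : `|h| < e.
  have : `|h| * e^-1 <= 2^-1.
    by apply: le_trans hr; rewrite ler_wpM2l // lerDr ltW // mulr_gt0.
  rewrite -ler_pdivlMr // invrK => /le_lt_trans; apply.
  by rewrite gtr_pMl // invf_lt1 ?ltr1n.
have [b fb] := near_f h he; rewrite (taylor_derive1 fb).
have [L [d [L0 d0 HL]]] := taylor_quad fb.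
set D := b 1%N; set S := psum (dcoef a) n h.
have [K K0 HK] : exists2 K, 0 <= K & forall t, `|t| <= `|h| ->
   `|psum a n.+1 (h + t) - psum a n.+1 h - S * t| <= K * `|t| ^+ 2.
  have /choice[KK HKK] : forall k, exists K, 0 <= K /\ forall t, `|t| <= `|h| ->
      `|(h + t) ^+ k - h ^+ k - k%:R * h ^+ k.-1 * t| <= K * `|t| ^+ 2.
    by move=> k; have [K K0 HK] := diffX_quad k h; exists K.
  exists (\sum_(k < n.+1) `|a k| * KK k) => [|t th].
    by apply: sumr_ge0 => k _; rewrite mulr_ge0 //; case: (HKK k).
  rewrite /S psum_dcoef /psum -sumrB mulr_suml -sumrB mulr_suml.
  apply: le_trans (ler_norm_sum _ _ _) _; apply: ler_sum => k _.
  have -> : a k * (h + t) ^+ k - a k * h ^+ k - k%:R * a k * h ^+ k.-1 * t =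
    a k * ((h + t) ^+ k - h ^+ k - k%:R * h ^+ k.-1 * t) by ring.
  by rewrite normrM -[leRHS]mulrA ler_wpM2l //; case: (HKK k) => _; apply.
pose B := 2 * M * r * (`|h| * (4 * r)) ^+ n.
have B0 : 0 <= B by rewrite !mulr_ge0 ?exprn_ge0 // ltW.
(* For every [N], [(D - S) * t] splits into two remainders of order at least [N], a tail, and two
   errors quadratic in [t]. The remainders tend to zero with [N]; afterwards [t] is made small to
   get rid of the quadratic errors. *)
have key (t : C) : `|t| < d -> `|t| <= `|h| -> `|D - S| * `|t| <= B * `|t| + (K + L) * `|t| ^+ 2.
  move=> td th; rewrite -subr_le0.
  apply: (@le_small_powers (`|h| * (4 * r)) _ (2 * M)) => //; first by rewrite mulr_ge0.
    have X0 : 0 <= B * `|t| + (K + L) * `|t| ^+ 2.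
      apply: addr_ge0; first exact: mulr_ge0.
      by apply: mulr_ge0; [exact: addr_ge0|exact: exprn_ge0].
    by apply: realB; apply: ger0_real => //; exact: mulr_ge0.
  move=> N; rewrite lerBlDr -normrM.
  pose Nn := maxn N n.+1; have nN : (n.+1 <= Nn)%N by rewrite leq_maxr.
  have E : (D - S) * t = (f (x + h + t) - psum a Nn (h + t)) - (f (x + h) - psum a Nn h)
     + (\sum_(n.+1 <= k < Nn) a k * ((h + t) ^+ k - h ^+ k)
     + ((psum a n.+1 (h + t) - psum a n.+1 h - S * t)
     - (f (x + h + t) - f (x + h) - D * t))).
    rewrite !(psum_split _ _ nN).
    have -> : \sum_(n.+1 <= k < Nn) a k * ((h + t) ^+ k - h ^+ k) =
      \sum_(n.+1 <= k < Nn) a k * (h + t) ^+ k - \sum_(n.+1 <= k < Nn) a k * h ^+ k.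
      by rewrite -sumrB; apply: eq_bigr => k _; rewrite mulrBr.
    ring.
  have bound (u : C) : `|u| <= 2 * `|h| -> `|f (x + u) - psum a Nn u| <= M * (`|h| * (4 * r)) ^+ N.
    move=> u2; have ur : `|u| * r <= `|h| * (4 * r).
      apply: (@le_trans _ _ (2 * `|h| * r)); first by rewrite ler_wpM2r // ltW.
      have -> : 2 * `|h| * r = `|h| * (2 * r) by ring.
      by rewrite ler_wpM2l // ler_wpM2r ?(ltW r0) // ler_nat.
    have ur2 : `|u| * r <= 2^-1 by exact: le_trans ur h4r.
    apply: le_trans (H u Nn ur2) _.
    rewrite ler_wpM2l //.
    apply: (@le_trans _ _ ((`|h| * (4 * r)) ^+ Nn)).
      by rewrite lerXn2r ?nnegrE ?mulr_ge0 // ltW.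
    have NNn : (N <= Nn)%N by exact: leq_maxl.
    rewrite -(subnK NNn) exprD ler_piMl ?exprn_ge0 //.
    by rewrite normX_half.
  rewrite E; apply: le_trans (ler_normD _ _) _; apply: lerD.
    rewrite -(addrA x h t); apply: le_trans (ler_normB _ _) _.
    rewrite -mulrA [2 * _]mulr_natl mulr2n; apply: lerD; apply: bound.
      by apply: le_trans (ler_normD _ _) _; rewrite mulr_natl mulr2n lerD2l.
    by rewrite mulr_natl mulr2n lerDl.
  apply: le_trans (ler_normD _ _) _; apply: lerD; first exact: tail_bound.
  apply: le_trans (ler_normB _ _) _; rewrite mulrDl; apply: lerD; [exact: HK|exact: HL].
apply: (@le_trans _ _ B); last by rewrite ler_wpM2l // !mulr_ge0 // ltW.
apply/ler_addgt0Pr => c c0.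
have KL0 : 0 < K + L + 1 by rewrite ltr_pwDr // addr_ge0.
have [t1 [t10 t1d t1h]] := pos_min d0 nh.
have [t [t0 tt1 tc]] := pos_min (divr_gt0 t10 (ltr0Sn _ 1)) (divr_gt0 c0 KL0).
have nt : `|t| = t by rewrite gtr0_norm.
have tlt : t < t1 by apply: le_lt_trans tt1 _; rewrite ltr_pdivrMr // ltr_pMr // ltr1n.
have := key t; rewrite nt (lt_le_trans tlt t1d) (le_trans (ltW tlt) t1h) => /(_ isT isT).
rewrite expr2 mulrA -mulrDl ler_pM2r // => /le_trans; apply.
rewrite lerD2l; apply: (@le_trans _ _ ((K + L + 1) * t)); first by rewrite ler_wpM2r ?(ltW t0) // lerDl.
by rewrite mulrC -ler_pdivlMr.
Qed.

Lemma psum_series a x y n : [series a k * (y - x) ^+ k]_k n = psum a n (y - x).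
Proof. by rewrite /series /= big_mkord. Qed.

(** A series converging at one [h0 != 0] has bounded terms there, which bounds its coefficients
    geometrically; the remainder bound is the limit of bounds on finite tails. The other direction
    needs powers of one half to become arbitrarily small. *)
Lemma analytic_taylor f x : (exists a : nat -> C,
    \forall y \near x, [series a k * (y - x) ^+ k]_k @ \oo --> f y) <->
  exists a, taylor f x a.
Proof.
split=> -[a H]; exists a.
- move: H => /nearE[e e0 H].
  pose h0 := e / 2; have h00 : 0 < h0 by rewrite divr_gt0.
  have nh0 : `|h0| = h0 by rewrite gtr0_norm.
  have h0e : `|h0| < e by rewrite nh0 ltr_pdivrMr // ltr_pMr // ltr1n.
  have /cvg_series_cvg_0 : cvgn [series a k * (x + h0 - x) ^+ k]_k.
    by apply/cvg_ex; exists (f (x + h0)); exact: H.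
  move/(@cvgrPdist_lt _ _ _ _ (eventually_filter)) => /(_ 1 ltr01) [N _ HN].
  (* From rank [N] on the terms are below 1; the earlier ones are bounded by their sum. *)
  pose M := 1 + \sum_(k < N) `|a k * h0 ^+ k|.
  have M0 : 0 <= M by rewrite addr_ge0 // sumr_ge0.
  pose r := h0^-1; have r0 : 0 < r by rewrite invr_gt0.
  have Ha k : `|a k| <= M * r ^+ k.
    rewrite /r exprVn ler_pdivlMr ?exprn_gt0 // -[X in X ^+ _]nh0 -normrX -normrM.
    have [Nk|kN] := leqP N k.
      have := HN k Nk; rewrite /= sub0r normrN addrAC subrr add0r => /ltW/le_trans; apply.
      by rewrite lerDl sumr_ge0.
    rewrite /M (bigD1 (Ordinal kN)) //= addrCA lerDl addr_ge0 // sumr_ge0 //.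
  exists (2 * M), r; split=> // [|h n hr]; first by rewrite mulr_ge0.
  have he : `|h| < e.
    apply: le_lt_trans (_ : h0 < e); last by rewrite -{1}nh0.
    move: hr; rewrite /r ler_pdivrMr // => /le_trans; apply.
    by rewrite ler_piMl ?half_le1 // ltW.
  apply/ler_addgt0Pr => c c0.
  have /(@cvgrPdist_lt _ _ _ _ (eventually_filter)) /(_ c c0)[N1 _ HN1] := H h he.
  pose N2 := maxn N1 n; have nN2 : (n <= N2)%N by exact: leq_maxr.
  have := HN1 N2 (leq_maxl _ _); rewrite psum_series (addrAC x) subrr add0r.
  move=> fN2; have -> : f (x + h) - psum a n h =
    (psum a N2 h - psum a n h) + (f (x + h) - psum a N2 h) by ring.
  apply: le_trans (ler_normD _ _) _; apply: lerD; last exact: ltW.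
  rewrite (psum_split a h nN2) addrAC subrr add0r.
  apply: le_trans (ler_norm_sum _ _ _) _.
  have q0 : 0 <= `|h| * r by rewrite mulr_ge0 // ltW.
  rewrite -(subnK nN2) -{1}(add0n n) big_addn addnK big_mkord.
  apply: (@le_trans _ _ (\sum_(i < N2 - n) M * (`|h| * r) ^+ n * (`|h| * r) ^+ i)).
    apply: ler_sum => i _; rewrite normrM normrX -[leRHS]mulrA -exprD addnC exprMn.
    by rewrite [leRHS]mulrCA [leRHS]mulrC [_ * `|h| ^+ _]mulrC mulrC ler_wpM2r ?exprn_ge0.
  rewrite -mulr_sumr -[2 * M]mulrC -[leRHS]mulrA [2 * _]mulrC mulrA.
  by rewrite ler_wpM2l ?geom_half // mulr_ge0 ?exprn_ge0.
- move: H => [M [r [M0 r0 H]]]; apply/nearE; exists (2 * r)^-1.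
    by rewrite invr_gt0 mulr_gt0.
  move=> h hr; have h2 : `|h| * r <= 2^-1 by rewrite -ler_pdivlMr // -invfM ltW.
  apply/(@cvgrPdist_lt _ _ _ _ (eventually_filter)) => c c0.
  have M10 : 0 < M + 1 by rewrite ltr_pwDr.
  have [N HN] := archC (divr_gt0 c0 M10).
  exists N => // n /= Nn; rewrite psum_series (addrAC x) subrr add0r.
  apply: le_lt_trans (H _ n h2) _.
  move: HN; rewrite ltr_pdivlMr //; apply: le_lt_trans; rewrite mulrC.
  apply: ler_pM; rewrite ?lerDl ?exprn_ge0 ?mulr_ge0 ?(ltW r0) //.
  rewrite -(subnK Nn) exprD; apply: le_trans (_ : (`|h| * r) ^+ N <= _).
    by rewrite ler_piMl ?exprn_ge0 ?mulr_ge0 ?(ltW r0) // normX_half ?mulr_ge0 ?(ltW r0).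
  by rewrite lerXn2r ?nnegrE ?mulr_ge0 ?(ltW r0) // ltW // half_gt0.
Qed.

Definition holo f x := \forall y \near x, exists a, taylor f y a.

Lemma near_join_nbhs (P : C -> Prop) x :
  (\forall y \near x, P y) -> \forall y \near x, \forall z \near y, P z.
Proof. by move=> /nbhs_interior; apply: filterS. Qed.

Lemma holo_taylor f x : holo f x -> exists a, taylor f x a.
Proof. exact: nbhs_singleton. Qed.

Lemma holo_derive1 f x : holo f x -> holo (derive1 f) x.
Proof.
move=> /near_join_nbhs; apply: filterS => y hy.
by have [a fa] := holo_taylor hy; exists (dcoef a); apply: taylor_deriv.
Qed.

Lemma taylor_derive1n k f x a : holo f x -> taylor f x a -> derive1n k f x = k`!%:R * a k.
Proof.
elim: k f a => [|k IH] f a fx fa; first by rewrite /derive1n /= fact0 mul1r (taylor_value fa).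
rewrite derive1Sn (IH _ _ (holo_derive1 fx) (taylor_deriv fx fa)) /dcoef.
by rewrite mulrA -natrM factS mulnC.
Qed.

Lemma analytic_holo (A : set C) f : open A -> analytic_on A f -> forall x, A x -> holo f x.
Proof.
move=> oA aA x Ax; have := open_nbhs_nbhs (conj oA Ax : open_nbhs x A).
by apply: filterS => y Ay; apply/analytic_taylor; apply: aA.
Qed.

(** The maximum principle. If [a p] is the first nonzero coefficient after [a 0], a step in a
    suitable direction multiplies [a 0] by [1 + s ^+ p] up to a higher-order error, so the modulus
    increases. *)
Lemma local_max f x a : taylor f x a -> (\forall y \near x, `|f y| <= `|f x|) ->
  \forall y \near x, f y = f x.
Proof.
move=> fa; have fx := taylor_value fa; case: (fa) => M [r [M0 r0 H]] /nearE[e e0 He].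
have [a0|a0] := eqVneq (a 0%N) 0.
  apply/nearE; exists e => // h /He; rewrite fx a0 normr0 normr_le0 => /eqP //.
have [az|] := pselect (forall k, a k.+1 = 0).
  apply/nearE; exists (2 * r)^-1; first by rewrite invr_gt0 mulr_gt0.
  move=> h hr; have h2 : `|h| * r <= 2^-1 by rewrite -ler_pdivlMr // -invfM ltW.
  apply/eqP; rewrite -subr_eq0 -normr_le0.
  apply: (@le_small_powers (`|h| * r) _ M) => //; first by rewrite mulr_ge0 // ltW.
  case=> [|n].
    have := H h 1%N h2; rewrite psum1 -fx => /le_trans; apply; rewrite ler_wpM2l //.
    by rewrite expr0 expr1 (le_trans h2) ?half_le1.
  have := H h n.+1 h2; rewrite /psum big_ord_recl expr0 mulr1 big1 ?addr0 -?fx //.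
  by move=> i _; rewrite /= /bump add1n az mul0r.
move=> /existsNP[k0 /eqP ak0].
have [|m am mmin] := @ex_minnP (fun k => a k.+1 != 0); first by exists k0.
exfalso; pose p := m.+1.
(* In this direction [a p * (s * eta) ^+ p] is [a 0 * s ^+ p]; the root exists because the field is
   algebraically closed. *)
pose eta := p.-root (a 0%N / a p).
have etap : eta ^+ p = a 0%N / a p by rewrite rootCK.
have eta0 : eta != 0.
  apply/eqP => e1; move: etap; rewrite e1 expr0n /= => /esym/eqP.
  by rewrite mulf_eq0 invr_eq0 (negPf a0) (negPf am).
have neta : 0 < `|eta| by rewrite normr_gt0.
pose K := M * (`|eta| * r) ^+ p.+1.
have K0 : 0 <= K by rewrite mulr_ge0 ?exprn_ge0 ?mulr_ge0 // ltW.
have na0 : 0 < `|a 0%N| by rewrite normr_gt0.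
have K10 : 0 < K + 1 by rewrite ltr_pwDr.
have q0 : 0 < (`|eta| * (2 * r))^-1 by rewrite invr_gt0 mulr_gt0 // mulr_gt0.
have [s1 [s10 s1e s1r]] := pos_min (divr_gt0 e0 neta) q0.
have [s2 [s20 s21 s2K]] := pos_min s10 (divr_gt0 na0 K10).
pose s := s2 / 2; have s0 : 0 < s by rewrite divr_gt0.
have ss2 : s < s2 by rewrite ltr_pdivrMr // ltr_pMr // ltr1n.
have ns : `|s * eta| = s * `|eta| by rewrite normrM gtr0_norm.
have he : `|s * eta| < e.
  by rewrite ns -ltr_pdivlMr // (lt_le_trans ss2) // (le_trans s21).
have hr : `|s * eta| * r <= 2^-1.
  rewrite ns -mulrA -ler_pdivlMr ?mulr_gt0 // -invfM mulrCA.
  by rewrite ltW // (lt_le_trans ss2) // (le_trans s21).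
have := H _ p.+1 hr; rewrite psumS.
have -> : psum a p (s * eta) = a 0%N.
  rewrite /psum big_ord_recl expr0 mulr1 big1 ?addr0 // => i _.
  rewrite /= /bump add1n; have [->|ai] := eqVneq (a i.+1) 0; first by rewrite mul0r.
  by have := mmin _ ai; rewrite leqNgt ltn_ord.
rewrite exprMn etap; have -> : a p * (s ^+ p * (a 0%N / a p)) = a 0%N * s ^+ p by field.
move=> B; have := He _ he; rewrite fx => /le_gtF/negP; apply.
have A1 : `|a 0%N| * (1 + s ^+ p) <= `|f (x + s * eta)| + K * s ^+ p.+1.
  have -> : `|a 0%N| * (1 + s ^+ p) = `|a 0%N + a 0%N * s ^+ p|.
    have s1p : 0 < 1 + s ^+ p by rewrite ltr_pwDl // exprn_ge0 // ltW.
    by rewrite -{2}[a 0%N]mulr1 -mulrDr normrM (gtr0_norm s1p).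
  rewrite -{1}(subKr (f (x + s * eta)) (a 0%N + _)).
  apply: le_trans (ler_normB _ _) _; rewrite lerD2l; apply: le_trans B _.
  by rewrite ns /K le_eqVlt; apply/orP; left; apply/eqP; rewrite !exprMn; ring.
rewrite -(ltrD2r (K * s ^+ p.+1)); apply: lt_le_trans A1.
rewrite mulrDr mulr1 ltrD2l exprS mulrA ltr_pM2r ?exprn_gt0 //.
apply: (@lt_le_trans _ _ ((K + 1) * s)); first by rewrite ltr_pM2r // ltrDl.
by rewrite mulrC -ler_pdivlMr // ltW // (lt_le_trans ss2).
Qed.

Lemma closed_norm_le f c : continuous f -> c \is Num.real -> closed [set x | `|f x| <= c].
Proof.
move=> cf cr; rewrite -[X in closed X]setCK; apply: open_closedC; rewrite openE => x /= /negP.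
rewrite -real_ltNge ?normr_real // => xc; rewrite /interior.
have d0 : 0 < `|f x| - c by rewrite subr_gt0.
have /(@cvgrPdist_lt _ _ _ _ (nbhs_filter x)) /(_ _ d0) := cf x.
apply: filterS => y yx; apply/negP; rewrite -real_ltNge ?normr_real //.
have : `|f x| <= `|f x - f y| + `|f y| by rewrite -{1}(subrK (f y) (f x)) ler_normD.
rewrite -lerBlDl => /(lt_le_trans _); apply; rewrite ltrBrDr addrC -ltrBrDr //.
Qed.

Lemma closed_norm_ge f c : continuous f -> c \is Num.real -> closed [set x | c <= `|f x|].
Proof.
move=> cf cr; rewrite -[X in closed X]setCK; apply: open_closedC; rewrite openE => x /= /negP.
rewrite -real_ltNge ?normr_real // => xc; rewrite /interior.
have d0 : 0 < c - `|f x| by rewrite subr_gt0.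
have /(@cvgrPdist_lt _ _ _ _ (nbhs_filter x)) /(_ _ d0) := cf x.
apply: filterS => y yx; apply/negP; rewrite -real_ltNge ?normr_real //.
have : `|f y| <= `|f x - f y| + `|f x| by rewrite -{1}(subrK (f x) (f y)) distrC ler_normD.
move=> /le_lt_trans; apply; rewrite -ltrBrDr //.
Qed.

Definition extreme_value := forall (K : set C) f, K !=set0 -> closed K ->
  (exists r, forall x, K x -> `|x| <= r) -> continuous f ->
  exists2 c, K c & forall t, K t -> `|f t| <= `|f c|.
Hypothesis evtC : extreme_value.

(** Liouville's theorem from the maximum principle. If [f - l] is not zero, its modulus attains a
    maximum, since it is small far away. Among the points of maximum take one farthest from the
    origin: the function is constant near it, so a still farther point is also one of maximum. *)
Lemma entire_limit f (l : C) : (forall x, exists a, taylor f x a) ->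
  (forall e, 0 < e -> exists2 r, 0 < r & forall w, r < `|w| -> `|f w - l| < e) ->
  forall x, f x = l.
Proof.
move=> fe lim w0; apply/eqP; rewrite -subr_eq0; apply/negP => /negP w0l.
pose g w := f w - l.
have ge x : exists a, taylor g x a.
  have [a fa] := fe x; exists (fun k => a k + if k is 0 then - l else 0).
  exact: taylorD fa (taylor_const _ _).
have gc : continuous g by move=> x; have [a ga] := ge x; exact: taylor_continuous ga.
have gw0 : 0 < `|g w0| by rewrite normr_gt0.
have [r r0 Hr] := lim _ gw0.
pose rho := r + `|w0|.
have rr : r <= rho by rewrite lerDl.
have rhor : rho \is Num.real by rewrite ger0_real // addr_ge0 // ltW.
have [c cK cmax] : exists2 c, `|c| <= rho & forall t, `|t| <= rho -> `|g t| <= `|g c|.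
  apply: (evtC (K := [set x | `|x| <= rho])) => //; last by exists rho.
    by exists w0; rewrite /= lerDr ltW.
  by apply: (closed_norm_le (f := id)) => // x; exact: cvg_id.
have cmaxT t : `|g t| <= `|g c|.
  have [/cmax //|tr] := real_leP (normr_real t) rhor.
  apply: le_trans (cmax w0 _); last by rewrite lerDr ltW.
  by apply: ltW; apply: Hr; apply: le_lt_trans tr.
have gwc : `|g w0| <= `|g c| by [].
(* The points of maximum form a closed bounded set, to which the extreme value property applies
   again, now for the modulus of the identity. *)
have [d [dc dmax]] : exists d, `|g d| = `|g c| /\ forall t, `|g t| = `|g c| -> `|t| <= `|d|.
  have [d dK dm] : exists2 d, `|g c| <= `|g d| & forall t, `|g c| <= `|g t| -> `|t| <= `|d|.
    apply: (evtC (K := [set x | `|g c| <= `|g x|]) (f := id)).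
  - by exists c => /=.
  - by apply: closed_norm_ge => //; rewrite normr_real.
  - exists rho => x /= xK; have [//|tr] := real_leP (normr_real x) rhor.
    have := lt_le_trans (Hr x (le_lt_trans rr tr)) (le_trans gwc xK).
    by rewrite ltxx.
  - by move=> x; exact: cvg_id.
  exists d; split=> [|t tc]; last by apply: dm; rewrite tc.
  by apply/eqP; rewrite eq_le cmaxT.
have [a ga] := ge d.
have /nearE[e e0 He] : \forall y \near d, g y = g d.
  by apply: local_max ga _; apply/nearE; exists 1 => // h _; rewrite dc.
have e20 : 0 < e / 2 by rewrite divr_gt0.
have e2e : e / 2 < e by rewrite ltr_pdivrMr // ltr_pMr // ltr1n.
(* A vector of norm one pointing away from the origin, chosen to be 1 when [d] is the origin. *)
pose u := if d == 0 then 1 else d / `|d|.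
have nu : `|u| = 1.
  rewrite /u; case: eqP => [_|/eqP d0]; first exact: normr1.
  by rewrite normrM normfV normr_id mulfV // normr_eq0.
have du : d = `|d| * u.
  rewrite /u; case: eqP => [->|/eqP d0]; first by rewrite normr0 mul0r.
  by rewrite mulrC divfK // normr_eq0.
have := dmax (d + e / 2 * u); rewrite He; last by rewrite normrM nu mulr1 gtr0_norm.
rewrite {2}du -mulrDl normrM nu mulr1 gtr0_norm ?ltr_wpDl // => /(_ dc).
by rewrite gerDl => /le_gtF; rewrite e20.
Qed.

Lemma entire_infinity f g b (e : C) : (forall x, exists a, taylor f x a) -> taylor g 0 b ->
  0 < e -> (forall h, h != 0 -> `|h| < e -> f h^-1 = g h) -> forall x, f x = g 0.
Proof.
move=> fe gb e0 fg; apply: entire_limit => // d d0.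
have [L [e' [L0 e'0 HL]]] := taylor_lip gb.
have L10 : 0 < L + 1 by rewrite ltr_pwDr.
have [c1 [c10 c1e c1e']] := pos_min e0 e'0.
have [c [c0 cc1 cd]] := pos_min c10 (divr_gt0 d0 L10).
exists c^-1 => [|w wc]; first by rewrite invr_gt0.
have w0 : w != 0 by rewrite -normr_gt0 (lt_trans _ wc) // invr_gt0.
have wic : `|w^-1| < c by rewrite normfV -[c]invrK ltf_pV2 // posrE ?invr_gt0 // normr_gt0.
rewrite -[w]invrK fg ?invr_eq0 //; last by apply: lt_le_trans c1e; apply: lt_le_trans cc1.
have := HL w^-1; rewrite add0r => /(_ _)/le_lt_trans; apply.
  by apply: lt_le_trans c1e'; apply: lt_le_trans cc1.
apply: (@le_lt_trans _ _ ((L + 1) * `|w^-1|)); first by rewrite ler_wpM2r // lerDl.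
by rewrite mulrC -ltr_pdivlMr //; apply: lt_le_trans cd.
Qed.
End Taylor.

(** * Parity, body and generators in the Grassmann algebra *)

Section Grassmann.
Local Open Scope fset_scope.
Local Open Scope ring_scope.
Variable C : numClosedFieldType.
Local Notation Lambda := (grassmann C).
Local Notation zeta := (zeta C).
Implicit Types (a b c : Lambda) (I J : {fset nat}) (n : nat) (Q : {fset nat} -> bool).

Lemma gcoef_sum (T : Type) (r : seq T) (P : pred T) (F : T -> Lambda) I :
  gcoef I (\sum_(t <- r | P t) F t) = \sum_(t <- r | P t) gcoef I (F t).
Proof. by apply: (big_morph (gcoef I)) => [x y|]; rewrite ?gcoefD ?gcoef0. Qed.

Definition gsupport a : {fset {fset nat}} := projT1 (cid (gcoef_finite a)).

Lemma gcoef_out a I : I \notin gsupport a -> gcoef I a = 0.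
Proof. exact: (projT2 (cid (gcoef_finite a)) I). Qed.

Lemma gcoef_zetas (D : {fset {fset nat}}) (f : {fset nat} -> C) I :
  gcoef I (\sum_(J <- D) f J *: zeta J) = if I \in D then f I else 0.
Proof.
rewrite gcoef_sum; case: ifPn => ID; last first.
  rewrite big_seq big1 // => J JD; rewrite gcoefZ gcoef_zeta.
  by case: eqP => [JI|]; [move: ID; rewrite -JI JD|rewrite mulr0].
rewrite (big_fsetD1 I) //= gcoefZ gcoef_zeta eqxx mulr1 big_seq big1 ?addr0 // => J.
by rewrite !inE gcoefZ gcoef_zeta => /andP[/negPf -> _]; rewrite mulr0.
Qed.

Lemma zetaE a : a = \sum_(I <- gsupport a) gcoef I a *: zeta I.
Proof.
apply: gcoefP => I; rewrite gcoef_zetas; case: ifPn => // /gcoef_out.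
by [].
Qed.

(** Parity ([gpar]), number of generators ([glev]) and degree ([gdeg]) are all conditions on the
    monomials that occur, so their closure properties are proved once for an arbitrary [Q]. *)
Definition gsupp (Q : {fset nat} -> bool) a := forall I, gcoef I a != 0 -> Q I.

Lemma gind (Q : {fset nat} -> bool) (P : Lambda -> Prop) a : gsupp Q a -> P 0 ->
  (forall b c, P b -> P c -> P (b + c)) -> (forall k I, Q I -> P (k *: zeta I)) -> P a.
Proof.
move=> Qa P0 PD PZ; rewrite (zetaE a); apply: (big_ind P) => // I _.
have [->|/Qa QI] := eqVneq (gcoef I a) 0; [by rewrite scale0r|exact: PZ].
Qed.

Lemma gindT (P : Lambda -> Prop) a : P 0 ->
  (forall b c, P b -> P c -> P (b + c)) -> (forall k I, P (k *: zeta I)) -> P a.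
Proof. by move=> P0 PD PZ; apply: (@gind xpredT). Qed.

Lemma gsupp0 Q : gsupp Q 0. Proof. by move=> I; rewrite gcoef0 eqxx. Qed.

Lemma gsuppD Q a b : gsupp Q a -> gsupp Q b -> gsupp Q (a + b).
Proof.
move=> Qa Qb I; rewrite gcoefD => ab; have [a0|/Qa //] := eqVneq (gcoef I a) 0.
by apply: Qb; move: ab; rewrite a0 add0r.
Qed.

Lemma gsuppZ Q k a : gsupp Q a -> gsupp Q (k *: a).
Proof. by move=> Qa I; rewrite gcoefZ mulf_eq0 negb_or => /andP[_ /Qa]. Qed.

Lemma gsuppN Q a : gsupp Q a -> gsupp Q (- a).
Proof. by rewrite -scaleN1r; apply: gsuppZ. Qed.

Lemma gsuppB Q a b : gsupp Q a -> gsupp Q b -> gsupp Q (a - b).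
Proof. by move=> Qa Qb; apply: gsuppD => //; apply: gsuppN. Qed.

Lemma gsupp_sum Q (T : Type) (r : seq T) (P : pred T) (F : T -> Lambda) :
  (forall t, P t -> gsupp Q (F t)) -> gsupp Q (\sum_(t <- r | P t) F t).
Proof. by move=> H; apply: (big_ind (gsupp Q)) => //; [exact: gsupp0|exact: gsuppD]. Qed.

Lemma gsupp_zeta Q I : Q I -> gsupp Q (zeta I).
Proof. by move=> QI J; rewrite gcoef_zeta; have [<-|] := eqVneq I J; rewrite ?eqxx. Qed.

Lemma gsuppM (Q Q' Q'' : {fset nat} -> bool) a b : gsupp Q a -> gsupp Q' b ->
  (forall I J, [disjoint I & J]%fset -> Q I -> Q' J -> Q'' (I `|` J)) -> gsupp Q'' (a * b).
Proof.
move=> Qa Qb H; apply: (@gind Q (fun x => gsupp Q'' (x * b)) a Qa); first by rewrite mul0r; apply: gsupp0.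
  by move=> x y Hx Hy; rewrite mulrDl; apply: gsuppD.
move=> k I QI; apply: (@gind Q' (fun x => gsupp Q'' (k *: zeta I * x)) b Qb).
  by rewrite mulr0; apply: gsupp0.
  by move=> x y Hx Hy; rewrite mulrDr; apply: gsuppD.
move=> l J QJ; rewrite -scalerAl -scalerAr zetaM; do 2!apply: gsuppZ.
rewrite /monomial_sign; case: ifP => dIJ; last by rewrite scale0r; apply: gsupp0.
by apply/gsuppZ/gsupp_zeta/H.
Qed.

Lemma gsuppW Q Q' a : (forall I, Q I -> Q' I) -> gsupp Q a -> gsupp Q' a.
Proof. by move=> QQ' Qa I /Qa/QQ'. Qed.

Definition gpar (e : bool) a := gsupp (fun I => odd #|` I| == e) a.

Lemma gevenE a : geven a <-> gpar false a.
Proof.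
split=> [/asboolP H I /H /negbTE /eqP //|H]; apply/asboolP => I /H /eqP ->//.
Qed.

Lemma goddE a : godd a <-> gpar true a.
Proof. by split=> [/asboolP H I /H /eqP //|H]; apply/asboolP => I /H /eqP ->. Qed.

Lemma gpar0 e : gpar e 0. Proof. exact: gsupp0. Qed.
Lemma gparD e a b : gpar e a -> gpar e b -> gpar e (a + b). Proof. exact: gsuppD. Qed.
Lemma gparN e a : gpar e a -> gpar e (- a). Proof. exact: gsuppN. Qed.
Lemma gparB e a b : gpar e a -> gpar e b -> gpar e (a - b). Proof. exact: gsuppB. Qed.
Lemma gparZ e k a : gpar e a -> gpar e (k *: a). Proof. exact: gsuppZ. Qed.

Lemma cardfsU_disj I J : [disjoint I & J]%fset -> (#|` I `|` J| = #|` I| + #|` J|)%N.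
Proof. by move=> /eqP dIJ; rewrite -(cardfsUI I J) dIJ cardfs0 addn0. Qed.

Lemma gparM e e' a b : gpar e a -> gpar e' b -> gpar (e (+) e') (a * b).
Proof.
move=> ea eb; apply: (gsuppM ea eb) => I J dIJ /eqP <- /eqP <-.
by rewrite cardfsU_disj // oddD.
Qed.

Lemma gpar1 : gpar false 1.
Proof. by rewrite -zeta1; apply: gsupp_zeta; rewrite cardfs0. Qed.

Lemma gpar_scal k : gpar false (k%:A : Lambda).
Proof. by apply: gparZ; apply: gpar1. Qed.

Lemma gparX a k : gpar false a -> gpar false (a ^+ k).
Proof.
move=> ea; elim: k => [|k IH]; first exact: gpar1.
by rewrite exprS -[false]/(false (+) false); apply: gparM.
Qed.

Lemma inversionsC I J : [disjoint I & J]%fset ->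
  (inversions I J + inversions J I = #|` I| * #|` J|)%N.
Proof.
move=> dIJ; rewrite /inversions [X in (_ + X)%N]exchange_big -big_split /=.
rewrite -sum1_size big_distrl /= big_seq [RHS]big_seq; apply: eq_bigr => i iI.
rewrite mul1n -sum1_size -big_split /= big_seq [RHS]big_seq; apply: eq_bigr => j jJ.
have := ltngtP i j; case=> // ij.
by move: jJ; rewrite -ij; have /fdisjointP/(_ i iI)/negPf -> := dIJ.
Qed.

Lemma zetaC I J : zeta I * zeta J = (-1) ^+ (odd #|` I| && odd #|` J|) *: (zeta J * zeta I).
Proof.
rewrite !zetaM [in RHS]fsetUC scalerA; congr (_ *: _).
rewrite /monomial_sign fdisjoint_sym; case: ifP => dJI; last by rewrite mulr0.
have dIJ : [disjoint I & J]%fset by rewrite fdisjoint_sym.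
rewrite -signr_odd -[X in _ = _ * X]signr_odd -oddM -(inversionsC dIJ) oddD.
by case: (odd (inversions I J)); case: (odd (inversions J I)); rewrite ?mulr1 ?mul1r ?mulN1r ?opprK.
Qed.

Lemma gcommute e e' a b : gpar e a -> gpar e' b -> a * b = (-1) ^+ (e && e') *: (b * a).
Proof.
move=> ea eb; apply: (@gind _ (fun x => x * b = (-1) ^+ (e && e') *: (b * x)) a ea).
  by rewrite mul0r mulr0 scaler0.
  by move=> x y Hx Hy; rewrite mulrDl mulrDr scalerDr Hx Hy.
move=> k I /eqP eI.
apply: (@gind _ (fun x => k *: zeta I * x = (-1) ^+ (e && e') *: (x * (k *: zeta I))) b eb).
  by rewrite mul0r mulr0 scaler0.
  by move=> x y Hx Hy; rewrite mulrDl mulrDr scalerDr Hx Hy.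
move=> l J /eqP eJ; rewrite -!scalerAl -!scalerAr zetaC eI eJ !scalerA; congr (_ *: _).
by ring.
Qed.

Lemma godd_anticomm a b : gpar true a -> gpar true b -> a * b = - (b * a).
Proof. by move=> oa ob; rewrite (gcommute oa ob) /= expr1 scaleN1r. Qed.

Lemma godd_sqr a : gpar true a -> a * a = 0.
Proof.
move=> oa; have E : (1 + 1 : C) *: (a * a) = 0.
  by rewrite scalerDl !scale1r {1}(godd_anticomm oa oa) addNr.
have := congr1 (fun x => (1 + 1 : C)^-1 *: x) E.
by rewrite scalerA mulVf ?scale1r ?scaler0 // -mulr2n pnatr_eq0.
Qed.

Definition gproj (e : bool) a : Lambda :=
  \sum_(I <- gsupport a) (if odd #|` I| == e then gcoef I a else 0) *: zeta I.

Lemma gcoef_proj e a I : gcoef I (gproj e a) = if odd #|` I| == e then gcoef I a else 0.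
Proof.
rewrite gcoef_zetas; case: ifPn => // /gcoef_out ->.
by rewrite if_same.
Qed.

Lemma gproj_par e a : gpar e (gproj e a).
Proof. by move=> I; rewrite gcoef_proj; case: ifP => //; rewrite eqxx. Qed.

Arguments gproj_par : clear implicits.

Lemma gprojD e a b : gproj e (a + b) = gproj e a + gproj e b.
Proof. by apply: gcoefP => I; rewrite gcoefD !gcoef_proj gcoefD; case: ifP; rewrite ?addr0. Qed.

Lemma gproj_sum a : gproj false a + gproj true a = a.
Proof.
by apply: gcoefP => I; rewrite gcoefD !gcoef_proj; case: odd; rewrite /= ?addr0 ?add0r.
Qed.

Lemma gproj_id e a : gpar e a -> gproj e a = a.
Proof.
move=> ea; apply: gcoefP => I; rewrite gcoef_proj; case: ifPn => // eI.
by have [->//|/ea] := eqVneq (gcoef I a) 0; rewrite (negPf eI).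
Qed.

Lemma gproj_other e a : gpar e a -> gproj (~~ e) a = 0.
Proof.
move=> ea; apply: gcoefP => I; rewrite gcoef_proj gcoef0; case: ifPn => // /eqP eI.
by have [//|/ea] := eqVneq (gcoef I a) 0; rewrite eI; case: (e).
Qed.

Lemma geven_comm a b : gpar false a -> a * b = b * a.
Proof.
move=> ea; rewrite -(gproj_sum b) mulrDr mulrDl.
by rewrite (gcommute ea (gproj_par false b)) (gcommute ea (gproj_par true b)) /= !scale1r.
Qed.

(** The grading automorphism: it is the effect of moving an odd factor across [a] ([gstarP]). *)
Definition gstar a := gproj false a - gproj true a.

Lemma gstarD a b : gstar (a + b) = gstar a + gstar b.
Proof. by rewrite /gstar !gprojD opprD addrACA. Qed.
Lemma gstar_even a : gpar false a -> gstar a = a.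
Proof. by move=> ea; rewrite /gstar (gproj_id ea) (gproj_other ea) subr0. Qed.
Lemma gstar_odd a : gpar true a -> gstar a = - a.
Proof. by move=> ea; rewrite /gstar (gproj_id ea) (gproj_other ea) sub0r. Qed.
Lemma gcoef_star a I : gcoef I (gstar a) = (-1) ^+ odd #|` I| * gcoef I a.
Proof.
rewrite gcoefD gcoefN !gcoef_proj; case: odd; rewrite /= ?expr0 ?expr1.
  by rewrite sub0r mulN1r.
by rewrite subr0 mul1r.
Qed.

Lemma gstarP a t : gpar true t -> a * t = t * gstar a.
Proof.
move=> ot; rewrite -{1}(gproj_sum a) mulrDl /gstar mulrBr.
by rewrite (geven_comm _ (gproj_par false a)) (godd_anticomm (gproj_par true a) ot).
Qed.

Lemma gstarM a b : gstar (a * b) = gstar a * gstar b.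
Proof.
rewrite -{1}(gproj_sum a) -{1}(gproj_sum b) !(mulrDl, mulrDr) !gstarD.
rewrite (gstar_even (gparM (gproj_par false a) (gproj_par false b))).
rewrite (gstar_odd (gparM (gproj_par true a) (gproj_par false b))).
rewrite (gstar_odd (gparM (gproj_par false a) (gproj_par true b))).
rewrite (gstar_even (gparM (gproj_par true a) (gproj_par true b))).
by rewrite /gstar !(mulrDl, mulrDr, mulrN, mulNr, opprK).
Qed.

Lemma bodyD a b : body (a + b) = body a + body b. Proof. exact: gcoefD. Qed.
Lemma bodyN a : body (- a) = - body a. Proof. exact: gcoefN. Qed.
Lemma bodyB a b : body (a - b) = body a - body b. Proof. by rewrite bodyD bodyN. Qed.
Lemma bodyZ k a : body (k *: a) = k * body a. Proof. exact: gcoefZ. Qed.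
Lemma body0 : body (0 : Lambda) = 0. Proof. exact: gcoef0. Qed.
Lemma body1 : body (1 : Lambda) = 1. Proof. by rewrite -zeta1 /body gcoef_zeta eqxx. Qed.
Lemma body_scal k : body (k%:A : Lambda) = k. Proof. by rewrite bodyZ body1 mulr1. Qed.

Lemma body_odd a : gpar true a -> body a = 0.
Proof. by move=> oa; apply/eqP/negP => /negP /oa; rewrite cardfs0. Qed.

Lemma bodyM a b : body (a * b) = body a * body b.
Proof.
apply: (@gindT (fun a => body (a * b) = body a * body b)); rewrite ?mul0r ?body0 ?mul0r //.
  by move=> x y Hx Hy; rewrite mulrDl !bodyD mulrDl Hx Hy.
move=> k I; apply: (@gindT (fun b => body (_ * b) = _ * body b)); rewrite ?mulr0 ?body0 ?mulr0 //.
  by move=> x y Hx Hy; rewrite mulrDr !bodyD mulrDr Hx Hy.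
move=> l J; rewrite -scalerAl -scalerAr zetaM !bodyZ /body !gcoef_zeta.
rewrite fsetU_eq0 /monomial_sign; have [->|I0] := eqVneq I fset0; last first.
  by rewrite andFb !(mulr0, mul0r).
have [->|J0] := eqVneq J fset0; last by rewrite !(mulr0, mul0r).
rewrite fdisjoint0X /inversions big_seq_fset0 expr0 /=; ring.
Qed.

Lemma bodyX a n : body (a ^+ n) = body a ^+ n.
Proof. by elim: n => [|n IH]; rewrite ?expr0 ?body1 // !exprS bodyM IH. Qed.

Lemma soulE a : a = (body a)%:A + soul a. Proof. by rewrite /soul addrC subrK. Qed.
Lemma body_soul a : body (soul a) = 0. Proof. by rewrite /soul bodyB body_scal subrr. Qed.

(* [a] only involves the generators of index less than [n]. *)
Definition glev n a := gsupp (fun I => [forall i : I, (val i < n)%N]) a.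

Lemma glevP n I : reflect (forall i, i \in I -> (i < n)%N) [forall i : I, (val i < n)%N].
Proof.
apply: (iffP forallP) => [H i iI|H i]; first exact: (H [` iI]).
exact: H (valP i).
Qed.

Lemma glev0 n : glev n 0. Proof. exact: gsupp0. Qed.
Lemma glevD n a b : glev n a -> glev n b -> glev n (a + b). Proof. exact: gsuppD. Qed.
Lemma glevN n a : glev n a -> glev n (- a). Proof. exact: gsuppN. Qed.
Lemma glevB n a b : glev n a -> glev n b -> glev n (a - b). Proof. exact: gsuppB. Qed.
Lemma glevZ n k a : glev n a -> glev n (k *: a). Proof. exact: gsuppZ. Qed.
Lemma glevM n a b : glev n a -> glev n b -> glev n (a * b).
Proof.
move=> la lb; apply: (gsuppM la lb) => I J _ /glevP HI /glevP HJ; apply/glevP => i.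
by rewrite in_fsetU => /orP[/HI|/HJ].
Qed.
Lemma glev1 n : glev n 1.
Proof. by rewrite -zeta1; apply: gsupp_zeta; apply/glevP. Qed.
Lemma glev_scal n k : glev n (k%:A : Lambda). Proof. exact/glevZ/glev1. Qed.
Lemma glevX n a k : glev n a -> glev n (a ^+ k).
Proof. by move=> la; elim: k => [|k IH]; [exact: glev1|rewrite exprS; exact: glevM]. Qed.
Lemma glevW n m a : (n <= m)%N -> glev n a -> glev m a.
Proof.
by move=> nm; apply: gsuppW => I /glevP H; apply/glevP => i /H /leq_trans; apply.
Qed.
Lemma glev_proj n e a : glev n a -> glev n (gproj e a).
Proof. by move=> la I; rewrite gcoef_proj; case: ifP => [_ /la //|]; rewrite eqxx. Qed.
Lemma glev_star n a : glev n a -> glev n (gstar a).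
Proof. by move=> la; apply: glevB; exact: glev_proj. Qed.
Lemma glev_soul n a : glev n a -> glev n (soul a).
Proof. by move=> la; apply: glevB => //; exact: glev_scal. Qed.

Lemma glev_ex a : exists n, glev n a.
Proof.
apply: (@gindT (fun a => exists n, glev n a)).
- by exists 0%N; exact: glev0.
- move=> x y [n Hn] [m Hm]; exists (maxn n m).
  by apply: glevD; [apply: glevW Hn; exact: leq_maxl|apply: glevW Hm; exact: leq_maxr].
move=> k I; exists (\sum_(i <- I) i).+1; apply: glevZ; apply: gsupp_zeta; apply/glevP => i iI.
by rewrite ltnS (big_fsetD1 i) //= leq_addr.
Qed.

Definition gdeg k a := gsupp (fun I => k <= #|` I|)%N a.

Lemma gdegM k l a b : gdeg k a -> gdeg l b -> gdeg (k + l) (a * b).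
Proof.
by move=> ka lb; apply: (gsuppM ka lb) => I J dIJ Ik Jl; rewrite cardfsU_disj // leq_add.
Qed.

Lemma gdeg_body0 a : body a = 0 -> gdeg 1 a.
Proof.
move=> a0 I aI; rewrite lt0n cardfs_eq0; apply: contra_neq aI => ->; exact: a0.
Qed.

Lemma gdegX a k : body a = 0 -> gdeg k (a ^+ k).
Proof.
move=> a0; elim: k => [|k IH]; first by move=> I.
by rewrite exprS -add1n; apply: gdegM => //; apply: gdeg_body0.
Qed.

Lemma glev_card n I : [forall i : I, (val i < n)%N] -> (#|` I| <= n)%N.
Proof.
move=> /glevP H; have /fsubset_leq_card : I `<=` [fset i | i in iota 0 n].
  by apply/fsubsetP => i iI; rewrite !inE /= mem_iota /= add0n H.
move=> /leq_trans; apply; rewrite card_imfset //= -{2}(size_iota 0 n).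
exact: size_undup.
Qed.

Lemma glev_gdeg n a : glev n a -> gdeg n.+1 a -> a = 0.
Proof.
move=> la da; apply: gcoefP => I; rewrite gcoef0; apply/eqP/negP => /negP aI.
by have := leq_trans (da I aI) (glev_card (la I aI)); rewrite ltnn.
Qed.

(** Every monomial of the power has degree above [n], yet only [n] generators are available. *)
Lemma soul_nilp n a : glev n a -> body a = 0 -> a ^+ n.+1 = 0.
Proof. by move=> la a0; apply: (@glev_gdeg n); [exact: glevX|exact: gdegX]. Qed.

Lemma nilp_ex a : body a = 0 -> exists n, a ^+ n = 0.
Proof. by move=> a0; have [n la] := glev_ex a; exists n.+1; exact: soul_nilp. Qed.

Lemma gunit_inv n a : glev n a -> body a != 0 ->
  let b := (body a)^-1 *: \sum_(k < n.+1) (- (body a)^-1 *: soul a) ^+ k in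
  b * a = 1 /\ a * b = 1.
Proof.
move=> la a0 /=; set t := - (body a)^-1 *: soul a.
have tn : t ^+ n.+1 = 0.
  by apply: soul_nilp; rewrite ?bodyZ ?body_soul ?mulr0 //; apply/glevZ/glev_soul.
have aE : a = body a *: (1 - t).
  by rewrite /t scalerBr scaleNr scalerN opprK scalerA mulfV // scale1r -soulE.
have G : (1 - t) * \sum_(k < n.+1) t ^+ k = 1.
  have E := subrX1 t n.+1; rewrite tn sub0r in E.
  by rewrite -[1 - t]opprB mulNr -E opprK.
have G' : (\sum_(k < n.+1) t ^+ k) * (1 - t) = 1.
  rewrite -[RHS]G mulr_suml mulr_sumr; apply: eq_bigr => i _.
  by rewrite mulrBr mulrBl mulr1 mul1r -exprS -exprSr.
split; first by rewrite [X in _ * X]aE -scalerAl -scalerAr scalerA mulVf // scale1r G'.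
by rewrite [X in X * _]aE -scalerAl -scalerAr scalerA mulfV // scale1r G.
Qed.

Lemma gunitE a : (a \is a GRing.unit) = (body a != 0).
Proof.
apply/idP/idP => [ua|a0].
  apply/eqP => b0; have := congr1 (@body C) (mulrV ua).
  by rewrite bodyM b0 mul0r body1 => /esym/eqP; rewrite oner_eq0.
have [n la] := glev_ex a; apply/unitrP; eexists; exact: gunit_inv la a0.
Qed.

Lemma ginvE n a : glev n a -> body a != 0 ->
  a^-1 = (body a)^-1 *: \sum_(k < n.+1) (- (body a)^-1 *: soul a) ^+ k.
Proof.
move=> la a0; have [H _] := gunit_inv la a0.
have ua : a \is a GRing.unit by rewrite gunitE.
by rewrite -[RHS]mulr1 -(mulrV ua) mulrA H mul1r.
Qed.

Lemma glevV n a : glev n a -> glev n a^-1.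
Proof.
move=> la; have [ua|/invr_out -> //] := boolP (a \is a GRing.unit).
rewrite (ginvE la) -?gunitE //; apply: glevZ; apply: gsupp_sum => k _.
by apply: glevX; apply/glevZ/glev_soul.
Qed.

Lemma gparV a : gpar false a -> gpar false a^-1.
Proof.
move=> ea; have [ua|/invr_out -> //] := boolP (a \is a GRing.unit).
have [n la] := glev_ex a; rewrite (ginvE la) -?gunitE //; apply: gparZ.
apply: gsupp_sum => k _; apply: gparX; apply: gparZ; apply: gparB => //; exact: gpar_scal.
Qed.

Lemma bodyV a : body a^-1 = (body a)^-1.
Proof.
have [ua|ua] := boolP (a \is a GRing.unit); last first.
  by rewrite invr_out //; move: ua; rewrite gunitE negbK => /eqP ->; rewrite invr0.
have a0 : body a != 0 by rewrite -gunitE.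
by apply: (mulfI a0); rewrite -bodyM mulrV // body1 mulfV.
Qed.

Lemma gstar1 : gstar 1 = 1. Proof. exact/gstar_even/gpar1. Qed.

Lemma odd_zeta n : gpar true (zeta [fset n]).
Proof. by apply: gsupp_zeta; rewrite cardfs1. Qed.

(** The generator of index [n] does not occur in [b], so multiplication by it sends distinct
    monomials of [b] to distinct monomials, up to sign. This is where infinitely many generators
    enter: some generator is always fresh. *)
Lemma zeta_mul_eq0 n b : glev n b -> zeta [fset n] * b = 0 -> b = 0.
Proof.
move=> lb zb; apply: gcoefP => J; rewrite gcoef0; apply/eqP/negP => /negP bJ.
have nJ : n \notin J by apply/negP => /(glevP _ _ (lb J bJ)); rewrite ltnn.
have := congr1 (gcoef ([fset n] `|` J)) zb; rewrite gcoef0 {1}(zetaE b) mulr_sumr gcoef_sum.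
have JS : J \in gsupport b by apply: contraNT bJ => /gcoef_out ->.
rewrite (big_fsetD1 J) //= big_seq big1 => [|I].
  rewrite addr0 -scalerAr zetaM !gcoefZ gcoef_zeta eqxx mulr1 => /eqP.
  rewrite mulf_eq0 (negPf bJ) /= /monomial_sign fdisjoint1X nJ /=.
  by rewrite signr_eq0.
rewrite !inE => /andP[IJ _]; rewrite -scalerAr zetaM !gcoefZ gcoef_zeta.
have [->|/lb/glevP bI] := eqVneq (gcoef I b) 0; first by rewrite mul0r.
case: eqP => [E|_]; last by rewrite !mulr0.
case/eqP: IJ; apply/fsetP => i; have [->|ni] := eqVneq i n.
  by rewrite (negPf nJ); apply/negP => /bI; rewrite ltnn.
by have := congr1 (fun K : {fset nat} => i \in K) E; rewrite /= !inE (negPf ni).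
Qed.

Lemma odd_mul_eq0 b : (forall t, gpar true t -> t * b = 0) -> b = 0.
Proof.
by move=> H; have [n lb] := glev_ex b; apply: zeta_mul_eq0 lb _; apply/H/odd_zeta.
Qed.

(** At [t = 0] the constant terms agree, and a fresh generator then separates the linear ones.
    Identities between superfunctions are turned into identities between their components in this
    way. *)
Lemma odd_linear_inj a b a' b' : (forall t, gpar true t -> a + t * b = a' + t * b') ->
  a = a' /\ b = b'.
Proof.
move=> H; have aa : a = a'.
  by have := H 0; rewrite !mul0r !addr0; apply; exact: gpar0.
split=> //; apply/eqP; rewrite -subr_eq0; apply/eqP/odd_mul_eq0 => t ot.
by have := H t ot; rewrite aa => /addrI E; rewrite mulrBr E subrr.
Qed.

Lemma odd_mul_par e b : (forall t, gpar true t -> gpar (~~ e) (t * b)) -> gpar e b.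
Proof.
move=> H; suff b0 : gproj (~~ e) b = 0.
  by rewrite -(gproj_sum b); case: e {H} b0 => /= ->; rewrite ?add0r ?addr0; exact: gproj_par.
apply: odd_mul_eq0 => t ot; have tb := H t ot.
have E : t * b = t * gproj e b + t * gproj (~~ e) b.
  rewrite -mulrDr -{1}(gproj_sum b); congr (_ * _).
  by case: (e) => //=; rewrite addrC.
have te := gparM ot (gproj_par e b).
have tne := gparM ot (gproj_par (~~ e) b).
have P : gpar (~~ e) (t * gproj (~~ e) b).
  rewrite (_ : t * gproj _ b = t * b - t * gproj e b); last by rewrite E addrC addKr.
  by apply: gparB.
apply: gcoefP => I; rewrite gcoef0; apply/eqP/negP => /negP c0.
by have /eqP := P I c0; have /eqP -> := tne I c0; case: (e).
Qed.

End Grassmann.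

Arguments gpar_scal {C} k.
Arguments gpar0 {C} e.
Arguments gpar1 {C}.
Arguments glev_scal {C} n k.
Arguments gproj_par {C} e a.
Arguments odd_zeta C n.

(** * Identities between even and odd elements by reflection *)

Inductive sexp : Type :=
  | SEven of nat | SOdd of nat | SNat of nat
  | SAdd of sexp & sexp | SOpp of sexp | SMul of sexp & sexp.

(* Coefficient, sorted even factors, strictly sorted odd factors *)
Definition smono : Type := int * (seq nat * seq nat).

Fixpoint einsert (i : nat) (e : seq nat) : seq nat :=
  if e is j :: e' then if (i <= j)%N then i :: e else j :: einsert i e' else [:: i].

Fixpoint oinsert (i : nat) (o : seq nat) : option (bool * seq nat) :=
  if o is j :: o' then
    if (i < j)%N then Some (false, i :: o) else if i == j then None else
    if oinsert i o' is Some (s, o'') then Some (~~ s, j :: o'') else None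
  else Some (false, [:: i]).

Fixpoint omerge (o1 o2 : seq nat) : option (bool * seq nat) :=
  if o1 is i :: o1' then
    if omerge o1' o2 is Some (s, o) then
      if oinsert i o is Some (s', o') then Some (s (+) s', o') else None
    else None
  else Some (false, o2).

Fixpoint pinsert (m : smono) (p : seq smono) : seq smono :=
  if p is m' :: p' then
    if m.2 == m'.2 then
      let c := (m.1 + m'.1)%R in if c == 0 then p' else (c, m.2) :: p'
    else m' :: pinsert m p'
  else [:: m].

Definition mmul (m m' : smono) : seq smono :=
  if omerge m.2.2 m'.2.2 is Some (s, o) then
    [:: ((if s then - (m.1 * m'.1) else m.1 * m'.1), (foldr einsert m'.2.1 m.2.1, o))]
  else [::].

Definition padd (p q : seq smono) := foldr pinsert q p.
Definition pmul (p q : seq smono) :=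
  foldr (fun m r => foldr (fun m' r' => padd (mmul m m') r') r q) [::] p.

Fixpoint snorm (x : sexp) : seq smono :=
  match x with
  | SEven i => [:: (1, ([:: i], [::]))]
  | SOdd i => [:: (1, ([::], [:: i]))]
  | SNat n => if n is 0 then [::] else [:: (n%:Z, ([::], [::]))]
  | SAdd x y => padd (snorm x) (snorm y)
  | SOpp x => [seq (- m.1, m.2) | m <- snorm x]
  | SMul x y => pmul (snorm x) (snorm y)
  end.

Section SuperRing.
Variable C : numClosedFieldType.
Local Notation Lambda := (grassmann C).
Variables (le lo : seq Lambda).

Fixpoint all_par (e : bool) (l : seq Lambda) : Prop :=
  if l is x :: l' then gpar e x /\ all_par e l' else True.

Hypothesis evens : all_par false le.
Hypothesis odds : all_par true lo.

(** An index out of range yields the default 0, which has both parities, so no bound on indices is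
    needed by the reflection. *)
Lemma all_par_nth e l i : all_par e l -> gpar e l`_i.
Proof.
elim: l i => [|x l IH] i /=; first by rewrite nth_nil => _; exact: gpar0.
by case: i => [|i] [px pl] //=; apply: IH.
Qed.

Let ee i := le`_i.
Let oo i := lo`_i.
Let eeP i : gpar false (ee i). Proof. exact: all_par_nth. Qed.
Let ooP i : gpar true (oo i). Proof. exact: all_par_nth. Qed.

Arguments eeP : clear implicits.
Arguments ooP : clear implicits.

Definition eprod (e : seq nat) : Lambda := foldr (fun i x => le`_i * x) 1 e.
Definition oprod (o : seq nat) : Lambda := foldr (fun i x => lo`_i * x) 1 o.
Definition meval (m : smono) : Lambda := (eprod m.2.1 * oprod m.2.2) *~ m.1.
Definition peval (p : seq smono) : Lambda := foldr (fun m x => meval m + x) 0 p.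

Fixpoint seval (x : sexp) : Lambda :=
  match x with
  | SEven i => le`_i
  | SOdd i => lo`_i
  | SNat n => n%:R
  | SAdd x y => seval x + seval y
  | SOpp x => - seval x
  | SMul x y => seval x * seval y
  end.

Lemma eprod_even e : gpar false (eprod e).
Proof.
elim: e => [|i e IH] /=; first exact: gpar1.
by rewrite -[false]/(false (+) false); apply: gparM => //; exact: eeP.
Qed.

Lemma eprod_insert i e : eprod (einsert i e) = ee i * eprod e.
Proof.
elim: e => [|j e IH] //=; case: ifP => // _ /=.
by rewrite IH !mulrA -/(ee j) (geven_comm (ee i) (eeP j)).
Qed.

Lemma eprod_merge e1 e2 : eprod (foldr einsert e2 e1) = eprod e1 * eprod e2.
Proof. by elim: e1 => [|i e1 IH] /=; rewrite ?mul1r // eprod_insert IH mulrA. Qed.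

Lemma oprod_insert i o : oo i * oprod o =
  if oinsert i o is Some (s, o') then (-1) ^+ s * oprod o' else 0.
Proof.
elim: o => [|j o IH] /=; first by rewrite expr0 mul1r.
case: ifP => _ /=; first by rewrite expr0 mul1r.
case: eqP => [<-|_]; first by rewrite mulrA -/(oo i) godd_sqr ?mul0r.
rewrite mulrA (godd_anticomm (ooP i) (ooP j)) mulNr -mulrA IH.
case: (oinsert i o) => [[s o']|] /=; last by rewrite mulr0 oppr0.
case: s => /=; rewrite ?expr1 ?expr0 ?mulN1r ?mul1r ?mulrN ?opprK //.
Qed.

Lemma oprod_merge o1 o2 : oprod o1 * oprod o2 =
  if omerge o1 o2 is Some (s, o) then (-1) ^+ s * oprod o else 0.
Proof.
elim: o1 => [|i o1 IH] /=; first by rewrite expr0 mul1r.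
rewrite -mulrA IH; case: (omerge o1 o2) => [[s o]|]; last by rewrite mulr0.
have -> : lo`_i * ((-1) ^+ s * oprod o) = (-1) ^+ s * (oo i * oprod o).
  by case: s; rewrite ?expr1 ?expr0 ?mulN1r ?mul1r ?mulrN.
rewrite oprod_insert; case: (oinsert i o) => [[s' o']|]; last by rewrite mulr0.
by rewrite mulrA signr_addb.
Qed.

Lemma peval_insert m p : peval (pinsert m p) = meval m + peval p.
Proof.
elim: p => [|m' p IH] //=; case: eqP => [E|_] /=; last by rewrite IH addrCA.
have mE : meval m + meval m' = (eprod m.2.1 * oprod m.2.2) *~ (m.1 + m'.1).
  by rewrite /meval -E mulrzDr.
rewrite addrA mE; case: eqP => [->|_] //=.
by rewrite mulr0z add0r.
Qed.

Lemma peval_add p q : peval (padd p q) = peval p + peval q.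
Proof. by elim: p => [|m p IH] /=; rewrite ?add0r // peval_insert IH addrA. Qed.

Lemma peval_mmul m m' : peval (mmul m m') = meval m * meval m'.
Proof.
rewrite /mmul /meval.
have -> : (eprod m.2.1 * oprod m.2.2) *~ m.1 * ((eprod m'.2.1 * oprod m'.2.2) *~ m'.1) =
   (eprod m.2.1 * eprod m'.2.1 * (oprod m.2.2 * oprod m'.2.2)) *~ (m.1 * m'.1).
  rewrite mulrzAl mulrzAr -mulrzA [(m'.1 * m.1)%R]mulrC; congr (_ *~ _).
  rewrite -!mulrA; congr (_ * _); rewrite !mulrA; congr (_ * _).
  by rewrite [RHS]geven_comm //; exact: eprod_even.
rewrite oprod_merge; case: (omerge _ _) => [[s o]|] /=; last by rewrite mulr0 mul0rz.
rewrite addr0 /meval /= eprod_merge; case: s; rewrite ?expr1 ?expr0 ?mulN1r ?mul1r //.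
by rewrite mulrN mulNrz mulrNz.
Qed.

Lemma peval_mul p q : peval (pmul p q) = peval p * peval q.
Proof.
elim: p => [|m p IH] /=; first by rewrite mul0r.
rewrite mulrDl -IH; move: (pmul p q) => r.
elim: q {IH} => [|m' q IH] /=; first by rewrite mulr0 add0r.
by rewrite peval_add peval_mmul IH mulrDr addrA.
Qed.

Lemma snormP x : peval (snorm x) = seval x.
Proof.
elim: x => [i|i|n|x IHx y IHy|x IHx|x IHx y IHy] /=.
- by rewrite /meval /= !mulr1 mulr1z addr0.
- by rewrite /meval /= !mulr1 mul1r mulr1z addr0.
- by case: n => [|n] //=; rewrite /meval /= mulr1 addr0 pmulrn.
- by rewrite peval_add IHx IHy.
- rewrite -IHx; elim: (snorm x) => [|m p IH] /=; first by rewrite oppr0.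
  by rewrite IH opprD; congr (_ + _); rewrite /meval /= mulrNz.
- by rewrite peval_mul IHx IHy.
Qed.

(** The tactic relies on soundness only: the difference is normalized by computation, and success
    means that the normal form is empty. *)
Lemma sring_correct x y : snorm (SAdd x (SOpp y)) = [::] -> seval x = seval y.
Proof.
by move=> E; apply/eqP; rewrite -subr_eq0 -[_ - _]/(seval (SAdd x (SOpp y))) -snormP E.
Qed.

End SuperRing.

Ltac s_index x l :=
  lazymatch l with
  | x :: _ => constr:(Some 0%N)
  | _ :: ?l' => lazymatch s_index x l' with Some ?n => constr:(Some n.+1) | _ => constr:(@None nat) end
  | _ => constr:(@None nat)
  end.

Ltac s_reify le lo t :=
  lazymatch s_index t le with
  | Some ?i => constr:(SEven i)
  | _ => lazymatch s_index t lo with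
    | Some ?i => constr:(SOdd i)
    | _ => lazymatch t with
      | (?a + ?b)%R => let x := s_reify le lo a in let y := s_reify le lo b in constr:(SAdd x y)
      | (- ?a)%R => let x := s_reify le lo a in constr:(SOpp x)
      | (?a * ?b)%R => let x := s_reify le lo a in let y := s_reify le lo b in constr:(SMul x y)
      | (?a ^+ 2)%R => let x := s_reify le lo a in constr:(SMul x x)
      | (?a ^+ 3)%R => let x := s_reify le lo a in constr:(SMul x (SMul x x))
      | 0%R => constr:(SNat 0)
      | 1%R => constr:(SNat 1)
      | (?n%:R)%R => constr:(SNat n)
      | _ => fail "sring: unknown atom" t
      end
    end
  end.

(* Proves an identity between polynomials in the even elements [le] and the odd elements [lo] *)
Ltac sring le lo :=
  lazymatch goal with |- ?a = ?b =>
    let x := s_reify le lo a in let y := s_reify le lo b in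
    refine (@sring_correct _ le lo _ _ x y _);
    [rewrite /=; repeat split; try by [] |rewrite /=; repeat split; try by []| vm_compute; reflexivity]
  end.

(* Replaces a factor [x_i x_j] of each monomial by the polynomial [r]. *)
Definition preduce (i j : nat) (r p : seq smono) : seq smono :=
  foldr (fun m q => padd (if (i \in m.2.1) && (j \in rem i m.2.1) then
    pmul [:: (m.1, (rem j (rem i m.2.1), m.2.2))] r else [:: m]) q) [::] p.

Section SuperRingModulo.
Variable C : numClosedFieldType.
Local Notation Lambda := (grassmann C).
Variables (le lo : seq Lambda).
Hypothesis evens : all_par false le.
Hypothesis odds : all_par true lo.

Lemma eprod_rem i e : i \in e -> eprod le e = le`_i * eprod le (rem i e).
Proof.
elim: e => [|j e IH] //=; rewrite inE eq_sym; case: eqVneq => [->//|_ /= ie].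
by rewrite IH // !mulrA (geven_comm le`_j) //; exact: all_par_nth.
Qed.

Lemma preduceP i j r p : le`_i * le`_j = seval le lo r ->
  peval le lo (preduce i j (snorm r) p) = peval le lo p.
Proof.
move=> rE; elim: p => [|m p IH] //=; rewrite peval_add IH; congr (_ + _).
case: ifP => [/andP[im jm]|_]; last by rewrite /= addr0.
have /= -> := peval_mul evens odds [:: (m.1, (rem j (rem i m.2.1), m.2.2))] (snorm r).
rewrite snormP // -rE addr0 /meval /=.
rewrite (eprod_rem im) (eprod_rem jm) mulrzAl; congr (_ *~ _).
have par k : gpar false le`_k by exact: all_par_nth.
by rewrite -(geven_comm _ (gparM (par i) (par j))) !mulrA.
Qed.

Lemma sring_mod_correct n i j r x y : le`_i * le`_j = seval le lo r ->
  iter n (preduce i j (snorm r)) (snorm (SAdd x (SOpp y))) = [::] -> seval le lo x = seval le lo y.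
Proof.
move=> rE E; apply/eqP; rewrite -subr_eq0 -[_ - _]/(seval le lo (SAdd x (SOpp y))) -snormP //.
have -> : peval le lo (snorm (SAdd x (SOpp y))) =
    peval le lo (iter n (preduce i j (snorm r)) (snorm (SAdd x (SOpp y)))).
  by elim: n {E} => [//|n IH] /=; rewrite preduceP.
by rewrite E.
Qed.

Lemma oprod_par o : gpar (odd (size o)) (oprod lo o).
Proof.
elim: o => [|i o IH] /=; first exact: gpar1.
by rewrite -addTb; apply: gparM => //; exact: all_par_nth.
Qed.

Lemma sring_par e x : all (fun m : smono => odd (size m.2.2) == e) (snorm x) -> gpar e (seval le lo x).
Proof.
rewrite -(snormP evens odds); elim: (snorm x) => [|m p IH] /=; first by move=> _; exact: gpar0.
move=> /andP[/eqP me /IH pe]; apply: gparD => //; rewrite /meval -me -scaler_int; apply: gparZ.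
have H : gpar false (eprod le m.2.1) by exact: eprod_even.
have H' : gpar (odd (size m.2.2)) (oprod lo m.2.2) by exact: oprod_par.
exact: (gparM H H').
Qed.
End SuperRingModulo.

(* As [sring], modulo the relation [rel : x * y = t] between two elements of [le] *)
Ltac sring_mod le lo rel :=
  lazymatch goal with |- ?a = ?b =>
    let x := s_reify le lo a in let y := s_reify le lo b in
    lazymatch type of rel with (?u * ?v)%R = ?t =>
      lazymatch s_index u le with Some ?i => lazymatch s_index v le with Some ?j =>
        let r := s_reify le lo t in
        (* Each pass of [preduce] rewrites one occurrence of the product per monomial. Any number of
           passes is sound, and eight suffice for the identities below. *)
        refine (@sring_mod_correct _ le lo _ _ 8%N i j r x y rel _);
        [rewrite /=; repeat split; try by [] |rewrite /=; repeat split; try by []| vm_compute; reflexivity]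
      end end
    end
  end.

Ltac sparity le lo :=
  lazymatch goal with |- gpar ?e ?a =>
    let x := s_reify le lo a in
    refine (@sring_par _ le lo _ _ e x _);
    [rewrite /=; repeat split; try by [] |rewrite /=; repeat split; try by []| vm_compute; reflexivity]
  end.

(** * Analytic functions with values in the Grassmann algebra *)

Section GrassmannAnalytic.
Variable C : numClosedFieldType.
Local Notation Lambda := (grassmann C).
Local Notation zeta := (zeta C).
Hypothesis archC : small_powers C.
Implicit Types (phi eta : C -> Lambda) (x y : C) (a b : nat -> Lambda) (z : Lambda).
Implicit Types (f g : C -> C) (I J : {fset nat}) (Q : {fset nat} -> bool).

(** Expansions are taken coefficient by coefficient. The common level [n] confines everything near
    [x] to finitely many monomials, which is what makes products and inverses analytic. *)
Definition gtaylor phi x a := exists n, [/\ forall k, glev n (a k),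
  \forall y \near x, glev n (phi y) &
  forall I, taylor (fun y => gcoef I (phi y)) x (fun k => gcoef I (a k))].

Lemma gtaylor_uniq phi x a b : gtaylor phi x a -> gtaylor phi x b -> a = b.
Proof.
move=> [n [_ _ Ha]] [m [_ _ Hb]]; apply/funext => k; apply: gcoefP => I.
by have := taylor_uniq (Ha I) (Hb I) => /(congr1 (fun u => u k)).
Qed.

Lemma gtaylor_near phi eta x a : gtaylor phi x a -> (\forall y \near x, phi y = eta y) ->
  gtaylor eta x a.
Proof.
move=> [n [la lp Ha]] pe; exists n; split=> // [|I].
  by apply: filterS2 lp pe => y lp <-.
by apply: taylor_near (Ha I) _; apply: filterS pe => y ->.
Qed.

Lemma gtaylor_value phi x a : gtaylor phi x a -> phi x = a 0%N.
Proof. by move=> [n [_ _ Ha]]; apply: gcoefP => I; exact: taylor_value (Ha I). Qed.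

Lemma gtaylor_gsupp Q phi x a : gtaylor phi x a -> (\forall y \near x, gsupp Q (phi y)) ->
  forall k, gsupp Q (a k).
Proof.
move=> [n [_ _ Ha]] Qp k I aI; apply: contraNT aI => nQ.
have T0 : taylor (fun=> 0) x (fun k => gcoef I (a k)).
  apply: taylor_near (Ha I) _; apply: filterS Qp => y Qy.
  by apply/eqP; apply: contraNT nQ => /Qy.
have := taylor_uniq T0 (taylor_const 0 x) => /(congr1 (fun u => u k)) /= ->.
by case: k {T0}.
Qed.

Lemma gtaylor_lev n phi x a : gtaylor phi x a -> (\forall y \near x, glev n (phi y)) ->
  forall k, glev n (a k).
Proof. exact: gtaylor_gsupp. Qed.

Lemma gtaylorD phi eta x a b : gtaylor phi x a -> gtaylor eta x b ->
  gtaylor (fun y => phi y + eta y) x (fun k => a k + b k).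
Proof.
move=> [n [la lp Ha]] [m [lb le Hb]]; exists (maxn n m).
have W k (u : Lambda) : glev n u -> glev (maxn n k) u by apply: glevW; exact: leq_maxl.
have W' k (u : Lambda) : glev m u -> glev (maxn k m) u by apply: glevW; exact: leq_maxr.
split=> [k||I]; first by apply: glevD; [exact: W|exact: W'].
  by apply: filterS2 lp le => y ly ly'; apply: glevD; [exact: W|exact: W'].
have -> : (fun k => gcoef I (a k + b k)) = (fun k => gcoef I (a k) + gcoef I (b k)).
  by apply/funext => k; rewrite gcoefD.
by apply: eq_taylor (taylorD (Ha I) (Hb I)) _ => y; rewrite gcoefD.
Qed.

Lemma gtaylor_scal f x (u : nat -> C) (c : Lambda) : taylor f x u ->
  gtaylor (fun y => f y *: c) x (fun k => u k *: c).
Proof.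
move=> fu; have [n lc] := glev_ex c; exists n; split=> [k||I]; first exact: glevZ.
  by apply/nearE; exists 1 => // h _; exact: glevZ.
have -> : (fun k => gcoef I (u k *: c)) = (fun k => gcoef I c * u k).
  by apply/funext => k; rewrite gcoefZ mulrC.
by apply: eq_taylor (taylorZ _ fu) _ => y; rewrite gcoefZ mulrC.
Qed.

Lemma gtaylor_const c x : gtaylor (fun=> c) x (fun k => if k is 0 then c else 0).
Proof.
have -> : (fun k => if k is 0 then c else 0) = (fun k => (if k is 0 then 1 else 0 : C) *: c).
  by apply/funext => -[|k]; rewrite ?scale1r ?scale0r.
have -> : (fun=> c) = (fun=> 1 *: c) :> (C -> Lambda) by apply/funext => y; rewrite scale1r.
exact: gtaylor_scal (taylor_const _ _).
Qed.

Lemma taylor_sum (T : Type) (r : seq T) (F : T -> C -> C) (G : T -> nat -> C) x :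
  (forall t, taylor (F t) x (G t)) ->
  taylor (fun y => \sum_(t <- r) F t y) x (fun k => \sum_(t <- r) G t k).
Proof.
move=> H; elim: r => [|t r IH].
  have -> : (fun k : nat => \sum_(t <- [::]) G t k) = (fun k => if k is 0 then 0 else 0).
    by apply/funext => -[|k]; rewrite big_nil.
  by apply: eq_taylor (taylor_const 0 x) _ => y; rewrite big_nil.
have -> : (fun k => \sum_(t <- t :: r) G t k) = (fun k => G t k + \sum_(t <- r) G t k).
  by apply/funext => k; rewrite big_cons.
by apply: eq_taylor (taylorD (H t) IH) _ => y; rewrite big_cons.
Qed.

Definition levset n : {fset {fset nat}} := fpowerset [fset i in iota 0 n]%fset.

Lemma in_levset n I : (I \in levset n) = [forall i : I, (val i < n)%N].
Proof.
rewrite fpowersetE; apply/fsubsetP/glevP => H i /H; rewrite !inE mem_iota //=.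
Qed.

Lemma glev_zetas n z : glev n z -> z = \sum_(I <- levset n) gcoef I z *: zeta I.
Proof.
move=> lz; apply: gcoefP => I; rewrite gcoef_zetas in_levset; case: ifPn => // nI.
by apply/eqP; apply: contraNT nI => /lz.
Qed.

Lemma gcoefM n (u v : Lambda) K : glev n u -> glev n v -> gcoef K (u * v) =
  \sum_(I <- levset n) \sum_(J <- levset n) gcoef K (zeta I * zeta J) * (gcoef I u * gcoef J v).
Proof.
move=> lu lv; rewrite {1}(glev_zetas lu) mulr_suml gcoef_sum; apply: eq_bigr => I _.
rewrite {1}(glev_zetas lv) mulr_sumr gcoef_sum; apply: eq_bigr => J _.
by rewrite -scalerAl -scalerAr !gcoefZ mulrA mulrC.
Qed.

Definition gcauchy a b k : Lambda := \sum_(i < k.+1) a i * b (k - i)%N.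

Lemma gtaylorM phi eta x a b : gtaylor phi x a -> gtaylor eta x b ->
  gtaylor (fun y => phi y * eta y) x (gcauchy a b).
Proof.
move=> [n0 [la lp Ha]] [m [lb le Hb]]; pose n := maxn n0 m.
have W (u : Lambda) : glev n0 u -> glev n u by apply: glevW; exact: leq_maxl.
have W' (u : Lambda) : glev m u -> glev n u by apply: glevW; exact: leq_maxr.
exists n; split=> [k||K].
- by apply: gsupp_sum => i _; apply: glevM; [exact: W|exact: W'].
- by apply: filterS2 lp le => y ly ly'; apply: glevM; [exact: W|exact: W'].
have -> : (fun k => gcoef K (gcauchy a b k)) = (fun k => \sum_(I <- levset n) \sum_(J <- levset n)
   gcoef K (zeta I * zeta J) * cauchy (fun k => gcoef I (a k)) (fun k => gcoef J (b k)) k).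
  apply/funext => k; rewrite gcoef_sum.
  under eq_bigr => i _ do rewrite (gcoefM _ (W _ (la _)) (W' _ (lb _))).
  rewrite exchange_big; apply: eq_bigr => I _; rewrite exchange_big; apply: eq_bigr => J _.
  by rewrite /cauchy mulr_sumr.
apply: (@taylor_near _ (fun y => \sum_(I <- levset n) \sum_(J <- levset n)
   gcoef K (zeta I * zeta J) * (gcoef I (phi y) * gcoef J (eta y)))).
  apply: taylor_sum => I; apply: taylor_sum => J; apply: taylorZ.
  exact: taylorM (Ha I) (Hb J).
by apply: filterS2 lp le => y ly ly'; rewrite (gcoefM _ (W _ ly) (W' _ ly')).
Qed.

Lemma gtaylor_star phi x a : gtaylor phi x a ->
  gtaylor (fun y => gstar (phi y)) x (fun k => gstar (a k)).
Proof.
move=> [n [la lp Ha]]; exists n; split=> [k||I]; first exact: glev_star.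
  by apply: filterS lp => y ly; exact: glev_star.
have -> : (fun k => gcoef I (gstar (a k))) = (fun k => (-1) ^+ odd #|` I| * gcoef I (a k)).
  by apply/funext => k; rewrite gcoef_star.
by apply: eq_taylor (taylorZ _ (Ha I)) _ => y; rewrite gcoef_star.
Qed.

Definition gan phi x := \forall y \near x, exists a, gtaylor phi y a.

Lemma gan_taylor phi x : gan phi x -> exists a, gtaylor phi x a.
Proof. exact: nbhs_singleton. Qed.

Lemma gan_near phi eta x : gan phi x -> (\forall y \near x, phi y = eta y) -> gan eta x.
Proof.
move=> px /near_join_nbhs pe; apply: filterS2 px pe => y [a pa] py.
by exists a; apply: gtaylor_near pa py.
Qed.

Lemma gan_const c x : gan (fun=> c) x.
Proof. by apply/nearE; exists 1 => // h _; eexists; exact: gtaylor_const. Qed.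

Lemma gan_scal f c x : holo f x -> gan (fun y => f y *: c) x.
Proof. by apply: filterS => y [a fa]; eexists; exact: gtaylor_scal fa. Qed.

Lemma ganD phi eta x : gan phi x -> gan eta x -> gan (fun y => phi y + eta y) x.
Proof. by apply: filterS2 => y [a pa] [b eb]; eexists; exact: gtaylorD pa eb. Qed.

Lemma ganM phi eta x : gan phi x -> gan eta x -> gan (fun y => phi y * eta y) x.
Proof. by apply: filterS2 => y [a pa] [b eb]; eexists; exact: gtaylorM pa eb. Qed.

Lemma gan_star phi x : gan phi x -> gan (fun y => gstar (phi y)) x.
Proof. by apply: filterS => y [a pa]; eexists; exact: gtaylor_star pa. Qed.

Lemma ganZ k phi x : gan phi x -> gan (fun y => k *: phi y) x.
Proof.
move=> px; apply: gan_near (ganM (gan_const (k%:A) x) px) _.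
by apply/nearE; exists 1 => // h _; rewrite -scalerAl mul1r.
Qed.

Lemma ganN phi x : gan phi x -> gan (fun y => - phi y) x.
Proof.
move=> px; apply: gan_near (ganZ (-1) px) _.
by apply/nearE; exists 1 => // h _; rewrite scaleN1r.
Qed.

Lemma ganB phi eta x : gan phi x -> gan eta x -> gan (fun y => phi y - eta y) x.
Proof. by move=> px ex; exact: ganD px (ganN ex). Qed.

Lemma ganX phi n x : gan phi x -> gan (fun y => phi y ^+ n) x.
Proof.
move=> px; elim: n => [|n IH].
  by apply: gan_near (gan_const 1 x) _; apply/nearE; exists 1 => // h _; rewrite expr0.
by apply: gan_near (ganM px IH) _; apply/nearE; exists 1 => // h _; rewrite exprS.
Qed.

Lemma gan_sum (T : Type) (r : seq T) (F : T -> C -> Lambda) x :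
  (forall t, gan (F t) x) -> gan (fun y => \sum_(t <- r) F t y) x.
Proof.
move=> H; elim: r => [|t r IH].
  by apply: gan_near (gan_const 0 x) _; apply/nearE; exists 1 => // h _; rewrite big_nil.
by apply: gan_near (ganD (H t) IH) _; apply/nearE; exists 1 => // h _; rewrite big_cons.
Qed.

Lemma gan_coef I phi x : gan phi x -> holo (fun y => gcoef I (phi y)) x.
Proof. by apply: filterS => y [a [n [_ _ /(_ I)]]] pa; eexists; exact: pa. Qed.

Lemma holo_continuous f x : holo f x -> {for x, continuous f}.
Proof. by move=> /holo_taylor[a fa]; exact: taylor_continuous fa. Qed.

Lemma holo_near_neq0 f x : holo f x -> f x != 0 -> \forall y \near x, f y != 0.
Proof.
move=> /holo_continuous cf fx0; have n0 : 0 < `|f x| by rewrite normr_gt0.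
have /(@cvgrPdist_lt _ _ _ _ (nbhs_filter x)) /(_ _ n0) := cf.
apply: filterS => y; apply: contraTneq => ->; by rewrite subr0 ltxx.
Qed.

Lemma holoV f x : holo f x -> f x != 0 -> holo (fun y => (f y)^-1) x.
Proof.
move=> fx fx0; apply: filterS2 fx (holo_near_neq0 fx fx0) => y [a fa] y0.
exact: taylorV fa y0.
Qed.

Lemma gan_body phi x : gan phi x -> holo (fun y => body (phi y)) x.
Proof. exact: gan_coef. Qed.

Lemma gan_near_unit phi x : gan phi x -> body (phi x) != 0 ->
  \forall y \near x, body (phi y) != 0.
Proof. by move=> /gan_body; exact: holo_near_neq0. Qed.

Lemma gan_near_lev phi x : gan phi x -> exists n, \forall y \near x, glev n (phi y).
Proof. by move=> /gan_taylor[a [n [_ lp _]]]; exists n. Qed.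

(** By nilpotence of the soul, the inverse is a polynomial in it whose coefficients are powers of
    the inverse of the body; the level bounds its length uniformly near [x]. *)
Lemma ganV phi x : gan phi x -> body (phi x) != 0 -> gan (fun y => (phi y)^-1) x.
Proof.
move=> px p0; have [n lp] := gan_near_lev px.
have hB := holoV (gan_body px) p0.
apply: (@gan_near (fun y => ((body (phi y))^-1%:A) *
  \sum_(k < n.+1) (- (((body (phi y))^-1)%:A * (phi y - (body (phi y))%:A))) ^+ k)).
  apply: ganM; first exact: gan_scal.
  apply: gan_sum => k; apply: ganX; apply: ganN; apply: ganM; first exact: gan_scal.
  by apply: ganB => //; apply: gan_scal; exact: gan_body.
apply: filterS2 lp (gan_near_unit px p0) => y ly y0.
rewrite (ginvE ly y0) -scalerAl mul1r; congr (_ *: _); apply: eq_bigr => k _.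
by rewrite -scalerAl mul1r scaleNr.
Qed.

(** By [gtaylor_uniq] the jet does not depend on the choice; it is set to 0 where there is no
    expansion. *)
Definition gjet phi x : nat -> Lambda :=
  if pselect (exists a, gtaylor phi x a) is left e then projT1 (cid e) else fun=> 0.

Lemma gjetE phi x a : gtaylor phi x a -> gjet phi x = a.
Proof.
move=> pa; rewrite /gjet; case: pselect => [e|[]]; last by exists a.
exact: gtaylor_uniq (projT2 (cid e)) pa.
Qed.

Definition gderiv phi x := gjet phi x 1%N.
Definition gdcoef a k : Lambda := k.+1%:R *: a k.+1.

Lemma gtaylor_deriv phi x a : gan phi x -> gtaylor phi x a -> gtaylor (gderiv phi) x (gdcoef a).
Proof.
move=> px pa; have [n [la lp Ha]] := pa; exists n; split=> [k||I]; first exact/glevZ/la.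
  apply: filterS2 px (near_join_nbhs lp) => y [b pb] ly.
  by rewrite /gderiv (gjetE pb); apply: gtaylor_lev pb ly _.
have -> : (fun k => gcoef I (gdcoef a k)) = dcoef (fun k => gcoef I (a k)).
  by apply/funext => k; rewrite /gdcoef gcoefZ.
apply: (@taylor_near _ (derive1 (fun y => gcoef I (phi y)))).
  by apply: taylor_deriv => //; exact: gan_coef.
apply: filterS px => y [b pb]; rewrite /gderiv (gjetE pb).
by have [m [_ _ /(_ I) Hb]] := pb; rewrite (taylor_derive1 Hb).
Qed.

Lemma gan_deriv phi x : gan phi x -> gan (gderiv phi) x.
Proof.
move=> /near_join_nbhs; apply: filterS => y py; have [a pa] := gan_taylor py.
by exists (gdcoef a); exact: gtaylor_deriv.
Qed.

Definition nilN z := projT1 (cid (nilp_ex (body_soul z))).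
Lemma nilNP z : soul z ^+ nilN z = 0. Proof. exact: (projT2 (cid (nilp_ex (body_soul z)))). Qed.

Definition jeval a z := \sum_(k < nilN z) a k * soul z ^+ k.

Lemma nilX0 (s : Lambda) N k : s ^+ N = 0 -> (N <= k)%N -> s ^+ k = 0.
Proof. by move=> s0 Nk; rewrite -(subnK Nk) exprD s0 mulr0. Qed.

Lemma sum_nilX a (s : Lambda) N M : s ^+ N = 0 -> (N <= M)%N ->
  \sum_(k < M) a k * s ^+ k = \sum_(k < N) a k * s ^+ k.
Proof.
move=> s0 NM; rewrite -!(big_mkord xpredT (fun k => a k * s ^+ k)).
rewrite (@big_cat_nat _ _ _ N) //=.
have -> : \sum_(N <= k < M) a k * s ^+ k = 0; last by rewrite addr0.
by rewrite big_nat big1 // => k /andP[Nk _]; rewrite (nilX0 s0 Nk) mulr0.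
Qed.

Lemma jevalE a z N : soul z ^+ N = 0 -> jeval a z = \sum_(k < N) a k * soul z ^+ k.
Proof.
move=> s0; rewrite /jeval.
have [NM|/ltnW MN] := leqP N (nilN z); first exact: sum_nilX.
by rewrite (sum_nilX _ (nilNP z) MN).
Qed.

(* The extension of [phi] from bodies to even elements, by Taylor expansion in
   the soul *)
Definition hat phi z := jeval (gjet phi (body z)) z.

Lemma hatE phi z a : gtaylor phi (body z) a -> hat phi z = jeval a z.
Proof. by move=> pa; rewrite /hat (gjetE pa). Qed.

Lemma hat_near phi eta z : (\forall y \near body z, phi y = eta y) -> gan phi (body z) ->
  hat phi z = hat eta z.
Proof.
move=> pe /gan_taylor[a pa]; rewrite (hatE pa).
by rewrite (hatE (gtaylor_near pa pe)).
Qed.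

Lemma hat_const c z : hat (fun=> c) z = c.
Proof.
rewrite (hatE (gtaylor_const c _)) (jevalE _ (_ : soul z ^+ (nilN z).+1 = 0)).
  by rewrite big_ord_recl expr0 mulr1 big1 ?addr0 // => i _; rewrite mul0r.
exact: nilX0 (nilNP z) _.
Qed.

Lemma hat_id z : hat (fun y => y%:A) z = z.
Proof.
have T := gtaylor_scal (1 : Lambda) (taylor_id (body z)).
rewrite (hatE T) (jevalE _ (_ : soul z ^+ (nilN z).+2 = 0)).
  rewrite 2!big_ord_recl /= expr0 expr1 mulr1 scale1r mul1r.
  rewrite big1 => [|i _]; last by rewrite scale0r mul0r.
  by rewrite addr0 -soulE.
by apply: nilX0 (nilNP z) _; rewrite ltnW.
Qed.

Lemma hat_scalar phi x a : gtaylor phi x a -> hat phi (x%:A) = phi x.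
Proof.
move=> pa; have pa' : gtaylor phi (body (x%:A : Lambda)) a by rewrite body_scal.
rewrite (hatE pa') (jevalE _ (_ : soul (x%:A) ^+ 1 = 0)).
  by rewrite big_ord1 expr0 mulr1 (gtaylor_value pa).
by rewrite expr1 /soul body_scal subrr.
Qed.

Lemma hat_value phi x : gan phi x -> hat phi (x%:A) = phi x.
Proof. by move=> /gan_taylor[a]; exact: hat_scalar. Qed.

Lemma hatD phi eta z : gan phi (body z) -> gan eta (body z) ->
  hat (fun y => phi y + eta y) z = hat phi z + hat eta z.
Proof.
move=> /gan_taylor[a pa] /gan_taylor[b eb].
rewrite (hatE pa) (hatE eb) (hatE (gtaylorD pa eb)) /jeval -big_split /=.
by apply: eq_bigr => k _; rewrite mulrDl.
Qed.

Lemma soul_even z : gpar false z -> gpar false (soul z).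
Proof. by move=> ez; apply: gparB => //; exact: gpar_scal. Qed.

(** Since [s] is central and [s ^+ N = 0], the terms of total degree at least [N] vanish, so the
    truncated Cauchy product is the product of the truncations. *)
Lemma gcauchy_sum a b (s : Lambda) N : (forall u, s * u = u * s) -> s ^+ N = 0 ->
  \sum_(k < N) gcauchy a b k * s ^+ k =
  (\sum_(k < N) a k * s ^+ k) * (\sum_(k < N) b k * s ^+ k).
Proof.
move=> sc s0.
have sXc k u : s ^+ k * u = u * s ^+ k.
  by elim: k => [|k IH]; rewrite ?expr0 ?mul1r ?mulr1 // exprS -mulrA IH !mulrA sc.
have E m : \sum_(k < m) gcauchy a b k * s ^+ k =
    \sum_(j < m) (\sum_(i < m - j) a i * s ^+ i) * (b j * s ^+ j).
  elim: m => [|m IH]; first by rewrite !big_ord0.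
  rewrite big_ord_recr IH big_ord_recr /= subSnn big_ord1 expr0 mulr1.
  have -> : \sum_(i < m) (\sum_(i0 < m.+1 - i) a i0 * s ^+ i0) * (b i * s ^+ i) =
    \sum_(i < m) ((\sum_(i0 < m - i) a i0 * s ^+ i0) * (b i * s ^+ i) + a (m - i)%N * b i * s ^+ m).
    apply: eq_bigr => i _; rewrite subSn ?(ltnW (ltn_ord i)) // big_ord_recr /= mulrDl; congr (_ + _).
    rewrite -mulrA (mulrA (s ^+ _)) sXc -!mulrA -exprD subnK //; exact: ltnW.
  rewrite big_split /= -addrA; congr (_ + _).
  rewrite /gcauchy (reindex_inj rev_ord_inj) /= big_ord_recr /= mulrDl mulr_suml subSS subnn.
  congr (_ + _); last by rewrite subn0 mulrA.
  by apply: eq_bigr => i _; rewrite subSS subKn ?(ltnW (ltn_ord i)).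
rewrite E mulr_sumr; apply: eq_bigr => j _.
have -> : \sum_(k < N) a k * s ^+ k =
  \sum_(k < N - j) a k * s ^+ k + \sum_(N - j <= k < N) a k * s ^+ k.
  have F m : \sum_(k < m) a k * s ^+ k = \sum_(0 <= k < m) a k * s ^+ k by rewrite big_mkord.
  by rewrite !F (@big_cat_nat _ _ _ (N - j)%N) //= leq_subr.
rewrite mulrDl [X in _ + X](_ : _ = 0) ?addr0 // mulr_suml big_nat big1 // => k /andP[Nk _].
rewrite -mulrA (mulrA (s ^+ k)) sXc -mulrA -exprD (nilX0 s0) ?mulr0 //.
by rewrite addnC -leq_subLR.
Qed.

Lemma hatM phi eta z : gpar false z -> gan phi (body z) -> gan eta (body z) ->
  hat (fun y => phi y * eta y) z = hat phi z * hat eta z.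
Proof.
move=> ez /gan_taylor[a pa] /gan_taylor[b eb].
rewrite (hatE pa) (hatE eb) (hatE (gtaylorM pa eb)) /jeval gcauchy_sum ?nilNP // => u.
by rewrite geven_comm //; exact: soul_even.
Qed.

Lemma hatZ k phi z : gan phi (body z) -> hat (fun y => k *: phi y) z = k *: hat phi z.
Proof.
move=> px; have /gan_taylor[a pa] := px.
have E : (fun y => k *: phi y) = (fun y => (k%:A) * phi y).
  by apply/funext => y; rewrite -scalerAl mul1r.
have T := gtaylorM (gtaylor_const (k%:A) (body z)) pa.
rewrite E (hatE pa) (hatE T) /jeval scaler_sumr; apply: eq_bigr => i _.
rewrite /gcauchy big_ord_recl subn0 big1 => [|j _]; last by rewrite mul0r.
by rewrite addr0 -!scalerAl mul1r.
Qed.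

Lemma hatN phi z : gan phi (body z) -> hat (fun y => - phi y) z = - hat phi z.
Proof.
move=> px; rewrite -scaleN1r -hatZ //; congr (hat _ z).
by apply/funext => y; rewrite scaleN1r.
Qed.

Lemma hatB phi eta z : gan phi (body z) -> gan eta (body z) ->
  hat (fun y => phi y - eta y) z = hat phi z - hat eta z.
Proof. by move=> px ex; rewrite hatD ?hatN //; exact: ganN. Qed.

Lemma body_hat phi z : gan phi (body z) -> body (hat phi z) = body (phi (body z)).
Proof.
move=> /gan_taylor[a pa]; rewrite (hatE pa) (jevalE _ (_ : soul z ^+ (nilN z).+1 = 0)).
  rewrite big_ord_recl expr0 mulr1 bodyD (gtaylor_value pa).
  rewrite [X in _ + X](_ : _ = 0) ?addr0 // /body gcoef_sum big1 // => i _.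
  by rewrite -/(body _) bodyM bodyX body_soul expr0n mulr0.
exact: nilX0 (nilNP z) _.
Qed.

Lemma hatV phi z : gpar false z -> gan phi (body z) -> body (phi (body z)) != 0 ->
  hat (fun y => (phi y)^-1) z = (hat phi z)^-1.
Proof.
move=> ez px p0; have Vx := ganV px p0.
have uz : hat phi z \is a GRing.unit by rewrite gunitE body_hat.
have : hat (fun y => phi y * (phi y)^-1) z = 1.
  rewrite -[RHS](hat_const 1 z); apply/esym/hat_near; last exact: gan_const.
  by apply: filterS (gan_near_unit px p0) => y y0; rewrite mulrV // gunitE.
by rewrite hatM // => E; apply: (mulrI uz); rewrite E mulrV.
Qed.

Lemma hat_star phi z : gpar false z -> gan phi (body z) ->
  hat (fun y => gstar (phi y)) z = gstar (hat phi z).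
Proof.
move=> ez /gan_taylor[a pa]; rewrite (hatE pa) (hatE (gtaylor_star pa)) /jeval.
have gs0 : gstar (0 : Lambda) = 0 by apply/gstar_even/gpar0.
rewrite (big_morph (@gstar C) (@gstarD C) gs0); apply: eq_bigr => k _.
by rewrite gstarM [gstar (_ ^+ _)]gstar_even //; apply/gparX/soul_even.
Qed.

Lemma hat_par e phi z : gpar false z -> gan phi (body z) ->
  (\forall y \near body z, gpar e (phi y)) -> gpar e (hat phi z).
Proof.
move=> ez /gan_taylor[a pa] ep; rewrite (hatE pa) /jeval; apply: gsupp_sum => k _.
rewrite -[e]addbF; apply: gparM; last exact/gparX/soul_even.
exact: gtaylor_gsupp pa ep k.
Qed.

(** Taylor's formula stops at first order because [n * n = 0]: the powers are
    [(s + n) ^+ k = s ^+ k + k n s ^+ (k - 1)]. It is used with [n] equal to theta+ theta-, and with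
    infinitesimal displacements in [chiral_inverse]. *)
Lemma hat_shift phi z (n : Lambda) : gpar false z -> gpar false n -> body n = 0 -> n * n = 0 ->
  gan phi (body z) -> hat phi (z + n) = hat phi z + n * hat (gderiv phi) z.
Proof.
move=> ez en n0 nn px; have [a pa] := gan_taylor px.
have bE : body (z + n) = body z by rewrite bodyD n0 addr0.
have sE : soul (z + n) = soul z + n by rewrite /soul bE addrAC.
have pa' : gtaylor phi (body (z + n)) a by rewrite bE.
set s := soul z; set N := nilN z.
have sN : s ^+ N = 0 := nilNP z.
have es : gpar false s by exact: soul_even.
have pow k : (s + n) ^+ k = s ^+ k + n * (k%:R *: s ^+ k.-1).
  elim: k => [|k IH]; first by rewrite !expr0 scale0r mulr0 addr0.
  rewrite exprS IH mulrDl !mulrDr -exprS !mulrA nn mul0r addr0 -addrA; congr (_ + _).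
  rewrite -(geven_comm s en) -mulrA -mulrDr; congr (_ * _).
  case: k {IH} => [|k]; first by rewrite expr0 scale0r mulr0 add0r scale1r.
  by rewrite /= -scalerAr -exprS -[k.+2%:R]natr1 scalerDl scale1r.
have sN1 : (s + n) ^+ N.+1 = 0 by rewrite pow [s ^+ N.+1]exprS !sN !(mulr0, scaler0, addr0).
rewrite (hatE pa') (hatE pa) (hatE (gtaylor_deriv px pa)).
rewrite (jevalE _ (_ : soul (z + n) ^+ N.+1 = 0)) ?sE //.
rewrite (jevalE a (_ : soul z ^+ N.+1 = 0)); last exact: nilX0 sN _.
rewrite (jevalE _ (sN : soul z ^+ N = 0)) -/s.
under eq_bigr => k _ do rewrite pow mulrDr.
rewrite big_split /=; congr (_ + _).
rewrite big_ord_recl scale0r !mulr0 add0r mulr_sumr; apply: eq_bigr => k _.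
rewrite /= /bump add1n /gdcoef /= mulrA -(geven_comm _ en) -mulrA; congr (_ * _).
by rewrite -scalerAr -scalerAl.
Qed.

Lemma gderivD phi eta x : gan phi x -> gan eta x ->
  gderiv (fun y => phi y + eta y) x = gderiv phi x + gderiv eta x.
Proof.
move=> /gan_taylor[a pa] /gan_taylor[b eb].
by rewrite /gderiv (gjetE pa) (gjetE eb) (gjetE (gtaylorD pa eb)).
Qed.

Lemma gderivM phi eta x : gan phi x -> gan eta x ->
  gderiv (fun y => phi y * eta y) x = gderiv phi x * eta x + phi x * gderiv eta x.
Proof.
move=> /gan_taylor[a pa] /gan_taylor[b eb].
rewrite /gderiv (gjetE pa) (gjetE eb) (gjetE (gtaylorM pa eb)).
rewrite (gtaylor_value pa) (gtaylor_value eb) /gcauchy big_ord_recl big_ord1 /= addrC.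
by [].
Qed.

(** Terms beyond the nilpotency order of the soul vanish, and the factorials cancel against those of
    [taylor_derive1n]. *)
Lemma soul_extensionE f z u : holo f (body z) -> taylor f (body z) u ->
  soul_extension f z = \sum_(k < nilN z) u k *: soul z ^+ k.
Proof.
move=> hf fu; rewrite /soul_extension.
rewrite -(@fsbig_widen _ _ _ _ `I_(nilN z)) //; last first.
  by move=> l /= [_ /negP]; rewrite -leqNgt => Nl; rewrite (nilX0 (nilNP z) Nl) scaler0.
rewrite -fsbig_ord; apply: eq_bigr => k _; congr (_ *: _).
by rewrite (taylor_derive1n archC _ hf fu) mulKf // pnatr_eq0 -lt0n fact_gt0.
Qed.

Definition comb_fun (s : combination C) y : Lambda := \sum_(t <- s) t.2 y *: zeta t.1.

Lemma gderiv_scal f x c : holo f x -> gderiv (fun y => f y *: c) x = derive1 f x *: c.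
Proof.
move=> /holo_taylor[u fu].
by rewrite /gderiv (gjetE (gtaylor_scal c fu)) (taylor_derive1 fu).
Qed.

Lemma gderiv_const c x : gderiv (fun=> c) x = 0.
Proof. by rewrite /gderiv (gjetE (gtaylor_const _ _)). Qed.

Lemma gderiv_near phi eta x : gan phi x -> (\forall y \near x, phi y = eta y) ->
  gderiv phi x = gderiv eta x.
Proof.
move=> /gan_taylor[a pa] pe.
by rewrite /gderiv (gjetE pa) (gjetE (gtaylor_near pa pe)).
Qed.

Definition comb_holo (s : combination C) x := {in s, forall t, holo t.2 x}.

Lemma comb_holo_cons t s x : comb_holo (t :: s) x -> holo t.2 x /\ comb_holo s x.
Proof.
move=> H; split; first exact: (H t (mem_head _ _)).
by move=> u us; apply: H; rewrite inE us orbT.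
Qed.

Lemma comb_analytic_holo (A : set C) s x : open A -> comb_analytic A s -> A x -> comb_holo s x.
Proof. by move=> oA aA Ax t ts; exact: analytic_holo (aA t ts) _ Ax. Qed.

Lemma comb_fun_cons t s : comb_fun (t :: s) = fun y => t.2 y *: zeta t.1 + comb_fun s y.
Proof. by apply/funext => y; rewrite /comb_fun big_cons. Qed.

Lemma comb_fun_nil : comb_fun [::] = fun=> 0.
Proof. by apply/funext => y; rewrite /comb_fun big_nil. Qed.

Lemma comb_gan s x : comb_holo s x -> gan (comb_fun s) x.
Proof.
elim: s => [|t s IH]; first by rewrite comb_fun_nil => _; exact: gan_const.
by move=> /comb_holo_cons[ht hs]; rewrite comb_fun_cons; apply: ganD; [exact: gan_scal|exact: IH].
Qed.

Lemma soul_ext_hat f z I : gpar false z -> holo f (body z) ->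
  soul_extension f z * zeta I = hat (fun y => f y *: zeta I) z.
Proof.
move=> ez hf; have [u fu] := holo_taylor hf.
rewrite (soul_extensionE hf fu) (hatE (gtaylor_scal _ fu)) /jeval mulr_suml.
apply: eq_bigr => k _; rewrite -!scalerAl; congr (_ *: _).
by rewrite geven_comm //; apply/gparX/soul_even.
Qed.

(** From here on a combination is replaced by the Grassmann-valued function [comb_fun] that it
    represents. *)
Lemma comb_eval_hat s z : gpar false z -> comb_holo s (body z) ->
  comb_eval s z = hat (comb_fun s) z.
Proof.
move=> ez; elim: s => [|t s IH]; first by rewrite comb_fun_nil hat_const /comb_eval big_nil.
move=> /comb_holo_cons[ht hs]; rewrite comb_fun_cons hatD; last exact: comb_gan.
  by rewrite -soul_ext_hat // -IH // /comb_eval big_cons.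
exact: gan_scal.
Qed.

Lemma comb_deriv_holo s x : comb_holo s x -> comb_holo (comb_deriv s) x.
Proof. by move=> hs _ /mapP[t ts ->]; apply: (holo_derive1 archC); exact: hs. Qed.

Lemma comb_fun_deriv s x : comb_holo s x ->
  comb_fun (comb_deriv s) x = gderiv (comb_fun s) x.
Proof.
elim: s => [|t s IH] hs; first by rewrite !comb_fun_nil gderiv_const.
have [ht hs'] := comb_holo_cons hs.
have -> : comb_deriv (t :: s) = (t.1, derive1 t.2 : C -> C) :: comb_deriv s by [].
rewrite !comb_fun_cons gderivD ?gderiv_scal ?IH //.
  exact: gan_scal.
exact: comb_gan.
Qed.

Lemma comb_eval_deriv (A : set C) s z : open A -> comb_analytic A s -> A (body z) -> gpar false z ->
  comb_eval (comb_deriv s) z = hat (gderiv (comb_fun s)) z.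
Proof.
move=> oA aA Az ez; have hs := comb_analytic_holo oA aA Az.
rewrite comb_eval_hat //; last exact: comb_deriv_holo.
apply: hat_near; last exact/comb_gan/comb_deriv_holo.
have := open_nbhs_nbhs (conj oA Az : open_nbhs _ A); apply: filterS => y Ay.
by apply: comb_fun_deriv; exact: comb_analytic_holo Ay.
Qed.

Lemma comb_fun_opp s y : comb_fun (comb_opp s) y = - comb_fun s y.
Proof.
rewrite /comb_fun /comb_opp big_map -sumrN; apply: eq_bigr => t _.
by rewrite /= scaleNr.
Qed.

Lemma holoN f x : holo f x -> holo (fun y => - f y) x.
Proof.
apply: filterS => y [a fa]; eexists; apply: eq_taylor (taylorZ (-1) fa) _ => t.
by rewrite mulN1r.
Qed.

Lemma comb_eval_opp s z : gpar false z -> comb_holo s (body z) ->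
  comb_eval (comb_opp s) z = - comb_eval s z.
Proof.
move=> ez hs; rewrite !comb_eval_hat //; last first.
  by move=> _ /mapP[t ts ->]; apply: holoN; exact: hs.
rewrite -hatN; last exact: comb_gan.
by congr (hat _ z); apply/funext => y; rewrite comb_fun_opp.
Qed.

(** The way back from functions to combinations: one pair for each of the finitely many monomials of
    level [n]. *)
Definition comb_of n phi : combination C := map (fun I => (I, fun y => gcoef I (phi y))) (levset n).

Lemma comb_fun_of n phi y : glev n (phi y) -> comb_fun (comb_of n phi) y = phi y.
Proof. by move=> lp; rewrite /comb_fun big_map [RHS](glev_zetas lp). Qed.

Lemma comb_of_analytic n phi (A : set C) : (forall x, A x -> gan phi x) ->
  comb_analytic A (comb_of n phi).
Proof.
move=> gA _ /mapP[I _ ->] x /gA/(gan_coef I)/holo_taylor Ax.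
exact/analytic_taylor.
Qed.

Lemma gtaylor_div phi eta (a : nat -> Lambda) : gtaylor phi 0 a -> a 0%N = 0 ->
  eta 0 = a 1%N -> (forall y, phi y = y *: eta y) -> gtaylor eta 0 (fun k => a k.+1).
Proof.
move=> [n [la lp Ha]] a0 e0 pe; exists n; split=> [k||I]; first exact: la.
  apply: filterS lp => y ly; have [->|y0] := eqVneq y 0; first by rewrite e0.
  have -> : eta y = y^-1 *: phi y by rewrite pe scalerA mulVf // scale1r.
  exact: glevZ.
apply: (taylor_shift (Ha I)); first by rewrite e0.
by move=> h; rewrite add0r pe gcoefZ a0 gcoef0 add0r.
Qed.

End GrassmannAnalytic.

(** * Chiral coordinates and superconformal maps *)

Section Chiral.
Variable C : numClosedFieldType.
Local Notation Lambda := (grassmann C).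
Hypothesis archC : small_powers C.
Implicit Types (phi eta : C -> Lambda) (x y : C) (z : Lambda) (p : superspace C) (A B : set C).

Lemma even_coordP p : gpar false (even_coord p).
Proof. by apply/gevenE; have /and3P[] := coordsP p. Qed.
Lemma odd_coordpP p : gpar true (odd_coordp p).
Proof. by apply/goddE; have /and3P[] := coordsP p. Qed.
Lemma odd_coordmP p : gpar true (odd_coordm p).
Proof. by apply/goddE; have /and3P[] := coordsP p. Qed.
Arguments even_coordP : clear implicits.
Arguments odd_coordpP : clear implicits.
Arguments odd_coordmP : clear implicits.

Lemma in_superspaceP z (t s : Lambda) : gpar false z -> gpar true t -> gpar true s ->
  in_superspace (z, t, s).
Proof. by move=> ez ot os; apply/and3P; split; [exact/gevenE|exact/goddE|exact/goddE]. Qed.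

Definition mkpt z (t s : Lambda) (h : in_superspace (z, t, s)) : superspace C := SuperPoint h.

Lemma superspace_eq p q : even_coord p = even_coord q -> odd_coordp p = odd_coordp q ->
  odd_coordm p = odd_coordm q -> p = q.
Proof.
case: p q => [[[z t] s] hp] [[[z' t'] s'] hq]; rewrite /even_coord /odd_coordp /odd_coordm /= => Ez Et Es.
by move: hp hq; rewrite Ez Et Es => hp hq; rewrite (bool_irrelevance hp hq).
Qed.

Lemma exists_pt z (t s : Lambda) : gpar false z -> gpar true t -> gpar true s ->
  exists p, [/\ even_coord p = z, odd_coordp p = t & odd_coordm p = s].
Proof. by move=> ez ot os; exists (mkpt (in_superspaceP ez ot os)). Qed.

Definition oddprod p := odd_coordp p * odd_coordm p.
(** The sign is the one for which D- kills this coordinate; D+ kills the antichiral one. *)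
Definition chiral_coord p := even_coord p + oddprod p.
Definition antichiral_coord p := even_coord p - oddprod p.

Lemma oddprod_even p : gpar false (oddprod p).
Proof. exact: (gparM (odd_coordpP p) (odd_coordmP p)). Qed.
Arguments oddprod_even : clear implicits.
Lemma oddprod_body p : body (oddprod p) = 0.
Proof. by rewrite /oddprod bodyM (body_odd (odd_coordpP p)) mul0r. Qed.
Lemma oddprod_sqr p : oddprod p * oddprod p = 0.
Proof.
have := odd_coordpP p; have := odd_coordmP p; rewrite /oddprod.
move: (odd_coordp p) (odd_coordm p) => t s os ot.
by sring ([::] : seq Lambda) [:: t; s].
Qed.
Lemma coordp_oddprod p : odd_coordp p * oddprod p = 0.
Proof. by rewrite /oddprod mulrA godd_sqr ?mul0r //; exact: odd_coordpP. Qed.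
Lemma chiral_even p : gpar false (chiral_coord p).
Proof. by apply: gparD; [exact: even_coordP|exact: oddprod_even]. Qed.
Arguments chiral_even : clear implicits.
Lemma body_chiral p : body (chiral_coord p) = body_coord p.
Proof. by rewrite /chiral_coord bodyD oddprod_body addr0. Qed.

Definition bounded_level A phi := exists n, forall x, A x -> glev n (phi x).

(* [c] is an analytic function of the chiral coordinates over [A]; dually, the
   functions of the antichiral coordinates are obtained by composing with
   [swap_pt] below. *)
Record chiral A (c : superspace C -> Lambda) phi eta : Prop := Chiral {
  chiral_gan0 : forall x, A x -> gan phi x ;
  chiral_gan1 : forall x, A x -> gan eta x ;
  chiral_lev0 : bounded_level A phi ;
  chiral_lev1 : bounded_level A eta ;
  chiralE : forall p, A (body_coord p) ->
    c p = hat phi (chiral_coord p) + odd_coordp p * hat eta (chiral_coord p) }.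

Lemma bounded_level2 (op : Lambda -> Lambda -> Lambda) A phi eta :
  (forall n a b, glev n a -> glev n b -> glev n (op a b)) ->
  bounded_level A phi -> bounded_level A eta -> bounded_level A (fun x => op (phi x) (eta x)).
Proof.
move=> H [n Hn] [m Hm]; exists (maxn n m) => x Ax; apply: H.
  exact: glevW (leq_maxl _ _) (Hn x Ax).
exact: glevW (leq_maxr _ _) (Hm x Ax).
Qed.

Lemma bounded_level1 (op : Lambda -> Lambda) A phi :
  (forall n a, glev n a -> glev n (op a)) ->
  bounded_level A phi -> bounded_level A (fun x => op (phi x)).
Proof. by move=> H [n Hn]; exists n => x Ax; apply/H/Hn. Qed.

Lemma bounded_level_const A c : bounded_level A (fun=> c).
Proof. by have [n lc] := glev_ex c; exists n. Qed.

Lemma chiral_const A c : chiral A (fun=> c) (fun=> c) (fun=> 0).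
Proof.
split=> [x _|x _|||p _]; try exact: gan_const; try exact: bounded_level_const.
by rewrite !hat_const mulr0 addr0.
Qed.

Lemma holo_id x : holo id x.
Proof. by apply/nearE; exists 1 => // h _; eexists; exact: taylor_id. Qed.

Lemma chiral_ext A c c' phi eta : chiral A c phi eta ->
  (forall p, A (body_coord p) -> c p = c' p) -> chiral A c' phi eta.
Proof. by move=> [g0 g1 l0 l1 E] cc; split=> // p Ap; rewrite -cc // E. Qed.

Lemma chiralS A B c phi eta : B `<=` A -> chiral A c phi eta -> chiral B c phi eta.
Proof.
move=> BA [g0 g1 [n ln] [m lm] E]; split=> [x /BA|x /BA|||p /BA].
- exact: g0. - exact: g1. - by exists n => x /BA /ln. - by exists m => x /BA /lm.
exact: E.
Qed.

Section Closure.
Variables (A : set C) (c c' : superspace C -> Lambda) (phi eta phi' eta' : C -> Lambda).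
Hypotheses (cA : chiral A c phi eta) (cA' : chiral A c' phi' eta').

Let ganb p (f : C -> Lambda) : (forall x, A x -> gan f x) -> A (body_coord p) ->
  gan f (body (chiral_coord p)).
Proof. by move=> gf Ap; rewrite body_chiral; exact: gf. Qed.

Lemma chiralD : chiral A (fun p => c p + c' p) (fun x => phi x + phi' x) (fun x => eta x + eta' x).
Proof.
case: cA cA' => [g0 g1 l0 l1 E] [g0' g1' l0' l1' E']; split=> [x Ax|x Ax|||p Ap].
- by apply: ganD; [exact: g0|exact: g0'].
- by apply: ganD; [exact: g1|exact: g1'].
- exact: bounded_level2 (@glevD C) l0 l0'.
- exact: bounded_level2 (@glevD C) l1 l1'.
rewrite E // E' // !hatD; try by apply: ganb.
by rewrite mulrDr addrACA.
Qed.

Lemma chiralZ k : chiral A (fun p => k *: c p) (fun x => k *: phi x) (fun x => k *: eta x).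
Proof.
case: cA => [g0 g1 l0 l1 E]; split=> [x Ax|x Ax|||p Ap].
- by apply: ganZ; exact: g0.
- by apply: ganZ; exact: g1.
- exact: bounded_level1 (fun n a => @glevZ C n k a) l0.
- exact: bounded_level1 (fun n a => @glevZ C n k a) l1.
rewrite E // !hatZ; try by apply: ganb.
by rewrite scalerDr scalerAr.
Qed.

Lemma chiralN : chiral A (fun p => - c p) (fun x => - phi x) (fun x => - eta x).
Proof.
case: cA => [g0 g1 l0 l1 E]; split=> [x Ax|x Ax|||p Ap].
- by apply: ganN; exact: g0.
- by apply: ganN; exact: g1.
- exact: bounded_level1 (@glevN C) l0.
- exact: bounded_level1 (@glevN C) l1.
rewrite E // !hatN; try by apply: ganb.
by rewrite opprD mulrN.
Qed.

(** The involution appears when theta+ is moved to the left of [phi]; the product of the two odd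
    parts vanishes as theta+ squares to zero. *)
Lemma chiralM : chiral A (fun p => c p * c' p) (fun x => phi x * phi' x)
  (fun x => eta x * phi' x + gstar (phi x) * eta' x).
Proof.
case: cA cA' => [g0 g1 l0 l1 E] [g0' g1' l0' l1' E']; split=> [x Ax|x Ax|||p Ap].
- by apply: ganM; [exact: g0|exact: g0'].
- apply: ganD; apply: ganM; [exact: g1|exact: g0'| |exact: g1'].
  exact/gan_star/g0.
- exact: bounded_level2 (@glevM C) l0 l0'.
- apply: (bounded_level2 (@glevD C)); apply: (bounded_level2 (@glevM C)) => //.
  exact: bounded_level1 (@glev_star C) l0.
have G := ganb _ Ap; have eu := chiral_even p.
rewrite E // E' // hatM // ?hatD ?hatM ?hat_star //; try by apply: G => // x Ax; apply: gan_star; exact: g0.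
- move: (hat phi _) (hat eta _) (hat phi' _) (hat eta' _) (odd_coordp p) (odd_coordpP p) => a b a' b' t ot.
  rewrite mulrDl !mulrDr [a * (t * b')]mulrA (gstarP a ot) -!mulrA -!addrA; congr (_ + _).
  rewrite [t * (b * (t * b'))](_ : _ = 0) ?addr0 1?addrC //.
  by rewrite [b * _]mulrA (gstarP b ot) !mulrA godd_sqr // !mul0r.
- by apply: G => x Ax; apply: ganM; [exact: g1|exact: g0'].
- by apply: G => x Ax; apply: ganM; [exact/gan_star/g0|exact: g1'].
Qed.

(** The odd component is the one forced by [chiralM] in the equation [c * c^-1 = 1]. *)
Lemma chiralV : (forall x, A x -> body (phi x) != 0) ->
  chiral A (fun p => (c p)^-1) (fun x => (phi x)^-1)
    (fun x => - (gstar (phi x)^-1 * eta x * (phi x)^-1)).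
Proof.
move=> p0; case: cA => [g0 g1 l0 l1 E].
have gV x : A x -> gan (fun x => (phi x)^-1) x by move=> Ax; apply: ganV; [exact: g0|exact: p0].
have gS x : A x -> gan (fun x => gstar (phi x)^-1) x by move=> Ax; exact/gan_star/gV.
have lV : bounded_level A (fun x => (phi x)^-1) by exact: bounded_level1 (@glevV C) l0.
split=> [x Ax|x Ax|||p Ap] //; first exact: gV.
- apply: ganN; apply: ganM; last exact: gV.
  by apply: ganM; [exact: gS|exact: g1].
- apply: (bounded_level1 (@glevN C)); apply: (bounded_level2 (@glevM C)) => //.
  apply: (bounded_level2 (@glevM C)) => //; exact: bounded_level1 (@glev_star C) lV.
have G := ganb _ Ap; have eu := chiral_even p.
have p0u : body (phi (body (chiral_coord p))) != 0 by rewrite body_chiral; exact: p0.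
have H0 := G _ g0; have H1 := G _ g1; have HV := G _ gV; have HS := G _ gS.
have HM := ganM HS H1; have HMM := ganM HM HV.
rewrite E // hatN // hatM // hatM // hat_star // hatV //.
have ua : hat phi (chiral_coord p) \is a GRing.unit by rewrite gunitE body_hat //; exact: G.
move: (hat phi _) (hat eta _) (odd_coordp p) (odd_coordpP p) ua => a b t ot ua.
have bt : body t = 0 by exact: body_odd.
have uab : a + t * b \is a GRing.unit.
  by rewrite gunitE bodyD bodyM bt mul0r addr0 -gunitE.
have E1 : t * b * (t * (gstar a^-1 * b / a)) = 0.
  by rewrite mulrA -[t * b * t]mulrA (gstarP b ot) !mulrA godd_sqr // !mul0r.
have E2 : a * (t * (gstar a^-1 * b / a)) = t * b / a.
  by rewrite mulrA (gstarP a ot) -!mulrA (mulrA (gstar a)) -gstarM mulrV // gstar1 mul1r.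
apply: (mulrI uab); move: E1 E2; move: (gstar a^-1 * b / a) => k E1 E2.
by rewrite mulrV // mulrN mulrBr !mulrDl mulrV // E1 E2 addr0 addrK.
Qed.

Lemma body_chiral_fun p : A (body_coord p) -> body (c p) = body (phi (body_coord p)).
Proof.
case: cA => [g0 g1 l0 l1 E] Ap; rewrite E // bodyD bodyM (body_odd (odd_coordpP p)) mul0r addr0.
by rewrite body_hat ?body_chiral //; exact: g0.
Qed.

Lemma chiral_at x (t : Lambda) p : A x -> even_coord p = x%:A -> odd_coordp p = t ->
  odd_coordm p = 0 -> c p = phi x + t * eta x.
Proof.
case: cA => [g0 g1 l0 l1 E] Ax pz pt ps.
have up : chiral_coord p = x%:A by rewrite /chiral_coord /oddprod ps mulr0 addr0 pz.
rewrite E; last by rewrite -body_chiral up body_scal.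
by rewrite up pt !hat_value //; [exact: g1|exact: g0].
Qed.

End Closure.

(** At points with scalar even coordinate and vanishing theta- the chiral expansion reads
    [phi x + t * eta x], so [odd_linear_inj] recovers the data. *)
Lemma chiral_scalar_inj A c c' phi eta phi' eta' x : chiral A c phi eta -> chiral A c' phi' eta' ->
  A x -> (forall p, body_coord p = x -> c p = c' p) -> phi x = phi' x /\ eta x = eta' x.
Proof.
move=> cA cA' Ax cc; apply: odd_linear_inj => t ot.
have [p [pz pt ps]] := exists_pt (gpar_scal x) ot (gpar0 true).
rewrite -(chiral_at cA Ax pz pt ps) -(chiral_at cA' Ax pz pt ps); apply: cc.
by rewrite /body_coord pz body_scal.
Qed.

Definition glue A phi phi' x : Lambda := if pselect (A x) is left _ then phi x else phi' x.

Lemma glueS A phi phi' x : A x -> glue A phi phi' x = phi x.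
Proof. by rewrite /glue; case: pselect. Qed.

Lemma glueN A B phi phi' x : (forall y, A y -> B y -> phi y = phi' y) -> B x ->
  glue A phi phi' x = phi' x.
Proof. by move=> H Bx; rewrite /glue; case: pselect => // Ax; apply: H. Qed.

Lemma chiral_near A c phi eta phi' eta' : open A -> chiral A c phi eta ->
  (forall x, A x -> phi x = phi' x) -> (forall x, A x -> eta x = eta' x) -> chiral A c phi' eta'.
Proof.
move=> oA [g0 g1 [n ln] [m lm] E] pp ee.
have nA x : A x -> \forall y \near x, A y by move=> Ax; exact: open_nbhs_nbhs (conj oA Ax).
have np x : A x -> \forall y \near x, phi y = phi' y by move=> /nA; apply: filterS => y /pp.
have ne x : A x -> \forall y \near x, eta y = eta' y by move=> /nA; apply: filterS => y /ee.
split=> [x Ax|x Ax|||p Ap].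
- exact: gan_near (g0 x Ax) (np x Ax).
- exact: gan_near (g1 x Ax) (ne x Ax).
- by exists n => x Ax; rewrite -pp //; exact: ln.
- by exists m => x Ax; rewrite -ee //; exact: lm.
rewrite E //; congr (_ + _ * _); apply: hat_near; rewrite body_chiral;
  by [exact: np|exact: g0|exact: ne|exact: g1].
Qed.

(** On the overlap both data describe the same function, hence agree by [chiral_scalar_inj]. *)
Lemma chiralU A B c phi eta phi' eta' : open A -> open B -> chiral A c phi eta ->
  chiral B c phi' eta' -> chiral (A `|` B) c (glue A phi phi') (glue A eta eta').
Proof.
move=> oA oB cA cB.
have agree x : A x -> B x -> phi x = phi' x /\ eta x = eta' x.
  move=> Ax Bx; apply: (@chiral_scalar_inj (A `&` B) c c).
  - by apply: chiralS cA => y [].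
  - by apply: chiralS cB => y [].
  - by [].
  - by [].
have cA' : chiral A c (glue A phi phi') (glue A eta eta').
  by apply: (chiral_near oA cA) => x Ax; rewrite glueS.
have cB' : chiral B c (glue A phi phi') (glue A eta eta').
  by apply: (chiral_near oB cB) => x Bx; rewrite (glueN (B := B)) // => y Ay By; case: (agree y Ay By).
case: cA' cB' => [g0 g1 [n ln] [m lm] E] [g0' g1' [n' ln'] [m' lm'] E'].
split=> [x [Ax|Bx]|x [Ax|Bx]|||p [Ap|Bp]].
- exact: g0. - exact: g0'. - exact: g1. - exact: g1'.
- exists (maxn n n') => x [/ln|/ln'].
    exact: glevW (leq_maxl _ _).
  exact: glevW (leq_maxr _ _).
- exists (maxn m m') => x [/lm|/lm'].
    exact: glevW (leq_maxl _ _).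
  exact: glevW (leq_maxr _ _).
- exact: E. - exact: E'.
Qed.

Lemma swap_in p : in_superspace (even_coord p, odd_coordm p, odd_coordp p).
Proof. by apply: in_superspaceP; [exact: even_coordP|exact: odd_coordmP|exact: odd_coordpP]. Qed.

Definition swap_pt p := mkpt (swap_in p).

Lemma swap_ptK : involutive swap_pt. Proof. by move=> p; apply: superspace_eq. Qed.
Lemma body_swap p : body_coord (swap_pt p) = body_coord p. Proof. by []. Qed.
Lemma chiral_swap p : chiral_coord (swap_pt p) = antichiral_coord p.
Proof.
rewrite /chiral_coord /antichiral_coord /oddprod; congr (_ + _).
exact: godd_anticomm (odd_coordmP p) (odd_coordpP p).
Qed.

End Chiral.

Arguments even_coordP {C} p.
Arguments odd_coordpP {C} p.
Arguments odd_coordmP {C} p.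
Arguments oddprod_even {C} p.
Arguments chiral_even {C} p.

(** * Normal forms of N=2 superconformal maps *)

Section Superconformal.
Variable C : numClosedFieldType.
Local Notation Lambda := (grassmann C).
Local Notation sp := (superspace C).
Hypothesis archC : small_powers C.
Implicit Types (phi eta f psi chi g h : C -> Lambda) (x y : C) (z t s : Lambda) (p : sp) (A : set C).
Implicit Types (F P M Z : superfun C) (H : sp -> sp) (U : set sp).

Lemma dewitt_open U : open U -> exists2 A : set C, open A & U = @body_coord C @^-1` A.
Proof. by move=> [A oA <-]; exists A. Qed.

Lemma dewitt_open_preimage A : open A -> open (@body_coord C @^-1` A).
Proof. by move=> oA; exists A. Qed.

Lemma exists_body x : exists p, body_coord p = x.
Proof.
have [p [pz _ _]] := exists_pt (gpar_scal x) (gpar0 (C := C) true) (gpar0 true).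
by exists p; rewrite /body_coord pz body_scal.
Qed.

Lemma body_image A : @body_coord C @` (@body_coord C @^-1` A) = A.
Proof.
apply/seteqP; split=> [x [p Ap <-] //|x Ax].
by have [p px] := exists_body x; exists p => //; rewrite /= px.
Qed.

Lemma exists_pt_body z t s : gpar false z -> gpar true t -> gpar true s ->
  exists p, [/\ even_coord p = z, odd_coordp p = t, odd_coordm p = s & body_coord p = body z].
Proof.
by move=> ez ot os; have [p [pz pt ps]] := exists_pt ez ot os; exists p; rewrite /body_coord pz.
Qed.

Lemma double_inj (a b : Lambda) : a + a = b + b -> a = b.
Proof.
have D (u : Lambda) : u + u = (1 + 1 : C) *: u by rewrite scalerDl scale1r.
rewrite !D => E; have := congr1 (fun u => (1 + 1 : C)^-1 *: u) E.
by rewrite !scalerA mulVf ?scale1r // -mulr2n pnatr_eq0.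
Qed.

Lemma gderiv_par e phi x : gan phi x -> (\forall y \near x, gpar e (phi y)) ->
  \forall y \near x, gpar e (gderiv phi y).
Proof.
move=> px /near_join_nbhs ep; apply: filterS2 px ep => y [a pa] ey.
by rewrite /gderiv (gjetE pa); apply: gtaylor_gsupp pa ey _.
Qed.

Lemma near_open A x : open A -> A x -> \forall y \near x, A y.
Proof. by move=> oA Ax; exact: open_nbhs_nbhs (conj oA Ax). Qed.

Section OnOpen.
Variables (A : set C) (z : Lambda).
Hypotheses (oA : open A) (Az : A (body z)) (ez : gpar false z).

Lemma hat_eqA phi eta : (forall x, A x -> gan phi x) -> (forall x, A x -> phi x = eta x) ->
  hat phi z = hat eta z.
Proof.
move=> gp pe; apply: hat_near; last exact: gp.
by apply: filterS (near_open oA Az) => y; exact: pe.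
Qed.

Lemma hat_parA e phi : (forall x, A x -> gan phi x) -> (forall x, A x -> gpar e (phi x)) ->
  gpar e (hat phi z) /\ gpar e (hat (gderiv phi) z).
Proof.
move=> gp ep; have N : \forall y \near body z, gpar e (phi y).
  by apply: filterS (near_open oA Az) => y; exact: ep.
split; apply: hat_par => //; [exact: gp|exact/gan_deriv/gp|].
by apply: gderiv_par => //; exact: gp.
Qed.

Lemma hat_gderivM phi eta : (forall x, A x -> gan phi x) -> (forall x, A x -> gan eta x) ->
  hat (gderiv (fun y => phi y * eta y)) z =
  hat (gderiv phi) z * hat eta z + hat phi z * hat (gderiv eta) z.
Proof.
move=> gp ge; have gp' x : A x -> gan (gderiv phi) x by move=> /gp; exact: gan_deriv.
have ge' x : A x -> gan (gderiv eta) x by move=> /ge; exact: gan_deriv.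
rewrite (@hat_eqA _ (fun y => gderiv phi y * eta y + phi y * gderiv eta y)).
- rewrite hatD ?hatM //; by [exact: gp|exact: ge|exact: gp'|exact: ge'|apply: ganM; by [exact: gp|exact: ge|exact: gp'|exact: ge']].
- by move=> x Ax; apply: gan_deriv => //; apply: ganM; [exact: gp|exact: ge].
- by move=> x Ax; rewrite gderivM //; [exact: gp|exact: ge].
Qed.

Lemma hat_gderivD phi eta : (forall x, A x -> gan phi x) -> (forall x, A x -> gan eta x) ->
  hat (gderiv (fun y => phi y + eta y)) z = hat (gderiv phi) z + hat (gderiv eta) z.
Proof.
move=> gp ge; rewrite (@hat_eqA _ (fun y => gderiv phi y + gderiv eta y)).
- by rewrite hatD //; apply: gan_deriv => //; [exact: gp|exact: ge].
- by move=> x Ax; apply: gan_deriv => //; apply: ganD; [exact: gp|exact: ge].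
- by move=> x Ax; rewrite gderivD //; [exact: gp|exact: ge].
Qed.
End OnOpen.

Definition cfun0 F := comb_fun (comp0 F).
Definition cfun1 F := comb_fun (comp1 F).
Definition cfun2 F := comb_fun (comp2 F).
Definition cfun3 F := comb_fun (comp3 F).

Section SuperfunEval.
Variables (A : set C) (F : superfun C).
Hypotheses (oA : open A) (aF : superfun_analytic A F).

Lemma cfun_gan x : A x -> [/\ gan (cfun0 F) x, gan (cfun1 F) x, gan (cfun2 F) x & gan (cfun3 F) x].
Proof.
by case: aF => a0 a1 a2 a3 Ax; split; apply: comb_gan; apply: comb_analytic_holo Ax.
Qed.

Lemma superfun_evalE p : A (body_coord p) -> superfun_eval F p =
  hat (cfun0 F) (even_coord p) + odd_coordp p * hat (cfun1 F) (even_coord p) +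
  odd_coordm p * hat (cfun2 F) (even_coord p) +
  odd_coordp p * odd_coordm p * hat (cfun3 F) (even_coord p).
Proof.
case: aF => a0 a1 a2 a3 Ap; rewrite /superfun_eval !comb_eval_hat //;
  by [exact: even_coordP|apply: comb_analytic_holo Ap].
Qed.

Let zero_eval z : comb_eval [::] z = 0 :> Lambda. Proof. by rewrite /comb_eval big_nil. Qed.

Lemma DplusE p : A (body_coord p) -> Dplus F p =
  hat (cfun1 F) (even_coord p) + odd_coordm p * hat (cfun3 F) (even_coord p)
  + odd_coordm p * hat (gderiv (cfun0 F)) (even_coord p)
  + odd_coordm p * odd_coordp p * hat (gderiv (cfun1 F)) (even_coord p).
Proof.
case: aF => a0 a1 a2 a3 Ap; have ez := even_coordP p.
rewrite /Dplus /superfun_eval /= !zero_eval !mulr0 !addr0.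
have ch (s : combination C) (h : comb_analytic A s) := comb_eval_hat archC ez (comb_analytic_holo archC oA h Ap).
have cd (s : combination C) (h : comb_analytic A s) := comb_eval_deriv archC oA h Ap ez.
rewrite (ch _ a1) (ch _ a3) (cd _ a0) (cd _ a1) (cd _ a2) (cd _ a3).
have op := odd_coordpP p; have om := odd_coordmP p.
rewrite -/(cfun0 F) -/(cfun1 F) -/(cfun2 F) -/(cfun3 F).
move: (hat (gderiv (cfun2 F)) _) (hat (gderiv (cfun3 F)) _) => u v.
rewrite !mulrDr (mulrA (odd_coordm p) (odd_coordm p) u) godd_sqr // mul0r addr0.
rewrite [odd_coordm p * (odd_coordp p * odd_coordm p * v)](_ : _ = 0).
  by rewrite addr0 !addrA !mulrA.
by rewrite (godd_anticomm op om) mulNr -mulrA mulrN mulrA godd_sqr // mul0r oppr0.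
Qed.

Lemma DminusE p : A (body_coord p) -> Dminus F p =
  hat (cfun2 F) (even_coord p) - odd_coordp p * hat (cfun3 F) (even_coord p)
  + odd_coordp p * hat (gderiv (cfun0 F)) (even_coord p)
  + odd_coordp p * odd_coordm p * hat (gderiv (cfun2 F)) (even_coord p).
Proof.
case: aF => a0 a1 a2 a3 Ap; have ez := even_coordP p.
rewrite /Dminus /superfun_eval /= !zero_eval !mulr0 !addr0.
rewrite comb_eval_opp //; last exact: comb_analytic_holo Ap.
have ch (s : combination C) (h : comb_analytic A s) := comb_eval_hat archC ez (comb_analytic_holo archC oA h Ap).
have cd (s : combination C) (h : comb_analytic A s) := comb_eval_deriv archC oA h Ap ez.
rewrite (ch _ a2) (ch _ a3) (cd _ a0) (cd _ a1) (cd _ a2) (cd _ a3).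
have op := odd_coordpP p.
rewrite -/(cfun0 F) -/(cfun1 F) -/(cfun2 F) -/(cfun3 F).
move: (hat (gderiv (cfun1 F)) _) (hat (gderiv (cfun3 F)) _) => u v.
rewrite !mulrDr (mulrA _ _ u) godd_sqr // mul0r addr0.
rewrite [odd_coordp p * (odd_coordp p * odd_coordm p * v)](_ : _ = 0).
  by rewrite addr0 !addrA !mulrA mulrN.
by rewrite !mulrA godd_sqr // !mul0r.
Qed.
End SuperfunEval.

(* The general N=2 superconformal map: psi, chi, g, h are the functions
   written psi^+, psi^-, g^+, g^- in the physics literature. *)
Record normal_form A H f psi chi g h : Prop := NormalForm {
  nf_gan : forall x, A x -> [/\ gan f x, gan psi x, gan chi x, gan g x & gan h x] ;
  nf_par : forall x, A x -> [/\ gpar false (f x), gpar true (psi x), gpar true (chi x),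
                               gpar false (g x) & gpar false (h x)] ;
  nf_even : forall p, A (body_coord p) -> let z := even_coord p in
    even_coord (H p) = hat f z + odd_coordp p * (hat g z * hat chi z)
      + odd_coordm p * (hat h z * hat psi z)
      + oddprod p * (hat (gderiv psi) z * hat chi z + hat psi z * hat (gderiv chi) z) ;
  nf_oddp : forall p, A (body_coord p) -> let z := even_coord p in
    odd_coordp (H p) = hat psi z + odd_coordp p * hat g z + oddprod p * hat (gderiv psi) z ;
  nf_oddm : forall p, A (body_coord p) -> let z := even_coord p in
    odd_coordm (H p) = hat chi z + odd_coordm p * hat h z - oddprod p * hat (gderiv chi) z ;
  nf_rel : forall z, gpar false z -> A (body z) -> hat (gderiv f) z =
    hat g z * hat h z + hat (gderiv psi) z * hat chi z - hat psi z * hat (gderiv chi) z ;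
  nf_lev : [/\ bounded_level A f, bounded_level A psi, bounded_level A chi, bounded_level A g &
      bounded_level A h] }.

Lemma bounded_level_comb_fun A (s : combination C) : bounded_level A (comb_fun s).
Proof.
have H (t : {fset nat} * (C -> C)) : bounded_level A (fun y => t.2 y *: zeta C t.1 : Lambda).
  by have [n Hn] := glev_ex (zeta C t.1); exists n => x _; exact: glevZ.
elim: s => [|t s IH]; first by rewrite comb_fun_nil; exact: bounded_level_const.
rewrite comb_fun_cons; exact: bounded_level2 (@glevD C) (H t) IH.
Qed.

(** All equations are tested at points with at most one nonzero odd coordinate. The vanishing of D+
    theta~- and D- theta~+ fixes the last two components of the odd coordinates; the two equations
    for z~ then determine its components and the relation [nf_rel]. *)
Lemma superconformal_normal_form U H : superconformal U H ->
  exists A, [/\ open A, U = @body_coord C @^-1` A &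
    exists f psi chi g h, normal_form A H f psi chi g h].
Proof.
move=> [/dewitt_open[A oA ->] [Z [P [M [[EZ EP EM] [H1 HP HM _ _]]]]]].
exists A; split=> //; rewrite /expands body_image in EZ EP EM.
have [aZ ZE] := EZ; have [aP PE] := EP; have [aM ME] := EM.
exists (cfun0 Z), (cfun0 P), (cfun0 M), (cfun1 P), (cfun2 M).
have gZ x : A x -> gan (cfun0 Z) x by move=> /(cfun_gan oA aZ)[].
have gP0 x : A x -> gan (cfun0 P) x by move=> /(cfun_gan oA aP)[].
have gP1 x : A x -> gan (cfun1 P) x by move=> /(cfun_gan oA aP)[].
have gM0 x : A x -> gan (cfun0 M) x by move=> /(cfun_gan oA aM)[].
have gM2 x : A x -> gan (cfun2 M) x by move=> /(cfun_gan oA aM)[].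
have val p : A (body_coord p) ->
    [/\ even_coord (H p) = superfun_eval Z p, odd_coordp (H p) = superfun_eval P p &
        odd_coordm (H p) = superfun_eval M p].
  by move=> Ap; split; [exact: ZE|exact: PE|exact: ME].
have g0 := gpar0 (C := C) true.
(* The values at points whose odd coordinates vanish *)
have par0 x : A x -> [/\ gpar false (cfun0 Z x), gpar true (cfun0 P x), gpar true (cfun0 M x),
    gpar false (cfun1 P x) & gpar false (cfun2 M x)].
  move=> Ax; have B t s : gpar true t -> gpar true s -> exists p,
    [/\ even_coord p = x%:A, odd_coordp p = t, odd_coordm p = s & A (body_coord p)].
    move=> ot os; have [p [pz pt ps pb]] := exists_pt_body (gpar_scal x) ot os.
    by exists p; rewrite pb body_scal.
  have [p [pz pt ps Ap]] := B _ _ g0 g0.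
  have [V1 V2 V3] := val p Ap.
  rewrite (superfun_evalE oA aZ Ap) pz pt ps !mul0r !addr0 hat_value // in V1; last exact: gZ.
  rewrite (superfun_evalE oA aP Ap) pz pt ps !mul0r !addr0 hat_value // in V2; last exact: gP0.
  rewrite (superfun_evalE oA aM Ap) pz pt ps !mul0r !addr0 hat_value // in V3; last exact: gM0.
  have oP0 : gpar true (cfun0 P x) by rewrite -V2; exact: odd_coordpP.
  have oM0 : gpar true (cfun0 M x) by rewrite -V3; exact: odd_coordmP.
  split=> //; first by rewrite -V1; exact: even_coordP.
    apply: odd_mul_par => t ot; have [q [qz qt qs Aq]] := B _ _ ot g0.
    have [_ W2 _] := val q Aq.
    rewrite (superfun_evalE oA aP Aq) qz qt qs !(mul0r,mulr0) !addr0 !hat_value // in W2;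
      [|exact: gP1|exact: gP0].
    rewrite (_ : t * _ = odd_coordp (H q) - cfun0 P x); last by rewrite W2 addrC addKr.
    by apply: gparB => //; exact: odd_coordpP.
  apply: odd_mul_par => s os; have [q [qz qt qs Aq]] := B _ _ g0 os.
  have [_ _ W3] := val q Aq.
  rewrite (superfun_evalE oA aM Aq) qz qt qs !(mul0r,mulr0) !addr0 !hat_value // in W3;
    [|exact: gM2|exact: gM0].
  rewrite (_ : s * _ = odd_coordm (H q) - cfun0 M x); last by rewrite W3 addrC addKr.
  by apply: gparB => //; exact: odd_coordmP.
have key z : gpar false z -> A (body z) ->
  [/\ hat (cfun2 P) z = 0, hat (cfun3 P) z = hat (gderiv (cfun0 P)) z,
      hat (cfun1 M) z = 0 & hat (cfun3 M) z = - hat (gderiv (cfun0 M)) z] /\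
  [/\ hat (cfun1 Z) z = hat (cfun1 P) z * hat (cfun0 M) z,
      hat (cfun2 Z) z = hat (cfun2 M) z * hat (cfun0 P) z,
      hat (cfun3 Z) z = hat (gderiv (cfun0 P)) z * hat (cfun0 M) z
                       + hat (cfun0 P) z * hat (gderiv (cfun0 M)) z &
      hat (gderiv (cfun0 Z)) z = hat (cfun1 P) z * hat (cfun2 M) z
        + hat (gderiv (cfun0 P)) z * hat (cfun0 M) z - hat (cfun0 P) z * hat (gderiv (cfun0 M)) z].
  move=> ez Az.
  have B t s : gpar true t -> gpar true s -> exists p,
    [/\ even_coord p = z, odd_coordp p = t, odd_coordm p = s & A (body_coord p)].
    move=> ot os; have [p [pz pt ps pb]] := exists_pt_body ez ot os.
    by exists p; rewrite pb.
  have [oP0 oP0'] := hat_parA oA Az ez gP0 (fun x Ax => let: And5 _ q _ _ _ := par0 x Ax in q).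
  have [oM0 oM0'] := hat_parA oA Az ez gM0 (fun x Ax => let: And5 _ _ q _ _ := par0 x Ax in q).
  have [eP1 _] := hat_parA oA Az ez gP1 (fun x Ax => let: And5 _ _ _ q _ := par0 x Ax in q).
  have [eM2 _] := hat_parA oA Az ez gM2 (fun x Ax => let: And5 _ _ _ _ q := par0 x Ax in q).
  have [P2 P3] : hat (cfun2 P) z = 0 /\ hat (gderiv (cfun0 P)) z - hat (cfun3 P) z = 0.
    apply: odd_linear_inj => t ot; have [p [pz pt ps Ap]] := B _ _ ot g0.
    have [_] := H1 p Ap; rewrite (DminusE oA aP Ap) pz pt ps !(mul0r, mulr0) !addr0 => E.
    by rewrite mulrBr [in LHS](addrC (t * _)) addrA E.
  have {}P3 : hat (cfun3 P) z = hat (gderiv (cfun0 P)) z by apply/esym/eqP; rewrite -subr_eq0 P3.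
  have [M1 M3] : hat (cfun1 M) z = 0 /\ hat (cfun3 M) z + hat (gderiv (cfun0 M)) z = 0.
    apply: odd_linear_inj => s os; have [p [pz pt ps Ap]] := B _ _ g0 os.
    have [E _] := H1 p Ap; move: E; rewrite (DplusE oA aM Ap) pz pt ps !(mul0r, mulr0) !addr0 => E.
    by rewrite mulrDr addrA E.
  have {}M3 : hat (cfun3 M) z = - hat (gderiv (cfun0 M)) z by apply/eqP; rewrite -addr_eq0 M3.
  split=> //.
  have [Z1 Zs] : hat (cfun1 Z) z = hat (cfun1 P) z * hat (cfun0 M) z /\
     hat (cfun3 Z) z + hat (gderiv (cfun0 Z)) z = hat (cfun2 M) z * hat (cfun1 P) z -
       hat (cfun0 M) z * (hat (gderiv (cfun0 P)) z + hat (gderiv (cfun0 P)) z).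
    apply: odd_linear_inj => s os; have [p [pz pt ps Ap]] := B _ _ g0 os.
    have := HP p Ap; have [_ _ ->] := val p Ap.
    rewrite (DplusE oA aZ Ap) (DplusE oA aP Ap) (superfun_evalE oA aM Ap) pz pt ps.
    rewrite !(mul0r, mulr0) !addr0 P3 => E; rewrite mulrDr addrA E.
    by sring [:: hat (cfun1 P) z; hat (cfun2 M) z] [:: s; hat (cfun0 M) z; hat (gderiv (cfun0 P)) z].
  have [Z2 Zd] : hat (cfun2 Z) z = hat (cfun2 M) z * hat (cfun0 P) z /\
     hat (gderiv (cfun0 Z)) z - hat (cfun3 Z) z = hat (cfun1 P) z * hat (cfun2 M) z -
       hat (cfun0 P) z * (hat (gderiv (cfun0 M)) z + hat (gderiv (cfun0 M)) z).
    apply: odd_linear_inj => t ot; have [p [pz pt ps Ap]] := B _ _ ot g0.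
    have := HM p Ap; have [_ -> _] := val p Ap.
    rewrite (DminusE oA aZ Ap) (DminusE oA aM Ap) (superfun_evalE oA aP Ap) pz pt ps.
    rewrite !(mul0r, mulr0) !addr0 M3 => E; rewrite mulrBr [in LHS](addrC (t * _)) addrA E.
    by sring [:: hat (cfun1 P) z; hat (cfun2 M) z] [:: t; hat (cfun0 P) z; hat (gderiv (cfun0 M)) z].
  split=> //.
    (* The two equations give the sum and the difference of the derivative of [f] and of the top
       component of z~; subtracting isolates the top component, and adding gives the relation. *)
    apply: double_inj; transitivity ((hat (cfun3 Z) z + hat (gderiv (cfun0 Z)) z)
       - (hat (gderiv (cfun0 Z)) z - hat (cfun3 Z) z)).
      by rewrite opprB addrA addrAC addrK.
    rewrite Zs Zd.
    by sring [:: hat (cfun1 P) z; hat (cfun2 M) z] [:: hat (cfun0 P) z; hat (cfun0 M) z;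
       hat (gderiv (cfun0 P)) z; hat (gderiv (cfun0 M)) z].
  apply: double_inj; transitivity ((hat (cfun3 Z) z + hat (gderiv (cfun0 Z)) z)
     + (hat (gderiv (cfun0 Z)) z - hat (cfun3 Z) z)).
    by rewrite [hat (cfun3 Z) z + _]addrC addrACA subrr addr0.
  rewrite Zs Zd.
  by sring [:: hat (cfun1 P) z; hat (cfun2 M) z] [:: hat (cfun0 P) z; hat (cfun0 M) z;
     hat (gderiv (cfun0 P)) z; hat (gderiv (cfun0 M)) z].
split.
- by move=> x Ax; split; [exact: gZ|exact: gP0|exact: gM0|exact: gP1|exact: gM2].
- exact: par0.
- move=> p Ap; have [_ [Z1 Z2 Z3 _]] := key _ (even_coordP p) Ap; have [-> _ _] := val p Ap.
  by rewrite (superfun_evalE oA aZ Ap) Z1 Z2 Z3.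
- move=> p Ap; have [[P2 P3 _ _] _] := key _ (even_coordP p) Ap; have [_ -> _] := val p Ap.
  by rewrite (superfun_evalE oA aP Ap) P2 P3 mulr0 addr0.
- move=> p Ap; have [[_ _ M1 M3] _] := key _ (even_coordP p) Ap; have [_ _ ->] := val p Ap.
  by rewrite (superfun_evalE oA aM Ap) M1 M3 mulr0 addr0 mulrN.
- by move=> z ez Az; have [_ [_ _ _]] := key z ez Az.
- by split; exact: bounded_level_comb_fun.
Qed.

Lemma chiral_par e A c phi eta : chiral A c phi eta ->
  (forall p, A (body_coord p) -> gpar e (c p)) ->
  forall x, A x -> gpar e (phi x) /\ gpar (~~ e) (eta x).
Proof.
move=> cA ec x Ax.
have V t : gpar true t -> gpar e (phi x + t * eta x).
  move=> ot; have [p [pz pt ps pb]] := exists_pt_body (gpar_scal x) ot (gpar0 (C := C) true).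
  by rewrite -(chiral_at cA Ax pz pt ps); apply: ec; rewrite pb body_scal.
have e0 : gpar e (phi x) by have := V 0; rewrite mul0r addr0; apply; exact: gpar0.
split=> //; apply: odd_mul_par => t ot; rewrite negbK.
rewrite (_ : t * _ = phi x + t * eta x - phi x); last by rewrite addrC addKr.
by apply: gparB => //; exact: V.
Qed.

Lemma chiral_expand A c phi eta p : chiral A c phi eta -> A (body_coord p) ->
  c p = hat phi (even_coord p) + oddprod p * hat (gderiv phi) (even_coord p)
        + odd_coordp p * hat eta (even_coord p).
Proof.
move=> [g0 g1 _ _ E] Ap; rewrite E //.
have H f : gan f (body_coord p) -> hat f (chiral_coord p) =
    hat f (even_coord p) + oddprod p * hat (gderiv f) (even_coord p).
  move=> gf; apply: hat_shift => //; first exact: even_coordP.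
  - exact: oddprod_even. - exact: oddprod_body. - exact: oddprod_sqr.
rewrite !H; [|exact: g1|exact: g0].
by rewrite mulrDr [odd_coordp p * (_ * _)]mulrA coordp_oddprod mul0r addr0.
Qed.

Lemma hat_gderiv_eqA A z phi eta : open A -> A (body z) -> (forall x, A x -> gan phi x) ->
  (forall x, A x -> phi x = eta x) -> hat (gderiv phi) z = hat (gderiv eta) z.
Proof.
move=> oA Az gp pe; apply: (hat_eqA oA Az); first by move=> x Ax; apply: gan_deriv => //; exact: gp.
move=> x Ax; apply: gderiv_near; first exact: gp.
by apply: filterS (near_open oA Ax) => y; exact: pe.
Qed.

(** The chiral even coordinate [u] and the antichiral one [v] of the image satisfy
    [u - v = 2 theta~+ theta~-]. Expanding both sides in theta+ and theta- expresses the data of [u]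
    and [v] through those of the odd coordinates, and this is the normal form. Antichirality is
    expressed as chirality after [swap_pt]. *)
Lemma normal_form_of_chiral A H (F k psi g G l chi h : C -> Lambda) : open A ->
  chiral A (fun p => even_coord (H p) + oddprod (H p)) F k ->
  chiral A (fun p => odd_coordp (H p)) psi g ->
  chiral A (fun p => even_coord (H (swap_pt p)) - oddprod (H (swap_pt p))) G l ->
  chiral A (fun p => odd_coordm (H (swap_pt p))) chi h ->
  normal_form A H (fun x => F x - psi x * chi x) psi chi g h.
Proof.
move=> oA cu ct cv cs.
have pF x : A x -> gpar false (F x).
  by move=> Ax; have [] := chiral_par (e := false) cu (fun p _ => gparD (even_coordP _) (oddprod_even _)) Ax.
have pG x : A x -> gpar false (G x).
  by move=> Ax; have [] := chiral_par (e := false) cv (fun p _ => gparB (even_coordP _) (oddprod_even _)) Ax.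
have ppsi x : A x -> gpar true (psi x) /\ gpar false (g x).
  exact: (chiral_par (e := true) ct (fun p _ => odd_coordpP _)).
have pchi x : A x -> gpar true (chi x) /\ gpar false (h x).
  exact: (chiral_par (e := true) cs (fun p _ => odd_coordmP _)).
have [gF _ _ _ _] := cu; have [gG _ _ _ _] := cv.
have [gpsi gg _ _ _] := ct; have [gchi gh _ _ _] := cs.
have X p : A (body_coord p) -> let z := even_coord p in let t := odd_coordp p in
   let s := odd_coordm p in
   [/\ even_coord (H p) + oddprod (H p) = hat F z + t * s * hat (gderiv F) z + t * hat k z,
       odd_coordp (H p) = hat psi z + t * s * hat (gderiv psi) z + t * hat g z,
       even_coord (H p) - oddprod (H p) = hat G z - t * s * hat (gderiv G) z + s * hat l z &
       odd_coordm (H p) = hat chi z - t * s * hat (gderiv chi) z + s * hat h z].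
  move=> Ap z t s; have Asw : A (body_coord (swap_pt p)) by [].
  have osw : oddprod (swap_pt p) = - (t * s).
    by rewrite /t /s (godd_anticomm (odd_coordpP p) (odd_coordmP p)) opprK.
  have := chiral_expand cv Asw; have := chiral_expand cs Asw; rewrite swap_ptK osw !mulNr => -> ->.
  by split=> //; [exact: chiral_expand cu Ap|exact: chiral_expand ct Ap].
have Rel z : gpar false z -> A (body z) ->
  [/\ hat F z = hat G z + (hat psi z * hat chi z + hat psi z * hat chi z),
      hat k z = hat g z * hat chi z + hat g z * hat chi z,
      hat l z = hat h z * hat psi z + hat h z * hat psi z &
      hat (gderiv F) z + hat (gderiv G) z = (hat g z * hat h z
        + hat (gderiv psi) z * hat chi z - hat psi z * hat (gderiv chi) z) +
       (hat g z * hat h z + hat (gderiv psi) z * hat chi z - hat psi z * hat (gderiv chi) z)].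
  move=> ez Az.
  have [oP oP'] := hat_parA oA Az ez gpsi (fun x Ax => (ppsi x Ax).1).
  have [oX oX'] := hat_parA oA Az ez gchi (fun x Ax => (pchi x Ax).1).
  have [eg _] := hat_parA oA Az ez gg (fun x Ax => (ppsi x Ax).2).
  have [eh _] := hat_parA oA Az ez gh (fun x Ax => (pchi x Ax).2).
  have [eF eF'] := hat_parA oA Az ez gF pF.
  have [eG eG'] := hat_parA oA Az ez gG pG.
  (* The identity [u - v = 2 theta~+ theta~-] at odd coordinates [t], [s]; the coefficients of 1,
     [t], [s] and [t * s] are compared next. *)
  have E t s : gpar true t -> gpar true s ->
    hat F z + t * s * hat (gderiv F) z + t * hat k z
     - (hat G z - t * s * hat (gderiv G) z + s * hat l z) =
    2 * ((hat psi z + t * s * hat (gderiv psi) z + t * hat g z) *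
     (hat chi z - t * s * hat (gderiv chi) z + s * hat h z)).
    move=> ot os; have [p [pz pt ps pb]] := exists_pt_body ez ot os.
    have := X p; rewrite pb pz pt ps => /(_ Az) /= [<- <- <- <-].
    rewrite opprD opprK addrACA subrr add0r /oddprod mulr_natl mulr2n //.
  move: (hat F z) (hat k z) (hat l z) (hat (gderiv F) z) (hat G z) (hat (gderiv G) z)
    (hat psi z) (hat (gderiv psi) z) (hat chi z) (hat (gderiv chi) z) (hat g z) (hat h z)
    E eF eF' eG eG' oP oP' oX oX' eg eh =>
    vF vk vl vF' vG vG' vp vp' vx vx' vg vh E eF eF' eG eG' oP oP' oX oX' eg eh.
  have o0 := gpar0 (C := C) true.
  have R1 : vF = vG + (vp * vx + vp * vx).
    have := E 0 0 o0 o0; rewrite !mul0r !(addr0, subr0) mulr_natl mulr2n => <-.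
    by rewrite addrC subrK.
  have R2 : vk = vg * vx + vg * vx.
    have [] // := @odd_linear_inj _ (vF - vG) vk (vp * vx + vp * vx) (vg * vx + vg * vx).
    move=> t ot; have := E t 0 ot o0; rewrite !(mulr0, mul0r) !(addr0, subr0) addrAC => ->.
    by sring [:: vg] [:: t; vp; vx].
  have R3 : vl = vh * vp + vh * vp.
    have [] // := @odd_linear_inj _ (vF - vG) (- vl) (vp * vx + vp * vx) (- (vh * vp + vh * vp)).
      move=> s os; have := E 0 s o0 os; rewrite !(mulr0, mul0r) !(addr0, subr0) opprD addrA.
      rewrite mulrN => ->.
      by sring [:: vh] [:: s; vp; vx].
    by move=> _ /oppr_inj.
  split=> //; apply/eqP; rewrite -subr_eq0; apply/eqP.
  apply: odd_mul_eq0 => s os; apply: odd_mul_eq0 => t ot.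
  have := E t s ot os; rewrite R1 R2 R3 => /eqP; rewrite -subr_eq0 => /eqP Ets.
  rewrite -[RHS]Ets.
  by sring [:: vG; vF'; vG'; vg; vh] [:: t; s; vp; vx; vp'; vx'].
have RF x : A x -> F x = G x + (psi x * chi x + psi x * chi x).
  move=> Ax; have Az : A (body (x%:A : Lambda)) by rewrite body_scal.
  have [R1 _ _ _] := Rel _ (gpar_scal x) Az; move: R1; rewrite !hat_value //;
    by [exact: gF|exact: gG|exact: gpsi|exact: gchi].
have gpc x : A x -> gan (fun y => psi y * chi y) x by move=> Ax; apply: ganM; [exact: gpsi|exact: gchi].
have gpc2 x : A x -> gan (fun y => psi y * chi y + psi y * chi y) x.
  by move=> Ax; apply: ganD; exact: gpc.
have RF' z : gpar false z -> A (body z) -> hat (gderiv F) z = hat (gderiv G) z +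
   ((hat (gderiv psi) z * hat chi z + hat psi z * hat (gderiv chi) z) +
    (hat (gderiv psi) z * hat chi z + hat psi z * hat (gderiv chi) z)).
  move=> ez Az; rewrite (hat_gderiv_eqA oA Az gF RF) (hat_gderivD oA Az) //.
  by rewrite (hat_gderivD oA Az) // (hat_gderivM oA Az ez).
have lP := chiral_lev0 ct; have lX := chiral_lev0 cs.
split.
- move=> x Ax; split; [|exact: gpsi|exact: gchi|exact: gg|exact: gh].
  by apply: ganB; [exact: gF|exact: gpc].
- move=> x Ax; have [ o1 e1] := ppsi x Ax; have [ o2 e2] := pchi x Ax; split=> //.
  by apply: gparB; [exact: pF|exact: (gparM o1 o2)].
- move=> p Ap z; have ez : gpar false z := even_coordP p.
  have [Xu _ Xv _] := X p Ap; have [R1 R2 R3 _] := Rel z ez Ap; have R' := RF' z ez Ap.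
  rewrite hatB; [|exact: gF|exact: gpc]; rewrite hatM //; [|exact: gpsi|exact: gchi].
  have [oP oP'] := hat_parA oA Ap ez gpsi (fun x Ax => (ppsi x Ax).1).
  have [oX oX'] := hat_parA oA Ap ez gchi (fun x Ax => (pchi x Ax).1).
  have [eg _] := hat_parA oA Ap ez gg (fun x Ax => (ppsi x Ax).2).
  have [eh _] := hat_parA oA Ap ez gh (fun x Ax => (pchi x Ax).2).
  have [eG eG'] := hat_parA oA Ap ez gG pG.
  have op := odd_coordpP p; have om := odd_coordmP p.
  apply: double_inj; transitivity ((even_coord (H p) + oddprod (H p)) + (even_coord (H p) - oddprod (H p))).
    by rewrite addrACA subrr addr0.
  rewrite Xu Xv /oddprod -/z R1 R2 R3 R'.
  by sring [:: hat G z; hat (gderiv G) z; hat g z; hat h z] [:: odd_coordp p; odd_coordm p;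
    hat psi z; hat chi z; hat (gderiv psi) z; hat (gderiv chi) z].
- by move=> p Ap z; have [_ -> _ _] := X p Ap; rewrite addrAC.
- by move=> p Ap z; have [_ _ _ ->] := X p Ap; rewrite addrAC.
- move=> z ez Az; have [_ _ _ R4] := Rel z ez Az; have R' := RF' z ez Az.
  have -> : hat (gderiv (fun x => F x - psi x * chi x)) z =
    hat (gderiv F) z - (hat (gderiv psi) z * hat chi z + hat psi z * hat (gderiv chi) z).
    have E : hat (gderiv F) z = hat (gderiv (fun x => (F x - psi x * chi x) + psi x * chi x)) z.
      by apply: (hat_gderiv_eqA oA Az gF) => x _; rewrite subrK.
    have gFm x : A x -> gan (fun y => F y - psi y * chi y) x.
      by move=> Ax; apply: ganB; [exact: gF|exact: gpc].
    rewrite E (hat_gderivD oA Az gFm gpc).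
    by rewrite (hat_gderivM oA Az ez) // addrK.
  apply: double_inj; rewrite -R4 R'.
  move: (hat (gderiv G) z) (hat (gderiv psi) z * hat chi z + _) => a d.
  have -> : a + (d + d) - d = a + d by rewrite addrA addrK.
  by rewrite addrACA [RHS]addrC -addrA.
- split=> //; [|exact: chiral_lev1 ct|exact: chiral_lev1 cs].
  exact: bounded_level2 (@glevB C) (chiral_lev0 cu) (bounded_level2 (@glevM C) lP lX).
Qed.

Lemma bounded_level_gderiv A phi : open A -> (forall x, A x -> gan phi x) -> bounded_level A phi ->
  bounded_level A (gderiv phi).
Proof.
move=> oA gp [n ln]; exists n => x Ax; have [a pa] := gan_taylor (gp x Ax).
rewrite /gderiv (gjetE pa); apply: gtaylor_lev pa _ _.
by apply: filterS (near_open oA Ax) => y; exact: ln.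
Qed.

Lemma comb_exists A phi : (forall x, A x -> gan phi x) -> bounded_level A phi ->
  exists2 s : combination C, comb_analytic A s & forall x, A x -> comb_fun s x = phi x.
Proof.
move=> gp [n ln]; exists (comb_of n phi); first exact: comb_of_analytic.
by move=> x /ln; exact: comb_fun_of.
Qed.

(** The components prescribed by the normal form are realized as combinations by [comb_exists]. The
    superconformal conditions are then polynomial identities between the functions and their
    derivatives, with [nf_rel] as the only analytic input. *)
Lemma superconformal_of_normal_form A H f psi chi g h : open A -> normal_form A H f psi chi g h ->
  (exists2 x, A x & body (g x) != 0) -> (exists2 x, A x & body (h x) != 0) ->
  superconformal (@body_coord C @^-1` A) H.
Proof.
move=> oA [ga pa ne np nm rel [lf lpsi lchi lg lh]] [xg Axg gxg] [xh Axh hxh].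
have gf x (Ax : A x) : gan f x by case: (ga x Ax).
have gpsi x (Ax : A x) : gan psi x by case: (ga x Ax).
have gchi x (Ax : A x) : gan chi x by case: (ga x Ax).
have gg x (Ax : A x) : gan g x by case: (ga x Ax).
have gh x (Ax : A x) : gan h x by case: (ga x Ax).
have gpsi' x (Ax : A x) : gan (gderiv psi) x by apply: gan_deriv => //; exact: gpsi.
have gchi' x (Ax : A x) : gan (gderiv chi) x by apply: gan_deriv => //; exact: gchi.
have lpsi' := bounded_level_gderiv oA gpsi lpsi.
have lchi' := bounded_level_gderiv oA gchi lchi.
have gM phi eta : (forall x, A x -> gan phi x) -> (forall x, A x -> gan eta x) ->
  forall x, A x -> gan (fun y => phi y * eta y) x by move=> g1 g2 x Ax; apply: ganM; [exact: g1|exact: g2].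
have lM phi eta := @bounded_level2 C *%R A phi eta (@glevM C).
have [s0 a0 e0] := comb_exists gf lf.
have [s1 a1 e1] := comb_exists (gM _ _ gg gchi) (lM _ _ lg lchi).
have [s2 a2 e2] := comb_exists (gM _ _ gh gpsi) (lM _ _ lh lpsi).
have g3 x : A x -> gan (fun y => gderiv psi y * chi y + psi y * gderiv chi y) x.
  by move=> Ax; apply: ganD; apply: gM.
have l3 : bounded_level A (fun y => gderiv psi y * chi y + psi y * gderiv chi y).
  by apply: (bounded_level2 (@glevD C)); exact: lM.
have [s3 a3 e3] := comb_exists g3 l3.
have [p0 b0 d0] := comb_exists gpsi lpsi.
have [p1 b1 d1] := comb_exists gg lg.
have [p3 b3 d3] := comb_exists gpsi' lpsi'.
have [m0 c0 k0] := comb_exists gchi lchi.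
have [m2 c2 k2] := comb_exists gh lh.
have gnx x : A x -> gan (fun y => - gderiv chi y) x by move=> Ax; apply: ganN; exact: gchi'.
have [m3 c3 k3] := comb_exists gnx (bounded_level1 (@glevN C) lchi').
pose Z := SuperFun s0 s1 s2 s3; pose P := SuperFun p0 p1 [::] p3; pose M := SuperFun m0 [::] m2 m3.
have aZ : superfun_analytic A Z by split.
have aP : superfun_analytic A P by split.
have aM : superfun_analytic A M by split.
have cg (s : combination C) : comb_analytic A s -> forall x, A x -> gan (comb_fun s) x.
  by move=> as_ x Ax; apply: comb_gan; exact: comb_analytic_holo Ax.
have hE z phi (s : combination C) : comb_analytic A s -> (forall x, A x -> comb_fun s x = phi x) ->
    A (body z) -> hat (comb_fun s) z = hat phi z.
  by move=> as_ se Az; apply: (hat_eqA oA Az) => //; exact: cg.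
have hE' z phi (s : combination C) : comb_analytic A s -> (forall x, A x -> comb_fun s x = phi x) ->
    A (body z) -> hat (gderiv (comb_fun s)) z = hat (gderiv phi) z.
  by move=> as_ se Az; apply: (hat_gderiv_eqA oA Az) => //; exact: cg.
have nil0 z : hat (comb_fun [::]) z = 0 :> Lambda by rewrite comb_fun_nil hat_const.
have nil1 z : A (body z) -> hat (gderiv (comb_fun [::])) z = 0 :> Lambda.
  move=> Az; rewrite comb_fun_nil -[RHS](hat_const 0 z); apply: (hat_eqA oA Az).
    by move=> x _; apply: gan_deriv => //; exact: gan_const.
  by move=> x _; rewrite gderiv_const.
have Deq z : gpar false z -> A (body z) ->
  [/\ hat (fun y => g y * chi y) z = hat g z * hat chi z,
     hat (fun y => h y * psi y) z = hat h z * hat psi z,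
     hat (fun y => gderiv psi y * chi y + psi y * gderiv chi y) z =
       hat (gderiv psi) z * hat chi z + hat psi z * hat (gderiv chi) z &
     hat (fun y => - gderiv chi y) z = - hat (gderiv chi) z].
  move=> ez Az; split.
  - by apply: hatM => //; [exact: gg|exact: gchi].
  - by apply: hatM => //; [exact: gh|exact: gpsi].
  - rewrite hatD; [|by apply: gM|by apply: gM].
    by rewrite !hatM //; [exact: gpsi|exact: gchi'|exact: gpsi'|exact: gchi].
  - by rewrite hatN //; exact: gchi'.
have par z : gpar false z -> A (body z) ->
  [/\ gpar true (hat psi z), gpar true (hat (gderiv psi) z), gpar true (hat chi z) &
      gpar true (hat (gderiv chi) z)] /\
  [/\ gpar false (hat g z), gpar false (hat (gderiv g) z), gpar false (hat h z) &
      gpar false (hat (gderiv h) z)].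
  move=> ez Az.
  have [ o1 o1'] := hat_parA oA Az ez gpsi (fun x Ax => let: And5 _ q _ _ _ := pa x Ax in q).
  have [ o2 o2'] := hat_parA oA Az ez gchi (fun x Ax => let: And5 _ _ q _ _ := pa x Ax in q).
  have [ o3 o3'] := hat_parA oA Az ez gg (fun x Ax => let: And5 _ _ _ q _ := pa x Ax in q).
  by have [ o4 o4'] := hat_parA oA Az ez gh (fun x Ax => let: And5 _ _ _ _ q := pa x Ax in q).
have DP p : A (body_coord p) -> let z := even_coord p in Dplus P p = hat g z
   + odd_coordm p * hat (gderiv psi) z + odd_coordm p * hat (gderiv psi) z
   + odd_coordm p * odd_coordp p * hat (gderiv g) z.
  move=> Ap z; rewrite (DplusE oA aP Ap) /cfun1 /cfun3 /cfun0 /=.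
  by rewrite (hE _ _ _ b1 d1) // (hE _ _ _ b3 d3) // (hE' _ _ _ b0 d0) // (hE' _ _ _ b1 d1).
have DM p : A (body_coord p) -> let z := even_coord p in Dminus M p = hat h z
   + odd_coordp p * hat (gderiv chi) z + odd_coordp p * hat (gderiv chi) z
   + odd_coordp p * odd_coordm p * hat (gderiv h) z.
  move=> Ap z; have [_ _ _ N] := Deq z (even_coordP p) Ap.
  rewrite (DminusE oA aM Ap) /cfun2 /cfun3 /cfun0 /=.
  by rewrite (hE _ _ _ c2 k2) // (hE _ _ _ c3 k3) // (hE' _ _ _ c0 k0) // (hE' _ _ _ c2 k2) // N mulrN opprK.
split; first exact: dewitt_open_preimage.
exists Z, P, M; rewrite /expands body_image; split; first split.
- split=> // p Ap; have [E1 E2 E3 _] := Deq _ (even_coordP p) Ap.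
  rewrite /comp (ne p Ap) (superfun_evalE oA aZ Ap) /cfun0 /cfun1 /cfun2 /cfun3 /=.
  by rewrite (hE _ _ _ a0 e0) // (hE _ _ _ a1 e1) // (hE _ _ _ a2 e2) // (hE _ _ _ a3 e3) // E1 E2 E3.
- split=> // p Ap; rewrite /comp (np p Ap) (superfun_evalE oA aP Ap) /cfun0 /cfun1 /cfun2 /cfun3 /=.
  by rewrite (hE _ _ _ b0 d0) // (hE _ _ _ b1 d1) // (hE _ _ _ b3 d3) // nil0 mulr0 addr0.
- split=> // p Ap; have [_ _ _ N] := Deq _ (even_coordP p) Ap.
  rewrite /comp (nm p Ap) (superfun_evalE oA aM Ap) /cfun0 /cfun1 /cfun2 /cfun3 /=.
  by rewrite (hE _ _ _ c0 k0) // (hE _ _ _ c2 k2) // (hE _ _ _ c3 k3) // nil0 mulr0 addr0 N mulrN.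
split.
- move=> p Ap; split.
    have [_ _ _ N] := Deq _ (even_coordP p) Ap.
    rewrite (DplusE oA aM Ap) /cfun1 /cfun3 /cfun0 /= nil0 nil1 // (hE _ _ _ c3 k3) //.
    by rewrite (hE' _ _ _ c0 k0) // N mulr0 mulrN add0r addNr add0r.
  rewrite (DminusE oA aP Ap) /cfun2 /cfun3 /cfun0 /= nil0 nil1 // (hE _ _ _ b3 d3) //.
  by rewrite (hE' _ _ _ b0 d0) // mulr0 sub0r addNr add0r.
- move=> p Ap; have ez := even_coordP p; have [E1 E2 E3 _] := Deq _ ez Ap.
  rewrite (DP p Ap) (nm p Ap) (DplusE oA aZ Ap) /cfun0 /cfun1 /cfun3 /=.
  rewrite (hE _ _ _ a1 e1) // (hE _ _ _ a3 e3) // (hE' _ _ _ a0 e0) // (hE' _ _ _ a1 e1) // E1 E3.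
  rewrite (hat_gderivM oA Ap ez) // rel //.
  have [[ o1 o2 o3 o4] [q1 q2 q3 q4]] := par _ ez Ap.
  have op := odd_coordpP p; have om := odd_coordmP p; rewrite /oddprod; move: (even_coord p) o1 o2 o3 o4 q1 q2 q3 q4 => z o1 o2 o3 o4 q1 q2 q3 q4.
  by sring [:: hat g z; hat (gderiv g) z; hat h z; hat (gderiv h) z] [:: odd_coordp p;
    odd_coordm p; hat psi z; hat (gderiv psi) z; hat chi z; hat (gderiv chi) z].
- move=> p Ap; have ez := even_coordP p; have [E1 E2 E3 _] := Deq _ ez Ap.
  rewrite (DM p Ap) (np p Ap) (DminusE oA aZ Ap) /cfun0 /cfun2 /cfun3 /=.
  rewrite (hE _ _ _ a2 e2) // (hE _ _ _ a3 e3) // (hE' _ _ _ a0 e0) // (hE' _ _ _ a2 e2) // E2 E3.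
  rewrite (hat_gderivM oA Ap ez) // rel //.
  have [[ o1 o2 o3 o4] [q1 q2 q3 q4]] := par _ ez Ap.
  have op := odd_coordpP p; have om := odd_coordmP p; rewrite /oddprod; move: (even_coord p) o1 o2 o3 o4 q1 q2 q3 q4 => z o1 o2 o3 o4 q1 q2 q3 q4.
  by sring [:: hat g z; hat (gderiv g) z; hat h z; hat (gderiv h) z] [:: odd_coordp p;
    odd_coordm p; hat psi z; hat (gderiv psi) z; hat chi z; hat (gderiv chi) z].
- have [p [pz pt ps pb]] := exists_pt_body (gpar_scal xg) (gpar0 (C := C) true) (gpar0 true).
  have Ap : A (body_coord p) by rewrite pb body_scal.
  exists p => //; rewrite (DP p Ap) pz ps !mul0r !addr0 hat_value; last exact: gg.
  by apply: contraNneq gxg => ->; rewrite body0.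
- have [p [pz pt ps pb]] := exists_pt_body (gpar_scal xh) (gpar0 (C := C) true) (gpar0 true).
  have Ap : A (body_coord p) by rewrite pb body_scal.
  exists p => //; rewrite (DM p Ap) pz pt !mul0r !addr0 hat_value; last exact: gh.
  by apply: contraNneq hxh => ->; rewrite body0.
Qed.

(** The relation [nf_rel] is what turns the theta+ theta- component of the image coordinate into the
    derivative that [hat_shift] predicts at z + theta+ theta-. *)
Lemma normal_form_chiral A H f psi chi g h : open A -> normal_form A H f psi chi g h ->
  chiral A (fun p => even_coord (H p) + oddprod (H p)) (fun x => f x + psi x * chi x)
    (fun x => g x * chi x + g x * chi x) /\
  chiral A (fun p => odd_coordp (H p)) psi g.
Proof.
move=> oA [ga pa ne np nm rel [lf lpsi lchi lg _]].
have gf x (Ax : A x) : gan f x by case: (ga x Ax).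
have gpsi x (Ax : A x) : gan psi x by case: (ga x Ax).
have gchi x (Ax : A x) : gan chi x by case: (ga x Ax).
have gg x (Ax : A x) : gan g x by case: (ga x Ax).
have gpc x : A x -> gan (fun y => psi y * chi y) x by move=> Ax; apply: ganM; [exact: gpsi|exact: gchi].
have ggc x : A x -> gan (fun y => g y * chi y) x by move=> Ax; apply: ganM; [exact: gg|exact: gchi].
have gfp x : A x -> gan (fun y => f y + psi y * chi y) x.
  by move=> Ax; apply: ganD; [exact: gf|exact: gpc].
have expand p phi eta : (forall x, A x -> gan phi x) -> (forall x, A x -> gan eta x) ->
    A (body_coord p) ->
    hat phi (chiral_coord p) + odd_coordp p * hat eta (chiral_coord p) =
    hat phi (even_coord p) + oddprod p * hat (gderiv phi) (even_coord p)
        + odd_coordp p * hat eta (even_coord p).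
  move=> gp ge Ap.
  have HS u : gan u (body_coord p) -> hat u (chiral_coord p) =
    hat u (even_coord p) + oddprod p * hat (gderiv u) (even_coord p).
    move=> gu; apply: hat_shift => //; first exact: even_coordP.
    - exact: oddprod_even. - exact: oddprod_body. - exact: oddprod_sqr.
  rewrite !HS; [|exact: ge|exact: gp].
  by rewrite mulrDr [odd_coordp p * (_ * _)]mulrA coordp_oddprod mul0r addr0.
have lpc := bounded_level2 (@glevM C) lpsi lchi.
have lgc := bounded_level2 (@glevM C) lg lchi.
split; split=> //.
- by move=> x Ax; apply: ganD; exact: ggc.
- exact: bounded_level2 (@glevD C) lf lpc.
- by apply: (bounded_level2 (@glevD C)).
- move=> p Ap; have ez := even_coordP p.
  rewrite (expand p) //; last by move=> x Ax; apply: ganD; exact: ggc.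
  rewrite (hat_gderivD oA Ap) // (hat_gderivM oA Ap ez) // rel //.
  rewrite !hatD ?hatM //; try (by [exact: gf|exact: gpc|exact: ggc|exact: gpsi|exact: gchi|exact: gg]).
  rewrite /oddprod (ne p Ap) (np p Ap) (nm p Ap) /oddprod.
  have [ o1 o2] := hat_parA oA Ap ez gpsi (fun x Ax => let: And5 _ q _ _ _ := pa x Ax in q).
  have [ o3 o4] := hat_parA oA Ap ez gchi (fun x Ax => let: And5 _ _ q _ _ := pa x Ax in q).
  have [q1 _] := hat_parA oA Ap ez gg (fun x Ax => let: And5 _ _ _ q _ := pa x Ax in q).
  have gh x (Ax : A x) : gan h x by case: (ga x Ax).
  have [q2 _] := hat_parA oA Ap ez gh (fun x Ax => let: And5 _ _ _ _ q := pa x Ax in q).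
  have [q3 _] := hat_parA oA Ap ez gf (fun x Ax => let: And5 q _ _ _ _ := pa x Ax in q).
  have op := odd_coordpP p; have om := odd_coordmP p; move: (even_coord p) o1 o2 o3 o4 q1 q2 q3 {ez} => z o1 o2 o3 o4 q1 q2 q3.
  by sring [:: hat f z; hat g z; hat h z] [:: odd_coordp p;
    odd_coordm p; hat psi z; hat (gderiv psi) z; hat chi z; hat (gderiv chi) z].
- by move=> p Ap; rewrite (expand p) // (np p Ap) /= addrAC.
Qed.

(* A superconformal map is determined by its chiral half, the coefficient [g]
   of the odd chiral coordinate being invertible. *)
Lemma normal_form_determined A H H' f psi chi g h f' psi' chi' g' h' : open A ->
  normal_form A H f psi chi g h -> normal_form A H' f' psi' chi' g' h' ->
  (forall x, A x -> body (g x) != 0) ->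
  (forall x, A x -> [/\ f x + psi x * chi x = f' x + psi' x * chi' x,
     g x * chi x + g x * chi x = g' x * chi' x + g' x * chi' x, psi x = psi' x & g x = g' x]) ->
  forall p, A (body_coord p) -> H p = H' p.
Proof.
move=> oA N N' g0 E.
have Echi x : A x -> chi x = chi' x.
  move=> Ax; have [_ /double_inj E2 _ E4] := E x Ax.
  by move: E2; rewrite -E4; apply: mulrI; rewrite gunitE g0.
have Epsi x : A x -> psi x = psi' x by move=> /E[].
have Eg x : A x -> g x = g' x by move=> /E[].
have Ef x : A x -> f x = f' x.
  move=> Ax; have [E1 _ E3 _] := E x Ax; move: E1; rewrite -E3 -(Echi x Ax).
  exact: addIr.
have [ga pa ne np nm rel _] := N; have [ga' pa' ne' np' nm' rel' _] := N'.
have gf x (Ax : A x) : gan f x by case: (ga x Ax).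
have gpsi x (Ax : A x) : gan psi x by case: (ga x Ax).
have gchi x (Ax : A x) : gan chi x by case: (ga x Ax).
have gg x (Ax : A x) : gan g x by case: (ga x Ax).
have gh x (Ax : A x) : gan h x by case: (ga x Ax).
have gh' x (Ax : A x) : gan h' x by case: (ga' x Ax).
have Eh x : A x -> h x = h' x.
  move=> Ax; have Az : A (body (x%:A : Lambda)) by rewrite body_scal.
  have := rel _ (gpar_scal x) Az; have := rel' _ (gpar_scal x) Az.
  rewrite -(hat_gderiv_eqA oA Az gf Ef) -(hat_gderiv_eqA oA Az gpsi Epsi).
  rewrite -(hat_gderiv_eqA oA Az gchi Echi) -(hat_eqA oA Az gpsi Epsi).
  rewrite -(hat_eqA oA Az gchi Echi) -(hat_eqA oA Az gg Eg) => -> /addIr/addIr.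
  rewrite !hat_value; try (by [exact: gh|exact: gg|exact: gh']).
  by move=> /esym; apply: mulrI; rewrite gunitE g0.
move=> p Ap; apply: superspace_eq.
- rewrite ne // ne' // -(hat_gderiv_eqA oA Ap gpsi Epsi) -(hat_gderiv_eqA oA Ap gchi Echi).
  rewrite -(hat_eqA oA Ap gpsi Epsi) -(hat_eqA oA Ap gchi Echi) -(hat_eqA oA Ap gg Eg).
  by rewrite -(hat_eqA oA Ap gf Ef) -(hat_eqA oA Ap gh Eh).
- rewrite np // np' // -(hat_gderiv_eqA oA Ap gpsi Epsi).
  by rewrite -(hat_eqA oA Ap gpsi Epsi) -(hat_eqA oA Ap gg Eg).
- rewrite nm // nm' // -(hat_gderiv_eqA oA Ap gchi Echi).
  by rewrite -(hat_eqA oA Ap gchi Echi) -(hat_eqA oA Ap gh Eh).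
Qed.

End Superconformal.

(** * The action of supermatrices on the sphere *)

Definition i0 : 'I_3 := @Ordinal 3 0 isT.
Definition i1 : 'I_3 := @Ordinal 3 1 isT.
Definition i2 : 'I_3 := @Ordinal 3 2 isT.

Lemma forall_ord3 (P : 'I_3 -> Prop) : P i0 -> P i1 -> P i2 -> forall i, P i.
Proof.
move=> p0 p1 p2 [[|[|[|//]]] h].
- by rewrite (_ : Ordinal h = i0) //; apply: val_inj.
- by rewrite (_ : Ordinal h = i1) //; apply: val_inj.
- by rewrite (_ : Ordinal h = i2) //; apply: val_inj.
Qed.

Lemma sum_ord3 (V : nmodType) (F : 'I_3 -> V) : \sum_i F i = F i0 + F i1 + F i2.
Proof.
rewrite !big_ord_recl big_ord0 addr0 addrA; congr (F _ + F _ + F _); exact: val_inj.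
Qed.

Section Supermatrix.
Variable C : numClosedFieldType.
Local Notation Lambda := (grassmann C).
Local Notation sp := (superspace C).
Implicit Types (X Y : 'M[Lambda]_3) (v : 'cV[Lambda]_3) (w : 'rV[Lambda]_3) (p : sp) (a b : Lambda).

Lemma mulmx3E m n (M : 'M[Lambda]_(m, 3)) (N : 'M[Lambda]_(3, n)) i j :
  (M *m N) i j = M i i0 * N i0 j + M i i1 * N i1 j + M i i2 * N i2 j.
Proof. by rewrite mxE sum_ord3. Qed.

Definition oddi (i : 'I_3) : bool := i == i2.

(* The indices 0 and 1 are even, the index 2 is odd. *)
Definition supermx X := forall i j, gpar (oddi i (+) oddi j) (X i j).
Definition supercol v := forall i, gpar (oddi i) (v i 0).
Definition superrow w := forall j, gpar (oddi j) (w 0 j).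

Lemma supermxM X Y : supermx X -> supermx Y -> supermx (X *m Y).
Proof.
move=> eX eY i j; rewrite mulmx3E.
have H k : gpar (oddi i (+) oddi j) (X i k * Y k j).
  by have := gparM (eX i k) (eY k j); rewrite addbA addbK.
by apply: gparD => //; exact: gparD.
Qed.

Lemma supercolM X v : supermx X -> supercol v -> supercol (X *m v).
Proof.
move=> eX ev i; rewrite mulmx3E.
have H k : gpar (oddi i) (X i k * v k 0) by have := gparM (eX i k) (ev k); rewrite addbK.
by apply: gparD => //; exact: gparD.
Qed.

Lemma superrowM w X : superrow w -> supermx X -> superrow (w *m X).
Proof.
move=> ew eX i; rewrite mulmx3E.
have H k : gpar (oddi i) (w 0 k * X k i) by have := gparM (ew k) (eX k i); rewrite addKb.
by apply: gparD => //; exact: gparD.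
Qed.

Lemma supermx1 : supermx 1%:M.
Proof.
move=> i j; rewrite mxE; case: eqP => [->|_]; first by rewrite addbb; exact: gpar1.
exact: gpar0.
Qed.

(* A homogeneous vector [v] and covector [w] annihilating it: they represent the
   chiral and the antichiral coordinates of a point. *)
Record homog v w : Prop := Homog {
  homog_col : supercol v ;
  homog_row : superrow w ;
  homog_ann : w *m v = 0 ;
  homog_unimod_col : exists r : 'rV[Lambda]_3, r *m v = 1%:M ;
  homog_unimod_row : exists c : 'cV[Lambda]_3, w *m c = 1%:M }.

Record supergl X Y : Prop := Supergl {
  supergl_l : supermx X ;
  supergl_r : supermx Y ;
  superglK : X *m Y = 1%:M ;
  superglV : Y *m X = 1%:M }.

Lemma supergl_sym X Y : supergl X Y -> supergl Y X.
Proof. by case. Qed.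

Lemma supergl1 : supergl 1%:M 1%:M.
Proof. by split; rewrite ?mulmx1 //; exact: supermx1. Qed.

Lemma superglM X Y X' Y' : supergl X Y -> supergl X' Y' -> supergl (X *m X') (Y' *m Y).
Proof.
move=> [eX eY XY YX] [eX' eY' XY' YX']; split; try exact: supermxM.
- by rewrite mulmxA -(mulmxA X) XY' mulmx1.
- by rewrite mulmxA -(mulmxA Y') YX mulmx1.
Qed.

Lemma homog_act X Y v w : supergl X Y -> homog v w -> homog (X *m v) (w *m Y).
Proof.
move=> [eX eY XY YX] [cv rw wv [r rv] [c wc]]; split.
- exact: supercolM.
- exact: superrowM.
- by rewrite mulmxA -(mulmxA w) YX mulmx1.
- by exists (r *m Y); rewrite mulmxA -(mulmxA r) YX mulmx1.
- by exists (X *m c); rewrite mulmxA -(mulmxA w) YX mulmx1.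
Qed.

Definition colscale v a : 'cV[Lambda]_3 := \col_i (v i 0 * a).
Definition rowscale b w : 'rV[Lambda]_3 := \row_i (b * w 0 i).

Lemma colscaleE v a i : colscale v a i 0 = v i 0 * a. Proof. by rewrite mxE. Qed.
Lemma rowscaleE b w i : rowscale b w 0 i = b * w 0 i. Proof. by rewrite mxE. Qed.

Lemma colscaleM X v a : X *m colscale v a = colscale (X *m v) a.
Proof.
apply/matrixP => i j; rewrite !mxE mulr_suml; apply: eq_bigr => k _.
by rewrite (ord1 j) colscaleE mulrA.
Qed.

Lemma rowscaleM b w X : rowscale b w *m X = rowscale b (w *m X).
Proof.
apply/matrixP => i j; rewrite !mxE mulr_sumr; apply: eq_bigr => k _.
by rewrite (ord1 i) rowscaleE mulrA.
Qed.

Lemma homog_scale v w a b : homog v w -> gpar false a -> gpar false b -> body a != 0 -> body b != 0 ->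
  homog (colscale v a) (rowscale b w).
Proof.
move=> [cv rw wv [r rv] [c wc]] ea eb a0 b0; split.
- by move=> i; rewrite colscaleE -[oddi i]addbF; exact: gparM.
- by move=> i; rewrite rowscaleE; exact: (gparM eb (rw i)).
- apply/matrixP => i j; have := congr1 (fun M : 'M[Lambda]_1 => b * M 0 0 * a) wv.
  rewrite (ord1 i) (ord1 j) !mulmx3E !colscaleE !rowscaleE mxE mulr0 mul0r => <-.
  by rewrite !mulrDr !mulrDl !mulrA.
- exists (rowscale a^-1 r); apply/matrixP => i j; rewrite (ord1 i) (ord1 j).
  have := congr1 (fun M : 'M[Lambda]_1 => a^-1 * M 0 0 * a) rv.
  rewrite !mulmx3E !colscaleE !rowscaleE !mxE eqxx mulr1 mulVr ?gunitE // => <-.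
  by rewrite !mulrDr !mulrDl !mulrA.
- exists (colscale c b^-1); apply/matrixP => i j; rewrite (ord1 i) (ord1 j).
  have := congr1 (fun M : 'M[Lambda]_1 => b * M 0 0 * b^-1) wc.
  rewrite !mulmx3E !colscaleE !rowscaleE !mxE eqxx mulr1 mulrV ?gunitE // => <-.
  by rewrite !mulrDr !mulrDl !mulrA.
Qed.

(** Odd entries have no body, so [w *m v = 0] becomes [w0 v0 + w1 v1 = 0] on bodies, and
    unimodularity prevents both even entries of [v], or of [w], from having zero body. Hence row and
    column lie in the same charts. *)
Lemma homog_body v w : homog v w ->
  [/\ (body (v i1 0) != 0) = (body (w 0 i0) != 0), (body (v i0 0) != 0) = (body (w 0 i1) != 0) &
      body (v i1 0) = 0 -> body (v i0 0) != 0].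
Proof.
move=> [cv rw wv [r rv] [c wc]].
have v2 : body (v i2 0) = 0 by apply: body_odd; exact: cv.
have w2 : body (w 0 i2) = 0 by apply: body_odd; exact: rw.
have := congr1 (fun M : 'M[Lambda]_1 => body (M 0 0)) wv.
have := congr1 (fun M : 'M[Lambda]_1 => body (M 0 0)) rv.
have := congr1 (fun M : 'M[Lambda]_1 => body (M 0 0)) wc.
rewrite !mulmx3E !mxE eqxx !bodyD !bodyM v2 w2 body1 body0 !(mulr0, mul0r, addr0).
move: (body (v i0 0)) (body (v i1 0)) (body (w 0 i0)) (body (w 0 i1)) => x0 x1 y0 y1 {v2 w2} Ew Er E.
have n1 : x1 = 0 -> x0 != 0.
  move=> x10; apply/eqP => x00; move: Er; rewrite x10 x00 !mulr0 addr0 => /esym/eqP.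
  by rewrite oner_eq0.
have n2 : y1 = 0 -> y0 != 0.
  move=> x10; apply/eqP => x00; move: Ew; rewrite x10 x00 !mul0r addr0 => /esym/eqP.
  by rewrite oner_eq0.
split=> //.
- case: (eqVneq x1 0) => [e|ne].
    by move: E; rewrite e mulr0 addr0 => /eqP; rewrite mulf_eq0 (negPf (n1 e)) orbF => ->.
  apply/esym; apply/negP => /eqP e; move: E; rewrite e mul0r add0r => /eqP.
  rewrite mulf_eq0 (negPf ne) orbF => /eqP f; by have := n2 f; rewrite e eqxx.
- case: (eqVneq x0 0) => [e|ne].
    move: E; rewrite e mulr0 add0r => /eqP; rewrite mulf_eq0 => /orP[->//|/eqP f].
    by have := n1 f; rewrite e eqxx.
  apply/esym; apply/negP => /eqP e; move: E; rewrite e mul0r addr0 => /eqP.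
  by rewrite mulf_eq0 (negPf ne) orbF (negPf (n2 e)).
Qed.

Definition colpt p : 'cV[Lambda]_3 := \col_i nth 0 [:: chiral_coord p; 1; odd_coordp p] i.
(** The doubled odd entry makes the row annihilate [colpt p]: the even entries contribute
    [2 theta+ theta-], which [2 theta- theta+] cancels. *)
Definition rowpt p : 'rV[Lambda]_3 := \row_i nth 0 [:: 1; - antichiral_coord p; odd_coordm p + odd_coordm p] i.

Lemma antichiral_even p : gpar false (antichiral_coord p).
Proof. by apply: gparB; [exact: even_coordP|exact: oddprod_even]. Qed.
Arguments antichiral_even : clear implicits.

Lemma homogpt p : homog (colpt p) (rowpt p).
Proof.
have ep := chiral_even p; have ap := antichiral_even p.
split.
- by apply: forall_ord3; rewrite mxE /=; [exact: chiral_even|exact: gpar1|exact: odd_coordpP].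
- apply: forall_ord3; rewrite mxE /=; [exact: gpar1|exact: gparN|].
  by apply: gparD; exact: odd_coordmP.
- apply/matrixP => i j; rewrite (ord1 i) (ord1 j) mulmx3E !mxE /= mul1r mulr1.
  rewrite /chiral_coord /antichiral_coord mulrDl (godd_anticomm (odd_coordmP p) (odd_coordpP p)).
  rewrite -/(oddprod p) -opprD opprB (addrC (_ + _) (_ - _)) addrA subrK subrr.
  by [].
- exists (\row_i (i == i1)%:R); apply/matrixP => i j; rewrite (ord1 i) (ord1 j) mulmx3E !mxE /=.
  by rewrite !mul0r mul1r add0r addr0.
- exists (\col_i (i == i0)%:R); apply/matrixP => i j; rewrite (ord1 i) (ord1 j) mulmx3E !mxE /=.
  by rewrite !mulr0 mul1r !addr0.
Qed.

Definition ptp v : Lambda := v i2 0 / v i1 0.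
Definition ptm w : Lambda := 2^-1 *: ((w 0 i0)^-1 * w 0 i2).
Definition ptz v w : Lambda := v i0 0 / v i1 0 - ptp v * ptm w.

Lemma pt_in v w : homog v w -> in_superspace (ptz v w, ptp v, ptm w).
Proof.
move=> [cv rw _ _ _]; have op : gpar true (ptp v) by exact: (gparM (cv i2) (gparV (cv i1))).
have om : gpar true (ptm w) by apply: gparZ; exact: (gparM (gparV (rw i0)) (rw i2)).
apply: in_superspaceP => //; apply: gparB; last exact: (gparM op om).
exact: (gparM (cv i0) (gparV (cv i1))).
Qed.

Lemma origin_in : in_superspace (0 : Lambda, 0 : Lambda, 0 : Lambda).
Proof. by apply: in_superspaceP; exact: gpar0. Qed.

(* By [pt_in], the default value is only taken off the homogeneous pairs. *)
Definition homog_pt v w : sp := insubd (mkpt origin_in) (ptz v w, ptp v, ptm w).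

Lemma homog_ptE v w : homog v w -> [/\ even_coord (homog_pt v w) = ptz v w,
  odd_coordp (homog_pt v w) = ptp v & odd_coordm (homog_pt v w) = ptm w].
Proof.
by move=> /pt_in h; rewrite /even_coord /odd_coordp /odd_coordm /homog_pt insubdK.
Qed.

Lemma chiral_homog_pt v w : homog v w -> chiral_coord (homog_pt v w) = v i0 0 / v i1 0.
Proof.
by move=> /homog_ptE[pz pp pm]; rewrite /chiral_coord /oddprod pz pp pm /ptz subrK.
Qed.

Lemma halfD (a : Lambda) : 2^-1 *: a + 2^-1 *: a = a.
Proof. by rewrite -scalerDl half_half scale1r. Qed.

(** [ptz] is built from the chiral quotient of the column; [w *m v = 0] converts it into a quotient
    of row entries. *)
Lemma antichiral_homog_pt v w : homog v w -> body (v i1 0) != 0 ->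
  antichiral_coord (homog_pt v w) = - ((w 0 i0)^-1 * w 0 i1).
Proof.
move=> h v1; have [pz pp pm] := homog_ptE h; rewrite /antichiral_coord /oddprod pz pp pm /ptz.
have [B _ _] := homog_body h; have w0 : body (w 0 i0) != 0 by rewrite -B.
have [cv rw wv _ _] := h; have uv : v i1 0 \is a GRing.unit by rewrite gunitE.
have uw : w 0 i0 \is a GRing.unit by rewrite gunitE.
have op : gpar true (ptp v) by exact: (gparM (cv i2) (gparV (cv i1))).
have om : gpar true ((w 0 i0)^-1 * w 0 i2) by exact: (gparM (gparV (rw i0)) (rw i2)).
have -> : v i0 0 / v i1 0 - ptp v * ptm w - ptp v * ptm w =
    v i0 0 / v i1 0 - ptp v * ((w 0 i0)^-1 * w 0 i2).
  by rewrite -addrA -opprD -mulrDr /ptm halfD.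
rewrite (godd_anticomm op om) opprK.
have := congr1 (fun M : 'M[Lambda]_1 => (w 0 i0)^-1 * M 0 0 / v i1 0) wv.
rewrite mulmx3E mxE mulr0 mul0r !mulrDr !mulrDl !mulrA mulVr // mul1r (mulrK uv) /ptp ?mulrA.
by move=> E; apply/eqP; rewrite -addr_eq0 addrAC E.
Qed.

Lemma homog_ptK p : homog_pt (colpt p) (rowpt p) = p.
Proof.
have h := homogpt p; have [pz pp pm] := homog_ptE h.
have pp' : odd_coordp (homog_pt (colpt p) (rowpt p)) = odd_coordp p.
  by rewrite pp /ptp !mxE /= divr1.
have pm' : odd_coordm (homog_pt (colpt p) (rowpt p)) = odd_coordm p.
  by rewrite pm /ptm !mxE /= invr1 mul1r scalerDr halfD.
apply: superspace_eq => //; move: (chiral_homog_pt h).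
by rewrite /chiral_coord /oddprod pp' pm' !mxE /= divr1 => /addIr.
Qed.

Lemma colpt_homog_pt v w : homog v w -> body (v i1 0) != 0 ->
  colpt (homog_pt v w) = colscale v (v i1 0)^-1 /\
  rowpt (homog_pt v w) = rowscale (w 0 i0)^-1 w.
Proof.
move=> h v1; have [B _ _] := homog_body h; have w0 : body (w 0 i0) != 0 by rewrite -B.
have [_ pp pm] := homog_ptE h.
split; apply/matrixP => i j; rewrite ?(ord1 i) ?(ord1 j) ?colscaleE ?rowscaleE.
  move: i; apply: forall_ord3; rewrite mxE /=; first exact: chiral_homog_pt.
    by rewrite mulrV ?gunitE.
  by rewrite pp.
move: j; apply: forall_ord3; rewrite mxE /=; first by rewrite mulVr ?gunitE.
  by rewrite (antichiral_homog_pt h v1) opprK.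
by rewrite pm halfD.
Qed.

Lemma homog_pt_scale v w a b : homog v w -> gpar false a -> gpar false b -> body a != 0 ->
  body b != 0 -> body (v i1 0) != 0 -> homog_pt (colscale v a) (rowscale b w) = homog_pt v w.
Proof.
move=> h ea eb a0 b0 v1; have h' := homog_scale h ea eb a0 b0.
have [pz pp pm] := homog_ptE h; have [pz' pp' pm'] := homog_ptE h'.
have [B _ _] := homog_body h; have w0 : body (w 0 i0) != 0 by rewrite -B.
have ua : a \is a GRing.unit by rewrite gunitE.
have ub : b \is a GRing.unit by rewrite gunitE.
have uv : v i1 0 \is a GRing.unit by rewrite gunitE.
have uw : w 0 i0 \is a GRing.unit by rewrite gunitE.
have E x : x * a / (v i1 0 * a) = x / v i1 0 by rewrite invrM // !mulrA mulrK.
have Ep : ptp (colscale v a) = ptp v by rewrite /ptp !colscaleE E.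
have Em : ptm (rowscale b w) = ptm w.
  by rewrite /ptm !rowscaleE invrM // mulrA -(mulrA _ b^-1) mulVr // mulr1.
apply: superspace_eq; rewrite ?pp ?pp' ?pm ?pm' // pz pz' /ptz Ep Em.
by rewrite !colscaleE E.
Qed.

End Supermatrix.
Arguments antichiral_even {C} p.

(** * Fractional linear maps in one chart *)

Section Fractional.
Variable C : numClosedFieldType.
Local Notation Lambda := (grassmann C).
Local Notation sp := (superspace C).
Hypothesis archC : small_powers C.
Implicit Types (M N : 'M[Lambda]_3) (v : 'cV[Lambda]_3) (w : 'rV[Lambda]_3) (p : sp) (a b c : Lambda).

Lemma body_star a : body (gstar a) = body a.
Proof. by rewrite /body gcoef_star cardfs0 expr0 mul1r. Qed.

Definition affine a b (x : C) : Lambda := a * x%:A + b.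

Lemma gan_affine a b x : gan (affine a b) x.
Proof.
apply: ganD; last exact: gan_const.
by apply: ganM; [exact: gan_const|exact/gan_scal/holo_id].
Qed.

Lemma body_affine a b x : body (affine a b x) = body a * x + body b.
Proof. by rewrite bodyD bodyM body_scal. Qed.

Lemma chiral_affine A a b c : chiral A (fun p => a * chiral_coord p + b + odd_coordp p * c)
  (affine a b) (fun=> c).
Proof.
split=> [x _|x _|||p Ap]; try exact: gan_const; try exact: bounded_level_const.
- exact: gan_affine.
- apply: (bounded_level2 (@glevD C)); last exact: bounded_level_const.
  apply: (bounded_level2 (@glevM C)); first exact: bounded_level_const.
  by exists 0%N => x _; exact: glev_scal.
have gi x : gan (fun y : C => y%:A : Lambda) x by exact/gan_scal/holo_id.
rewrite hat_const /affine hatD; [|by apply: ganM => //; exact: gan_const|exact: gan_const].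
by rewrite hatM ?hat_const ?hat_id //; [exact: chiral_even|exact: gan_const].
Qed.

Section Fraction.
Variables (A : set C) (a b c a' b' c' : Lambda).
Hypothesis A0 : forall x, A x -> body (affine a' b' x) != 0.

Lemma chiral_fraction : exists phi eta : C -> Lambda,
  chiral A (fun p => (a * chiral_coord p + b + odd_coordp p * c) /
    (a' * chiral_coord p + b' + odd_coordp p * c')) phi eta /\
  forall x, A x -> body c' = 0 -> body (eta x) = body c / body (affine a' b' x).
Proof.
do 2!eexists; split; first exact: chiralM (chiral_affine A a b c) (chiralV (chiral_affine A a' b' c') A0).
move=> x Ax bc'; rewrite bodyD !bodyM bodyV bodyN !bodyM bc' mulr0 mul0r oppr0 mulr0 addr0.
by [].
Qed.

Lemma chiral_fraction_l : exists phi eta : C -> Lambda,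
  chiral A (fun p => (a' * chiral_coord p + b' + odd_coordp p * c')^-1 *
    (a * chiral_coord p + b + odd_coordp p * c)) phi eta /\
  forall x, A x -> body c' = 0 -> body (eta x) = body c / body (affine a' b' x).
Proof.
do 2!eexists; split; first exact: chiralM (chiralV (chiral_affine A a' b' c') A0) (chiral_affine A a b c).
move=> x Ax bc'; rewrite bodyD !bodyM body_star bodyV bodyN !bodyM bc' mulr0 mul0r oppr0 mul0r add0r.
by rewrite mulrC.
Qed.
End Fraction.

Definition denset M : set C := [set x | body (M i1 i0) * x + body (M i1 i1) != 0].

Lemma denset_open M : open (denset M).
Proof.
rewrite openE => x Ax; have := gan_body (gan_affine (M i1 i0) (M i1 i1) x).
move=> /holo_near_neq0; rewrite body_affine => /(_ Ax).
by apply: filterS => y; rewrite body_affine.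
Qed.
Arguments denset_open : clear implicits.

Definition fracmap M N p : sp := homog_pt (M *m colpt p) (rowpt p *m N).

Lemma mulmx_colpt M p i : (M *m colpt p) i 0 =
  M i i0 * chiral_coord p + M i i1 + odd_coordp p * gstar (M i i2).
Proof. by rewrite mulmx3E !mxE /= mulr1 (gstarP _ (odd_coordpP p)). Qed.

Lemma rowpt_mulmx N p j : (rowpt (swap_pt p) *m N) 0 j =
  - N i1 j * chiral_coord p + N i0 j + odd_coordp p * (N i2 j + N i2 j).
Proof.
rewrite mulmx3E !mxE /= mul1r.
have -> : antichiral_coord (swap_pt p) = chiral_coord p by rewrite -chiral_swap swap_ptK.
rewrite mulNr (geven_comm _ (chiral_even p)) mulNr mulrDl mulrDr; congr (_ + _).
  exact: addrC.
by rewrite mulrDr.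
Qed.

Lemma body_mulmx_colpt M N p : supergl M N ->
  body ((M *m colpt p) i1 0) = body (M i1 i0) * body_coord p + body (M i1 i1).
Proof.
move=> [eM _ _ _]; rewrite mulmx_colpt !bodyD !bodyM body_chiral (body_odd (odd_coordpP p)) mul0r.
by rewrite addr0.
Qed.

Lemma supergl_body M N : supergl M N -> body (M i2 i2) != 0.
Proof.
move=> [eM eN /(congr1 (fun X : 'M[Lambda]_3 => body (X i2 i2))) + _].
rewrite mulmx3E mxE eqxx body1 !bodyD !bodyM.
rewrite (body_odd (eM i2 i0)) (body_odd (eM i2 i1)) !mul0r !add0r => E.
by apply/eqP => E0; move/eqP: E; rewrite E0 mul0r eq_sym oner_eq0.
Qed.

Lemma denset_neq0 M N : supergl M N -> exists x, denset M x.
Proof.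
move=> [eM eN /(congr1 (fun X : 'M[Lambda]_3 => body (X i1 i1))) + _].
rewrite mulmx3E mxE eqxx body1 !bodyD !bodyM (body_odd (eM i1 i2)) mul0r addr0 => E.
case: (eqVneq (body (M i1 i1)) 0) => [e|ne]; last by exists 0; rewrite /denset /= mulr0 add0r.
exists 1; rewrite /denset /= mulr1 e addr0; apply/eqP => e'.
by move/eqP: E; rewrite e e' !mul0r addr0 eq_sym oner_eq0.
Qed.

Lemma fracmap_chiral M N : supergl M N ->
  (exists phi eta, chiral (denset M) (fun p => chiral_coord (fracmap M N p)) phi eta) /\
  (exists phi eta, chiral (denset M) (fun p => odd_coordp (fracmap M N p)) phi eta /\
    forall x, denset M x -> body (eta x) != 0).
Proof.
move=> MN; have [eM eN _ _] := MN.
have A0 x : denset M x -> body (affine (M i1 i0) (M i1 i1) x) != 0 by rewrite body_affine.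
have H p := homog_act MN (homogpt p).
split.
  have [phi [eta [ch _]]] := chiral_fraction (M i0 i0) (M i0 i1) (gstar (M i0 i2)) (gstar (M i1 i2)) A0.
  exists phi, eta; apply: chiral_ext ch _ => p Ap.
  by rewrite /fracmap chiral_homog_pt // !mulmx_colpt.
have [phi [eta [ch be]]] := chiral_fraction (M i2 i0) (M i2 i1) (gstar (M i2 i2)) (gstar (M i1 i2)) A0.
exists phi, eta; split.
  apply: chiral_ext ch _ => p Ap.
  by rewrite /fracmap; have [_ -> _] := homog_ptE (H p); rewrite /ptp !mulmx_colpt.
move=> x Ax; rewrite be // !body_star; last exact: body_odd (eM i1 i2).
by rewrite mulf_neq0 ?invr_eq0 ?A0 // (supergl_body MN).
Qed.

(** Column entries are affine in the chiral coordinates, and row entries at the swapped point are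
    too, so their quotients are chiral and [normal_form_of_chiral] applies. The coefficients [g] and
    [h] have nonzero body because the odd diagonal entries of [M] and [N] do. *)
Lemma superconformal_fracmap M N : supergl M N ->
  superconformal (@body_coord C @^-1` denset M) (fracmap M N).
Proof.
move=> MN; have [eM eN _ _] := MN.
have [[F [k cu]] [psi [g [ct g0]]]] := fracmap_chiral MN.
have H p := homog_act MN (homogpt p).
have B0 x : denset M x -> body (affine (- N i1 i0) (N i0 i0) x) != 0.
  move=> Ax; have [p px] := exists_body x.
  have [E _ _] := homog_body (H (swap_pt p)).
  have : body ((rowpt (swap_pt p) *m N) 0 i0) != 0 by rewrite -E (body_mulmx_colpt _ MN) body_swap px.
  rewrite rowpt_mulmx !bodyD !bodyM body_chiral (body_odd (odd_coordpP p)) mul0r addr0.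
  by rewrite body_scal px.
have [G [l [cv _]]] := chiral_fraction_l (- N i1 i1) (N i0 i1) (N i2 i1 + N i2 i1) (N i2 i0 + N i2 i0) B0.
have [chi [h [cs bh]]] := chiral_fraction_l (- N i1 i2) (N i0 i2) (N i2 i2 + N i2 i2) (N i2 i0 + N i2 i0) B0.
have V1 p : denset M (body_coord p) -> body ((M *m colpt (swap_pt p)) i1 0) != 0.
  by rewrite (body_mulmx_colpt _ MN) body_swap.
have cv' : chiral (denset M) (fun p => antichiral_coord (fracmap M N (swap_pt p)))
    (fun x => - G x) (fun x => - l x).
  apply: chiral_ext (chiralN cv) _ => p Ap.
  by rewrite /fracmap antichiral_homog_pt // ?rowpt_mulmx //; exact: V1.
have cs' : chiral (denset M) (fun p => odd_coordm (fracmap M N (swap_pt p)))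
    (fun x => 2^-1 *: chi x) (fun x => 2^-1 *: h x).
  apply: chiral_ext (chiralZ cs _) _ => p Ap.
  by rewrite /fracmap; have [_ _ ->] := homog_ptE (H (swap_pt p)); rewrite /ptm !rowpt_mulmx.
have nf := normal_form_of_chiral archC (denset_open M) cu ct cv' cs'.
have [x Ax] := denset_neq0 MN.
apply: (superconformal_of_normal_form archC (denset_open M) nf); exists x => //.
  exact: g0.
rewrite bodyZ mulf_neq0 ?invr_eq0 ?pnatr_eq0 //.
rewrite bh //; last by rewrite bodyD (body_odd (eN i2 i0)) addr0.
rewrite mulf_neq0 ?invr_eq0 ?B0 // bodyD -mulr2n mulrn_eq0 /=.
exact: supergl_body (supergl_sym MN).
Qed.

End Fractional.
Arguments denset_open {C} M.

Lemma superconformal_ext (C : numClosedFieldType) U (H H' : superspace C -> superspace C) :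
  (forall p, U p -> H p = H' p) -> superconformal U H -> superconformal U H'.
Proof.
move=> HH [oU [Z [P [M [[[aZ EZ] [aP EP] [aM EM]] [H1 H2 H3 H4 H5]]]]]].
split=> //; exists Z, P, M; split.
  by split; split=> // p Up; rewrite /= -HH //; [exact: EZ|exact: EP|exact: EM].
by split=> // p Up; rewrite -HH //; [exact: H2|exact: H3].
Qed.

(** * The transition function as a supermatrix *)

Section ChartChange.
Variable C : numClosedFieldType.
Local Notation Lambda := (grassmann C).
Local Notation sp := (superspace C).
Implicit Types (X Y : 'M[Lambda]_3) (v : 'cV[Lambda]_3) (w : 'rV[Lambda]_3) (p q : sp) (a b c : Lambda).

(* The homogeneous form of the transition function of the sphere. *)
Definition swapmx (k : C) : 'M[Lambda]_3 :=
  \matrix_(i, j) nth 0 (nth [::] [:: [:: 0; 1; 0]; [:: 1; 0; 0]; [:: 0; 0; k%:A]] i) j.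

Lemma swapmx_col k v : [/\ (swapmx k *m v) i0 0 = v i1 0, (swapmx k *m v) i1 0 = v i0 0 &
  (swapmx k *m v) i2 0 = k *: v i2 0].
Proof.
by rewrite !mulmx3E !mxE /= !mul0r !mul1r !(add0r, addr0) mulr_algl.
Qed.

Lemma swapmx_row k w : [/\ (w *m swapmx k) 0 i0 = w 0 i1, (w *m swapmx k) 0 i1 = w 0 i0 &
  (w *m swapmx k) 0 i2 = k *: w 0 i2].
Proof.
by rewrite !mulmx3E !mxE /= !mulr0 !mulr1 !(add0r, addr0) mulr_algr.
Qed.

Lemma swapmx_super k : supermx (swapmx k).
Proof.
move=> i j; move: i; apply: forall_ord3; move: j; apply: forall_ord3; rewrite mxE /=;
  by [exact: gpar0|exact: gpar1|exact: gpar_scal].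
Qed.

Lemma swapmxM k l : k * l = 1 -> swapmx k *m swapmx l = 1%:M.
Proof.
move=> kl; apply/matrixP => i j; move: i; apply: forall_ord3; move: j; apply: forall_ord3;
  by rewrite mulmx3E !mxE /= ?(mul0r, mulr0, mulr1, add0r, addr0) // mulr_algl scalerA kl scale1r.
Qed.

Definition chartmx (d : bool) := if d then swapmx 'i else 1%:M.
Definition chartmxV (d : bool) := if d then swapmx (- 'i) else 1%:M.

Lemma supergl_chart d : supergl (chartmx d) (chartmxV d).
Proof.
case: d; last exact: supergl1.
have ii : 'i * - 'i = 1 :> C by rewrite mulrN -expr2 sqrCi opprK.
by split; rewrite ?swapmxM //; [exact: swapmx_super|exact: swapmx_super|rewrite mulrC].
Qed.

(** Since [(z + theta+ theta-)^-1 = z^-1 - theta+ theta- z^-2], the product of the new odd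
    coordinates, with its factor ['i ^+ 2 = -1], exactly cancels the nilpotent part and leaves
    [z^-1]. *)
Lemma transition_homog p q : body_coord q != 0 ->
  coords p = ((even_coord q)^-1, 'i *: odd_coordp q / even_coord q, 'i *: odd_coordm q / even_coord q) ->
  p = homog_pt (swapmx 'i *m colpt q) (rowpt q *m swapmx (- 'i)).
Proof.
move=> q0 E; have H := homog_act (supergl_chart true) (homogpt q).
have [hz hp hm] := homog_ptE H; move: hz hp hm.
have [C0 C1 C2] := swapmx_col 'i (colpt q); have [R0 R1 R2] := swapmx_row (- 'i) (rowpt q).
rewrite /= /ptz /ptp /ptm C0 C1 C2 R0 R2 !mxE /= => hz hp hm.
have op := odd_coordpP q; have om := odd_coordmP q; have ez := even_coordP q.
have uz : even_coord q \is a GRing.unit by rewrite gunitE.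
have uc : chiral_coord q \is a GRing.unit by rewrite gunitE body_chiral.
have ua : antichiral_coord q \is a GRing.unit.
  by rewrite gunitE /antichiral_coord bodyB oddprod_body subr0.
have ev : gpar false (even_coord q)^-1 by exact: gparV.
have Vc : (chiral_coord q)^-1 = (even_coord q)^-1 - oddprod q * ((even_coord q)^-1 * (even_coord q)^-1).
  apply: (mulrI uc); rewrite mulrV // /chiral_coord /oddprod.
  transitivity ((even_coord q * (even_coord q)^-1) +
    odd_coordp q * odd_coordm q * (even_coord q)^-1 * (1 - (even_coord q * (even_coord q)^-1))).
    by rewrite mulrV // subrr mulr0 addr0.
  by sring [:: even_coord q; (even_coord q)^-1] [:: odd_coordp q; odd_coordm q].
have Va : (antichiral_coord q)^-1 = (even_coord q)^-1 + oddprod q * ((even_coord q)^-1 * (even_coord q)^-1).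
  apply: (mulrI ua); rewrite mulrV // /antichiral_coord /oddprod.
  transitivity ((even_coord q * (even_coord q)^-1) -
    odd_coordp q * odd_coordm q * (even_coord q)^-1 * (1 - (even_coord q * (even_coord q)^-1))).
    by rewrite mulrV // subrr mulr0 subr0.
  by sring [:: even_coord q; (even_coord q)^-1] [:: odd_coordp q; odd_coordm q].
have Em : 2^-1 *: ((- antichiral_coord q)^-1 * (- 'i *: (odd_coordm q + odd_coordm q))) =
    'i *: (odd_coordm q / even_coord q).
  rewrite invrN mulNr scaleNr mulrN opprK -scalerAr scalerA mulrC -scalerA; congr (_ *: _).
  rewrite mulrDr scalerDr halfD Va /oddprod.
  by sring [:: (even_coord q)^-1] [:: odd_coordp q; odd_coordm q].
have Ep : 'i *: odd_coordp q / chiral_coord q = 'i *: (odd_coordp q / even_coord q).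
  rewrite -scalerAl; congr (_ *: _); rewrite Vc /oddprod.
  by sring [:: (even_coord q)^-1] [:: odd_coordp q; odd_coordm q].
have Ez : even_coord p = (even_coord q)^-1 by rewrite /even_coord E.
have Eop : odd_coordp p = 'i *: odd_coordp q / even_coord q by rewrite /odd_coordp E.
have Eom : odd_coordm p = 'i *: odd_coordm q / even_coord q by rewrite /odd_coordm E.
apply: superspace_eq.
- rewrite hz Em Ep Ez -scalerAl -scalerAr scalerA -expr2 sqrCi scaleN1r opprK mul1r Vc /oddprod.
  by sring [:: (even_coord q)^-1] [:: odd_coordp q; odd_coordm q].
- by rewrite hp Ep Eop scalerAl.
- by rewrite hm Em Eom scalerAl.
Qed.
End ChartChange.

(** * The action on the sphere *)

Section SphereAction.
Variable C : numClosedFieldType.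
Local Notation Lambda := (grassmann C).
Local Notation sp := (superspace C).
Hypothesis archC : small_powers C.
Variable S : superRiemannSphere C.
Implicit Types (X Y : 'M[Lambda]_3) (v : 'cV[Lambda]_3) (w : 'rV[Lambda]_3) (p q : sp) (a b c : Lambda).
Implicit Types (s : S) (d e : bool).

Definition chart d : superchart C S := if d then Upsilon S else Delta S.

Definition hpoint v w : S := if body (v i1 0) != 0 then chart_inv (Delta S) (homog_pt v w)
  else chart_inv (Upsilon S) (homog_pt (chartmxV C true *m v) (w *m chartmx C true)).

Lemma homog_chart d v w : homog v w -> homog (chartmxV C d *m v) (w *m chartmx C d).
Proof. exact: homog_act (supergl_sym (supergl_chart C d)). Qed.

Lemma chartmxK d v : chartmx C d *m (chartmxV C d *m v) = v.
Proof. by rewrite mulmxA (superglK (supergl_chart C d)) mul1mx. Qed.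
Lemma chartmxVK d v : chartmxV C d *m (chartmx C d *m v) = v.
Proof. by rewrite mulmxA (superglV (supergl_chart C d)) mul1mx. Qed.
Lemma chartmxrK d w : w *m chartmx C d *m chartmxV C d = w.
Proof. by rewrite -mulmxA (superglK (supergl_chart C d)) mulmx1. Qed.
Lemma chartmxVrK d w : w *m chartmxV C d *m chartmx C d = w.
Proof. by rewrite -mulmxA (superglV (supergl_chart C d)) mulmx1. Qed.

Lemma mulmx_chart1 v : (chartmxV C true *m v) i1 0 = v i0 0.
Proof. by have [] := swapmx_col (- 'i) v. Qed.

Lemma body_homog_pt v w : homog v w -> body_coord (homog_pt v w) = body (v i0 0) / body (v i1 0).
Proof. by move=> h; rewrite -body_chiral chiral_homog_pt // bodyM bodyV. Qed.

(** On the overlap the two charts define the same point: the transition function acts as a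
    supermatrix, so passing to [Upsilon] and back only rescales the pair. *)
Lemma hpoint_upsilon v w : homog v w -> body (v i0 0) != 0 ->
  hpoint v w = chart_inv (Upsilon S) (homog_pt (chartmxV C true *m v) (w *m chartmx C true)).
Proof.
move=> h v0; rewrite /hpoint; case: ifP => // v1.
have h' := homog_chart true h.
have u1 : body ((chartmxV C true *m v) i1 0) != 0 by rewrite mulmx_chart1.
set q := homog_pt (chartmxV C true *m v) _.
have [Ec Er] := colpt_homog_pt h' u1; rewrite -/q in Ec Er.
have q0 : body_coord q != 0.
  rewrite body_homog_pt // mulmx_chart1 mulf_neq0 ?invr_eq0 //.
  by have [-> _ _] := swapmx_col (- 'i) v.
have := transition_homog q0 (sphere_transition S q0).
have [eJ eJ' JJ' J'J] := supergl_chart C true.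
rewrite -/(chartmx C true) -/(chartmxV C true) Ec Er colscaleM rowscaleM chartmxK chartmxrK.
have [B0 _ _] := homog_body h'; have w0 : body ((w *m chartmx C true) 0 i0) != 0 by rewrite -B0.
rewrite homog_pt_scale //; first last.
- by rewrite bodyV invr_eq0.
- by rewrite bodyV invr_eq0.
- by apply: gparV; case: h' => _ rw _ _ _; exact: (rw i0).
- by apply: gparV; case: h' => cv _ _ _ _; exact: (cv i1).
by move=> <-; rewrite chart_mapK // inE; exact/sphere_overlap.
Qed.

Lemma hpointE d v w : homog v w -> body ((chartmxV C d *m v) i1 0) != 0 ->
  hpoint v w = chart_inv (chart d) (homog_pt (chartmxV C d *m v) (w *m chartmx C d)).
Proof.
case: d => h; first by rewrite mulmx_chart1; exact: hpoint_upsilon.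
by rewrite /= mul1mx mulmx1 /hpoint => ->.
Qed.

Lemma chart_cover v w : homog v w -> exists d, body ((chartmxV C d *m v) i1 0) != 0.
Proof.
move=> /homog_body[_ _ H]; case: (eqVneq (body (v i1 0)) 0) => e.
  by exists true; rewrite mulmx_chart1; exact: H.
by exists false; rewrite /= mul1mx.
Qed.

Lemma hpoint_scale v w a b : homog v w -> gpar false a -> gpar false b -> body a != 0 ->
  body b != 0 -> hpoint (colscale v a) (rowscale b w) = hpoint v w.
Proof.
move=> h ea eb a0 b0; have [d vd] := chart_cover h.
rewrite (hpointE h vd) (@hpointE d); [|exact: homog_scale|].
  by rewrite colscaleM rowscaleM homog_pt_scale //; exact: homog_chart.
by rewrite colscaleM colscaleE bodyM mulf_neq0.
Qed.

Lemma hpoint_chart d p : hpoint (chartmx C d *m colpt p) (rowpt p *m chartmxV C d) =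
  chart_inv (chart d) p.
Proof.
rewrite (@hpointE d); first by rewrite chartmxVK chartmxVrK homog_ptK.
  exact: homog_act (supergl_chart C d) (homogpt p).
by rewrite chartmxVK mxE /= body1 oner_eq0.
Qed.

(** The axioms of the sphere locate the domain of [Delta] inside the chart [Upsilon]. The converse
    location follows from the transition function: its body is an inverse, so it cannot be zero. *)
Lemma chart_dom_hpoint d v w : homog v w ->
  chart_dom (chart d) (hpoint v w) <-> body ((chartmxV C d *m v) i1 0) != 0.
Proof.
move=> h; split; last by move=> vd; rewrite (hpointE h vd); exact: chart_inv_dom.
have [B0 B1 H] := homog_body h; have h' := homog_chart true h.
case: d; last first.
  rewrite /= mul1mx => Dh; apply/eqP => v1; have v0 := H v1.
  move: Dh; rewrite (hpoint_upsilon h v0) => /sphere_overlap.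
  rewrite body_homog_pt // mulmx_chart1; have [-> _ _] := swapmx_col (- 'i) v.
  by rewrite v1 mul0r eqxx.
rewrite mulmx_chart1 => Uh; apply/eqP => v0.
have v1 : body (v i1 0) != 0 by apply/eqP => /H; rewrite v0 eqxx.
have E : hpoint v w = chart_inv (Delta S) (homog_pt v w) by rewrite /hpoint v1.
pose q := Upsilon S (hpoint v w).
have qE : chart_inv (Upsilon S) q = hpoint v w by rewrite /q chart_mapK // inE.
have q0 : body_coord q != 0.
  by apply: (sphere_overlap S q).1; rewrite qE E; exact: chart_inv_dom.
have /(congr1 (fun t : Lambda * Lambda * Lambda => body t.1.1)) := sphere_transition S q0.
rewrite qE E chart_invK -/(even_coord _) -/(body_coord _) body_homog_pt // v0 mul0r bodyV.
by move=> /esym/eqP; rewrite invr_eq0 (negPf q0).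
Qed.

Definition scol s : 'cV[Lambda]_3 :=
  if pselect (chart_dom (Delta S) s) then colpt (Delta S s) else chartmx C true *m colpt (Upsilon S s).
Definition srow s : 'rV[Lambda]_3 :=
  if pselect (chart_dom (Delta S) s) then rowpt (Delta S s) else rowpt (Upsilon S s) *m chartmxV C true.

Lemma homog_sphere s : homog (scol s) (srow s).
Proof.
rewrite /scol /srow; case: pselect => h; first exact: homogpt.
exact: homog_act (supergl_chart C true) (homogpt _).
Qed.

Lemma hpointK s : hpoint (scol s) (srow s) = s.
Proof.
have : (chart_dom (Delta S) `|` chart_dom (Upsilon S)) s by rewrite sphere_cover.
rewrite /scol /srow; case: pselect => Ds Us.
  by have := hpoint_chart false (Delta S s); rewrite /= mul1mx mulmx1 => ->; rewrite chart_mapK // inE.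
by case: Us => // Us; rewrite (hpoint_chart true) /= chart_mapK // inE.
Qed.

Lemma hpoint_homog v w : homog v w -> exists a b, [/\ gpar false a, gpar false b, body a != 0,
  body b != 0 & scol (hpoint v w) = colscale v a /\ srow (hpoint v w) = rowscale b w].
Proof.
move=> h; have D := chart_dom_hpoint false h; rewrite /= mul1mx in D.
have [d [Ed1 Ed2 Ed3]] : exists d, [/\ body ((chartmxV C d *m v) i1 0) != 0,
    scol (hpoint v w) = chartmx C d *m colpt (chart d (hpoint v w)) &
    srow (hpoint v w) = rowpt (chart d (hpoint v w)) *m chartmxV C d].
  rewrite /scol /srow; case: pselect => [Dh|nD].
    have v1 := D.1 Dh; by exists false; rewrite /= mul1mx mulmx1 mul1mx.
  exists true; split=> //; rewrite mulmx_chart1; have [_ _] := homog_body h; apply.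
  by apply/eqP; apply: contra_notT nD; move/D.
have hd := homog_chart d h; have [Ec Er] := colpt_homog_pt hd Ed1.
have [B0 _ _] := homog_body hd.
exists ((chartmxV C d *m v) i1 0)^-1, ((w *m chartmx C d) 0 i0)^-1.
rewrite !bodyV !invr_eq0 -B0 Ed1; split=> //.
- by apply: gparV; case: hd => cv _ _ _ _; exact: (cv i1).
- by apply: gparV; case: hd => _ rw _ _ _; exact: (rw i0).
by rewrite Ed2 Ed3 (hpointE h Ed1) chart_invK Ec Er colscaleM rowscaleM chartmxK chartmxrK.
Qed.

(** The chosen representatives [scol s] and [srow s] do not matter: any others differ by even units
    ([hpoint_homog]), which leave the point unchanged ([hpoint_scale]). *)
Definition spheremap X Y s : S := hpoint (X *m scol s) (srow s *m Y).

Lemma spheremap_hpoint X Y v w : supergl X Y -> homog v w ->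
  spheremap X Y (hpoint v w) = hpoint (X *m v) (w *m Y).
Proof.
move=> XY h; have [a [b [ea eb a0 b0 [Ec Er]]]] := hpoint_homog h.
rewrite /spheremap Ec Er colscaleM rowscaleM hpoint_scale //; exact: homog_act.
Qed.

Lemma spheremap1 s : spheremap 1%:M 1%:M s = s.
Proof. by rewrite /spheremap mul1mx mulmx1 hpointK. Qed.

Lemma spheremapM X Y X' Y' s : supergl X Y -> supergl X' Y' ->
  spheremap X Y (spheremap X' Y' s) = spheremap (X *m X') (Y' *m Y) s.
Proof.
move=> XY XY'; rewrite {2}/spheremap spheremap_hpoint //; last exact: homog_act (homog_sphere s).
by rewrite /spheremap !mulmxA.
Qed.

Lemma spheremapK X Y : supergl X Y -> cancel (spheremap X Y) (spheremap Y X).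
Proof.
move=> XY s; rewrite spheremapM //; last exact: supergl_sym.
by case: XY => _ _ _ YX; rewrite YX spheremap1.
Qed.

Lemma spheremap_chart X Y d p : supergl X Y -> spheremap X Y (chart_inv (chart d) p) =
  hpoint (X *m chartmx C d *m colpt p) (rowpt p *m (chartmxV C d *m Y)).
Proof.
move=> XY; rewrite -hpoint_chart spheremap_hpoint // ?mulmxA //.
exact: homog_act (supergl_chart C d) (homogpt p).
Qed.

Section Charts.
Variables (X Y : 'M[Lambda]_3) (d e : bool).
Hypothesis XY : supergl X Y.
Let M := chartmxV C e *m (X *m chartmx C d).
Let N := (chartmxV C d *m Y) *m chartmx C e.

Lemma supergl_charts : supergl M N.
Proof. by apply: superglM; [exact/supergl_sym/supergl_chart|exact/superglM/supergl_chart]. Qed.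

Lemma spheremap_domain :
  local_domain (chart d) (chart e) (spheremap X Y) = @body_coord C @^-1` denset M.
Proof.
apply/seteqP; split=> p; rewrite /local_domain /denset /= spheremap_chart //;
  have h := homog_act (superglM XY (supergl_chart C d)) (homogpt p);
  rewrite -(body_mulmx_colpt p supergl_charts) (chart_dom_hpoint e h) /M !mulmxA //.
Qed.

Lemma spheremap_expression p : denset M (body_coord p) ->
  local_expression (chart d) (chart e) (spheremap X Y) p = fracmap M N p.
Proof.
move=> Dp; rewrite /local_expression spheremap_chart //.
have h := homog_act (superglM XY (supergl_chart C d)) (homogpt p).
rewrite (@hpointE e) //; last by rewrite mulmxA (body_mulmx_colpt p supergl_charts).
by rewrite chart_invK /fracmap /M /N !mulmxA.
Qed.

Lemma superconformal_spheremap : superconformal (local_domain (chart d) (chart e) (spheremap X Y))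
  (local_expression (chart d) (chart e) (spheremap X Y)).
Proof.
rewrite spheremap_domain; apply: superconformal_ext (superconformal_fracmap archC supergl_charts).
by move=> p Dp; rewrite spheremap_expression.
Qed.
End Charts.

Lemma spheremap_automorphism X Y : supergl X Y -> superconformal_automorphism (spheremap X Y).
Proof.
have H X' Y' : supergl X' Y' -> superconformal_in_charts (spheremap X' Y').
  by move=> h; split; [exact: (superconformal_spheremap false false h)|
   exact: (superconformal_spheremap false true h)|exact: (superconformal_spheremap true false h)|
   exact: (superconformal_spheremap true true h)].
move=> XY; exists (spheremap Y X); first by split; apply: spheremapK => //; exact: supergl_sym.
by split; apply: H => //; exact: supergl_sym.
Qed.

End SphereAction.

(** * Inverting even supermatrices *)

Section SupermatrixInverse.
Variable C : numClosedFieldType.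
Local Notation Lambda := (grassmann C).
Implicit Types (X Y N : 'M[Lambda]_3).

Lemma gstar_id (a : Lambda) (e : bool) : gstar a = (-1) ^+ e *: a -> gpar e a.
Proof.
move=> sa I aI; have := congr1 (gcoef I) sa; rewrite gcoef_star gcoefZ => /(mulIf aI).
have n1 : (1 == -1 :> C) = false by rewrite -subr_eq0 opprK -mulr2n pnatr_eq0.
by case: odd; case: e sa => _ //= /eqP; rewrite ?expr0 ?expr1 ?n1 // eq_sym n1.
Qed.

(* A supermatrix is even exactly when it is fixed by this ring automorphism, so
   the inverse of an even supermatrix is even. *)
Definition mxstar X : 'M[Lambda]_3 := \matrix_(i, j) ((-1) ^+ (oddi i (+) oddi j) *: gstar (X i j)).

Lemma mxstarM X Y : mxstar (X *m Y) = mxstar X *m mxstar Y.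
Proof.
apply/matrixP => i j; rewrite [RHS]mulmx3E [LHS]mxE mulmx3E !gstarD !gstarM 2!scalerDr.
have H k : (-1) ^+ (oddi i (+) oddi j) *: (gstar (X i k) * gstar (Y k j)) =
    (-1) ^+ (oddi i (+) oddi k) *: gstar (X i k) * ((-1) ^+ (oddi k (+) oddi j) *: gstar (Y k j)).
  by rewrite -scalerAl -scalerAr scalerA -signr_addb addbA addbK.
by rewrite !H !mxE.
Qed.

Lemma mxstarP X : mxstar X = X -> supermx X.
Proof.
move=> E i j; apply: gstar_id; have := congr1 (fun M : 'M[Lambda]_3 => M i j) E.
by rewrite mxE => Eij; rewrite -{2}Eij scalerA -signr_addb addbb scale1r.
Qed.

Lemma mxstar_super X : supermx X -> mxstar X = X.
Proof.
move=> eX; apply/matrixP => i j; rewrite mxE; have := eX i j; case: (_ (+) _) => pX.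
  by rewrite (gstar_odd pX) expr1 scaleN1r opprK.
by rewrite (gstar_even pX) expr0 scale1r.
Qed.

Lemma mxstar1 : mxstar 1%:M = 1%:M.
Proof. by apply: mxstar_super; exact: supermx1. Qed.

(** Entries of [N ^+ k] have degree at least [k], while all powers involve the same finite set of
    generators. *)
Lemma soul_mx_nilp N : (forall i j, body (N i j) = 0) -> exists k, N ^+ k = 0.
Proof.
move=> N0; have [l lN] : exists l, forall i j, glev l (N i j).
  have [f Hf] : exists f : 'I_3 -> 'I_3 -> nat, forall i j, glev (f i j) (N i j).
    exists (fun i j => projT1 (cid (glev_ex (N i j)))) => i j.
    exact: (projT2 (cid (glev_ex (N i j)))).
  exists (\sum_i \sum_j f i j)%N => i j; apply: glevW (Hf i j).
  rewrite (bigD1 i) //= (bigD1 j) //= -addnA; exact: leq_addr.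
exists l.+1; apply/matrixP => i j; rewrite [RHS]mxE.
have mlev : forall k i j, glev l ((N ^+ k) i j).
  elim=> [|k IH] a b; first by rewrite expr0 mxE; case: eqP => _; [exact: glev1|exact: glev0].
  rewrite exprS mulmx3E; do 2?[apply: glevD]; apply: glevM => //; exact: IH.
have mdeg : forall k i j, gdeg k ((N ^+ k) i j).
  elim=> [|k IH] a b; first by [].
  have H c : gdeg k.+1 (N a c * (N ^+ k) c b).
    by rewrite -add1n; apply: gdegM => //; exact: gdeg_body0.
  by rewrite exprS mulmx3E; apply: gsuppD; [apply: gsuppD|]; exact: H.
exact: glev_gdeg (mlev _ _ _) (mdeg _ _ _).
Qed.

Lemma map_mx_body X Y : map_mx (@body C) (X *m Y) = map_mx (@body C) X *m map_mx (@body C) Y.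
Proof.
apply/matrixP => i j; rewrite [in LHS]mxE [in RHS]mxE mulmx3E !bodyD !bodyM sum_ord3 /=.
by rewrite !mxE.
Qed.

(** Lifting the inverse of the body gives [X *m lift Z = 1 - N] with [N] nilpotent, and a finite
    geometric series inverts it. The inverse is even because [mxstar] sends it to another right
    inverse of [X]. *)
Lemma supergl_ex X (Z : 'M[C]_3) : supermx X -> map_mx (@body C) X *m Z = 1%:M ->
  exists Y, supergl X Y.
Proof.
move=> eX XZ; pose lift (M : 'M[C]_3) : 'M[Lambda]_3 := map_mx (fun k => k%:A) M.
have liftM M M' : lift (M *m M') = lift M *m lift M'.
  apply/matrixP => i j; rewrite !mxE !sum_ord3 !scalerDl !mxE.
  by rewrite !mulr_algl !scalerA.
have lift1 : lift 1%:M = 1%:M.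
  by apply/matrixP => i j; rewrite !mxE; case: eqP => _; rewrite ?scale1r ?scale0r.
have body_lift M : map_mx (@body C) (lift M) = M.
  by apply/matrixP => i j; rewrite !mxE body_scal.
have ZX : Z *m map_mx (@body C) X = 1%:M by exact: mulmx1C.
pose N := 1%:M - X *m lift Z.
have [k Nk] : exists k, N ^+ k = 0.
  apply: soul_mx_nilp => i j; rewrite [N i j]mxE [(- (X *m lift Z)) i j]mxE bodyB.
  have := congr1 (fun M : 'M[C]_3 => M i j) (map_mx_body X (lift Z)).
  rewrite body_lift XZ !mxE => ->; case: eqP => _; first by rewrite body1 subrr.
  by rewrite body0 subrr.
pose V : 'M[Lambda]_3 := \sum_(i < k) N ^+ i.
have WE : X *m lift Z = 1 - N by rewrite /N opprB addrC subrK.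
have WV : X *m lift Z *m V = 1%:M.
  rewrite WE; have := subrX1 N k; rewrite Nk sub0r => E.
  by rewrite -[1 - N]opprB mulNmx -[_ *m _]/(_ * _) -E opprK.
have VW : V *m (X *m lift Z) = 1%:M.
  rewrite -[RHS]WV WE /V -[_ *m _]/(_ * _) -[RHS]/(_ * _) mulr_suml mulr_sumr.
  by apply: eq_bigr => i _; rewrite mulrBr mulrBl mulr1 mul1r -exprS -exprSr.
pose Y := lift Z *m V.
have XY : X *m Y = 1%:M by rewrite /Y mulmxA.
have YX : Y *m X = 1%:M.
  have LL : lift Z *m lift (map_mx (@body C) X) = 1%:M by rewrite -liftM ZX.
  have LR : lift (map_mx (@body C) X) *m lift Z = 1%:M by rewrite -liftM XZ.
  rewrite -[Y *m X]mulmx1 -LL mulmxA -(mulmxA Y) /Y -(mulmxA (lift Z)) VW mulmx1 LL.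
  by [].
exists Y; split=> //; apply: mxstarP.
have XsY : X *m mxstar Y = 1%:M by rewrite -{1}(mxstar_super eX) -mxstarM XY mxstar1.
by rewrite -[LHS]mul1mx -YX -mulmxA XsY mulmx1.
Qed.

End SupermatrixInverse.

(** * Liouville's theorem and rigidity *)

Section Liouville.
Variable C : numClosedFieldType.
Local Notation Lambda := (grassmann C).
Hypotheses (archC : small_powers C) (evtC : extreme_value C).
Implicit Types (phi eta psi : C -> Lambda) (x y h e : C).

Lemma gan_near_all phi x : gan phi x -> \forall y \near x, gan phi y.
Proof. by move=> gx; exact: near_join_nbhs gx. Qed.

Lemma gan_inv_scal phi x : x != 0 -> gan phi x -> gan (fun y => y^-1 *: phi y) x.
Proof.
move=> x0 gp; apply: (@gan_near C (fun y => (y^-1)%:A * phi y)).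
  by apply: ganM => //; apply: gan_scal; apply: holoV => //; exact: holo_id.
by apply/nearE; exists 1 => // h _; rewrite mulr_algl.
Qed.

Lemma near_neq0 x : x != 0 -> \forall y \near x, y != 0.
Proof. by move=> x0; apply: (@holo_near_neq0 C id) => //; exact: holo_id. Qed.

Lemma gan_div0 phi : gan phi 0 -> phi 0 = 0 -> exists2 eta, gan eta 0 &
  eta 0 = gderiv phi 0 /\ forall y, phi y = y *: eta y.
Proof.
move=> gp p0; pose eta y := if y == 0 then gderiv phi 0 else y^-1 *: phi y.
have eE y : phi y = y *: eta y.
  rewrite /eta; case: eqVneq => [->|y0]; first by rewrite scale0r.
  by rewrite scalerA mulfV // scale1r.
have eta0 : eta 0 = gderiv phi 0 by rewrite /eta eqxx.
exists eta => //; apply: filterS (gan_near_all gp) => y gy.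
have [->|y0] := eqVneq y 0.
  have [a pa] := gan_taylor gp; exists (fun k => a k.+1).
  apply: (gtaylor_div pa) => //; first by rewrite -(gtaylor_value pa).
  by rewrite eta0 /gderiv (gjetE pa).
apply: gan_taylor; apply: gan_near (gan_inv_scal y0 gy) _.
by apply: filterS (near_neq0 y0) => u u0; rewrite /eta (negPf u0).
Qed.

Lemma gan_entire_const phi eta e : (forall x, gan phi x) -> gan eta 0 -> 0 < e ->
  (forall h, h != 0 -> `|h| < e -> phi h^-1 = eta h) -> forall x, phi x = eta 0.
Proof.
move=> gp ge e0 H x; apply: gcoefP => I.
have [b eb] := holo_taylor (gan_coef I ge).
apply: (entire_infinity archC evtC (f := fun y => gcoef I (phi y)) (g := fun y => gcoef I (eta y)) _ eb e0).
  by move=> y; exact: holo_taylor (gan_coef I (gp y)).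
by move=> h h0 he; rewrite H.
Qed.

(** The quotient [(phi x - phi 0) / x] extends to an entire function that tends to [eta 0] at
    infinity, hence is constant. *)
Lemma gan_entire_affine phi eta e : (forall x, gan phi x) -> gan eta 0 -> 0 < e ->
  (forall h, h != 0 -> `|h| < e -> phi h^-1 = h^-1 *: eta h) ->
  forall x, phi x = x *: eta 0 + phi 0.
Proof.
move=> gp ge e0 H x.
have gp0 y : gan (fun y => phi y - phi 0) y by apply: ganB => //; exact: gan_const.
have [q gq [_ qE]] := gan_div0 (gp0 0) (subrr _).
have qN y : y != 0 -> q y = y^-1 *: (phi y - phi 0).
  by move=> y0; rewrite qE scalerA mulVf // scale1r.
have gq' y : gan q y.
  have [->//|y0] := eqVneq y 0; apply: gan_near (gan_inv_scal y0 (gp0 y)) _.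
  by apply: filterS (near_neq0 y0) => u u0; rewrite qN.
have -> : eta 0 = q x.
  rewrite (@gan_entire_const q (fun h => eta h - h *: phi 0) e) ?scale0r ?subr0 //.
    by apply: ganB => //; apply: gan_scal; exact: holo_id.
  move=> h h0 he; rewrite qN ?invr_eq0 // invrK H // scalerBr scalerA mulfV // scale1r.
  by [].
by rewrite -qE subrK.
Qed.

Lemma gan_uniq_punct phi eta x e : gan phi x -> gan eta x -> 0 < e ->
  (forall h, h != 0 -> `|h| < e -> phi (x + h) = eta (x + h)) -> phi x = eta x.
Proof.
move=> /gan_taylor[a pa] /gan_taylor[b eb] e0 H; rewrite (gtaylor_value pa) (gtaylor_value eb).
apply: gcoefP => I; have [n [_ _ Ta]] := pa; have [m [_ _ Tb]] := eb.
have E := taylor_uniq_punct (Ta I) (Tb I).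
have {}E : (fun k => gcoef I (a k)) = (fun k => gcoef I (b k)).
  by apply: E; exists e => // h h0 he; rewrite H.
by have := f_equal (fun u => u 0%N) E.
Qed.

Lemma body_unit_neq0 (n a : Lambda) : n * a = 0 -> n != 0 -> body a = 0.
Proof.
move=> na n0; apply/eqP; apply: contraNT n0; rewrite -gunitE => ua.
by rewrite -(mulrK ua n) na mul0r.
Qed.

Lemma nilpotent_ex : exists n : Lambda, [/\ gpar false n, body n = 0, n * n = 0 & n != 0].
Proof.
have o0 : gpar true (zeta C [fset 0%N]%fset) by exact: odd_zeta.
have o1 : gpar true (zeta C [fset 1%N]%fset) by exact: odd_zeta.
exists (zeta C [fset 0%N]%fset * zeta C [fset 1%N]%fset); split.
- exact: (gparM o0 o1).
- by rewrite bodyM (body_odd o0) mul0r.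
- by sring ([::] : seq Lambda) [:: zeta C [fset 0%N]%fset; zeta C [fset 1%N]%fset].
- rewrite (godd_anticomm o0 o1) oppr_eq0; apply/eqP.
  have l0 : glev 1 (zeta C [fset 0%N]%fset).
    by apply: gsupp_zeta; apply/glevP => i; rewrite inE => /eqP ->.
  move=> /(zeta_mul_eq0 l0) /(congr1 (gcoef [fset 0%N]%fset)).
  by rewrite gcoef_zeta eqxx gcoef0 => /eqP; rewrite oner_eq0.
Qed.

(* If a superconformal map has a superconformal inverse, evaluating both at
   points of Lambda shows that its derivatives are invertible. *)
Lemma chiral_inverse A B (H H' : superspace C -> superspace C) F k psi g F' k' psi' g' :
  open A -> open B ->
  chiral A (fun p => chiral_coord (H p)) F k -> chiral A (fun p => odd_coordp (H p)) psi g ->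
  chiral B (fun p => chiral_coord (H' p)) F' k' -> chiral B (fun p => odd_coordp (H' p)) psi' g' ->
  (forall p, A (body_coord p) -> B (body_coord (H p)) /\ H' (H p) = p) ->
  forall x, A x -> body (g x) != 0 /\ body (gderiv F x) != 0.
Proof.
move=> oA oB cu ct cu' ct' inv x Ax.
have [eF ok] := chiral_par (e := false) cu (fun p _ => chiral_even _) Ax.
have [op eg] := chiral_par (e := true) ct (fun p _ => odd_coordpP _) Ax.
have [gF gk _ _ _] := cu; have [gp gg _ _ _] := ct.
have [gF' gk' _ _ EF'] := cu'; have [gp' gg' _ _ Ep'] := ct'.
have BF : B (body (F x)).
  have [p px] := exists_body x; have [] := inv p; first by rewrite px.
  by rewrite -body_chiral (body_chiral_fun cu) px.
have [eF1 eF2] := hat_parA archC oB BF eF gF' (fun y By => (chiral_par (e := false) cu' (fun p _ => chiral_even _) By).1).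
have [ok1 ok2] := hat_parA archC oB BF eF gk' (fun y By => (chiral_par (e := false) cu' (fun p _ => chiral_even _) By).2).
have [op1 op2] := hat_parA archC oB BF eF gp' (fun y By => (chiral_par (e := true) ct' (fun p _ => odd_coordpP _) By).1).
have [eg1 eg2] := hat_parA archC oB BF eF gg' (fun y By => (chiral_par (e := true) ct' (fun p _ => odd_coordpP _) By).2).
have shift phi n : gpar false n -> body n = 0 -> n * n = 0 -> (forall y, B y -> gan phi y) ->
    hat phi (F x + n) = hat phi (F x) + n * hat (gderiv phi) (F x).
  by move=> en n0 nn gphi; apply: hat_shift => //; exact: gphi.
split.
  (* The coefficient of [t] in the odd coordinate of [H' (H p) = p], where theta+ is [t] and theta-
     is 0. On bodies it reduces to [g x * g' (F x) = 1]. *)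
  have E : k x * hat (gderiv psi') (F x) - psi x * k x * hat (gderiv g') (F x) + g x * hat g' (F x) = 1.
    have [] // := @odd_linear_inj C (hat psi' (F x) + psi x * hat g' (F x)) (k x * hat (gderiv psi') (F x)
      - psi x * k x * hat (gderiv g') (F x) + g x * hat g' (F x)) 0 1.
    move=> t ot; have [p [pz pt ps pb]] := exists_pt_body (gpar_scal x) ot (gpar0 (C := C) true).
    rewrite body_scal in pb; have Ap : A (body_coord p) by rewrite pb.
    have [Bq Eq] := inv p Ap; have := Ep' _ Bq.
    rewrite Eq pt (chiral_at cu Ax pz pt ps) (chiral_at ct Ax pz pt ps).
    have en : gpar false (t * k x) := gparM ot ok.
    have n0 : body (t * k x) = 0 by rewrite bodyM (body_odd ot) mul0r.
    have nn : t * k x * (t * k x) = 0 by sring ([::] : seq Lambda) [:: t; k x].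
    rewrite !shift // add0r mulr1 => Et.
    transitivity (hat psi' (F x) + t * k x * hat (gderiv psi') (F x) +
      (psi x + t * g x) * (hat g' (F x) + t * k x * hat (gderiv g') (F x))) => //.
    by sring [:: g x; hat g' (F x); hat (gderiv g') (F x)] [:: t; psi x; k x; hat psi' (F x); hat (gderiv psi') (F x)].
  have := congr1 (@body C) E; rewrite bodyD bodyB !bodyM (body_odd ok) !(mul0r, mulr0) subr0 add0r body1.
  by move=> Eb; apply/eqP => g0; move/eqP: Eb; rewrite g0 mul0r eq_sym oner_eq0.
(* Displacing the even coordinate by [n] with [n * n = 0] differentiates [H' (H p) = p]. The result
   is [n * (1 - ...) = 0], and the bracket would be a unit if the derivative of [F] had zero
   body. *)
have [n [en n0 nn nN]] := nilpotent_ex.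
have ex : gpar false (x%:A : Lambda) := gpar_scal x.
have o0 : gpar true (0 : Lambda) := gpar0 true.
have [p [pz pt ps pb]] := exists_pt_body (gparD ex en) o0 o0.
have [q [qz qt qs qb]] := exists_pt_body ex o0 o0.
rewrite bodyD n0 addr0 body_scal in pb; rewrite body_scal in qb.
have Ap : A (body_coord p) by rewrite pb.
have Aq : A (body_coord q) by rewrite qb.
have [Bp Ep] := inv p Ap; have [Bq Eq] := inv q Aq.
have up : chiral_coord p = x%:A + n by rewrite /chiral_coord /oddprod pt mul0r addr0 pz.
have uq : chiral_coord q = x%:A by rewrite /chiral_coord /oddprod qt mul0r addr0 qz.
have sh phi : gan phi x -> hat phi (x%:A + n) = phi x + n * gderiv phi x.
  move=> gphi; rewrite hat_shift // ?body_scal // !hat_value //; exact: gan_deriv.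
have D b phi : (forall y, A y -> gan phi y) -> (forall y, A y -> gpar b (phi y)) -> gpar b (gderiv phi x).
  move=> gphi ephi; rewrite -(hat_value (gan_deriv archC (gphi x Ax))).
  by apply: (hat_parA archC oA _ ex gphi ephi).2; rewrite body_scal.
have eFx := D _ _ gF (fun y Ay => (chiral_par (e := false) cu (fun p _ => chiral_even _) Ay).1).
have opx := D _ _ gp (fun y Ay => (chiral_par (e := true) ct (fun p _ => odd_coordpP _) Ay).1).
have := EF' _ Bp; have := EF' _ Bq.
rewrite Ep Eq up uq (chiral_at cu Ax qz qt qs) (chiral_at ct Ax qz qt qs) !mul0r !addr0.
have [_ _ _ _ EF] := cu; have [_ _ _ _ Et] := ct.
rewrite (EF p Ap) (Et p Ap) pt !mul0r !addr0 up !sh; [|exact: gp|exact: gF].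
have nn' : n * gderiv F x * (n * gderiv F x) = 0.
  transitivity (n * n * (gderiv F x * gderiv F x)); last by rewrite nn mul0r.
  by sring [:: n; gderiv F x] ([::] : seq Lambda).
have nF0 : body (n * gderiv F x) = 0 by rewrite bodyM n0 mul0r.
rewrite !shift //; try exact: (gparM en eFx).
move=> E1 E2; apply/eqP => F0.
have : n * (1 - (gderiv F x * hat (gderiv F') (F x) + psi x * gderiv F x * hat (gderiv k') (F x)
   + gderiv psi x * hat k' (F x))) = 0.
  have E3 : n = (hat F' (F x) + n * gderiv F x * hat (gderiv F') (F x) +
     (psi x + n * gderiv psi x) * (hat k' (F x) + n * gderiv F x * hat (gderiv k') (F x)))
     - (hat F' (F x) + psi x * hat k' (F x)) - n * n * gderiv psi x * gderiv F x * hat (gderiv k') (F x).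
    by rewrite nn !mul0r subr0 -E1 -E2 addrC addKr.
  transitivity (n - n * (gderiv F x * hat (gderiv F') (F x) + psi x * gderiv F x * hat (gderiv k') (F x)
   + gderiv psi x * hat k' (F x))); first by rewrite mulrBr mulr1.
  apply/eqP; rewrite subr_eq0; apply/eqP; rewrite {1}E3.
  by sring [:: n; gderiv F x; hat F' (F x); hat (gderiv F') (F x)] [:: psi x; gderiv psi x; hat k' (F x); hat (gderiv k') (F x)].
move=> /body_unit_neq0 /(_ nN) /eqP.
rewrite bodyB body1 !bodyD !bodyM F0 (body_odd opx) !(mul0r, mulr0) !addr0 subr0 oner_eq0.
by [].
Qed.

End Liouville.

(** * The identity theorem on the sphere *)

Section Agreement.
Variable C : numClosedFieldType.
Local Notation Lambda := (grassmann C).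
Local Notation sp := (superspace C).
Hypothesis archC : small_powers C.
Variable S : superRiemannSphere C.
Implicit Types (p q : sp) (s t : S) (d e : bool) (T : S -> S) (A : set C).

Lemma chart_other d s : chart_dom (chart S d) s ->
  (chart_dom (chart S (~~ d)) s <-> body_coord (chart S d s) != 0) /\
  (chart_dom (chart S (~~ d)) s -> body_coord (chart S d s) * body_coord (chart S (~~ d) s) = 1).
Proof.
move=> Ds; have sE : s = chart_inv (chart S d) (chart S d s) by rewrite chart_mapK // inE.
have key p : body_coord p != 0 -> body_coord p * body_coord (Delta S (chart_inv (Upsilon S) p)) = 1.
  move=> p0; have /(congr1 (fun t : Lambda * Lambda * Lambda => body t.1.1)) := sphere_transition S p0.
  rewrite /= -/(even_coord _) -/(body_coord _) bodyV => ->.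
  by rewrite mulfV.
case: d Ds sE => Ds sE /=; rewrite /= in sE.
  split; first by rewrite {1}sE; exact: sphere_overlap.
  by rewrite {1}sE => /sphere_overlap p0; rewrite {2}sE; exact: key.
have H p : body_coord p != 0 <-> chart_dom (chart S true) (chart_inv (Delta S) p).
  have h := homogpt p; have := chart_dom_hpoint S true h.
  have := hpoint_chart S false p; rewrite /= mul1mx mulmx1 => ->.
  by rewrite mulmx_chart1 mxE /= body_chiral => -[h1 h2]; split.
split; first by rewrite {1}sE; split=> [/H|/H].
move=> Us; have uE : chart_inv (Upsilon S) (Upsilon S s) = s by rewrite chart_mapK // inE.
have p0 : body_coord (Upsilon S s) != 0 by apply/(sphere_overlap S); rewrite uE.
by have := key _ p0; rewrite uE mulrC.
Qed.

Lemma chart_some s : exists d, chart_dom (chart S d) s.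
Proof.
have : (chart_dom (Delta S) `|` chart_dom (Upsilon S)) s by rewrite sphere_cover.
by case=> h; [exists false|exists true].
Qed.

Record chart_expr T d e A (F k psi g : C -> Lambda) : Prop := ChartExpr {
  cx_open : open A ;
  cx_dom : forall p, local_domain (chart S d) (chart S e) T p <-> A (body_coord p) ;
  cx_chiral : chiral A (fun p => chiral_coord (local_expression (chart S d) (chart S e) T p)) F k ;
  cx_oddp : chiral A (fun p => odd_coordp (local_expression (chart S d) (chart S e) T p)) psi g ;
  cx_normal : exists f chi h, [/\ normal_form A (local_expression (chart S d) (chart S e) T) f psi chi g h,
    forall x, F x = f x + psi x * chi x & forall x, k x = g x * chi x + g x * chi x] }.

Lemma normal_formS A B H f psi chi g h : B `<=` A -> normal_form A H f psi chi g h ->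
  normal_form B H f psi chi g h.
Proof.
move=> BA [ga pa ne np nm rel [lf lp lc lg lh]]; split.
- by move=> x /BA; exact: ga. - by move=> x /BA; exact: pa.
- by move=> p /BA; exact: ne. - by move=> p /BA; exact: np. - by move=> p /BA; exact: nm.
- by move=> z ez /BA; exact: rel.
have H0 phi : bounded_level A phi -> bounded_level B phi.
  by move=> [n Hn]; exists n => x /BA; exact: Hn.
by split; exact: H0.
Qed.

Lemma chart_exprP T d e : superconformal_in_charts T ->
  exists A F k psi g, chart_expr T d e A F k psi g.
Proof.
move=> TS; have : superconformal (local_domain (chart S d) (chart S e) T)
    (local_expression (chart S d) (chart S e) T).
  by case: TS => *; case: d; case: e.
move=> /(superconformal_normal_form archC)[A [oA UA [f [psi [chi [g [h nf]]]]]]].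
have [cu ct] := normal_form_chiral archC oA nf.
exists A, (fun x => f x + psi x * chi x), (fun x => g x * chi x + g x * chi x), psi, g; split=> //.
  by move=> p; rewrite UA.
by exists f, chi, h.
Qed.

Lemma chart_expr_determined T T' d e A F k psi g A' F' k' psi' g' B :
  chart_expr T d e A F k psi g -> chart_expr T' d e A' F' k' psi' g' ->
  open B -> B `<=` A -> B `<=` A' -> (forall x, B x -> body (g x) != 0) ->
  (forall x, B x -> [/\ F x = F' x, k x = k' x, psi x = psi' x & g x = g' x]) ->
  forall p, B (body_coord p) -> T (chart_inv (chart S d) p) = T' (chart_inv (chart S d) p).
Proof.
move=> [oA dA _ _ [f [chi [h [nf FE kE]]]]] [oA' dA' _ _ [f' [chi' [h' [nf' FE' kE']]]]] oB BA BA' g0 E p Bp.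
have : local_expression (chart S d) (chart S e) T p = local_expression (chart S d) (chart S e) T' p.
  apply: (normal_form_determined archC oB (normal_formS BA nf) (normal_formS BA' nf') g0) => // x Bx.
  by rewrite -FE -FE' -kE -kE'; exact: E.
have /dA D := BA _ Bp; have /dA' D' := BA' _ Bp.
rewrite /local_expression => /(congr1 (chart_inv (chart S e))).
by rewrite !chart_mapK // inE.
Qed.

Lemma automorphism_deriv_neq0 T d e A F k psi g : superconformal_automorphism T ->
  chart_expr T d e A F k psi g -> forall x, A x -> body (g x) != 0 /\ body (gderiv F x) != 0.
Proof.
move=> [Ti [TK TiK] [TS TiS]] [oA dA cu ct _].
have [B [F' [k' [psi' [g' [oB dB cu' ct' _]]]]]] := chart_exprP e d TiS.
apply: (chiral_inverse archC oA oB cu ct cu' ct') => p /dA Ap.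
have qE : chart_inv (chart S e) (local_expression (chart S d) (chart S e) T p) = T (chart_inv (chart S d) p).
  by rewrite /local_expression chart_mapK // inE.
split; first by apply/dB; rewrite /local_domain /= qE TK; exact: chart_inv_dom.
by rewrite /local_expression qE TK chart_invK.
Qed.

(** The body of a chart expression depends only on the body of its argument, so maps superconformal
    in the charts preserve this relation. It stands in for injectivity on bodies when combined with
    the inverse automorphism. *)
Definition same_body s t := forall d, chart_dom (chart S d) s ->
  chart_dom (chart S d) t /\ body_coord (chart S d s) = body_coord (chart S d t).

Lemma same_body_chart T d e p q : superconformal_in_charts T -> body_coord p = body_coord q ->
  local_domain (chart S d) (chart S e) T p -> local_domain (chart S d) (chart S e) T q /\
  body_coord (local_expression (chart S d) (chart S e) T p) =
  body_coord (local_expression (chart S d) (chart S e) T q).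
Proof.
move=> /(chart_exprP d e)[A [F [k [psi [g [oA dom cu _ _]]]]]] pq /dom Ap.
have Aq : A (body_coord q) by rewrite -pq.
split; first exact/dom.
by rewrite -!body_chiral (body_chiral_fun cu Ap) (body_chiral_fun cu Aq) pq.
Qed.

Lemma same_body_map T s t : superconformal_in_charts T -> same_body s t -> same_body (T s) (T t).
Proof.
move=> TS st e De; have [d Ds] := chart_some s; have [Dt bst] := st d Ds.
have sE : chart_inv (chart S d) (chart S d s) = s by rewrite chart_mapK // inE.
have tE : chart_inv (chart S d) (chart S d t) = t by rewrite chart_mapK // inE.
have [] := @same_body_chart T d e _ _ TS bst; first by rewrite /local_domain /= sE.
by rewrite /local_domain /local_expression /= sE tE.
Qed.

Lemma same_body_inf s t : ~ chart_dom (Delta S) s -> ~ chart_dom (Delta S) t -> same_body s t.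
Proof.
have Z r : ~ chart_dom (Delta S) r -> chart_dom (chart S true) r /\ body_coord (chart S true r) = 0.
  move=> nr; have [[|] Dr] := chart_some r; last by [].
  split=> //.
  have [H _] := chart_other Dr; apply/eqP; apply: contra_notT nr => r0.
  exact/H.
by move=> /[dup] ns /Z[Ds bs] /Z[Dt bt] [|] // _; rewrite bs bt.
Qed.

Lemma open_ball_set (x r : C) : open [set y : C | `|y - x| < r].
Proof.
rewrite openE => y yr; apply/nearE; exists (r - `|y - x|); first by rewrite subr_gt0.
move=> h hr; rewrite /= addrAC; apply: le_lt_trans (ler_normD _ _) _.
by rewrite -ltrBrDl.
Qed.

Lemma open_ball (A : set C) x : open A -> A x -> exists2 r : C, 0 < r & forall y, `|y - x| < r -> A y.
Proof.
move=> oA Ax; have /nearE[r r0 H] := near_open oA Ax.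
by exists r => // y yr; rewrite -(subrK x y) addrC; exact: H.
Qed.

Lemma avoid_ball (x b : C) : exists2 r : C, 0 < r & forall y, y != x -> `|y - x| < r -> y != b.
Proof.
have [->|bx] := eqVneq b x; first by exists 1.
exists `|b - x|; first by rewrite normr_gt0 subr_eq0.
by move=> y _; apply: contraTneq => ->; rewrite ltxx.
Qed.

(** At an exceptional body [x] the two images first have to be placed in a common chart; then the
    chiral data, equal on a punctured neighbourhood, agree at [x] by analyticity and determine the
    maps. *)
Lemma agree_everywhere T T' : superconformal_automorphism T -> superconformal_in_charts T' ->
  (forall d, exists b1 b2 : C, forall q, body_coord q != b1 -> body_coord q != b2 ->
    T (chart_inv (chart S d) q) = T' (chart_inv (chart S d) q)) -> T =1 T'.
Proof.
move=> Taut T'S agree s; have [_ _ [TS _]] := Taut.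
have [d Ds] := chart_some s; have [b1 [b2 ag]] := agree d.
set p := chart S d s; have sE : chart_inv (chart S d) p = s by rewrite /p chart_mapK // inE.
set x := body_coord p.
have mk e e' : chart_dom (chart S e) (T s) -> chart_dom (chart S e') (T' s) ->
    exists A F k psi g A' F' k' psi' g', [/\ chart_expr T d e A F k psi g,
      chart_expr T' d e' A' F' k' psi' g' & exists r : C, [/\ 0 < r,
      forall y, `|y - x| < r -> A y /\ A' y & forall q, body_coord q != x -> `|body_coord q - x| < r ->
        T (chart_inv (chart S d) q) = T' (chart_inv (chart S d) q)]].
  move=> De De'; have [A [F [k [psi [g cx]]]]] := chart_exprP d e TS.
  have [A' [F' [k' [psi' [g' cx']]]]] := chart_exprP d e' T'S.
  exists A, F, k, psi, g, A', F', k', psi', g'; split=> //.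
  have Ax : A x by apply/(cx_dom cx); rewrite /local_domain /= sE.
  have Ax' : A' x by apply/(cx_dom cx'); rewrite /local_domain /= sE.
  have [r1 r10 H1] := open_ball (cx_open cx) Ax.
  have [r2 r20 H2] := open_ball (cx_open cx') Ax'.
  have [r3 r30 H3] := avoid_ball x b1.
  have [r4 r40 H4] := avoid_ball x b2.
  have [r5 [r50 h1 h2]] := pos_min r10 r20; have [r6 [r60 h3 h4]] := pos_min r30 r40.
  have [r [r0 h5 h6]] := pos_min r50 r60.
  exists r; split=> //.
    move=> y yr; have y5 := lt_le_trans yr h5.
    by split; [apply: H1; exact: lt_le_trans y5 h1|apply: H2; exact: lt_le_trans y5 h2].
  move=> q qx qr; have q6 := lt_le_trans qr h6; apply: ag.
    by apply: H3 => //; exact: lt_le_trans q6 h3.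
  by apply: H4 => //; exact: lt_le_trans q6 h4.
have [e De] := chart_some (T s); have [e' De'] := chart_some (T' s).
(* If the images were seen in opposite charts, the bodies of the two expressions would have product
   1 near [x], hence at [x]. The body of [F x] is then nonzero, which puts [T s] in the overlap. *)
have De'' : chart_dom (chart S e') (T s).
  have [<-//|ne] := eqVneq e e'; have {ne} ee' : e' = ~~ e by case: e e' ne {De De'} => -[].
  subst e'; have [A [F [k [psi [g [A' [F' [k' [psi' [g' [cx cx' [r [r0 AA ee]]]]]]]]]]]]] := mk _ _ De De'.
  have [Ax Ax'] : A x /\ A' x by apply: AA; rewrite subrr normr0.
  have gb phi : gan phi x -> gan (fun y => (body (phi y))%:A : Lambda) x.
    by move=> gphi; apply: gan_scal; exact: gan_body.
  have gP : gan (fun y => (body (F y))%:A * (body (F' y))%:A : Lambda) x.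
    by apply: ganM; apply: gb; [exact: chiral_gan0 (cx_chiral cx) _ Ax|exact: chiral_gan0 (cx_chiral cx') _ Ax'].
  have E1 : (body (F x))%:A * (body (F' x))%:A = 1 :> Lambda.
    apply: (gan_uniq_punct gP (gan_const 1 x) r0) => h h0 hr.
    have [q qE] := exists_body (x + h).
    have qr : `|body_coord q - x| < r by rewrite qE addrC addKr.
    have [Aq Aq'] := AA _ qr.
    have Tq := ee q _ qr; rewrite qE -{2}[x]addr0 (inj_eq (addrI x)) in Tq; move/(_ h0): Tq => Tq.
    have Dq := (cx_dom cx q).2 Aq; have Dq' := (cx_dom cx' q).2 Aq'.
    rewrite /local_domain /= -Tq in Dq'; have [_ /(_ Dq')] := chart_other Dq.
    rewrite {2}Tq -!body_chiral -/(local_expression _ _ _ _) -/(local_expression _ _ _ _).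
    rewrite (body_chiral_fun (cx_chiral cx) Aq) (body_chiral_fun (cx_chiral cx') Aq') qE => E.
    by rewrite mulr_algl scalerA E scale1r.
  have [H _] := chart_other De; apply/H; rewrite -{1}sE -body_chiral -/(local_expression _ _ _ _).
  rewrite (body_chiral_fun (cx_chiral cx)) //; apply/eqP => F0.
  by move/eqP: E1; rewrite F0 scale0r mul0r eq_sym oner_eq0.
have [A [F [k [psi [g [A' [F' [k' [psi' [g' [cx cx' [r [r0 AA ee]]]]]]]]]]]]] := mk _ _ De'' De'.
have [Ax Ax'] : A x /\ A' x by apply: AA; rewrite subrr normr0.
have g0 y : A y -> body (g y) != 0 by move=> Ay; have [] := automorphism_deriv_neq0 Taut cx Ay.
have EP y : `|y - x| < r -> y != x -> [/\ F y = F' y, k y = k' y, psi y = psi' y & g y = g' y].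
  move=> yr yx; pose B := [set y : C | `|y - x| < r].
  have BA : B `<=` A by move=> z /AA[]. 
  have BA' : B `<=` A' by move=> z /AA[].
  have q_eq q : body_coord q = y -> local_expression (chart S d) (chart S e') T q =
      local_expression (chart S d) (chart S e') T' q.
    by move=> qy; rewrite /local_expression ee // qy.
  have [E1 E2] := chiral_scalar_inj (chiralS BA (cx_chiral cx)) (chiralS BA' (cx_chiral cx')) yr
    (fun q qy => congr1 (@chiral_coord C) (q_eq q qy)).
  by have [E3 E4] := chiral_scalar_inj (chiralS BA (cx_oddp cx)) (chiralS BA' (cx_oddp cx')) yr
    (fun q qy => congr1 (@odd_coordp C) (q_eq q qy)).
have Ex : [/\ F x = F' x, k x = k' x, psi x = psi' x & g x = g' x].
  have Q h : h != 0 -> `|h| < r -> [/\ F (x + h) = F' (x + h), k (x + h) = k' (x + h),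
     psi (x + h) = psi' (x + h) & g (x + h) = g' (x + h)].
    by move=> h0 hr; apply: EP; rewrite ?(addrC x) ?addrK // -{2}[x]add0r (inj_eq (addIr x)).
  have [[gF gk _ _ _] [gF' gk' _ _ _]] := (cx_chiral cx, cx_chiral cx').
  have [[gp gg _ _ _] [gp' gg' _ _ _]] := (cx_oddp cx, cx_oddp cx').
  by split; [apply: (gan_uniq_punct (gF x Ax) (gF' x Ax') r0)|apply: (gan_uniq_punct (gk x Ax) (gk' x Ax') r0)
    |apply: (gan_uniq_punct (gp x Ax) (gp' x Ax') r0)|apply: (gan_uniq_punct (gg x Ax) (gg' x Ax') r0)]
    => h h0 hr; case: (Q h h0 hr).
rewrite -sE; apply: (chart_expr_determined cx cx' (@open_ball_set x r)) => //.
- by move=> y /AA[]. - by move=> y /AA[]. - by move=> y /AA[/g0].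
- by move=> y yr; have [->|yx] := eqVneq y x; [exact: Ex|exact: EP].
- by rewrite /= subrr normr0.
Qed.

End Agreement.

(** * Automorphisms are given by supermatrices *)

Section Infinity.
Variable C : numClosedFieldType.
Local Notation Lambda := (grassmann C).
Hypotheses (archC : small_powers C) (evtC : extreme_value C).

(* [F], [k], [psi], [g] are the chiral data of a map fixing infinity, and the
   primed functions its data in the coordinates at infinity. *)
Lemma fixed_infinity_affine (F k psi g F' k' psi' g' : C -> Lambda) (r : C) :
  (forall x, [/\ gan F x, gan k x, gan psi x & gan g x]) ->
  [/\ gan F' 0, gan k' 0, gan psi' 0 & gan g' 0] -> 0 < r ->
  F' 0 = 0 -> psi' 0 = 0 -> body (gderiv F' 0) != 0 -> body (g' 0) != 0 -> gpar true (psi 0) ->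
  (forall h : C, h != 0 -> `|h| < r -> [/\ F h^-1 * F' h = 1,
     ('i / h) *: (k h^-1 * F' h) + F h^-1 * k' h = 0,
     psi' h = - 'i *: (psi h^-1 * F' h) &
     g' h = 'i *: (psi h^-1 * k' h) + h^-1 *: (g h^-1 * F' h)]) ->
  exists a b c c' : Lambda, [/\ forall x, F x = a * x%:A + b, forall x, k x = c * x%:A + c',
    forall x, psi x = psi 0, forall x, g x = g 0 & body a != 0 /\ body (g 0) != 0].
Proof.
move=> gE [gF' gk' gp' gg'] r0 F0 p0 dF0 g0 op rel.
(* The zero of [F'] is simple because its derivative has nonzero body, so [F1] is invertible near
   0. *)
have [F1 gF1 [F10 F1E]] := gan_div0 gF' F0.
have [p1 gp1 [p10 p1E]] := gan_div0 gp' p0.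
have i0 : 'i != 0 :> C := neq0Ci C.
have b1 : body (F1 0) != 0 by rewrite F10.
have gV : gan (fun h => (F1 h)^-1) 0 by exact: ganV.
have rel1 (h : C) : h != 0 -> `|h| < r -> [/\ F1 h \is a GRing.unit,
    F h^-1 = h^-1 *: (F1 h)^-1, psi h^-1 = 'i *: (p1 h / F1 h),
    k h^-1 = h^-1 *: ('i *: ((F1 h)^-1 * k' h / F1 h)) &
    g h^-1 = (g' h - 'i *: (psi h^-1 * k' h)) / F1 h].
  move=> h0 hr; have [R1 R2 R3 R4] := rel h h0 hr.
  rewrite !F1E p1E in R1 R2 R3 R4.
  have u : F1 h \is a GRing.unit.
    rewrite gunitE; apply/eqP => f0; have := congr1 (@body C) R1.
    by rewrite bodyM bodyZ f0 !mulr0 body1 => /eqP; rewrite eq_sym oner_eq0.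
  have hF : F h^-1 = h^-1 *: (F1 h)^-1.
    by apply: (mulIr u); rewrite -scalerAl mulVr // -R1 -scalerAr scalerA mulVf // scale1r.
  have Ep : psi h^-1 = 'i *: (p1 h / F1 h).
    apply: (mulIr u); rewrite -scalerAl mulrVK //.
    have -> : p1 h = h^-1 *: (h *: p1 h) by rewrite scalerA mulVf // scale1r.
    rewrite R3 -scalerAr !scalerA [X in X *: _](_ : _ = 1) ?scale1r //.
    transitivity (- ('i * 'i) * (h * h^-1) : C); first by ring.
    by rewrite -expr2 sqrCi opprK mulfV // mulr1.
  split=> //.
    apply: (mulIr u); rewrite -!scalerAl mulrVK //.
    have E2 : 'i *: (k h^-1 * F1 h) = - (F h^-1 * k' h).
      apply/eqP; rewrite -addr_eq0 -R2 -scalerAr scalerA mulrVK ?unitfE //.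
    have -> : k h^-1 * F1 h = - 'i *: ('i *: (k h^-1 * F1 h)).
      by rewrite scalerA mulNr -expr2 sqrCi opprK scale1r.
    rewrite E2.
    by rewrite hF scalerN scaleNr opprK -scalerAl scalerA mulrC -scalerA.
  apply: (mulIr u); rewrite mulrVK // R4 addrC addKr -scalerAr scalerA mulVf // scale1r.
  by [].
(* By [rel1], at infinity [F] and [k] have at most a simple pole while [psi] and [g] stay regular;
   Liouville's theorem is applied to each in turn, [psi] before [g] since the latter involves the
   former. *)
have FE := @gan_entire_affine C archC evtC F (fun h => (F1 h)^-1) r (fun x => let: And4 q _ _ _ := gE x in q) gV r0
  (fun h h0 hr => let: And5 _ q _ _ _ := rel1 h h0 hr in q).
have gk1 : gan (fun h => 'i *: ((F1 h)^-1 * k' h / F1 h)) 0.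
  by apply: ganZ; apply: ganM => //; apply: ganM.
have kE := @gan_entire_affine C archC evtC k _ r (fun x => let: And4 _ q _ _ := gE x in q) gk1 r0
  (fun h h0 hr => let: And5 _ _ _ q _ := rel1 h h0 hr in q).
have gp2 : gan (fun h => 'i *: (p1 h / F1 h)) 0 by apply: ganZ; apply: ganM.
have pE := @gan_entire_const C archC evtC psi _ r (fun x => let: And4 _ _ q _ := gE x in q) gp2 r0
  (fun h h0 hr => let: And5 _ _ q _ _ := rel1 h h0 hr in q).
have gg2 : gan (fun h => (g' h - 'i *: (psi 0 * k' h)) / F1 h) 0.
  by apply: ganM => //; apply: ganB => //; apply: ganZ; apply: ganM => //; exact: gan_const.
have gEq (h : C) : h != 0 -> `|h| < r -> g h^-1 = (g' h - 'i *: (psi 0 * k' h)) / F1 h.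
  by move=> h0 hr; have [_ _ _ _ ->] := rel1 h h0 hr; rewrite !pE.
have gC := @gan_entire_const C archC evtC g _ r (fun x => let: And4 _ _ _ q := gE x in q) gg2 r0 gEq.
exists (F1 0)^-1, (F 0), ('i *: ((F1 0)^-1 * k' 0 / F1 0)), (k 0); split.
- by move=> x; rewrite mulr_algr; exact: FE.
- by move=> x; rewrite mulr_algr; exact: kE.
- by move=> x; rewrite !pE.
- by move=> x; rewrite !gC.
rewrite bodyV invr_eq0 b1 gC bodyM bodyB bodyZ bodyM (body_odd op) mul0r mulr0 subr0.
by rewrite mulf_neq0 // bodyV invr_eq0.
Qed.
End Infinity.

(** * Elimination sending a point to infinity *)

Section ClearColumn.
Variable C : numClosedFieldType.
Local Notation Lambda := (grassmann C).

Definition clearmx (b c : Lambda) : 'M[Lambda]_3 :=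
  \matrix_(i, j) nth 0 (nth [::] [:: [:: 1; 0; 0]; [:: b; 1; 0]; [:: c; 0; 1]] i) j.

Lemma supergl_clear b c : gpar false b -> gpar true c -> supergl (clearmx b c) (clearmx (- b) (- c)).
Proof.
have M b1 c1 b2 c2 : b1 + b2 = 0 -> c1 + c2 = 0 -> clearmx b1 c1 *m clearmx b2 c2 = 1%:M.
  move=> b0 c0; apply/matrixP => i j; move: i; apply: forall_ord3; move: j; apply: forall_ord3;
  by rewrite mulmx3E !mxE /= ?(mul0r, mulr0, mul1r, mulr1, add0r, addr0).
have P b1 c1 : gpar false b1 -> gpar true c1 -> supermx (clearmx b1 c1).
  move=> eb oc i j; move: i; apply: forall_ord3; move: j; apply: forall_ord3; rewrite mxE /= //;
  by [exact: gpar1|exact: gpar0].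
move=> eb oc; split; [exact: P|by apply: P; exact: gparN|by apply: M; rewrite subrr|].
by apply: M; rewrite addNr.
Qed.

(** Gaussian elimination needs a pivot of nonzero body; one of the two even entries has it, and a
    swap brings it to the top. *)
Lemma clear_column (v : 'cV[Lambda]_3) w : homog v w -> exists X Y, supergl X Y /\
  (X *m v) i1 0 = 0 /\ (X *m v) i2 0 = 0.
Proof.
have key (v' : 'cV[Lambda]_3) w' : homog v' w' -> body (v' i0 0) != 0 -> exists X Y, supergl X Y /\
    (X *m v') i1 0 = 0 /\ (X *m v') i2 0 = 0.
  move=> h v0; have [cv _ _ _ _] := h; have u : v' i0 0 \is a GRing.unit by rewrite gunitE.
  exists (clearmx (- (v' i1 0 / v' i0 0)) (- (v' i2 0 / v' i0 0))), (clearmx (- - (v' i1 0 / v' i0 0)) (- - (v' i2 0 / v' i0 0))).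
  split.
    apply: supergl_clear; apply: gparN; [exact: (gparM (cv i1) (gparV (cv i0)))|].
    exact: (gparM (cv i2) (gparV (cv i0))).
  by rewrite !mulmx3E !mxE /= !mul0r !mul1r !mulNr !mulrVK // !addr0 ?add0r !addNr.
move=> h; have [B0 B1 B2] := homog_body h.
have [v1|v1] := eqVneq (body (v i1 0)) 0; first by apply: key h _; exact: B2.
have J : supergl (swapmx (1 : C)) (swapmx 1).
  by split; rewrite ?swapmxM ?mulr1 //; exact: swapmx_super.
have [] := key _ _ (homog_act J h); first by have [-> _ _] := swapmx_col 1 v.
move=> X [Y [XY H]]; exists (X *m swapmx 1), (swapmx 1 *m Y); split; first exact: superglM.
by rewrite -mulmxA.
Qed.
End ClearColumn.

(** * Automorphisms normalized at infinity *)

Section FixingInfinity.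
Variable C : numClosedFieldType.
Local Notation Lambda := (grassmann C).
Local Notation sp := (superspace C).
Hypotheses (archC : small_powers C) (evtC : extreme_value C).
Variable S : superRiemannSphere C.
Implicit Types (p q : sp) (s t : S) (d e : bool) (X Y M N : 'M[Lambda]_3).

Lemma delta_hpoint v w : homog v w -> body (v i1 0) != 0 -> Delta S (hpoint S v w) = homog_pt v w.
Proof. by move=> h v1; rewrite /hpoint v1 chart_invK. Qed.

Lemma chiral_data_ext A c (phi eta phi' eta' : C -> Lambda) : phi =1 phi' -> eta =1 eta' ->
  chiral A c phi eta -> chiral A c phi' eta'.
Proof. by move=> /funext <- /funext <-. Qed.

Lemma chiral_mulmx T d e A F k psi g M i : chart_expr T d e A F k psi g ->
  chiral A (fun p => (M *m colpt (local_expression (chart S d) (chart S e) T p)) i 0)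
    (fun x => M i i0 * F x + M i i1 + M i i2 * psi x)
    (fun x => gstar (M i i0) * k x + gstar (M i i2) * g x).
Proof.
move=> [_ _ cu ct _].
have K a := @chiral_const C A a.
have H := chiralD (chiralD (chiralM (K (M i i0)) cu) (K (M i i1))) (chiralM (K (M i i2)) ct).
apply: chiral_ext (chiral_data_ext _ _ H) _ => [x|x|p Ap] //=.
  by rewrite !mul0r !add0r addr0.
by rewrite mulmx3E !mxE /= mulr1.
Qed.

Definition origin : sp := mkpt (@origin_in C).
Definition infinity : S := chart_inv (Upsilon S) origin.

Lemma infinity_dom : ~ chart_dom (Delta S) infinity.
Proof. by move=> /sphere_overlap; rewrite /body_coord body0 eqxx. Qed.

Variable T : S -> S.
Hypothesis Taut : superconformal_automorphism T.

Section Normalized.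
Variables (X Y : 'M[Lambda]_3).
Hypothesis XY : supergl X Y.
Let T' s := spheremap X Y (T s).
Hypothesis Tinf : ~ chart_dom (Delta S) (T' infinity).

(** A finite point sent outside [Delta] would have an image of the same body as that of infinity;
    applying the inverse maps, it would have the body of infinity itself. *)
Lemma normalized_dom p : chart_dom (Delta S) (T' (chart_inv (Delta S) p)).
Proof.
have [Ti [TK TiK] [TS TiS]] := Taut.
have [? _ [YS _]] := spheremap_automorphism archC S (supergl_sym XY).
apply: contrapT => nD.
have D : chart_dom (Delta S) (chart_inv (Delta S) p) by exact: chart_inv_dom.
have sb2 := same_body_map archC TiS (same_body_map archC YS (same_body_inf nD Tinf)).
rewrite /T' !(spheremapK XY) !TK in sb2.
by have [/infinity_dom] := sb2 false D.
Qed.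

Lemma normalized_hpoint d e p : local_domain (chart S d) (chart S e) T p ->
  let V := X *m chartmx C e *m colpt (local_expression (chart S d) (chart S e) T p) in
  let W := rowpt (local_expression (chart S d) (chart S e) T p) *m (chartmxV C e *m Y) in
  T' (chart_inv (chart S d) p) = hpoint S V W /\ homog V W.
Proof.
move=> D V W; split; last exact: homog_act (superglM XY (supergl_chart C e)) (homogpt _).
have -> : T' (chart_inv (chart S d) p) =
    spheremap X Y (chart_inv (chart S e) (local_expression (chart S d) (chart S e) T p)).
  by rewrite /local_expression chart_mapK // inE.
by rewrite spheremap_chart.
Qed.

Lemma normalized_delta d e p : local_domain (chart S d) (chart S e) T p ->
  chart_dom (Delta S) (T' (chart_inv (chart S d) p)) ->
  let V := X *m chartmx C e *m colpt (local_expression (chart S d) (chart S e) T p) in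
  let r := Delta S (T' (chart_inv (chart S d) p)) in
  [/\ body (V i1 0) != 0, chiral_coord r = V i0 0 / V i1 0 & odd_coordp r = V i2 0 / V i1 0].
Proof.
move=> D D' V r; have [E h] := normalized_hpoint D; rewrite -/V in E h.
have V1 : body (V i1 0) != 0.
  by move: D'; rewrite E => /(chart_dom_hpoint S false h); rewrite /= mul1mx.
have Er : r = homog_pt V _ := etrans (congr1 (chart_map (Delta S)) E) (delta_hpoint h V1).
clearbody r V; rewrite Er; split; [exact: V1|exact: chiral_homog_pt h|].
by have [_ -> _] := homog_ptE h.
Qed.

(** Each of the two target charts of [T] gives chiral data on an open set, the denominator being
    invertible by [normalized_dom]. These sets cover the plane, and the data glue. *)
Lemma normalized_entire : exists F k psi g,
  chiral [set: C] (fun p => chiral_coord (Delta S (T' (chart_inv (Delta S) p)))) F k /\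
  chiral [set: C] (fun p => odd_coordp (Delta S (T' (chart_inv (Delta S) p)))) psi g.
Proof.
have [_ _ [TS _]] := Taut.
have cov : forall x, exists e, forall p, body_coord p = x -> local_domain (chart S false) (chart S e) T p.
  move=> x; have [p px] := exists_body x; have [e De] := chart_some (T (chart_inv (Delta S) p)).
  exists e => q qx; have [A [F [k [psi [g [_ dom _ _ _]]]]]] := chart_exprP archC false e TS.
  by apply/dom; rewrite qx -px; apply/dom.
have loc e : exists A F k psi g, [/\ open A,
   forall p, local_domain (chart S false) (chart S e) T p -> A (body_coord p),
   chiral A (fun p => chiral_coord (Delta S (T' (chart_inv (Delta S) p)))) F k &
   chiral A (fun p => odd_coordp (Delta S (T' (chart_inv (Delta S) p)))) psi g].
  have [A [F [k [psi [g cx]]]]] := chart_exprP archC false e TS.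
  have cV i := chiral_mulmx (X *m chartmx C e) i cx.
  have dV p : A (body_coord p) -> [/\ _, _ & _] :=
    fun Ap => normalized_delta ((cx_dom cx p).2 Ap) (normalized_dom p).
  have V0 x : A x -> body ((X *m chartmx C e) i1 i0 * F x + (X *m chartmx C e) i1 i1 + (X *m chartmx C e) i1 i2 * psi x) != 0.
    move=> Ax; have [p px] := exists_body x; rewrite -px in Ax *.
    by rewrite -(body_chiral_fun (cV i1) Ax); have [] := dV p Ax.
  have c0 := chiralM (cV i0) (chiralV (cV i1) V0).
  have c2 := chiralM (cV i2) (chiralV (cV i1) V0).
  do 5!eexists; split; first exact: cx_open cx.
  - by move=> p /(cx_dom cx).
  - by apply: chiral_ext c0 _ => p Ap; have [_ -> _] := dV p Ap.
  - by apply: chiral_ext c2 _ => p Ap; have [_ _ ->] := dV p Ap.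
have [A [F [k [psi [g [oA dA cu ct]]]]]] := loc false.
have [A' [F' [k' [psi' [g' [oA' dA' cu' ct']]]]]] := loc true.
have AT : A `|` A' = [set: C].
  apply/seteqP; split=> // x _; have [p px] := exists_body x.
  have [[] H] := cov x; have := H p px; first by move/dA'; rewrite px; right.
  by move/dA; rewrite px; left.
by do 4!eexists; rewrite -AT; split; [exact: chiralU cu cu'|exact: chiralU ct ct'].
Qed.

(** [Tinf] fixes infinity only up to soul; here the soul vanishes as well, so that the expansions at
    infinity have no constant term. *)
Hypothesis Tinf_exact : forall e, chart_dom (chart S e) (T infinity) ->
  let V := X *m chartmx C e *m colpt (chart S e (T infinity)) in V i1 0 = 0 /\ V i2 0 = 0.

(** The functions are the chiral coordinates [V1 / V0] and [- 'i V2 / V0] of the image in the chart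
    at infinity, so the last clause is the transition function. The nonvanishing of derivatives
    comes from the inverse automorphism together with invertibility of the supermatrix. *)
Lemma normalized_infinity : exists F' k' psi' g' (r : C), [/\ 0 < r,
  [/\ gan F' 0, gan k' 0, gan psi' 0 & gan g' 0],
  [/\ F' 0 = 0, psi' 0 = 0, body (gderiv F' 0) != 0 & body (g' 0) != 0],
  forall x, `|x| < r -> gpar false (F' x) /\ gpar true (k' x) &
  forall (x : C) (t : Lambda) p, x != 0 -> `|x| < r -> even_coord p = x%:A -> odd_coordp p = t ->
    odd_coordm p = 0 -> let r := Delta S (T' (chart_inv (Upsilon S) p)) in
    chiral_coord r * (F' x + t * k' x) = 1 /\
    psi' x + t * g' x = - 'i *: (odd_coordp r * (F' x + t * k' x))].
Proof.
have [_ _ [TS _]] := Taut.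
have [e De] := chart_some (T infinity); have [V1 V2] := Tinf_exact De.
have [A [F [k [psi [g cx]]]]] := chart_exprP archC true e TS.
set M := X *m chartmx C e in V1 V2.
have MN : supergl M (chartmxV C e *m Y) := superglM XY (supergl_chart C e).
have cV i := chiral_mulmx M i cx.
set phi := fun i (x : C) => M i i0 * F x + M i i1 + M i i2 * psi x.
set eta := fun i (x : C) => gstar (M i i0) * k x + gstar (M i i2) * g x.
have {}cV i : chiral A (fun p => (M *m colpt (local_expression (chart S true) (chart S e) T p)) i 0)
   (phi i) (eta i) by exact: cV.
have ob : body_coord origin = 0 by rewrite /body_coord body0.
have A0 : A 0 by rewrite -ob; apply/(cx_dom cx).
have phi0 i : phi i 0 = (M *m colpt (chart S e (T infinity))) i 0.
  rewrite -[LHS]addr0 -[X in _ + X](mul0r (eta i 0)); apply/esym.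
  by apply: (chiral_at (p := origin) (cV i)) => //; rewrite scale0r.
have p1 : phi i1 0 = 0 by rewrite phi0.
have p2 : phi i2 0 = 0 by rewrite phi0.
have p0 : body (phi i0 0) != 0.
  have h := homog_act MN (homogpt (chart S e (T infinity))).
  by rewrite phi0; have [_ _] := homog_body h; apply; rewrite V1 body0.
have gphi i x : A x -> gan (phi i) x by move=> Ax; exact: (chiral_gan0 (cV i) Ax).
have [r1 r10 H1] := open_ball (cx_open cx) A0.
have /nearE[r2 r20 H2] := gan_near_unit (gphi i0 0 A0) p0.
have [r [r0 rr1 rr2]] := pos_min r10 r20.
pose D := [set x : C | `|x| < r].
have DA : D `<=` A by move=> x xr; apply: H1; rewrite subr0; exact: lt_le_trans xr rr1.
have D0 : D 0 by rewrite /D /= normr0.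
have ph0 x : D x -> body (phi i0 x) != 0.
  by move=> xr; rewrite -(add0r x); apply: H2; exact: lt_le_trans xr rr2.
have cVD i := chiralS DA (cV i).
have cF := chiralM (cVD i1) (chiralV (cVD i0) ph0).
have cP := chiralZ (chiralM (cVD i2) (chiralV (cVD i0) ph0)) (- 'i).
move: cF cP; set F' := (fun x : C => phi i1 x * (phi i0 x)^-1); set psi' := (fun x : C => - 'i *: _).
set k' := (fun x : C => eta i1 x * _ + _); set g' := (fun x : C => - 'i *: (eta i2 x * _ + _)) => cF cP.
exists F', k', psi', g', r.
have [gF' gk' _ _ _] := cF; have [gp' gg' _ _ _] := cP.
split=> //.
- by split; [exact: gF'|exact: gk'|exact: gp'|exact: gg'].
- split.
  + by rewrite /F' p1 mul0r.
  + by rewrite /psi' p2 mul0r scaler0.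
  + have [_ dF] := automorphism_deriv_neq0 archC Taut cx A0.
    have E1 : gderiv F' 0 * phi i0 0 + F' 0 * gderiv (phi i0) 0 = gderiv (phi i1) 0.
      rewrite -gderivM; [|exact: gF'|exact: gphi].
      apply: gderiv_near; first by apply: ganM; [exact: gF'|exact: gphi].
      apply/nearE; exists r => // h hr; rewrite add0r /F' -mulrA mulVr ?mulr1 // gunitE.
      exact: ph0.
    have [gF gk _ _ _] := cx_chiral cx; have [gp gg _ _ _] := cx_oddp cx.
    have E2 : gderiv (phi i1) 0 = M i1 i0 * gderiv F 0 + M i1 i2 * gderiv psi 0.
      have G1 := ganM (gan_const (M i1 i0) 0) (gF 0 A0).
      have G2 := ganM (gan_const (M i1 i2) 0) (gp 0 A0).
      have G3 := ganD G1 (gan_const (M i1 i1) 0).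
      rewrite /phi (gderivD G3 G2) (gderivD G1 (gan_const _ _)) !gderivM ?gderiv_const; try exact: gan_const.
      * by rewrite !mul0r !add0r addr0.
      * exact: gp. * exact: gF.
    have F'00 : F' 0 = 0 by rewrite /F' p1 mul0r.
    have E3 : gderiv F' 0 * phi i0 0 = M i1 i0 * gderiv F 0 + M i1 i2 * gderiv psi 0.
      by rewrite -E2 -E1 F'00 mul0r addr0.
    have [eM _ _ _] := MN.
    have E4 : body (gderiv F' 0) * body (phi i0 0) = body (M i1 i0) * body (gderiv F 0).
      by rewrite -[LHS]bodyM E3 bodyD !bodyM (body_odd (eM i1 i2)) mul0r addr0.
    apply/eqP => F0; move/eqP: E4; rewrite F0 mul0r eq_sym mulf_eq0 (negPf dF) orbF => /eqP m10.
    have := congr1 (@body C) p1; rewrite /phi !bodyD !bodyM m10 (body_odd (eM i1 i2)) !mul0r add0r addr0 body0 => m11.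
    by have [y] := denset_neq0 MN; rewrite /denset /= m10 m11 mul0r addr0 eqxx.
  + have [g0 _] := automorphism_deriv_neq0 archC Taut cx A0.
    have [eM _ _ _] := MN.
    rewrite /g' p2 bodyZ mulf_neq0 ?oppr_eq0 ?neq0Ci //.
    rewrite bodyD bodyM (_ : gstar 0 = 0); last by rewrite gstar_even //; exact: gpar0.
    rewrite mul0r body0 addr0 mulf_neq0 ?bodyV ?invr_eq0 //.
    rewrite /eta bodyD !bodyM !body_star (body_odd (eM i2 i0)) mul0r add0r mulf_neq0 //.
    exact: supergl_body MN.
- move=> x xr; have Vpar i p : gpar (oddi i) ((M *m colpt (local_expression (chart S true) (chart S e) T p)) i 0).
    by have [eM _ _ _] := MN; have [cc _ _ _ _] := homogpt (local_expression (chart S true) (chart S e) T p);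
      apply: supercolM.
  exact: (chiral_par (e := false) cF (fun p _ => gparM (Vpar i1 p) (gparV (Vpar i0 p))) xr).
- move=> x t p x0 xr pz pt ps R.
  have pb : body_coord p = x by rewrite /body_coord pz body_scal.
  have Dp : local_domain (chart S true) (chart S e) T p by apply/(cx_dom cx); rewrite pb; exact: DA.
  have DR : chart_dom (Delta S) (T' (chart_inv (chart S true) p)).
    have Dd : chart_dom (Delta S) (chart_inv (Upsilon S) p) by apply/(sphere_overlap S); rewrite pb.
    have <- : chart_inv (Delta S) (Delta S (chart_inv (Upsilon S) p)) = chart_inv (chart S true) p.
      by rewrite chart_mapK // inE.
    exact: normalized_dom.
  have [W1 W2 W3] := normalized_delta Dp DR.
  rewrite -(chiral_at cF xr pz pt ps) -(chiral_at cP xr pz pt ps) -/R in W2 W3 *.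
  rewrite W2 W3 -/M; move: (W1); rewrite -/M.
  have W0 : body ((M *m colpt (local_expression (chart S true) (chart S e) T p)) i0 0) != 0.
    have Dpb : D (body_coord p) by rewrite pb.
    have := body_chiral_fun (cVD i0) Dpb; rewrite pb => W0; have := ph0 x xr.
    by rewrite -W0.
  move: W0; move: ((_ *m _) i0 0) ((_ *m _) i1 0) ((_ *m _) i2 0) => v0 v1 v2; rewrite -!gunitE => u0 u1.
  have E u : u / v1 * (v1 / v0) = u / v0 by rewrite mulrA mulrVK.
  by split; [rewrite E mulrV|rewrite E].
Qed.

End Normalized.
End FixingInfinity.

(** * Every automorphism is a supermatrix action *)

Section Classification.
Variable C : numClosedFieldType.
Local Notation Lambda := (grassmann C).
Local Notation sp := (superspace C).
Hypotheses (archC : small_powers C) (evtC : extreme_value C).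
Variable S : superRiemannSphere C.
Implicit Types (p q : sp) (s t : S) (d e : bool) (X Y M N : 'M[Lambda]_3).

Lemma hat_affine (a b z : Lambda) : gpar false z -> hat (affine a b) z = a * z + b.
Proof.
move=> ez; have gi x : gan (fun y : C => y%:A : Lambda) x by exact/gan_scal/holo_id.
rewrite /affine hatD; [|by apply: ganM => //; exact: gan_const|exact: gan_const].
by rewrite hatM ?hat_const ?hat_id //; exact: gan_const.
Qed.

Lemma scal_inv (x : C) : x != 0 -> (x%:A : Lambda)^-1 = (x^-1)%:A.
Proof.
move=> x0; have u : (x%:A : Lambda) \is a GRing.unit by rewrite gunitE body_scal.
by apply: (mulIr u); rewrite mulVr // mulr_algl scalerA mulVf // scale1r.
Qed.

Variable T : S -> S.
Hypothesis Taut : superconformal_automorphism T.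

Section AffineForm.
Variables (X Y : 'M[Lambda]_3).
Hypothesis XY : supergl X Y.
Let T' s := spheremap X Y (T s).
Hypothesis Tinf : ~ chart_dom (Delta S) (T' (infinity S)).
Hypothesis Tinf_exact : forall e, chart_dom (chart S e) (T (infinity S)) ->
  let V := X *m chartmx C e *m colpt (chart S e (T (infinity S))) in V i1 0 = 0 /\ V i2 0 = 0.

(** A point with coordinates [(h, t, 0)] in the chart at infinity has coordinates
    [(1 / h, 'i t / h, 0)] in [Delta]. Comparing the two expansions of its image in powers of [t]
    gives the relations that [fixed_infinity_affine] requires. *)
Lemma normalized_affine : exists a b c c' p0 g0 : Lambda,
  [/\ gpar false a /\ gpar false b, gpar true c /\ gpar true c', gpar true p0 /\ gpar false g0,
    body a != 0 /\ body g0 != 0 &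
  forall p, let r := Delta S (T' (chart_inv (Delta S) p)) in
    chiral_coord r = a * chiral_coord p + b + odd_coordp p * (c * chiral_coord p + c') /\
    odd_coordp r = p0 + odd_coordp p * g0].
Proof.
have [F [k [psi [g [cu ct]]]]] := normalized_entire archC Taut XY Tinf.
have [F' [k' [psi' [g' [r [r0 gN [F'0 p'0 dF' g'0] pF' rel]]]]]] := normalized_infinity archC Taut XY Tinf Tinf_exact.
have eF x : gpar false (F x) /\ gpar true (k x).
  exact: (chiral_par (e := false) cu (fun p _ => chiral_even _) (x := x) I).
have ep x : gpar true (psi x) /\ gpar false (g x).
  exact: (chiral_par (e := true) ct (fun p _ => odd_coordpP _) (x := x) I).
have [gF gk _ _ EF] := cu; have [gp gg _ _ Ep] := ct.
have [] // := fixed_infinity_affine archC evtC (F := F) (k := k) (psi := psi) (g := g)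
  (F' := F') (k' := k') (psi' := psi') (g' := g') (r := r).
- by move=> x; split; [exact: gF|exact: gk|exact: gp|exact: gg].
- exact: (ep 0).1.
- move=> h h0 hr; have [eF' ok'] := pF' h hr.
  have [[eFh okh] [oph egh]] := (eF h^-1, ep h^-1).
  have eJ := gpar_scal (- 'i : C); have ec := gpar_scal ('i / h : C).
  have R (t : Lambda) : gpar true t ->
    F h^-1 * F' h + t * (('i / h)%:A * (k h^-1 * F' h) + F h^-1 * k' h) = 1 + t * 0 /\
    psi' h + t * g' h = (- 'i)%:A * (psi h^-1 * F' h) + t * (- ((- 'i)%:A * (psi h^-1 * k' h)) +
      (- 'i)%:A * ('i / h)%:A * (g h^-1 * F' h)).
    move=> ot; have [p [pz pt ps pb]] := exists_pt_body (gpar_scal h) ot (gpar0 (C := C) true).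
    rewrite body_scal in pb; have pn : body_coord p != 0 by rewrite pb.
    have := rel h t p h0 hr pz pt ps; set q := Delta S (chart_inv (Upsilon S) p).
    have qE : chart_inv (Delta S) q = chart_inv (Upsilon S) p.
      by rewrite /q chart_mapK // inE; exact/(sphere_overlap S).
    rewrite -qE /=; have := sphere_transition S pn; rewrite -/q pz pt ps scaler0 mul0r scal_inv // => E.
    have q1 : even_coord q = (h^-1)%:A by rewrite /even_coord E.
    have q2 : odd_coordp q = ('i / h)%:A * t.
      rewrite /odd_coordp E /= mulr_algr scalerA mulr_algl; congr (_ *: _).
      exact: mulrC.
    have q3 : odd_coordm q = 0 by rewrite /odd_coordm E.
    rewrite (chiral_at cu I q1 q2 q3) (chiral_at ct I q1 q2 q3) => -[R1 R2]; split.
      rewrite mulr0 addr0; apply: etrans R1.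
      by sring [:: ('i / h)%:A; F h^-1; F' h] [:: t; k h^-1; k' h].
    apply: (etrans R2); rewrite -(mulr_algl (- 'i) ((psi h^-1 + _) * _)).
    by sring [:: (- 'i)%:A; ('i / h)%:A; g h^-1; F' h] [:: t; psi h^-1; k' h].
  have [E1 E2] := odd_linear_inj (fun (t : Lambda) ot => (R t ot).1).
  have [E3 E4] := odd_linear_inj (fun (t : Lambda) ot => (R t ot).2).
  split.
  + exact: E1.
  + by rewrite -[RHS]E2 mulr_algl.
  + by rewrite E3 mulr_algl.
  + rewrite E4; congr (_ + _); first by rewrite mulr_algl scaleNr opprK.
    rewrite -mulrA !mulr_algl scalerA; congr (_ *: _).
    by rewrite mulNr mulrA -expr2 sqrCi mulN1r opprK.
move=> a [b [c [c' [Fa ka pc gc [a0 g00]]]]].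
exists a, b, c, c', (psi 0), (g 0).
have bE : b = F 0 by rewrite Fa scale0r mulr0 add0r.
have cE : c' = k 0 by rewrite ka scale0r mulr0 add0r.
have aE : a = F 1 - F 0 by rewrite -bE Fa scale1r mulr1 addrK.
have cE' : c = k 1 - k 0 by rewrite -cE ka scale1r mulr1 addrK.
split=> //.
- by rewrite aE bE; split; [apply: gparB|]; have [] := eF 0; have [] := eF 1.
- by rewrite cE' cE; split; [apply: gparB|]; have [] := eF 0; have [] := eF 1.
move=> p R; rewrite (EF p I) (Ep p I).
have -> : F = affine a b by apply/funext => x; rewrite Fa.
have -> : k = affine c c' by apply/funext => x; rewrite ka.
have -> : psi = fun=> psi 0 by apply/funext => x; rewrite pc.
have -> : g = fun=> g 0 by apply/funext => x; rewrite gc.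
by rewrite !hat_affine ?hat_const //; exact: chiral_even.
Qed.

(** The image coordinate contains theta+ times the chiral coordinate, which is not linear in the
    column; rescaling by the even unit [1 + be * theta+] removes this term. *)
Lemma normalized_matrix : exists M N, supergl M N /\
  forall p, exists2 c : Lambda, body c != 0 &
    M *m colpt p = colscale (colpt (Delta S (T' (chart_inv (Delta S) p)))) c.
Proof.
have [a [b [c [c' [p0 [g0 [[ea eb] [oc oc'] [op eg] [a0 g00] rel]]]]]]] := normalized_affine.
have ua : a \is a GRing.unit by rewrite gunitE.
(* The value of [be] makes the terms with [c] cancel, as [be] and theta+ anticommute; [al] and [E]
   collect what the rescaling leaves. *)
pose be := a^-1 * c; pose al := b * be - c'; pose E := g0 + p0 * be.
have obe : gpar true be := gparM (gparV ea) oc.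
have oal : gpar true al := gparB (gparM eb obe) oc'.
have eE : gpar false E := gparD eg (gparM op obe).
pose M : 'M[Lambda]_3 := \matrix_(i, j) nth 0 (nth [::] [:: [:: a; b; al]; [:: 0; 1; be]; [:: 0; p0; E]] i) j.
pose Z : 'M[C]_3 := \matrix_(i, j) nth 0 (nth [::] [:: [:: (body a)^-1; - (body a)^-1 * body b; 0];
  [:: 0; 1; 0]; [:: 0; 0; (body g0)^-1]] i) j.
have eM : supermx M.
  move=> i j; move: i; apply: forall_ord3; move: j; apply: forall_ord3; rewrite mxE /= //;
  by [exact: gpar1|exact: gpar0].
have [||N MN] := @supergl_ex C M Z => //.
  have bE : body E = body g0 by rewrite bodyD bodyM (body_odd op) mul0r addr0.
  apply/matrixP => i j; rewrite mxE sum_ord3.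
  move: i; apply: forall_ord3; move: j; apply: forall_ord3; rewrite !mxE /= ?(body_odd op, body_odd obe, body_odd oal, bE, body0, body1)
    ?(mul0r, mulr0, mul1r, mulr1, add0r, addr0) // ?mulfV //.
  by rewrite mulrA mulrN mulfV // mulN1r addNr.
exists M, N; split=> // p; have [E1 E2] := rel p.
have ot := odd_coordpP p; have eu := chiral_even p.
exists (1 + be * odd_coordp p); first by rewrite bodyD body1 bodyM (body_odd obe) mul0r addr0 oner_eq0.
apply/matrixP => i j; rewrite (ord1 j) colscaleE mulmx3E.
have cE : c = a * be by rewrite /be mulrA mulrV // mul1r.
move: i; apply: forall_ord3; rewrite !mxE /=.
- rewrite E1 cE /al.
  by sring [:: a; b; chiral_coord p] [:: be; c'; odd_coordp p].
- by rewrite mul0r add0r mul1r mulr1.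
- rewrite E2 /E mul0r add0r.
  by sring [:: g0] [:: be; p0; odd_coordp p].
Qed.
End AffineForm.

Lemma chart_col e s : chart_dom (chart S e) s -> exists2 a : Lambda, body a != 0 &
  scol s = colscale (chartmx C e *m colpt (chart S e s)) a.
Proof.
move=> De; have [a [b [_ _ a0 _ [E _]]]] := hpoint_homog S (homog_act (supergl_chart C e) (homogpt (chart S e s))).
by exists a => //; rewrite -E hpoint_chart chart_mapK // inE.
Qed.

(** After normalization the chiral half of [T] is that of a triangular supermatrix [M]; undoing the
    normalization by [Y] yields the candidate. It has the same chiral data as [T] over an open set
    that misses at most one body, which suffices for [agree_everywhere]. *)
Theorem automorphism_spheremap : exists X Y, supergl X Y /\ T =1 spheremap X Y.
Proof.
have [Ti [TK TiK] [TS TiS]] := Taut.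
have [X [Y [XY [X1 X2]]]] := clear_column (homog_sphere (T (infinity S))).
have Tinf : ~ chart_dom (Delta S) (spheremap X Y (T (infinity S))).
  move=> /(chart_dom_hpoint S false (homog_act XY (homog_sphere _))).
  by rewrite /= mul1mx X1 body0 eqxx.
have Tex e : chart_dom (chart S e) (T (infinity S)) ->
   let V := X *m chartmx C e *m colpt (chart S e (T (infinity S))) in V i1 0 = 0 /\ V i2 0 = 0.
  move=> /chart_col[a a0 E] V; rewrite E colscaleM !colscaleE mulmxA -/V in X1 X2.
  have ua : a \is a GRing.unit by rewrite gunitE.
  by split; apply: (mulIr ua); rewrite mul0r.
have [M [N [MN HM]]] := normalized_matrix XY Tinf Tex.
have WW := superglM (supergl_sym XY) MN.
exists (Y *m M), (N *m X); split=> //.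
have Waut := spheremap_automorphism archC S WW; have [? _ [WS _]] := Waut.
have [A [F [k [psi [g cx]]]]] := chart_exprP archC false false TS.
have [B [F' [k' [psi' [g' cx']]]]] := chart_exprP archC false false WS.
have key p : A (body_coord p) -> exists2 c : Lambda, body c != 0 &
    (Y *m M) *m colpt p = colscale (colpt (Delta S (T (chart_inv (Delta S) p)))) c.
  move=> Ap; have [c c0 Ec] := HM p; set q := Delta S (T (chart_inv (Delta S) p)).
  have D : local_domain (chart S false) (chart S false) T p by apply/(cx_dom cx).
  have qE : chart_inv (Delta S) q = T (chart_inv (Delta S) p) by rewrite /q chart_mapK // inE.
  have E : spheremap X Y (T (chart_inv (Delta S) p)) = hpoint S (X *m colpt q) (rowpt q *m Y).
    by rewrite -qE -[chart_inv _ _]/(chart_inv (chart S false) q) spheremap_chart //= mulmx1 mul1mx.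
  have h := homog_act XY (homogpt q).
  have := normalized_dom archC Taut XY Tinf p; rewrite E => /(chart_dom_hpoint S false h).
  rewrite /= mul1mx => V1; rewrite E delta_hpoint // in Ec.
  have [E1 _] := colpt_homog_pt h V1.
  have [_ _ XYe YXe] := XY.
  exists (((X *m colpt q) i1 0)^-1 * c); first by rewrite bodyM bodyV mulf_neq0 ?invr_eq0.
  rewrite -mulmxA Ec E1 -colscaleM.
  apply/matrixP => i j; rewrite (ord1 j) colscaleM colscaleE mulmxA YXe mul1mx !mxE -mulrA.
  by [].
have ee p : A (body_coord p) -> [/\ B (body_coord p),
   chiral_coord (local_expression (chart S false) (chart S false) T p) =
   chiral_coord (local_expression (chart S false) (chart S false) (spheremap (Y *m M) (N *m X)) p) &
   odd_coordp (local_expression (chart S false) (chart S false) T p) =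
   odd_coordp (local_expression (chart S false) (chart S false) (spheremap (Y *m M) (N *m X)) p)].
  move=> Ap; have [c c0 E] := key p Ap; have h := homog_act WW (homogpt p).
  have uc : c \is a GRing.unit by rewrite gunitE.
  have sE : spheremap (Y *m M) (N *m X) (chart_inv (Delta S) p) =
     hpoint S (Y *m M *m colpt p) (rowpt p *m (N *m X)).
    by rewrite -[chart_inv _ _]/(chart_inv (chart S false) p) spheremap_chart //= mulmx1 mul1mx.
  have W1 : body ((Y *m M *m colpt p) i1 0) != 0 by rewrite E colscaleE mxE /= mul1r.
  split.
  - apply/(cx_dom cx'); rewrite /local_domain /= sE; apply/(chart_dom_hpoint S false h).
    by rewrite /= mul1mx.
  - rewrite /local_expression /= sE delta_hpoint // chiral_homog_pt // E !colscaleE !mxE /= mul1r mulrK //.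
  - rewrite /local_expression /= sE delta_hpoint //; have [_ -> _] := homog_ptE h.
    by rewrite /ptp E !colscaleE !mxE /= mul1r mulrK.
have AB : A `<=` B.
  by move=> x; have [p px] := exists_body x; rewrite -px => /ee[].
have agree p : A (body_coord p) -> T (chart_inv (Delta S) p) = spheremap (Y *m M) (N *m X) (chart_inv (Delta S) p).
  apply: (chart_expr_determined archC cx cx' (cx_open cx)) => //.
    by move=> x /(automorphism_deriv_neq0 archC Taut cx)[].
  move=> x Ax.
  have [E1 E2] := chiral_scalar_inj (cx_chiral cx) (chiralS AB (cx_chiral cx')) Ax
    (fun q qx => let: And3 _ h _ := ee q (eq_ind_r A Ax qx) in h).
  by have [E3 E4] := chiral_scalar_inj (cx_oddp cx) (chiralS AB (cx_oddp cx')) Ax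
    (fun q qx => let: And3 _ _ h := ee q (eq_ind_r A Ax qx) in h).
(* Two finite points whose images both leave [Delta] have images of the same body, hence, applying
   the inverse, have the same body themselves. *)
have comp : exists b : C, forall x, x != b -> A x.
  case: (pselect (exists x, ~ A x)) => [[b nAb]|all]; last first.
    by exists 0 => x _; apply: contrapT => nA; apply: all; exists x.
  exists b => x; apply: contraNP => nAx.
  have [p pb] := exists_body b; have [q qx] := exists_body x.
  rewrite -pb in nAb; rewrite -qx in nAx.
  have np : ~ chart_dom (Delta S) (T (chart_inv (Delta S) p)) by move=> /(cx_dom cx).
  have nq : ~ chart_dom (Delta S) (T (chart_inv (Delta S) q)) by move=> /(cx_dom cx).
  have := same_body_map archC TiS (same_body_inf nq np); rewrite !TK => /(_ false (chart_inv_dom _ _))[_].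
  by rewrite /= !chart_invK pb qx => ->.
have [b Hb] := comp.
apply: (agree_everywhere archC Taut WS) => -[|].
  (* In the chart [Upsilon], body 0 is the part outside [Delta] and [b^-1] corresponds to the
     excluded [b]. *)
  exists 0, b^-1 => q q0 qb; pose p := Delta S (chart_inv (Upsilon S) q).
  have pE : chart_inv (Delta S) p = chart_inv (Upsilon S) q.
    by rewrite /p chart_mapK // inE; exact/(sphere_overlap S).
  rewrite /= -pE; apply: agree; apply: Hb; apply: contra qb => /eqP pb.
  have D : chart_dom (chart S false) (chart_inv (Upsilon S) q) by exact/(sphere_overlap S).
  have [_ H] := chart_other D; have := H (chart_inv_dom _ _).
  rewrite /= chart_invK -/p pb => E; apply/eqP.
  by rewrite -[RHS]mulr1 -E mulKf //; apply/eqP => b0; move/eqP: E; rewrite b0 mul0r eq_sym oner_eq0.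
by exists b, b => q qb _; exact/agree/Hb.
Qed.

End Classification.

(** * Factorization of supermatrices and the superprojective formulas *)

Section OddFactor.
Variable C : numClosedFieldType.
Local Notation Lambda := (grassmann C).
Variables (G G' p p' r r' : Lambda).

(** Its action is the superprojective map with identity Moebius matrix, gamma+- equal to [p], [p']
    and delta+- equal to [r], [r']; there [G] is e+ + h+. *)
Definition oddmx : 'M[Lambda]_3 :=
  \matrix_(i, j) nth 0 (nth [::]
   [:: [:: 1 + (p * r' + r * p') - r * r' * (p * p'); r * r'; 2 * G * (r * r' * p' - r')];
       [:: - (p * p'); 1; 2 * G * (p' - p * p' * r')];
       [:: p - r * (p * p'); r; G * (1 + 2 * r * p' - 2 * r * (p * p') * r')]] i) j.

Hypotheses (eG : gpar false G) (eG' : gpar false G') (op : gpar true p) (op' : gpar true p')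
  (or : gpar true r) (or' : gpar true r').
Hypothesis GG : G * G' = 1 - p * r' + r * p'.

Lemma oddmx_super : supermx oddmx.
Proof.
by move=> i j; move: i; apply: forall_ord3; move: j; apply: forall_ord3; rewrite mxE /=; sparity [:: G] [:: p; p'; r; r'].
Qed.

Variables (y s t : Lambda).
Hypotheses (ey : gpar false y) (os : gpar true s) (ot : gpar true t).

(* [oddmx] maps the point with coordinates [y], [s], [t] to the one with
   coordinates [oddmap_z], [oddmap_p], [oddmap_m], up to the factors [oddmap_den]
   on the columns and [oddmap_num] on the rows. *)
Definition oddmap_z := y + s * (G * (1 - p * p' * y) * (p' * y + r'))
  + t * (G' * (1 + p * p' * y) * (p * y + r)) + s * t * (2 * (p * p') * y + (p * r' + r * p')).
Definition oddmap_p := p * y + r + s * (G * (1 - p * p' * y)) + s * t * p.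
Definition oddmap_m := p' * y + r' + t * (G' * (1 + p * p' * y)) - s * t * p'.
Definition oddmap_den := - (p * p') * (y + s * t) + 1 + 2 * G * (p' - p * p' * r') * s.
Definition oddmap_num := 1 + (p * r' + r * p') - r * r' * (p * p')
  - (oddmap_z - oddmap_p * oddmap_m) * - (p * p') + 2 * oddmap_m * (p - r * (p * p')).

Ltac go := sring_mod [:: y; G; G'] [:: s; t; p; p'; r; r'] GG.

Lemma oddmap0 : (1 + (p * r' + r * p') - r * r' * (p * p')) * (y + s * t) + r * r'
   + 2 * G * (r * r' * p' - r') * s = (oddmap_z + oddmap_p * oddmap_m) * oddmap_den.
Proof. rewrite /oddmap_z /oddmap_p /oddmap_m /oddmap_den. go. Qed.

Lemma oddmap2 : (p - r * (p * p')) * (y + s * t) + r + G * (1 + 2 * r * p' - 2 * r * (p * p') * r') * s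
  = oddmap_p * oddmap_den.
Proof. rewrite /oddmap_z /oddmap_p /oddmap_m /oddmap_den. go. Qed.

Lemma oddmap_row1 : r * r' - (oddmap_z - oddmap_p * oddmap_m) * 1 + 2 * oddmap_m * r =
   - (oddmap_num * (y - s * t)).
Proof. rewrite /oddmap_num /oddmap_z /oddmap_p /oddmap_m /oddmap_den. go. Qed.

Lemma oddmap_row2 : 2 * G * (r * r' * p' - r') - (oddmap_z - oddmap_p * oddmap_m) * (2 * G * (p' - p * p' * r'))
  + 2 * oddmap_m * (G * (1 + 2 * r * p' - 2 * r * (p * p') * r')) = oddmap_num * (2 * t).
Proof. rewrite /oddmap_num /oddmap_z /oddmap_p /oddmap_m /oddmap_den. go. Qed.

Lemma oddmap_z_even : gpar false oddmap_z. Proof. by rewrite /oddmap_z; sparity [:: y; G; G'] [:: s; t; p; p'; r; r']. Qed.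
Lemma oddmap_p_odd : gpar true oddmap_p. Proof. by rewrite /oddmap_p; sparity [:: y; G; G'] [:: s; t; p; p'; r; r']. Qed.
Lemma oddmap_m_odd : gpar true oddmap_m. Proof. by rewrite /oddmap_m; sparity [:: y; G; G'] [:: s; t; p; p'; r; r']. Qed.
Lemma oddmap_num_even : gpar false oddmap_num.
Proof.
have := oddmap_z_even; have := oddmap_p_odd; have := oddmap_m_odd => *.
by rewrite /oddmap_num; sparity [:: oddmap_z] [:: oddmap_p; oddmap_m; p; p'; r; r'].
Qed.
Lemma oddmap_num_body : body oddmap_num = 1.
Proof.
have := oddmap_m_odd; rewrite /oddmap_num; move: oddmap_z oddmap_p oddmap_m => Z P M oM.
rewrite !(bodyD, bodyM, bodyN, body1) (body_odd op) (body_odd or) (body_odd oM).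
by rewrite !(mul0r, mulr0, oppr0, addr0, subr0).
Qed.
Lemma oddmap_den_body : body oddmap_den = 1.
Proof.
rewrite /oddmap_den !(bodyD, bodyM, bodyN, body1) (body_odd op) (body_odd os).
by rewrite !(mul0r, mulr0, oppr0, addr0, add0r, subr0).
Qed.
End OddFactor.

Section Mobius.
Variable C : numClosedFieldType.
Local Notation Lambda := (grassmann C).
Variables (a b c d w : Lambda).
Hypotheses (ea : gpar false a) (eb : gpar false b) (ec : gpar false c) (ed : gpar false d) (ew : gpar false w).
Hypothesis det : a * d - b * c = 1.
Let D := c * w + d.
Hypothesis D0 : body D != 0.
Let i := D^-1.
Let y := (a * w + b) * i.

Definition mobmx : 'M[Lambda]_3 :=
  \matrix_(i, j) nth 0 (nth [::] [:: [:: a; b; 0]; [:: c; d; 0]; [:: 0; 0; 1]] i) j.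

Lemma mobmx_super : supermx mobmx.
Proof.
by move=> k j; move: k; apply: forall_ord3; move: j; apply: forall_ord3; rewrite mxE /=; sparity [:: a; b; c; d] ([::] : seq Lambda).
Qed.

Let eD : gpar false D. Proof. by rewrite /D; sparity [:: c; d; w] ([::] : seq Lambda). Qed.
Let ei : gpar false i. Proof. exact: gparV. Qed.
Let ey : gpar false y. Proof. by rewrite /y; sparity [:: a; b; w; i] ([::] : seq Lambda). Qed.
Let Di : D * i = 1. Proof. by rewrite mulrV // gunitE. Qed.

(** Eliminating [a], [b], [d] in favour of [y], [c], [D], [i] turns the determinant condition into
    [D * i = 1], a relation of the form that [sring_mod] reduces by. *)
Lemma mobius_rel : exists y D i : Lambda, [/\ gpar false y, gpar false D & gpar false i] /\
  [/\ D * i = 1, a = y * c + i, d = D - c * w & b = y * D - y * c * w - w * i] /\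
  [/\ c * w + d = D, (c * w + d)^-1 = i & (a * w + b) * i = y].
Proof.
exists y, D, i; split=> //; split; split=> //.
- have -> : y * c + i = ((a * w + b) * c + (a * d - b * c)) * i.
    rewrite det mulrDl mul1r /y; congr (_ + _).
    by sring [:: a; b; c; w; i] ([::] : seq Lambda).
  transitivity (a * (D * i)); first by rewrite Di mulr1.
  by rewrite /D; sring [:: a; b; c; d; w; i] ([::] : seq Lambda).
- by rewrite [RHS]addrC /D addKr.
- have -> : w * i = (a * d - b * c) * w * i by rewrite det mul1r.
  transitivity (b * (D * i)); first by rewrite Di mulr1.
  by rewrite /y /D; sring [:: a; b; c; d; w; i] ([::] : seq Lambda).
Qed.
End Mobius.

Section Superprojective.
Variable C : numClosedFieldType.
Local Notation Lambda := (grassmann C).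
Implicit Types (a b c d p r G w y s t D i : Lambda).

(* The superprojective data in terms of [p] = gamma d - delta c and
   [r] = a delta - b gamma, for which the map is the one of the odd factor
   [oddmx] composed with the Moebius transformation. *)
Section Data.
Variables (a b c d p p' r r' G G' : Lambda).
Definition sp_gamma p r := a * p + c * r.
Definition sp_delta p r := b * p + d * r.
(** With [sp_quart] it gives the nilpotent corrections from [G], [G'] to e+, e-. The two correcting
    factors are mutually inverse ([sp_twist_inv]), so [e+ e- = G G']. *)
Definition sp_twist := a * b * (p * p') + a * d * (p * r' + r * p') + c * d * (r * r').
Definition sp_quart := a * d * (r * r' * (p * p')).
Definition sp_eplus := G * (1 + sp_twist - sp_quart).
Definition sp_eminus := G' * (1 - sp_twist - sp_quart).
Definition superprojective_of : superprojective_data C :=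
  let gp := sp_gamma p r in let gm := sp_gamma p' r' in
  let dp := sp_delta p r in let dm := sp_delta p' r' in
  let ep := sp_eplus in let em := sp_eminus in
  SuperprojectiveData a b c d ep em (- (ep * gp * gm * d)) (em * gp * gm * d)
    (ep * (dp * dm * c - (gp * dm + dp * gm) * d - dp * dm * gp * gm * d))
    (- (em * (dp * dm * c - (gp * dm + dp * gm) * d + dp * dm * gp * gm * d))) gp gm dp dm.
End Data.

Section Relations.
Variables (a b c d p p' r r' : Lambda).
Hypotheses (ea : gpar false a) (eb : gpar false b) (ec : gpar false c) (ed : gpar false d)
  (op : gpar true p) (op' : gpar true p') (or : gpar true r) (or' : gpar true r').
Hypothesis det : a * d - b * c = 1.

Let det' : a * d = 1 + b * c. Proof. by rewrite -det subrK. Qed.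

Ltac go := sring_mod [:: a; b; c; d] [:: p; p'; r; r'] det'.

Lemma sp_twist_inv : (1 + sp_twist a b c d p p' r r' - sp_quart a d p p' r r') *
  (1 - sp_twist a b c d p p' r r' - sp_quart a d p p' r r') = 1.
Proof. by rewrite /sp_twist /sp_quart; go. Qed.

Lemma sp_gamma_delta : sp_gamma a c p r * sp_delta b d p' r' - sp_delta b d p r * sp_gamma a c p' r' =
  p * r' - r * p'.
Proof. by rewrite /sp_gamma /sp_delta; go. Qed.

(** These are the coefficients of [w] and of 1 in [e (c w + d) + f w + h], the numerator obtained
    when the two rho+ terms are put over [(c w + d)^2]. *)
Lemma sp_plus_lin G : gpar false G ->
  sp_eplus a b c d p p' r r' G * c + - (sp_eplus a b c d p p' r r' G * sp_gamma a c p r * sp_gamma a c p' r' * d) =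
    G * (c - a * (p * p')) /\
  sp_eplus a b c d p p' r r' G * d + sp_eplus a b c d p p' r r' G * (sp_delta b d p r * sp_delta b d p' r' * c -
   (sp_gamma a c p r * sp_delta b d p' r' + sp_delta b d p r * sp_gamma a c p' r') * d -
    sp_delta b d p r * sp_delta b d p' r' * sp_gamma a c p r * sp_gamma a c p' r' * d) =
    G * (d - b * (p * p')).
Proof.
move=> eG; rewrite /sp_eplus /sp_twist /sp_quart /sp_gamma /sp_delta; split;
  sring_mod [:: a; b; c; d; G] [:: p; p'; r; r'] det'.
Qed.

Lemma sp_minus_lin G : gpar false G ->
  sp_eminus a b c d p p' r r' G * c + sp_eminus a b c d p p' r r' G * sp_gamma a c p r * sp_gamma a c p' r' * d =
    G * (c + a * (p * p')) /\
  sp_eminus a b c d p p' r r' G * d + - (sp_eminus a b c d p p' r r' G * (sp_delta b d p r * sp_delta b d p' r' * c -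
   (sp_gamma a c p r * sp_delta b d p' r' + sp_delta b d p r * sp_gamma a c p' r') * d +
    sp_delta b d p r * sp_delta b d p' r' * sp_gamma a c p r * sp_gamma a c p' r' * d)) =
    G * (d + b * (p * p')).
Proof.
move=> eG; rewrite /sp_eminus /sp_twist /sp_quart /sp_gamma /sp_delta; split;
  sring_mod [:: a; b; c; d; G] [:: p; p'; r; r'] det'.
Qed.

Lemma sp_mixed w : gpar false w -> 2 * sp_gamma a c p r * sp_gamma a c p' r' * d * w -
  (sp_gamma a c p r * sp_delta b d p' r' + sp_delta b d p r * sp_gamma a c p' r') * (c * w - d)
  - 2 * sp_delta b d p r * sp_delta b d p' r' * c =
  2 * (p * p') * (a * w + b) + (p * r' + r * p') * (c * w + d).
Proof.
move=> ew; rewrite /sp_gamma /sp_delta; sring_mod [:: a; b; c; d; w] [:: p; p'; r; r'] det'.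
Qed.

Lemma sp_gamma_num w : gpar false w -> sp_gamma a c p r * w + sp_delta b d p r =
  p * (a * w + b) + r * (c * w + d).
Proof.
move=> ew; rewrite /sp_gamma /sp_delta; sring [:: a; b; c; d; w] [:: p; r].
Qed.

Lemma sp_gamma_cross : sp_gamma a c p r * d - sp_delta b d p r * c = p.
Proof. by rewrite /sp_gamma /sp_delta; go. Qed.
End Relations.
End Superprojective.

Section SuperprojectivePoint.
Variable C : numClosedFieldType.
Local Notation Lambda := (grassmann C).
Local Notation sp := (superspace C).
Variables (a b c d p p' r r' G G' : Lambda).
Hypotheses (ea : gpar false a) (eb : gpar false b) (ec : gpar false c) (ed : gpar false d)
  (op : gpar true p) (op' : gpar true p') (or : gpar true r) (or' : gpar true r')
  (eG : gpar false G) (eG' : gpar false G').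
Hypotheses (det : a * d - b * c = 1) (GG : G * G' = 1 - p * r' + r * p').

Lemma sp_eplus_even : gpar false (sp_eplus a b c d p p' r r' G).
Proof. by rewrite /sp_eplus /sp_twist /sp_quart; sparity [:: a; b; c; d; G] [:: p; p'; r; r']. Qed.
Lemma sp_eminus_even : gpar false (sp_eminus a b c d p p' r r' G').
Proof. by rewrite /sp_eminus /sp_twist /sp_quart; sparity [:: a; b; c; d; G'] [:: p; p'; r; r']. Qed.

Lemma superprojective_of_admissible : superprojective_admissible (superprojective_of a b c d p p' r r' G G').
Proof.
have e1 := sp_eplus_even; have e2 := sp_eminus_even.
have og : gpar true (sp_gamma a c p r) by rewrite /sp_gamma; sparity [:: a; c] [:: p; r].
have og' : gpar true (sp_gamma a c p' r') by rewrite /sp_gamma; sparity [:: a; c] [:: p'; r'].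
have odl : gpar true (sp_delta b d p r) by rewrite /sp_delta; sparity [:: b; d] [:: p; r].
have odl' : gpar true (sp_delta b d p' r') by rewrite /sp_delta; sparity [:: b; d] [:: p'; r'].
rewrite /superprojective_of /=.
set ep := sp_eplus _ _ _ _ _ _ _ _ _ in e1 *; set em := sp_eminus _ _ _ _ _ _ _ _ _ in e2 *.
set gp := sp_gamma a c p r in og *; set gm := sp_gamma a c p' r' in og' *.
set dp := sp_delta b d p r in odl *; set dm := sp_delta b d p' r' in odl' *.
split=> //.
- have E (u : Lambda) : gpar false u -> geven u by move=> /gevenE.
  by rewrite /= !E //; sparity [:: c; d; ep; em] [:: gp; gm; dp; dm].
- have E (u : Lambda) : gpar true u -> godd u by move=> /goddE.
  by rewrite /= !E.
- split=> //.
  transitivity (G * G' * ((1 + sp_twist a b c d p p' r r' - sp_quart a d p p' r r') *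
    (1 - sp_twist a b c d p p' r r' - sp_quart a d p p' r r'))).
    rewrite /ep /em /sp_eplus /sp_eminus /sp_twist /sp_quart.
    by sring [:: a; b; c; d; G; G'] [:: p; p'; r; r'].
  rewrite (sp_twist_inv ea eb ec ed op op' or or' det) mulr1 GG.
  have := sp_gamma_delta ea eb ec ed op op' or or' det; rewrite -/gp -/gm -/dp -/dm => E.
  rewrite -addrA -[- (p * r') + _]opprK opprD opprK -E opprB addrA.
  by rewrite addrAC.
Qed.

Variable q : sp.
Let w := even_coord q.
Hypothesis D0 : body (c * w + d) != 0.

(** The Moebius factor sends [q] to the point with coordinates [y], [rho+ i], [rho- i], where [i] is
    the inverse of [c w + d], and the odd factor acts on it by the [oddmap] formulas. The row
    identity is stated for the matrix itself, which avoids computing its inverse. *)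
Lemma superprojective_homog : exists x : sp,
  coords x = superprojective_map (superprojective_of a b c d p p' r r' G G') q /\
  exists e k : Lambda, [/\ gpar false k, body e != 0, body k != 0,
    oddmx G p p' r r' *m mobmx a b c d *m colpt q = colscale (colpt x) e &
    rowpt x *m (oddmx G p p' r r' *m mobmx a b c d) = rowscale k (rowpt q)].
Proof.
have ew : gpar false w := even_coordP q.
have [y [D [i [[ey eD ei] [[Di aE dE bE] [DE iE yE]]]]]] := mobius_rel ea eb ec ed ew det D0.
have orp := odd_coordpP q; have orm := odd_coordmP q.
set rp := odd_coordp q in orp; set rm := odd_coordm q in orm.
have os : gpar true (rp * i) := gparM orp ei.
have ot : gpar true (rm * i) := gparM orm ei.
have [x [xz xp xm]] := exists_pt (oddmap_z_even eG eG' op op' or or' ey os ot)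
  (oddmap_p_odd eG eG' op op' or or' ey os ot) (oddmap_m_odd eG eG' op op' or or' ey os ot).
exists x; split.
  have AB : a * w + b = y * D.
    transitivity ((a * w + b) * (D * i)); first by rewrite Di mulr1.
    by rewrite -yE; sring [:: a; b; w; D; i] ([::] : seq Lambda).
  have [P1 P2] := sp_plus_lin ea eb ec ed op op' or or' det eG.
  have [M1 M2] := sp_minus_lin ea eb ec ed op op' or or' det eG'.
  have mix := sp_mixed ea eb ec ed op op' or or' det ew.
  have num := sp_gamma_num ea eb ec ed op or ew; have num' := sp_gamma_num ea eb ec ed op' or' ew.
  have cr := sp_gamma_cross ea eb ec ed op op' or or' det; have cr' := sp_gamma_cross ea eb ec ed op' op or' or det.
  have e1 := sp_eplus_even; have e2 := sp_eminus_even.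
  rewrite (surjective_pairing (coords x)) (surjective_pairing (coords x).1).
  rewrite -/(even_coord x) -/(odd_coordp x) -/(odd_coordm x) xz xp xm.
  rewrite /superprojective_map /superprojective_of -/w -/rp -/rm.
  rewrite num num' mix cr cr' AB DE -!exprVn.
  have iE' : D^-1 = i by rewrite -DE iE.
  rewrite iE'; move: P1 P2 M1 M2 e1 e2.
  move: (sp_eplus _ _ _ _ _ _ _ _ _) (sp_eminus _ _ _ _ _ _ _ _ _) => ep em.
  set f1 := - (ep * _ * _ * _); set f2 := em * _ * _ * _; set h1 := ep * (_ - _ - _); set h2 := - (em * _).
  move=> P1 P2 M1 M2 e1 e2.
  have lin (e f h : Lambda) : f * w + h = (e * c + f) * w + (e * d + h) - e * (c * w + d).
    have -> : e * (c * w + d) = e * c * w + e * d by rewrite mulrDr mulrA.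
    by rewrite mulrDl [X in X - _]addrACA [X in X - _]addrC addrK.
  have F1 : f1 * w + h1 = G * (D - p * p' * (y * D)) - ep * D.
    transitivity ((ep * c + f1) * w + (ep * d + h1) - ep * (c * w + d)).
      exact: lin.
    rewrite P1 P2 -AB -DE; congr (_ - _).
    by sring [:: G; a; b; c; d; w] [:: p; p'].
  have F2 : f2 * w + h2 = G' * (D + p * p' * (y * D)) - em * D.
    transitivity ((em * c + f2) * w + (em * d + h2) - em * (c * w + d)).
      exact: lin.
    rewrite M1 M2 -AB -DE; congr (_ - _).
    by sring [:: G'; a; b; c; d; w] [:: p; p'].
  rewrite F1 F2 /oddmap_z /oddmap_p /oddmap_m.
  congr (_, _, _); sring_mod [:: y; D; i; ep; em; G; G'] [:: rp; rm; p; p'; r; r'] Di.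
have cx : chiral_coord x = oddmap_z G G' p p' r r' y (rp * i) (rm * i) +
   oddmap_p G p p' r y (rp * i) (rm * i) * oddmap_m G' p p' r' y (rp * i) (rm * i).
  by rewrite /chiral_coord /oddprod xz xp xm.
have ax : antichiral_coord x = oddmap_z G G' p p' r r' y (rp * i) (rm * i) -
   oddmap_p G p p' r y (rp * i) (rm * i) * oddmap_m G' p p' r' y (rp * i) (rm * i).
  by rewrite /antichiral_coord /oddprod xz xp xm.
pose m := c * chiral_coord q + d.
have qc : chiral_coord q = w + rp * rm by [].
have qa : antichiral_coord q = w - rp * rm by [].
have em : gpar false m by rewrite /m qc; sparity [:: c; d; w] [:: rp; rm].
have m0 : a * chiral_coord q + b = (y + rp * i * (rm * i)) * m.
  rewrite /m qc dE bE aE.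
  by sring_mod [:: y; c; D; w; i] [:: rp; rm] Di.
have m2 : rp = rp * i * m.
  by rewrite /m qc dE; sring_mod [:: y; c; D; w; i] [:: rp; rm] Di.
pose k := i + c * (rp * i * (rm * i)).
have ek : gpar false k by rewrite /k; sparity [:: c; i] [:: rp; rm].
have k0 : a - (y - rp * i * (rm * i)) * c = k.
  by rewrite /k aE; sring [:: y; c; i] [:: rp; rm].
have k1 : b - (y - rp * i * (rm * i)) * d = k * - antichiral_coord q.
  by rewrite /k qa dE bE; sring_mod [:: y; c; D; w; i] [:: rp; rm] Di.
have k2 : 2 * (rm * i) = k * (rm + rm).
  by rewrite /k; sring_mod [:: y; c; D; w; i] [:: rp; rm] Di.
pose den := oddmap_den G p p' r' y (rp * i) (rm * i).
pose num := oddmap_num G G' p p' r r' y (rp * i) (rm * i).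
have dbl (u : Lambda) : u + u = 2 * u by rewrite mulr_natl mulr2n.
have bi : body i != 0 by rewrite -iE bodyV invr_eq0.
exists (den * m), (num * k); split.
- exact: (gparM (oddmap_num_even eG eG' op op' or or' ey os ot) ek).
- have bd : body den = 1 by apply: oddmap_den_body.
  rewrite bodyM bd mul1r /m bodyD bodyM body_chiral.
  by move: D0; rewrite bodyD bodyM.
- rewrite bodyM (oddmap_num_body eG eG' op op' or or' ey os ot) mul1r /k bodyD !bodyM.
  by rewrite (body_odd orp) !mul0r mulr0 addr0.
- rewrite -mulmxA; have -> : mobmx a b c d *m colpt q =
      colscale (\col_j nth 0 [:: y + rp * i * (rm * i); 1; rp * i] j) m.
    apply/matrixP => j l; rewrite (ord1 l) colscaleE mulmx3E; move: j; apply: forall_ord3; rewrite !mxE /=.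
    + by rewrite mul0r addr0 mulr1 m0.
    + by rewrite mul0r addr0 mulr1 mul1r.
    + by rewrite !mul0r !add0r mul1r -m2.
  rewrite colscaleM; apply/matrixP => j l; rewrite (ord1 l) !colscaleE (mulrA _ den m); congr (_ * _).
  rewrite mulmx3E; move: j; apply: forall_ord3; rewrite !mxE /= mulr1.
  + by rewrite cx; exact: oddmap0.
  + by rewrite mul1r.
  + by rewrite xp; apply: (@oddmap2 C G G').
- rewrite mulmxA; have -> : rowpt x *m oddmx G p p' r r' =
      rowscale num (\row_j nth 0 [:: 1; - (y - rp * i * (rm * i)); 2 * (rm * i)] j).
    apply/matrixP => l j; rewrite (ord1 l) rowscaleE mulmx3E; move: j; apply: forall_ord3; rewrite !mxE /= ax xm mul1r.
    + by rewrite mulr1 /num /oddmap_num dbl mulNr.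
    + rewrite mulrN -(oddmap_row1 eG eG' op op' or or' GG ey os ot) mulNr.
      by rewrite dbl.
    + rewrite -(oddmap_row2 eG eG' op op' or or' GG ey os ot) mulNr.
      by rewrite dbl.
  rewrite rowscaleM; apply/matrixP => l j; rewrite (ord1 l) !rowscaleE -(mulrA num k); congr (_ * _).
  rewrite mulmx3E; move: j; apply: forall_ord3; rewrite !mxE /= ?mul1r ?mulr1 ?mulr0 ?addr0 ?add0r.
  + by rewrite mulNr k0.
  + by rewrite mulNr k1.
  + by rewrite k2.
Qed.

End SuperprojectivePoint.

Section SquareRoot.
Variable C : numClosedFieldType.
Local Notation Lambda := (grassmann C).
Implicit Types (n s t u : Lambda).

(* Newton's step sqrt(1 + n) ~ 1 + n/2 squares the nilpotent error. *)
Lemma nilpotent_sqrt k n : gpar false n -> n ^+ k.+1 = 0 -> exists2 s, gpar false s & s * s = 1 + n.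
Proof.
elim: k n => [|k IH] n en nk.
  have n0 : n = 0 by rewrite -[n]expr1.
  by exists 1; [exact: gpar1|rewrite n0 mulr1 addr0].
have n0 : body n = 0.
  by have := congr1 (@body C) nk; rewrite bodyX body0 => /eqP; rewrite expf_eq0 => /eqP.
pose h := 2^-1 *: n; pose u := 1 + h.
have eh : gpar false h by exact: gparZ.
have eu : gpar false u by apply: gparD => //; exact: gpar1.
have uu : u \is a GRing.unit by rewrite gunitE bodyD body1 bodyZ n0 mulr0 addr0 oner_eq0.
have nE : n = h + h by rewrite halfD.
have ev : gpar false u^-1 by exact: gparV.
pose w := (- (2^-1 * 2^-1)) *: (u^-1 * u^-1) : Lambda.
have ew : gpar false w by apply: gparZ; exact: (gparM ev ev).
have [||s es ss] := IH (n * n * w).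
- exact: (gparM (gparM en en) ew).
- have cw : GRing.comm (n * n) w by rewrite /GRing.comm geven_comm //; exact: (gparM en en).
  have E : (n * n) ^+ k.+1 = n ^+ k.+2 * n ^+ k.
    by rewrite -expr2 -exprM -exprD mul2n -addnn [in RHS]addSnnS.
  by rewrite exprMn_comm // E nk !mul0r.
exists (u * s); first exact: (gparM eu es).
have -> : u * s * (u * s) = u * u * (s * s).
  by rewrite !mulrA; congr (_ * _); rewrite -!mulrA; congr (_ * _); exact: geven_comm.
rewrite ss mulrDr mulr1.
have -> : u * u * (n * n * w) = - (h * h).
  have -> : n * n * w = - (h * h) * (u^-1 * u^-1).
    by rewrite /w /h -scalerAr -!scalerAl -!scalerAr scalerA scaleNr mulNr -scalerAl.
  rewrite mulrA (geven_comm _ (gparM eu eu)) -mulrA (mulrA (u * u)) mulrK // mulrV // mulr1.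
  by [].
rewrite /u mulrDl !mulrDr !mul1r mulr1 nE -!addrA; congr (_ + (_ + _)).
by rewrite subrr addr0.
Qed.

Lemma even_unit_sqrt t : gpar false t -> body t != 0 -> exists2 s, gpar false s & s * s = t.
Proof.
move=> et t0; pose n := (body t)^-1 *: soul t.
have en : gpar false n by apply: gparZ; apply: gparB => //; exact: gpar_scal.
have [k nk] := nilp_ex (body_soul t).
have [|s es ss] := @nilpotent_sqrt k n en.
  by rewrite /n exprZn [soul t ^+ _]exprS nk mulr0 scaler0.
exists (sqrtC (body t) *: s); first exact: gparZ.
rewrite -scalerAl -scalerAr scalerA ss -expr2 sqrtCK /n scalerDr scalerA mulfV // scale1r.
by rewrite -soulE.
Qed.
End SquareRoot.

(** * Factorization of even supermatrices *)

Section Decomposition.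
Variable C : numClosedFieldType.
Local Notation Lambda := (grassmann C).

Section OddPart.
Variables (al be p r E Ei : Lambda).
Hypotheses (oal : gpar true al) (obe : gpar true be) (op : gpar true p) (or : gpar true r)
  (eE : gpar false E) (eEi : gpar false Ei) (EEi : E * Ei = 1).
(* The parameters of the odd factor of a supermatrix whose last column is
   (2 al, 2 be, E) and whose last row is (p, r, E) after the Moebius factor has
   been split off; [dec_nu] is the even scalar, see [dec_oddmx]. *)
Definition dec_p := Ei * (be + p * al * be * Ei).
Definition dec_r := Ei * (- al + r * al * be * Ei).
Definition dec_kap := 2 * r * dec_p - 2 * r * (p * dec_p) * dec_r.
Definition dec_nu := 1 + be * r * Ei.
Definition dec_G := E * (1 - be * r * Ei) * (1 - dec_kap).
Definition dec_G' := (1 - p * dec_r + r * dec_p) * (1 + dec_kap) * dec_nu * Ei.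

Lemma dec_GG : dec_G * dec_G' = 1 - p * dec_r + r * dec_p.
Proof.
rewrite /dec_G /dec_G' /dec_nu /dec_kap /dec_p /dec_r.
sring_mod [:: E; Ei] [:: al; be; p; r] EEi.
Qed.

Lemma dec_oddmx i j : dec_nu * oddmx dec_G p dec_p r dec_r i j =
  nth 0 (nth [::] [:: [:: 1 + al * p * Ei; al * r * Ei; 2 * al];
     [:: be * p * Ei; 1 + be * r * Ei; 2 * be]; [:: p; r; E]] i) j.
Proof.
move: i; apply: forall_ord3; move: j; apply: forall_ord3; rewrite mxE /=;
  rewrite /dec_nu /dec_G /dec_kap /dec_p /dec_r; sring_mod [:: E; Ei] [:: al; be; p; r] EEi.
Qed.

Lemma dec_nu_body : body dec_nu = 1.
Proof. by rewrite /dec_nu bodyD body1 !bodyM (body_odd or) mulr0 mul0r addr0. Qed.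

Lemma dec_par : [/\ gpar true dec_p, gpar true dec_r, gpar false dec_G, gpar false dec_G' & gpar false dec_nu].
Proof.
by rewrite /dec_G /dec_G' /dec_nu /dec_kap /dec_p /dec_r; split; sparity [:: E; Ei] [:: al; be; p; r].
Qed.
End OddPart.

(** The odd row and column are split off by a Schur-type reduction relative to the entry [E]. What
    remains is an even invertible two-by-two block, normalized to determinant one by a square root
    of its determinant. *)
Lemma supergl_decomposition (X Y : 'M[Lambda]_3) : supergl X Y ->
  exists a b c d p p' r r' G G' nu : Lambda,
  [/\ [/\ gpar false a, gpar false b, gpar false c & gpar false d],
      [/\ gpar true p, gpar true p', gpar true r & gpar true r'],
      [/\ gpar false G, gpar false G', gpar false nu & body nu != 0],
      a * d - b * c = 1 /\ G * G' = 1 - p * r' + r * p' &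
      forall i j, X i j = nu * (oddmx G p p' r r' *m mobmx a b c d) i j].
Proof.
move=> XY; have [eX eY XYe YXe] := XY.
have E0 := supergl_body XY; set E := X i2 i2 in E0; set Ei := E^-1.
have eE : gpar false E := eX i2 i2. have eEi : gpar false Ei := gparV eE.
have EEi : E * Ei = 1 by rewrite mulrV // gunitE.
set Ga := X i2 i0; set De := X i2 i1.
have oGa : gpar true Ga := eX i2 i0. have oDe : gpar true De := eX i2 i1.
pose al := 2^-1 *: X i0 i2; pose be := 2^-1 *: X i1 i2.
have oal : gpar true al by apply: gparZ; exact: (eX i0 i2).
have obe : gpar true be by apply: gparZ; exact: (eX i1 i2).
have alE : X i0 i2 = 2 * al by rewrite mulr_natl mulr2n halfD.
have beE : X i1 i2 = 2 * be by rewrite mulr_natl mulr2n halfD.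
(* The subtracted terms are exactly what the entries [1 + al * p * Ei] and their analogues in
   [dec_oddmx] contribute, so the even block of [X] is the even block of the odd factor times this
   matrix. *)
pose m00 := X i0 i0 - al * Ga * Ei; pose m01 := X i0 i1 - al * De * Ei.
pose m10 := X i1 i0 - be * Ga * Ei; pose m11 := X i1 i1 - be * De * Ei.
have e00 : gpar false m00 by rewrite /m00; apply: gparB; [exact: (eX i0 i0)|sparity [:: Ei] [:: al; Ga]].
have e01 : gpar false m01 by rewrite /m01; apply: gparB; [exact: (eX i0 i1)|sparity [:: Ei] [:: al; De]].
have e10 : gpar false m10 by rewrite /m10; apply: gparB; [exact: (eX i1 i0)|sparity [:: Ei] [:: be; Ga]].
have e11 : gpar false m11 by rewrite /m11; apply: gparB; [exact: (eX i1 i1)|sparity [:: Ei] [:: be; De]].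
pose t := m00 * m11 - m01 * m10.
have ex00 : gpar false (X i0 i0) := eX i0 i0. have ex01 : gpar false (X i0 i1) := eX i0 i1.
have ex10 : gpar false (X i1 i0) := eX i1 i0. have ex11 : gpar false (X i1 i1) := eX i1 i1.
have et : gpar false t by rewrite /t; sparity [:: m00; m01; m10; m11] ([::] : seq Lambda).
have t0 : body t != 0.
  have B i j : body ((X *m Y) i j) = body (X i i0) * body (Y i0 j) + body (X i i1) * body (Y i1 j)
     + body (X i i2) * body (Y i2 j) by rewrite mulmx3E !bodyD !bodyM.
  have := B i1 i1; have := B i1 i0; have := B i0 i1; have := B i0 i0.
  rewrite XYe !mxE /= body0 body1 (body_odd (eX i0 i2)) (body_odd (eX i1 i2)) !mul0r !addr0.
  rewrite /t bodyB !bodyM !bodyB !bodyM (body_odd oal) (body_odd obe) !mul0r !subr0.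
  move: (body (X i0 i0)) (body (X i0 i1)) (body (X i1 i0)) (body (X i1 i1)) => x00 x01 x10 x11.
  move: (body (Y i0 i0)) (body (Y i0 i1)) (body (Y i1 i0)) (body (Y i1 i1)) => y00 y01 y10 y11 E1 E2 E3 E4.
  have : (x00 * x11 - x01 * x10) * (y00 * y11 - y01 * y10) = 1.
    transitivity ((x00 * y00 + x01 * y10) * (x10 * y01 + x11 * y11)
      - (x00 * y01 + x01 * y11) * (x10 * y00 + x11 * y10)); first by ring.
    by rewrite -E1 -E2 -E3 -E4 mul0r subr0 mulr1.
  by move=> Et; apply/eqP => t0; move/eqP: Et; rewrite t0 mul0r eq_sym oner_eq0.
(* Dividing the block by this root gives determinant one; the root itself goes into the scalar
   [nu]. *)
have [s es ss] := even_unit_sqrt et t0.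
have s0 : body s != 0 by apply: contraNneq t0 => s0; rewrite -ss bodyM s0 mul0r.
pose si := s^-1; have esi : gpar false si := gparV es.
have ssi : s * si = 1 by rewrite mulrV // gunitE.
have tsi : t * (si * si) = 1.
  by rewrite -ss; transitivity ((s * si) * (s * si)); [sring [:: s; si] ([::] : seq Lambda)|rewrite ssi mulr1].
(* Cramer's rule for the row equation [(p, r) m = (Ga, De)]. *)
pose p := (Ga * m11 - De * m10) * (si * si); pose r := (De * m00 - Ga * m01) * (si * si).
have op : gpar true p by rewrite /p; sparity [:: m11; m10; si] [:: Ga; De].
have or : gpar true r by rewrite /r; sparity [:: m00; m01; si] [:: Ga; De].
have pr0 : p * m00 + r * m10 = Ga.
  transitivity (Ga * (t * (si * si))); last by rewrite tsi mulr1.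
  by rewrite /p /r /t; sring [:: m00; m01; m10; m11; si] [:: Ga; De].
have pr1 : p * m01 + r * m11 = De.
  transitivity (De * (t * (si * si))); last by rewrite tsi mulr1.
  by rewrite /p /r /t; sring [:: m00; m01; m10; m11; si] [:: Ga; De].
have oal' : gpar true (al * si) := gparM oal esi.
have obe' : gpar true (be * si) := gparM obe esi.
have eE' : gpar false (E * si) := gparM eE esi.
have eEi' : gpar false (Ei * s) := gparM eEi es.
have EEi' : E * si * (Ei * s) = 1.
  by transitivity ((E * Ei) * (s * si)); [sring [:: E; Ei; s; si] ([::] : seq Lambda)|rewrite EEi ssi mulr1].
have [op' or' eG eG' enu] := dec_par oal' obe' op or eE' eEi'.
exists (m00 * si), (m01 * si), (m10 * si), (m11 * si), p, (dec_p (al * si) (be * si) p (Ei * s)), r,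
  (dec_r (al * si) (be * si) r (Ei * s)), (dec_G (al * si) (be * si) p r (E * si) (Ei * s)),
  (dec_G' (al * si) (be * si) p r (Ei * s)), (s * dec_nu (be * si) r (Ei * s)).
split.
- by split; [exact: (gparM e00 esi)|exact: (gparM e01 esi)|exact: (gparM e10 esi)|exact: (gparM e11 esi)].
- by [].
- split=> //; first exact: (gparM es enu).
  by rewrite bodyM dec_nu_body // mulr1.
- split; last exact: dec_GG oal' obe' op or eE' eEi' EEi'.
  transitivity (t * (si * si)) => //.
  by rewrite /t; sring [:: m00; m01; m10; m11; si] ([::] : seq Lambda).
move=> i j; rewrite mulmx3E -mulrA !mulrDr !(mulrA (dec_nu _ _ _)).
rewrite !(dec_oddmx oal' obe' op or eE' eEi' EEi').
move: i; apply: forall_ord3; move: j; apply: forall_ord3; rewrite !mxE /= ?mulr0 ?addr0 ?add0r ?mulr1.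
- transitivity (m00 + al * Ei * (p * m00 + r * m10)).
    by rewrite pr0 /m00; sring [:: X i0 i0; Ei] [:: al; Ga].
  by sring_mod [:: m00; m10; Ei; s; si] [:: al; p; r] ssi.
- transitivity (m01 + al * Ei * (p * m01 + r * m11)).
    by rewrite pr1 /m01; sring [:: X i0 i1; Ei] [:: al; De].
  by sring_mod [:: m01; m11; Ei; s; si] [:: al; p; r] ssi.
- by rewrite alE; sring_mod [:: s; si] [:: al] ssi.
- transitivity (m10 + be * Ei * (p * m00 + r * m10)).
    by rewrite pr0 /m10; sring [:: X i1 i0; Ei] [:: be; Ga].
  by sring_mod [:: m00; m10; Ei; s; si] [:: be; p; r] ssi.
- transitivity (m11 + be * Ei * (p * m01 + r * m11)).
    by rewrite pr1 /m11; sring [:: X i1 i1; Ei] [:: be; De].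
  by sring_mod [:: m01; m11; Ei; s; si] [:: be; p; r] ssi.
- by rewrite beE; sring_mod [:: s; si] [:: be] ssi.
- by rewrite -/Ga -pr0; sring_mod [:: m00; m10; s; si] [:: p; r] ssi.
- by rewrite -/De -pr1; sring_mod [:: m01; m11; s; si] [:: p; r] ssi.
- by rewrite -/E; sring_mod [:: E; s; si] ([::] : seq Lambda) ssi.
Qed.

(** The determinant condition inverts the substitution defining gamma and delta, and [sp_twist_inv]
    inverts the passage from [G], [G'] to e+, e-. *)
Lemma admissible_superprojective_of (q : superprojective_data C) : superprojective_admissible q ->
  exists a b c d p p' r r' G G' : Lambda,
  [/\ [/\ gpar false a, gpar false b, gpar false c & gpar false d],
      [/\ gpar true p, gpar true p', gpar true r & gpar true r'],
      gpar false G /\ gpar false G',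
      a * d - b * c = 1 /\ G * G' = 1 - p * r' + r * p' &
      q = superprojective_of a b c d p p' r r' G G'].
Proof.
case: q => a b c d ep em fp fm hp hm gp gm dp dm [/= ev od [det epm] [fpE fmE] [hpE hmE]].
case/and5P: ev => /gevenE ea /gevenE eb /gevenE ec /gevenE ed /and3P[/gevenE eep /gevenE eem _].
case/and5P: od => /goddE ogp /goddE ogm /goddE odp /goddE odm _.
have det' : a * d = 1 + b * c by rewrite -det subrK.
pose p := gp * d - dp * c; pose p' := gm * d - dm * c.
pose r := a * dp - b * gp; pose r' := a * dm - b * gm.
have op : gpar true p by rewrite /p; sparity [:: c; d] [:: gp; dp].
have op' : gpar true p' by rewrite /p'; sparity [:: c; d] [:: gm; dm].
have or : gpar true r by rewrite /r; sparity [:: a; b] [:: gp; dp].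
have or' : gpar true r' by rewrite /r'; sparity [:: a; b] [:: gm; dm].
have gpE : gp = sp_gamma a c p r by rewrite /sp_gamma /p /r; sring_mod [:: a; b; c; d] [:: gp; dp] det'.
have gmE : gm = sp_gamma a c p' r' by rewrite /sp_gamma /p' /r'; sring_mod [:: a; b; c; d] [:: gm; dm] det'.
have dpE : dp = sp_delta b d p r by rewrite /sp_delta /p /r; sring_mod [:: a; b; c; d] [:: gp; dp] det'.
have dmE : dm = sp_delta b d p' r' by rewrite /sp_delta /p' /r'; sring_mod [:: a; b; c; d] [:: gm; dm] det'.
pose tw := sp_twist a b c d p p' r r'; pose qu := sp_quart a d p p' r r'.
have etw : gpar false tw by rewrite /tw /sp_twist; sparity [:: a; b; c; d] [:: p; p'; r; r'].
have equ : gpar false qu by rewrite /qu /sp_quart; sparity [:: a; d] [:: p; p'; r; r'].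
have inv : (1 + tw - qu) * (1 - tw - qu) = 1 := sp_twist_inv ea eb ec ed op op' or or' det.
pose G := ep * (1 - tw - qu); pose G' := em * (1 + tw - qu).
have eG : gpar false G by rewrite /G; sparity [:: ep; tw; qu] ([::] : seq Lambda).
have eG' : gpar false G' by rewrite /G'; sparity [:: em; tw; qu] ([::] : seq Lambda).
have epE : ep = sp_eplus a b c d p p' r r' G.
  rewrite /sp_eplus -/tw -/qu; transitivity (ep * ((1 + tw - qu) * (1 - tw - qu))); first by rewrite inv mulr1.
  by rewrite /G; sring [:: ep; tw; qu] ([::] : seq Lambda).
have emE : em = sp_eminus a b c d p p' r r' G'.
  rewrite /sp_eminus -/tw -/qu; transitivity (em * ((1 + tw - qu) * (1 - tw - qu))); first by rewrite inv mulr1.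
  by rewrite /G'; sring [:: em; tw; qu] ([::] : seq Lambda).
exists a, b, c, d, p, p', r, r', G, G'; split=> //.
  split=> //; transitivity (ep * em * ((1 + tw - qu) * (1 - tw - qu))).
    by rewrite /G /G'; sring [:: ep; em; tw; qu] ([::] : seq Lambda).
  rewrite inv mulr1 epm gpE gmE dpE dmE.
  have E := sp_gamma_delta ea eb ec ed op op' or or' det.
  have sub3 (u v : Lambda) : 1 - u + v = 1 - (u - v) by rewrite opprB [RHS]addrA [RHS]addrAC.
  by rewrite !sub3 E.
by rewrite fpE fmE hpE hmE /superprojective_of -epE -emE -gpE -gmE -dpE -dmE.
Qed.

Lemma supergl_oddmob (a b c d p p' r r' G G' : Lambda) :
  [/\ gpar false a, gpar false b, gpar false c & gpar false d] ->
  [/\ gpar true p, gpar true p', gpar true r & gpar true r'] ->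
  gpar false G /\ gpar false G' -> a * d - b * c = 1 /\ G * G' = 1 - p * r' + r * p' ->
  exists Y, supergl (oddmx G p p' r r' *m mobmx a b c d) Y.
Proof.
move=> [ea eb ec ed] [op op' or or'] [eG eG'] [det GG].
have eX : supermx (oddmx G p p' r r' *m mobmx a b c d).
  by apply: supermxM; [exact: oddmx_super|exact: mobmx_super].
have bdet : body a * body d - body b * body c = 1 by rewrite -!bodyM -bodyB det body1.
have bG : body G * body G' = 1.
  by rewrite -bodyM GG bodyD bodyB body1 !bodyM (body_odd op) (body_odd or) !mul0r subr0 addr0.
pose Z : 'M[C]_3 := \matrix_(i, j) nth 0 (nth [::] [:: [:: body d; - body b; 0];
  [:: - body c; body a; 0]; [:: 0; 0; body G']] i) j.
apply: (supergl_ex (Z := Z) eX); rewrite map_mx_body.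
have -> : map_mx (@body C) (oddmx G p p' r r') =
   \matrix_(i, j) nth 0 (nth [::] [:: [:: 1; 0; 0]; [:: 0; 1; 0]; [:: 0; 0; body G]] i) j.
  apply/matrixP => i j; rewrite !mxE; move: i; apply: forall_ord3; move: j; apply: forall_ord3 => /=;
  by rewrite ?(bodyD, bodyN, bodyM, body0, body1, body_odd op, body_odd op', body_odd or, body_odd or', mul0r, mulr0, oppr0, addr0, mulr1).
apply/matrixP => i j; rewrite !mxE !sum_ord3 !mxE !sum_ord3 !mxE.
move: i; apply: forall_ord3; move: j; apply: forall_ord3 => /=;
  rewrite ?(body0, body1, mul0r, mulr0, mul1r, mulr1, addr0, add0r) //.
- by rewrite mulrN.
- by rewrite mulrN addrC [_ * body a]mulrC subrr.
- by rewrite mulrN mulrC subrr.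
- by rewrite mulrN addrC [body d * _]mulrC [body c * _]mulrC.
Qed.

End Decomposition.

(** * The group and its superprojective description *)

Section SphereAutomorphisms.
Variable C : numClosedFieldType.
Local Notation Lambda := (grassmann C).
Local Notation sp := (superspace C).
Hypotheses (archC : small_powers C) (evtC : extreme_value C).
Variable S : superRiemannSphere C.

Lemma spheremap_superprojective (a b c d p p' r r' G G' nu : Lambda) (X Y : 'M[Lambda]_3) :
  [/\ gpar false a, gpar false b, gpar false c & gpar false d] ->
  [/\ gpar true p, gpar true p', gpar true r & gpar true r'] ->
  [/\ gpar false G, gpar false G', gpar false nu & body nu != 0] ->
  a * d - b * c = 1 /\ G * G' = 1 - p * r' + r * p' ->
  supergl X Y -> (forall i j, X i j = nu * (oddmx G p p' r r' *m mobmx a b c d) i j) ->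
  has_superprojective_expression (superprojective_of a b c d p p' r r' G G')
    (spheremap X Y : S -> S).
Proof.
move=> [ea eb ec ed] [op op' or or'] [eG eG' en n0] [det GG] XY.
set Xn := oddmx G p p' r r' *m mobmx a b c d => EX.
have colE (v : 'cV[Lambda]_3) : X *m v = colscale (Xn *m v) nu.
  apply/matrixP => i j; rewrite (ord1 j) colscaleE !mxE mulr_suml; apply: eq_bigr => k _.
  by rewrite EX -mulrA geven_comm.
have rowE (w : 'rV[Lambda]_3) : w *m X = rowscale nu (w *m Xn).
  apply/matrixP => i j; rewrite (ord1 i) rowscaleE !mxE mulr_sumr; apply: eq_bigr => k _.
  by rewrite EX mulrA -(geven_comm (w 0 k) en) -mulrA.
have X10 : body (X i1 i0) = body nu * body c.
  rewrite EX bodyM mulmx3E !mxE /= !(bodyD, bodyM, bodyN, body0, body1) (body_odd op).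
  by rewrite !(mul0r, mulr0, oppr0, mul1r, add0r, addr0).
have X11 : body (X i1 i1) = body nu * body d.
  rewrite EX bodyM mulmx3E !mxE /= !(bodyD, bodyM, bodyN, body0, body1) (body_odd op).
  by rewrite !(mul0r, mulr0, oppr0, mul1r, add0r, addr0).
have dens q : denset X (body_coord q) <-> body (c * even_coord q + d) != 0.
  rewrite /denset /= X10 X11 bodyD bodyM -/(body_coord q) -mulrA -mulrDr mulf_eq0.
  by rewrite (negPf n0).
have [dom expr] : (local_domain (Delta S) (Delta S) (spheremap X Y) =
    @body_coord C @^-1` denset X) /\ (forall q, denset X (body_coord q) ->
    local_expression (Delta S) (Delta S) (spheremap X Y) q = fracmap X Y q).
  have := spheremap_domain S false false XY; have := @spheremap_expression C S X Y false false XY.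
  by rewrite /= !mul1mx !mulmx1.
split=> q; rewrite dom; first exact: dens.
move=> Dq; rewrite (expr q Dq).
have [x [<- [e [k [ek e0 k0 cE rE]]]]] :=
  superprojective_homog ea eb ec ed op op' or or' eG eG' det GG ((dens q).1 Dq).
have nk0 : body (nu * k) != 0 by rewrite bodyM mulf_neq0.
have eN : gpar false (nu * k) by exact: gparM en ek.
have [sX _ XYe _] := XY.
have c1 : X *m colpt q = colscale (colpt x) (e * nu).
  by rewrite colE cE; apply/matrixP => i j; rewrite (ord1 j) !colscaleE mulrA.
(* Applying [Y] to the row identity for [X] gives [rowpt q *m Y] without a formula for [Y]. *)
have r1 : rowpt q *m Y = rowscale (nu * k)^-1 (rowpt x).
  have : rowpt x *m X *m Y = rowscale (nu * k) (rowpt q *m Y).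
    by rewrite rowE rE; apply/matrixP => i j; rewrite (ord1 i) !rowscaleM !rowscaleE mulrA.
  rewrite -mulmxA XYe mulmx1 => ->.
  by apply/matrixP => i j; rewrite (ord1 i) !rowscaleE mulrA mulVr ?mul1r // gunitE.
rewrite /fracmap c1 r1 homog_pt_scale ?homog_ptK //.
- exact: homogpt.
- have [cv _ _ _ _] := homogpt q; have := @supercolM C X _ sX cv i1.
  by rewrite c1 colscaleE mxE /= mul1r.
- exact: gparV.
- by rewrite bodyM mulf_neq0.
- by rewrite bodyV invr_eq0.
- by rewrite mxE /= body1 oner_eq0.
Qed.

Lemma superconformal_automorphism_group :
  transformation_group [set T : S -> S | superconformal_automorphism T].
Proof.
split=> [|f g /=|f [g [fK gK] [cf cg]]].
- have -> : id = spheremap 1%:M 1%:M :> (S -> S) by apply/funext => s; rewrite spheremap1.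
  exact/spheremap_automorphism/supergl1.
- move=> /(automorphism_spheremap archC evtC)[X [Y [XY fE]]].
  move=> /(automorphism_spheremap archC evtC)[X' [Y' [XY' gE]]].
  have -> : f \o g = spheremap (X *m X') (Y' *m Y).
    by apply/funext => s; rewrite /= fE gE spheremapM.
  exact/spheremap_automorphism/superglM.
- by exists g => //; exists f.
Qed.

Lemma automorphism_superprojective (T : S -> S) : superconformal_automorphism T ->
  exists2 q, superprojective_admissible q & has_superprojective_expression q T.
Proof.
move=> /(automorphism_spheremap archC evtC)[X [Y [XY TE]]].
have [a [b [c [d [p [p' [r [r' [G [G' [nu [ev od en dG EX]]]]]]]]]]]] := supergl_decomposition XY.
exists (superprojective_of a b c d p p' r r' G G').
  case: ev od en dG => ea eb ec ed [op op' or or'] [eG eG' _ _] [det GG].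
  exact: superprojective_of_admissible.
have -> : T = spheremap X Y by apply/funext.
exact: spheremap_superprojective ev od en dG XY EX.
Qed.

(** The expression determines an automorphism where [c w + d] has nonzero body, that is, off at most
    one body in [Delta]; the identity theorem does the rest. *)
Lemma superprojective_unique q (T T' : S -> S) : body (sp_c q) != 0 \/ body (sp_d q) != 0 ->
  superconformal_automorphism T -> superconformal_automorphism T' ->
  has_superprojective_expression q T -> has_superprojective_expression q T' -> T = T'.
Proof.
move=> cd0 Taut [_ _ [T'S _]] [D E] [D' E']; apply/funext.
have agree p : body (sp_c q * even_coord p + sp_d q) != 0 ->
    T (chart_inv (Delta S) p) = T' (chart_inv (Delta S) p).
  move=> h; have d1 := (D p).2 h; have d1' := (D' p).2 h.
  have e1 := E _ d1; have e1' := E' _ d1'.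
  have /(congr1 (chart_inv (Delta S))) :
      local_expression (Delta S) (Delta S) T p = local_expression (Delta S) (Delta S) T' p.
    by apply: val_inj; rewrite /= e1 e1'.
  by rewrite /local_expression !chart_mapK // inE.
have [b Hb] : exists b : C, forall p, body_coord p != b ->
    T (chart_inv (Delta S) p) = T' (chart_inv (Delta S) p).
  (* When [c] has zero body this is 0 by convention, and no point is actually excluded since [d]
     then has nonzero body. *)
  exists (- (body (sp_d q) / body (sp_c q))) => p pb; apply: agree.
  rewrite bodyD bodyM -/(body_coord p).
  have [c0|c0] := eqVneq (body (sp_c q)) 0.
    by case: cd0; rewrite c0 ?eqxx // mul0r add0r.
  apply: contra pb; rewrite addr_eq0 => /eqP h.
  by rewrite -mulNr -h mulrAC mulfV // mul1r.
apply: (agree_everywhere archC Taut T'S) => -[|]; last by exists b, b => p pb _; exact: Hb.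
exists 0, b^-1 => p p0 pb; pose t := Delta S (chart_inv (Upsilon S) p).
have tE : chart_inv (Delta S) t = chart_inv (Upsilon S) p.
  by rewrite /t chart_mapK // inE; exact/(sphere_overlap S).
rewrite /= -tE; apply: Hb; apply: contra pb => /eqP tb.
have Dp : chart_dom (chart S false) (chart_inv (Upsilon S) p) by exact/(sphere_overlap S).
have [_ H] := chart_other Dp; have := H (chart_inv_dom _ _).
rewrite /= chart_invK -/t tb => bp; apply/eqP.
by rewrite -[RHS]mulr1 -bp mulKf //; apply/eqP => b0; move/eqP: bp; rewrite b0 mul0r eq_sym oner_eq0.
Qed.

Lemma superprojective_automorphism q : superprojective_admissible q ->
  exists! T : S -> S, superconformal_automorphism T /\ has_superprojective_expression q T.
Proof.
move=> /admissible_superprojective_of[a [b [c [d [p [p' [r [r' [G [G' [ev od eG dG ->]]]]]]]]]]].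
have [Y XY] := supergl_oddmob ev od eG dG.
have Haut := spheremap_automorphism archC S XY.
have Hex : has_superprojective_expression (superprojective_of a b c d p p' r r' G G')
    (spheremap (oddmx G p p' r r' *m mobmx a b c d) Y : S -> S).
  apply: (spheremap_superprojective (nu := 1) ev od _ dG XY).
    by case: eG; split=> //; [exact: gpar1|rewrite body1 oner_eq0].
  by move=> i j; rewrite mul1r.
exists (spheremap (oddmx G p p' r r' *m mobmx a b c d) Y); split=> // T [Taut Tex].
apply: superprojective_unique Haut Taut Hex Tex => /=.
apply/orP; rewrite -negb_and; apply/andP => -[/eqP c0 /eqP d0].
have [/(congr1 (@body C)) + _] := dG.
by rewrite bodyB !bodyM c0 d0 !mulr0 subr0 body1 => /esym/eqP; rewrite oner_eq0.
Qed.

End SphereAutomorphisms.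

(** * The complex numbers *)

Section ComplexNumbers.
Variable R : realType.
Let CR : numClosedFieldType := complex R.

Lemma gt0_complexE (e : CR) : 0 < e -> 0 < complex.Re e /\ e = (complex.Re e)%:C%C.
Proof.
by case: e => x y; rewrite ltcE /= => /andP[/eqP -> x0].
Qed.

Lemma small_powers_complex : small_powers CR.
Proof.
move=> e /gt0_complexE[e0 ->]; exists (Num.bound (complex.Re e)^-1).
have := upper_nthrootP (leqnn (Num.bound (complex.Re e)^-1)); move: (Num.bound _) => n h.
have -> : (2^-1 : CR) ^+ n = ((2 ^- n)%:C)%C by rewrite exprVn fmorphV rmorphXn /= rmorph_nat.
by rewrite ltcR -[ltRHS]invrK ltf_pV2 // posrE ?invr_gt0 // exprn_gt0.
Qed.

Lemma normr_real_complex (x : R) : `|x%:C%C : CR| = `|x|%:C%C.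
Proof. by rewrite normc_def /= expr0n addr0 sqrtr_sqr. Qed.

Lemma real_complex_continuous : continuous (fun x : R => x%:C%C : CR).
Proof.
move=> x; apply/(@cvgrPdist_lt _ _ _ _ (nbhs_filter x)) => e /gt0_complexE[e0 ->].
have := @cvg_id _ (nbhs x); move/(@cvgrPdist_lt _ _ _ _ (nbhs_filter x))/(_ _ e0).
by apply: filterS => y; rewrite -ltcR -normr_real_complex rmorphB.
Qed.

Lemma Re_norm_continuous : continuous (fun z : CR => complex.Re `|z|).
Proof.
move=> z; apply/(@cvgrPdist_lt _ _ _ _ (nbhs_filter z)) => e e0.
have ec : 0 < e%:C%C :> CR by rewrite ltcR.
have := @cvg_id _ (nbhs z); move/(@cvgrPdist_lt _ _ _ _ (nbhs_filter z))/(_ _ ec).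
apply: filterS => y yz; rewrite -ltcR; apply: le_lt_trans yz.
apply: le_trans (ler_dist_dist z y).
by have := normc_ge_Re (`|z| - `|y|); rewrite raddfB.
Qed.

(** The problem is pulled back to the real plane, where a closed subset of a square is compact. *)
Lemma extreme_value_complex : extreme_value CR.
Proof.
move=> K f K0 cK [r Kr] cf.
pose phi (u : R * R) : CR := u.1%:C%C + 'i * u.2%:C%C.
have phiE (z : CR) : phi (complex.Re z, complex.Im z) = z.
  by rewrite /phi /= mulrC mulrC -complexE.
have cphi : continuous phi.
  move=> u; apply: (@cvgD _ CR _ _ (nbhs_filter u)).
    by apply: (cvg_comp _ _ (@cvg_fst _ _ _ _ _) ); exact: real_complex_continuous.
  apply: (@cvgMr CR _ _ (nbhs_filter u)).
  by apply: (cvg_comp _ _ (@cvg_snd _ _ _ _ _) ); exact: real_complex_continuous.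
have Re_norm (z : CR) : `|complex.Re z| <= complex.Re `|z|.
  by rewrite -lecR; have := normc_ge_Re z; rewrite normc_def.
have Im_norm (z : CR) : `|complex.Im z| <= complex.Re `|z|.
  have := Re_norm (z * 'i); rewrite -complexiE ReiNIm normrN normrM.
  by rewrite complexiE normCi mulr1.
pose s := complex.Re r.
have compK : compact (phi @^-1` K).
  apply: (@subclosed_compact _ _ (`[- s, s] `*` `[- s, s])).
  - by apply: closed_comp => // u _; exact: cphi.
  - by apply: compact_setX; exact: segment_compact.
  move=> u /= /Kr; rewrite lecE => /andP[_ zs].
  have -> : u = (complex.Re (phi u), complex.Im (phi u)).
    have -> : phi u = (u.1 +i* u.2)%C by rewrite /phi -complexiE [RHS]complexE.
    by case: u {zs}.
  have rx := le_trans (Re_norm (phi u)) zs; have ry := le_trans (Im_norm (phi u)) zs.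
  by move: rx ry; rewrite !ler_norml; split; rewrite /= in_itv.
have [||[x y] Kxy xymax] := @compact_EVT_max _ R (fun u => complex.Re `|f (phi u)|) _ _ compK.
- by have [z Kz] := K0; exists (complex.Re z, complex.Im z); rewrite /= phiE.
- apply: continuous_subspaceT => u.
  apply: (cvg_comp _ _ (cvg_comp _ _ (cphi u) (cf _))); exact: Re_norm_continuous.
exists (phi (x, y)); first by move: Kxy; rewrite inE.
move=> z Kz; have := xymax (complex.Re z, complex.Im z); rewrite inE /= phiE => /(_ Kz).
have E (w : CR) : `|w| = (complex.Re `|w|)%:C%C by rewrite normc_def.
by move=> h; rewrite (E (f z)) (E (f (phi _))) lecR.
Qed.
End ComplexNumbers.

Theorem mainTheorem3 (R : realType) (S : superRiemannSphere (complex R)) :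
  transformation_group [set T : S -> S | superconformal_automorphism T] /\
  (forall T : S -> S, superconformal_automorphism T ->
     exists2 q : superprojective_data (complex R),
       superprojective_admissible q & has_superprojective_expression q T) /\
  (forall q : superprojective_data (complex R), superprojective_admissible q ->
     exists! T : S -> S,
       superconformal_automorphism T /\ has_superprojective_expression q T).
Proof.
have archC := @small_powers_complex R; have evtC := @extreme_value_complex R.
split; first exact: superconformal_automorphism_group archC evtC S.
split=> [T|q]; first exact: automorphism_superprojective archC evtC S T.
exact: superprojective_automorphism archC S q.
Qed.
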